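(* Let $K=\mathbb F_2(z)$, let $Q=\left[\frac{z,1+z^3}{K}\right)$, and let $\Sigma=\Sigma_{\mathcal A,\mathcal B}$ be the square complex with $V_4$-action associated to the $V_4$-structure $(\mathcal A,\mathcal B)$, $\mathcal A=\{b_1,b_1^{-1},c_1\}$, $\mathcal B=\{b_2,b_2^{-1},c_2\}$, of the group $\langle b_1,b_2,c_1,c_2\rangle\le Q^\times/K^\times$ (all defined in the context). There exists an arithmetic lattice $\Lambda$ arising from the quaternion algebra $Q$ with the following properties: (1) The Bruhat-Tits action of $\Lambda$ on the product of trees $T_0\times T_\infty\cong T_3\times T_3$ is simply transitive on the vertices. (2) $\Lambda$ is isomorphic to the fundamental group $\pi_1^{\mathrm{orb}}(\Sigma,V_4,s_{00})$ of the quotient orbispace of $\Sigma$ by the $V_4$-action. The square complex $\Sigma$ has four vertices, twelve (unoriented) edges and nine squares. The group $\Lambda$ has the presentation $$\Lambda=\bigl\langle b_1,b_2,c_1,c_2\ \big|\ c_1^2,\ c_2^2,\ c_1c_2=c_2c_1,\ b_1b_2c_1b_2,\ b_1c_2b_1b_2^{-1}\bigr\rangle .$$ (3) $\Lambda$ has a torsion-free normal subgroup $\Gamma$ such that $\Lambda/\Gamma\cong V_4$, and $\Gamma$ is (isomorphic to) the fundamental group of the square complex $\Sigma$.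
   Context: **Quaternion algebra.** $K=\mathbb F_2(z)$ and $Q=K\{I,J\}/(I^2+I=z,\ J^2=1+z^3,\ IJ=J(I+1))$, a quaternion algebra over $K$ with basis $1,I,J,IJ$. Let $R=\mathbb F_2[z,\frac1{z(1+z^3)}]$, $\mathfrak O=R\oplus RI\oplus RJ\oplus R\,IJ$ and $G(R)=\mathfrak O^\times/R^\times\subseteq Q^\times/K^\times$. View $\mathbb F_2((y))$ as an extension of $K$ via $z=y^2+y$ (it is the completion of $K$ at $z=0$) and $\mathbb F_2((t))$ as an extension of $K$ via $u:=z^{-1}=t^2+t$ (the completion of $K$ at $z=\infty$). The $K$-algebra homomorphisms $\rho_y:Q\to M_2(\mathbb F_2((y)))$, $$I\mapsto\begin{pmatrix}y&0\\0&1+y\end{pmatrix},\quad J\mapsto\begin{pmatrix}0&1+z^3\\1&0\end{pmatrix},$$ and $\rho_t:Q\to M_2(\mathbb F_2((t)))$, $$I\mapsto\begin{pmatrix}1+u+t&1+u^3\\ u^{-1}&u+t\end{pmatrix},\quad J\mapsto\begin{pmatrix}0&u^{-1}+u^2\\ u^{-2}&0\end{pmatrix},$$ induce an embedding $Q^\times/K^\times\hookrightarrow \mathrm{PGL}_2(\mathbb F_2((y)))\times\mathrm{PGL}_2(\mathbb F_2((t)))$, under which $G(R)$ is a cocompact lattice. An *arithmetic lattice arising from $Q$* is a subgroup of $Q^\times/K^\times$ commensurable with $G(R)$, regarded as a lattice in this product. **Bruhat-Tits action.** $T_0$ and $T_\infty$ are the Bruhat-Tits trees of $\mathrm{PGL}_2(\mathbb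 F_2((y)))$ and $\mathrm{PGL}_2(\mathbb F_2((t)))$: vertices are homothety classes of lattices (over the valuation ring) in the 2-dimensional column space, adjacent when they have representatives $\pi M_1\subsetneq M_2\subsetneq M_1$ ($\pi$ a uniformizer); matrices act by left multiplication. Both are isomorphic to $T_3$, where $T_n$ is the tree with constant valency $n$. Subgroups of $Q^\times/K^\times$ act on $T_0\times T_\infty$ componentwise through $(\rho_y,\rho_t)$. **Elements.** $c_1,c_2,b_1,b_2\in Q^\times/K^\times$ are the classes of $C_1=1+z^2+IJ$, $C_2=z+z^2+IJ$, $B_1=(1+z)I+J$, $B_2=z+z^2+(1+z)I+J+IJ$. **$V_4$-structures.** A $V_4$-structure of a group $\Lambda'$ is an ordered pair $(\mathcal A,\mathcal B)$ of finite subsets of $\Lambda'$ such that $\mathcal A\cup\mathcal B$ generates $\Lambda'$, $\mathcal A$ and $\mathcal B$ are closed under inverses, $\mathcal A\mathcal B=\mathcal B\mathcal A$, and both maps $\mathcal A\times\mathcal B\to\mathcal A\mathcal B$, $(a,b)\mapsto ab$ and $(a,b)\mapsto ba$, are bijections. The square complex $\Sigma_{\mathcal A,\mathcal B}$ (a two-dimensional combinatorial cell complex whose 2-cells are attached along closed edge paths of length 4) has vertices $s_{00},s_{01},s_{10},s_{11}$; for each $a\in\mathcal A$, $i\in\{0,1\}$ a vertical edge $(a,i)$ from $s_{i0}$ to $s_{i1}$; for each $b\in\mathcal B$, $j\in\{0,1\}$ a horizontal edge $(b,j)$ from $s_{0j}$ to $s_{1j}$ (the reverse of an edge $e$ is $\bar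 e$); and for each $a,a'\in\mathcal A$, $b,b'\in\mathcal B$ with $ab'=ba'$ a square $[a,b';b,a']$ glued to the path $\bigl((a,0),(b',1),\overline{(a',1)},\overline{(b,0)}\bigr)$. The group $V_4=\langle\gamma_v,\gamma_h\mid\gamma_v^2=\gamma_h^2=1,\gamma_v\gamma_h=\gamma_h\gamma_v\rangle$ acts on it: $\gamma_v$ interchanges $s_{ij}$ with $s_{i(1-j)}$, $(a,i)$ with $\overline{(a^{-1},i)}$, and $(b,0)$ with $(b,1)$; $\gamma_h$ interchanges $s_{ij}$ with $s_{(1-i)j}$, $(a,0)$ with $(a,1)$, and $(b,j)$ with $\overline{(b^{-1},j)}$; squares are permuted accordingly. **Orbispace fundamental group.** For a discrete group $G$ acting continuously on a space $S$ and $s\in S$, $\pi_1^{\mathrm{orb}}(S,G,s)$ is the set of pairs $[\alpha;g]$ with $g\in G$ and $\alpha$ a homotopy class (fixed endpoints) of paths from $s$ to $gs$, with product $[\alpha;g]*[\beta;h]=[\alpha*(g\beta);gh]$ (first $\alpha$, then $g\beta$). *)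

(* Defs.v *)
From HB Require Import structures.
From mathcomp Require Import all_boot all_order all_algebra generic_quotient.
From mathcomp Require Import all_classical all_reals all_analysis.
From mathcomp Require Import ring.

Set Implicit Arguments.
Unset Strict Implicit.
Unset Printing Implicit Defensive.

Import Order.TTheory GRing.Theory Num.Theory.
Import numFieldNormedType.Exports.

Local Open Scope classical_set_scope.
Local Open Scope ring_scope.
Local Open Scope quotient_scope.
Local Open Scope card_scope.

Record powser (F : Type) := PowSer { pcoef :> nat -> F }.

Section PowerSeries.
Variable F : fieldType.
Implicit Types f g h : powser F.

Lemma pcoefK : cancel (@pcoef F) (@PowSer F). Proof. by case. Qed.

HB.instance Definition _ := Choice.copy (powser F) (can_type pcoefK).

Lemma powserP f g : f =1 g -> f = g.
Proof. by case: f g => [f] [g] /= /funext ->. Qed.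

Definition ps0 : powser F := PowSer (fun=> 0).
Definition psN f : powser F := PowSer (fun n => - f n).
Definition psD f g : powser F := PowSer (fun n => f n + g n).

Lemma psDA : associative psD.
Proof. by move=> f g h; apply: powserP => n /=; rewrite addrA. Qed.
Lemma psDC : commutative psD.
Proof. by move=> f g; apply: powserP => n /=; rewrite addrC. Qed.
Lemma ps0D : left_id ps0 psD.
Proof. by move=> f; apply: powserP => n /=; rewrite add0r. Qed.
Lemma psND : left_inverse ps0 psN psD.
Proof. by move=> f; apply: powserP => n /=; rewrite addNr. Qed.

HB.instance Definition _ := GRing.isZmodule.Build (powser F) psDA psDC ps0D psND.

Definition psC (c : F) : powser F := PowSer (fun n => if n == 0%N then c else 0).
Definition psX : powser F := PowSer (fun n => (n == 1%N)%:R).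
Definition psM f g : powser F :=
  PowSer (fun n => \sum_(i < n.+1) f i * g (n - i)%N).

Let trunc f n : {poly F} := \poly_(i < n.+1) f i.

Let psM_trunc f g n k : (k <= n)%N -> psM f g k = (trunc f n * trunc g n)`_k.
Proof.
move=> kn; rewrite coefM; apply: eq_bigr => i _.
by rewrite !coef_poly !ltnS (leq_trans (leq_ord i) kn) (leq_trans (leq_subr _ _) kn).
Qed.

Let coefM_eq (p p' q q' : {poly F}) n :
  (forall k, (k <= n)%N -> p`_k = p'`_k) -> (forall k, (k <= n)%N -> q`_k = q'`_k) ->
  (p * q)`_n = (p' * q')`_n.
Proof.
move=> hp hq; rewrite !coefM; apply: eq_bigr => i _.
by rewrite hp ?leq_ord// hq ?leq_subr.
Qed.

Lemma psMA : associative psM.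
Proof.
move=> f g h; apply: powserP => n.
rewrite (psM_trunc _ _ (leqnn n)) (psM_trunc (psM f g) _ (leqnn n)).
have E f1 g1 k : (k <= n)%N -> (trunc (psM f1 g1) n)`_k = (trunc f1 n * trunc g1 n)`_k.
  by move=> kn; rewrite coef_poly ltnS kn (psM_trunc _ _ kn).
rewrite (@coefM_eq _ (trunc f n) _ (trunc g n * trunc h n))//; last first.
  by move=> k kn; rewrite E.
rewrite mulrA; apply/esym/coefM_eq => // k kn; exact: E.
Qed.

Lemma psMC : commutative psM.
Proof.
by move=> f g; apply: powserP => n; rewrite !(psM_trunc _ _ (leqnn n)) mulrC.
Qed.

Lemma ps1M : left_id (psC 1) psM.
Proof.
move=> f; apply: powserP => n /=.
by rewrite big_ord_recl subn0 /= mul1r big1 ?addr0// => i _; rewrite mul0r.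
Qed.

Lemma psMDl : left_distributive psM psD.
Proof.
move=> f g h; apply: powserP => n /=; rewrite -big_split/=.
by apply: eq_bigr => i _; rewrite mulrDl.
Qed.

Lemma ps1_neq0 : psC 1 != 0.
Proof.
by apply/eqP => /(congr1 (fun f : powser F => f 0%N)) /= /eqP; rewrite oner_eq0.
Qed.

HB.instance Definition _ := GRing.Zmodule_isComNzRing.Build (powser F)
  psMA psMC ps1M psMDl ps1_neq0.

Definition ps_unit : pred (powser F) := fun f => `[< exists g, g * f = 1 >].
Definition ps_inv f : powser F :=
  if pselect (exists g, g * f = 1) is left e then projT1 (cid e) else f.

Lemma ps_mulVr : {in ps_unit, left_inverse 1 ps_inv *%R}.
Proof.
move=> f /asboolP e; rewrite /ps_inv; case: pselect => // e'.
by case: cid.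
Qed.
Lemma ps_unitP f g : g * f = 1 -> ps_unit f.
Proof. by move=> e; apply/asboolP; exists g. Qed.
Lemma ps_invr_out : {in [predC ps_unit], ps_inv =1 id}.
Proof.
by move=> f /asboolPn nf; rewrite /ps_inv; case: pselect.
Qed.

HB.instance Definition _ := GRing.ComNzRing_hasMulInverse.Build (powser F)
  ps_mulVr ps_unitP ps_invr_out.

Let psn0 f : f != 0 -> exists n, (f n != 0) && [forall i : 'I_n, f i == 0].
Proof.
move=> fn0; have [n Hn] : exists n, f n != 0.
  apply: contrapT => H; move/eqP: fn0; apply; apply: powserP => n /=.
  by apply/eqP; apply: contrapT => /negP E; apply: H; exists n.
have ex : exists n, (fun n => f n != 0) n by exists n.
exists (ex_minn ex); case: ex_minnP => m -> Hm /=.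
apply/forallP => i; case: eqP => // /eqP /Hm; by rewrite leqNgt ltn_ord.
Qed.

Lemma ps_idomain f g : f * g = 0 -> (f == 0) || (g == 0).
Proof.
move=> fg; apply/negPn; rewrite negb_or; apply/negP => /andP[].
move=> /psn0[m /andP[fm /forallP f0]] /psn0[n /andP[gn /forallP g0]].
have /(congr1 (fun h : powser F => h (m + n)%N)) /= := fg.
have mn : (m < (m + n).+1)%N by rewrite ltnS leq_addr.
rewrite (bigD1 (Ordinal mn)) //= big1 ?addr0 => [/eqP|i].
  by rewrite addKn mulf_eq0 (negPf fm) (negPf gn).
rewrite -val_eqE /= neq_ltn => /orP[im|mi].
  by rewrite (eqP (f0 (Ordinal im))) mul0r.
have h : (m + n - i < n)%N.
  by rewrite ltn_subLR ?ltn_add2r // -ltnS.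
by rewrite (eqP (g0 (Ordinal h))) mulr0.
Qed.

HB.instance Definition _ := GRing.ComUnitRing_isIntegral.Build (powser F) ps_idomain.

End PowerSeries.

(* F((X)) as the field of fractions of F[[X]]. *)
Definition laurent (F : fieldType) := {fraction (powser F)}.
HB.instance Definition _ (F : fieldType) := GRing.Field.on (laurent F).

Definition laurC (F : fieldType) (c : F) : laurent F := tofrac (psC c).
Definition laurX (F : fieldType) : laurent F := tofrac (psX F).
Definition laur_int (F : fieldType) : set (laurent F) := range (@tofrac (powser F)).

Section LaurentConstants.
Variable F : fieldType.

Lemma laurC_is_zmod_morphism : zmod_morphism (@laurC F).
Proof.
move=> c d; rewrite /laurC -rmorphB; congr tofrac; apply: powserP => -[|n] //=.
by rewrite subrr.
Qed.
Lemma laurC_is_monoid_morphism : monoid_morphism (@laurC F).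
Proof.
split=> [|c d]; first by rewrite /laurC -[RHS](rmorph1 (@tofrac (powser F))).
rewrite /laurC -rmorphM; congr tofrac; apply: powserP => -[|n] /=.
  by rewrite big_ord_recl big_ord0 addr0.
rewrite big_ord_recl /= mulr0 add0r big1// => i _; exact: mul0r.
Qed.
HB.instance Definition _ :=
  GRing.isZmodMorphism.Build F (laurent F) (@laurC F) laurC_is_zmod_morphism.
HB.instance Definition _ :=
  GRing.isMonoidMorphism.Build F (laurent F) (@laurC F) laurC_is_monoid_morphism.

(* The embedding F(z) -> F((X)) with z |-> a, for a transcendental over F.    *)
Definition ratfun_eval (a : laurent F) (x : {fraction {poly F}}) : laurent F :=
  (map_poly (@laurC F) (frac (repr x)).1).[a] /
  (map_poly (@laurC F) (frac (repr x)).2).[a].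

Lemma ratfun_evalE (a : laurent F) (p q : {poly F}) :
  (forall r : {poly F}, r != 0 -> (map_poly (@laurC F) r).[a] != 0) -> q != 0 ->
  ratfun_eval a (tofrac p / tofrac q) =
  (map_poly (@laurC F) p).[a] / (map_poly (@laurC F) q).[a].
Proof.
move=> tr q0; rewrite /ratfun_eval; set x := tofrac p / tofrac q.
have d0 := denom_ratioP (repr x); set n := (frac (repr x)).1.
set d := (frac (repr x)).2 in d0 *.
have xE : x = tofrac n / tofrac d.
  have -> : x = \pi_({fraction {poly F}}) (Ratio n d).
    by rewrite /n /d Ratio_numden reprK.
  apply: (mulIf (x := tofrac d)); rewrite ?tofrac_eq0// mulfVK ?tofrac_eq0//.
  rewrite /tofrac; unlock FracField.tofrac.
  rewrite -[LHS](FracField.pi_mul (Ratio n d) (Ratio d 1)).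
  apply/eqmodP; rewrite /= FracField.equivfE /FracField.mulf.
  by rewrite !numden_Ratio ?mulf_neq0 ?oner_eq0// !mulr1 mulrC.
have npdq : n * q = p * d.
  apply/eqP; rewrite -(tofrac_eq (n * q)) !rmorphM /=; apply/eqP.
  by apply/eqP; rewrite -eqr_div ?tofrac_eq0// -xE.
apply/eqP; rewrite eqr_div ?tr//.
by rewrite -!hornerM -!rmorphM npdq.
Qed.

End LaurentConstants.

(* The quaternion algebra [a, b): basis 1, I, J, IJ, with                     *)
(*   I^2 = I + a,  J^2 = b,  IJ = J(1 - I).                                   *)
(* An element is alpha + beta J with alpha, beta in F + F I, and              *)
(* J alpha = (conj alpha) J where conj I = 1 - I.                             *)

Record quat (F : Type) (a b : F) :=
  Quat { qu1 : F; quI : F; quJ : F; quIJ : F }.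

Section Quaternion.
Variables (F : fieldType) (a b : F).
Local Notation Q := (quat a b).
Local Notation mkQ := (Quat a b).
Implicit Types x y : Q.

Definition quat_tuple x := (qu1 x, quI x, quJ x, quIJ x).
Definition tuple_quat (t : F * F * F * F) : Q :=
  let: (x0, x1, x2, x3) := t in mkQ x0 x1 x2 x3.
Lemma quat_tupleK : cancel quat_tuple tuple_quat. Proof. by case. Qed.
HB.instance Definition _ := Choice.copy Q (can_type quat_tupleK).

Definition quD x y : Q :=
  mkQ (qu1 x + qu1 y) (quI x + quI y) (quJ x + quJ y) (quIJ x + quIJ y).
Definition quN x : Q := mkQ (- qu1 x) (- quI x) (- quJ x) (- quIJ x).

Ltac quat_ring := repeat case=> ? ? ? ?; congr Quat => /=; ring.

Lemma quDA : associative quD. Proof. by quat_ring. Qed.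
Lemma quDC : commutative quD. Proof. by quat_ring. Qed.
Lemma qu0D : left_id (mkQ 0 0 0 0) quD. Proof. by quat_ring. Qed.
Lemma quND : left_inverse (mkQ 0 0 0 0) quN quD. Proof. by quat_ring. Qed.
HB.instance Definition _ := GRing.isZmodule.Build Q quDA quDC qu0D quND.

Definition quM x y : Q :=
  let: Quat x0 x1 x2 x3 := x in let: Quat y0 y1 y2 y3 := y in
  mkQ (x0 * y0 + a * (x1 * y1) + b * (x2 * (y2 + y3) - a * (x3 * y3)))
      (x0 * y1 + x1 * y0 + x1 * y1 + b * (x3 * y2 - x2 * y3))
      (x0 * y2 + a * (x1 * y3) + x2 * (y0 + y1) - a * (x3 * y1))
      (x0 * y3 + x1 * y2 + x1 * y3 - x2 * y1 + x3 * y0).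

Lemma quMA : associative quM. Proof. by quat_ring. Qed.
Lemma qu1M : left_id (mkQ 1 0 0 0) quM. Proof. by quat_ring. Qed.
Lemma quM1 : right_id (mkQ 1 0 0 0) quM. Proof. by quat_ring. Qed.
Lemma quMDl : left_distributive quM quD. Proof. by quat_ring. Qed.
Lemma quMDr : right_distributive quM quD. Proof. by quat_ring. Qed.
Lemma qu1_neq0 : mkQ 1 0 0 0 != 0.
Proof. by apply/eqP => -[] /eqP; rewrite oner_eq0. Qed.
HB.instance Definition _ := GRing.Zmodule_isNzRing.Build Q
  quMA qu1M quM1 quMDl quMDr qu1_neq0.

Definition quZ (c : F) x : Q := mkQ (c * qu1 x) (c * quI x) (c * quJ x) (c * quIJ x).
Lemma quZA c d x : quZ c (quZ d x) = quZ (c * d) x.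
Proof. by case: x => *; congr Quat => /=; ring. Qed.
Lemma quZ1 : left_id 1 quZ. Proof. by quat_ring. Qed.
Lemma quZDr : right_distributive quZ +%R.
Proof. by move=> c; quat_ring. Qed.
Lemma quZDl x : {morph quZ^~ x : c d / c + d}.
Proof. by move=> c d; case: x => *; congr Quat => /=; ring. Qed.
HB.instance Definition _ := GRing.Zmodule_isLmodule.Build F Q quZA quZ1 quZDr quZDl.

Lemma quZMl (c : F) x y : c *: (x * y) = (c *: x) * y.
Proof. by case: x y => [? ? ? ?] [? ? ? ?]; congr Quat => /=; ring. Qed.
HB.instance Definition _ := GRing.Lmodule_isLalgebra.Build F Q quZMl.
Lemma quZMr (c : F) x y : c *: (x * y) = x * (c *: y).
Proof. by case: x y => [? ? ? ?] [? ? ? ?]; congr Quat => /=; ring. Qed.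
HB.instance Definition _ := GRing.Lalgebra_isAlgebra.Build F Q quZMr.

Definition quconj x : Q :=
  mkQ (qu1 x + quI x) (- quI x) (- quJ x) (- quIJ x).
Definition qunorm x : F :=
  let: Quat x0 x1 x2 x3 := x in
  x0 ^+ 2 + x0 * x1 - a * x1 ^+ 2 - b * (x2 ^+ 2 + x2 * x3 - a * x3 ^+ 2).

Lemma qunormM x y : qunorm (x * y) = qunorm x * qunorm y.
Proof. by case: x y => [? ? ? ?] [? ? ? ?]; rewrite /= ; ring. Qed.
Lemma qunorm1 : qunorm 1 = 1. Proof. by rewrite /=; ring. Qed.
Lemma quconjM x : quconj x * x = qunorm x *: 1.
Proof. by case: x => *; congr Quat => /=; ring. Qed.
Lemma quMconj x : x * quconj x = qunorm x *: 1.
Proof. by case: x => *; congr Quat => /=; ring. Qed.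

Definition qu_unit : pred Q := fun x => qunorm x != 0.
Definition quV x : Q := if qunorm x == 0 then x else (qunorm x)^-1 *: quconj x.

Lemma quVM : {in qu_unit, left_inverse 1 quV *%R}.
Proof.
move=> x; rewrite unfold_in => nx.
by rewrite /quV (negPf nx) -scalerAl quconjM scalerA mulVf// scale1r.
Qed.
Lemma quMV : {in qu_unit, right_inverse 1 quV *%R}.
Proof.
move=> x; rewrite unfold_in => nx.
by rewrite /quV (negPf nx) -scalerAr quMconj scalerA mulVf// scale1r.
Qed.
Lemma qu_unitP x y : y * x = 1 /\ x * y = 1 -> qu_unit x.
Proof.
move=> [/(congr1 qunorm)]; rewrite qunormM qunorm1 => e _; apply/eqP => nx0.
by move/eqP: e; rewrite nx0 mulr0 eq_sym oner_eq0.
Qed.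
Lemma quV_out : {in [predC qu_unit], quV =1 id}.
Proof. by move=> x; rewrite inE unfold_in negbK /quV => ->. Qed.
HB.instance Definition _ := GRing.NzRing_hasMulInverse.Build Q
  quVM quMV qu_unitP quV_out.

Definition qI : Q := mkQ 0 1 0 0.
Definition qJ : Q := mkQ 0 0 1 0.

Lemma quatE x : x = qu1 x *: 1 + quI x *: qI + quJ x *: qJ + quIJ x *: (qI * qJ).
Proof. by case: x => *; congr Quat => /=; ring. Qed.
Lemma qII : qI ^+ 2 = qI + a *: 1. Proof. by congr Quat => /=; ring. Qed.
Lemma qJJ : qJ ^+ 2 = b *: 1. Proof. by congr Quat => /=; ring. Qed.
Lemma qIJ : qI * qJ = qJ * (1 - qI). Proof. by congr Quat => /=; ring. Qed.

(* The K-linear extension of I |-> mI, J |-> mJ along e : F -> L. *)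
Definition quat_rep (L : fieldType) (e : F -> L) (mI mJ : 'M[L]_2) x : 'M[L]_2 :=
  (e (qu1 x))%:M + e (quI x) *: mI + e (quJ x) *: mJ + e (quIJ x) *: (mI *m mJ).

Definition qunits := {x : Q | x \is a GRing.unit}.
HB.instance Definition _ := Choice.on qunits.

Definition proj_eq (x y : qunits) :=
  `[< exists2 c : F, c != 0 & val x = c *: val y >].

Implicit Types u v w : qunits.
Lemma proj_eq_refl : reflexive proj_eq.
Proof. by move=> x; apply/asboolP; exists 1; rewrite ?oner_eq0 ?scale1r. Qed.
Lemma proj_eq_sym : symmetric proj_eq.
Proof.
suff H u v : proj_eq u v -> proj_eq v u by move=> u v; apply/idP/idP; exact: H.
move=> /asboolP[c c0 e]; apply/asboolP; exists c^-1; rewrite ?invr_eq0//.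
by rewrite e scalerA mulVf// scale1r.
Qed.
Lemma proj_eq_trans : transitive proj_eq.
Proof.
move=> y x z /asboolP[c c0 e] /asboolP[d d0 f]; apply/asboolP.
by exists (c * d); rewrite ?mulf_neq0// e f scalerA.
Qed.
Canonical proj_equiv := EquivRel proj_eq proj_eq_refl proj_eq_sym proj_eq_trans.

(* pquat is the group of units modulo F^x. *)
Definition pquat := {eq_quot proj_eq}.
HB.instance Definition _ := Choice.on pquat.
HB.instance Definition _ := EqQuotient.on pquat.

Definition qu_one : qunits := exist _ 1 (unitr1 Q).
Definition qu_inv u : qunits :=
  exist _ (val u)^-1 (etrans (unitrV (val u)) (valP u)).
Definition qu_mul u v : qunits :=
  exist _ (val u * val v) (etrans (unitrMr (val v) (valP u)) (valP v)).

Definition pq_one : pquat := \pi_pquat qu_one.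
Definition pq_inv := lift_op1 pquat qu_inv.
Definition pq_mul := lift_op2 pquat qu_mul.

Lemma pi_pq_inv : {morph \pi_pquat : u / qu_inv u >-> pq_inv u}.
Proof.
move=> u; unlock pq_inv; apply/eqmodP/asboolP => /=.
have /eqmodP/asboolP[c c0 e] : u = repr (\pi_pquat u) %[mod pquat] by rewrite reprK.
exists c^-1; rewrite ?invr_eq0//= e invrZ ?unitfE//; exact: valP.
Qed.
Canonical pi_pq_inv_morph := PiMorph1 pi_pq_inv.

Lemma pi_pq_mul : {morph \pi_pquat : u v / qu_mul u v >-> pq_mul u v}.
Proof.
move=> u v; unlock pq_mul; apply/eqmodP/asboolP => /=.
have /eqmodP/asboolP[c c0 e] : u = repr (\pi_pquat u) %[mod pquat] by rewrite reprK.
have /eqmodP/asboolP[d d0 f] : v = repr (\pi_pquat v) %[mod pquat] by rewrite reprK.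
by exists (c * d); rewrite ?mulf_neq0//= e f -scalerAl -scalerAr scalerA.
Qed.
Canonical pi_pq_mul_morph := PiMorph2 pi_pq_mul.

Lemma pq_mulA : associative pq_mul.
Proof.
elim/quotW=> u; elim/quotW=> v; elim/quotW=> w; rewrite !piE.
by congr \pi; apply: val_inj; rewrite /= mulrA.
Qed.
Lemma pq_mul1g : left_id pq_one pq_mul.
Proof.
by elim/quotW=> u; rewrite /pq_one !piE; congr \pi; apply: val_inj; rewrite /= mul1r.
Qed.
Lemma pq_mulg1 : right_id pq_one pq_mul.
Proof.
by elim/quotW=> u; rewrite /pq_one !piE; congr \pi; apply: val_inj; rewrite /= mulr1.
Qed.
Lemma pq_mulVg : left_inverse pq_one pq_inv pq_mul.
Proof.
elim/quotW=> u; rewrite /pq_one !piE; congr \pi; apply: val_inj => /=.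
by rewrite mulVr// (valP u).
Qed.
Lemma pq_mulgV : right_inverse pq_one pq_inv pq_mul.
Proof.
elim/quotW=> u; rewrite /pq_one !piE; congr \pi; apply: val_inj => /=.
by rewrite mulrV// (valP u).
Qed.
HB.instance Definition _ := isGroup.Build pquat
  pq_mulA pq_mul1g pq_mulg1 pq_mulVg pq_mulgV.

(* The class of a unit; non-units, on which it is never used, are sent to 1. *)
Definition pclass x : pquat := \pi_pquat (insubd qu_one x).

End Quaternion.

Section Groups.
Variable G : groupType.
Implicit Types (A B H N : set G).
Local Open Scope group_scope.

Definition subgroup H :=
  [/\ H 1, (forall x y, H x -> H y -> H (x * y)) & (forall x, H x -> H x^-1)].

Definition generated A : set G := smallest subgroup A.

Definition prod_set A B : set G := [set a * b | a in A & b in B].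

Definition lcosets N H : set (set G) := [set prod_set [set x] N | x in H].

Definition finite_index N H := finite_set (lcosets N H).

Definition commensurable H1 H2 :=
  finite_index (H1 `&` H2) H1 /\ finite_index (H1 `&` H2) H2.

Definition normal_subgroup N H :=
  [/\ subgroup N, N `<=` H & (forall x n, H x -> N n -> N (x * n * x^-1))].

Definition torsion_free H := forall x n, H x -> (0 < n)%N -> x ^+ n = 1 -> x = 1.

Record V4_structure H A B : Prop := V4Structure {
  V4_finl : finite_set A;
  V4_finr : finite_set B;
  V4_gen : generated (A `|` B) = H;
  V4_invl : forall a, A a -> A a^-1;
  V4_invr : forall b, B b -> B b^-1;
  V4_comm : prod_set A B = prod_set B A;
  V4_bijl : set_bij (A `*` B) (prod_set A B) (fun p => p.1 * p.2);
  V4_bijr : set_bij (A `*` B) (prod_set A B) (fun p => p.2 * p.1)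
}.

(* Words in X and the formal inverses of its elements: (x, true) is x^-1. *)
Definition word (X : Type) := seq (X * bool).

Definition word_eval X (f : X -> G) (w : word X) : G :=
  \prod_(l <- w) (if l.2 then (f l.1)^-1 else f l.1).

End Groups.

(* Equality of words in the group < X | u = v for all (u, v) in rels >. *)
Inductive pres_eq (X : Type) (rels : set (word X * word X)) :
    word X -> word X -> Prop :=
| PresRefl w : pres_eq rels w w
| PresSym v w : pres_eq rels v w -> pres_eq rels w v
| PresTrans u v w : pres_eq rels u v -> pres_eq rels v w -> pres_eq rels u w
| PresFree x b : pres_eq rels [:: (x, b); (x, ~~ b)] [::]
| PresRel u v : rels (u, v) -> pres_eq rels u v
| PresCat u u' v v' : pres_eq rels u u' -> pres_eq rels v v' ->
    pres_eq rels (u ++ v) (u' ++ v').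

(* H = < X | rels > with f giving the elements named by the generators. *)
Definition presentation (G : groupType) (H : set G) (X : Type) (f : X -> G)
    (rels : set (word X * word X)) :=
  H = range (word_eval f) /\
  forall u v, word_eval f u = word_eval f v <-> pres_eq rels u v.

(* Sets with a composition law, isomorphic through a multiplicative bijection. *)
Definition isomorphic (T U : Type) (A : set T) (mulT : T -> T -> T)
    (B : set U) (mulU : U -> U -> U) :=
  exists2 f : T -> U, set_bij A B f &
    forall x y, A x -> A y -> f (mulT x y) = mulU (f x) (f y).

Record regular_tree (T : eqType) (V : set T) (adj : T -> T -> Prop) (n : nat) :
    Prop := RegularTree {
  rt_inhab : V !=set0;
  rt_vertex : forall v w, adj v w -> V v /\ V w;
  rt_sym : forall v w, adj v w -> adj w v;
  rt_irr : forall v, ~ adj v v;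
  rt_conn : forall v w, V v -> V w ->
    exists2 p, path (fun x y => `[< adj x y >]) v p & last v p = w;
  rt_acyclic : forall c : seq T, (2 < size c)%N -> uniq c ->
    ~ cycle (fun x y => `[< adj x y >]) c;
  rt_valency : forall v, V v -> [set w | adj v w] #= `I_n
}.

Section BruhatTits.
Variable F : fieldType.
Local Notation L := (laurent F).
Implicit Types M N : set 'cV[L]_2.

Definition std_lattice : set 'cV[L]_2 := [set v | forall i, laur_int (v i 0)].

Definition is_lattice M :=
  exists2 g : 'M[L]_2, g \in unitmx & M = [set g *m v | v in std_lattice].

Definition scale_lattice (c : L) M : set 'cV[L]_2 := [set c *: v | v in M].

Definition homothety_class M : set (set 'cV[L]_2) :=
  [set scale_lattice c M | c in [set c | c != 0]].

(* The tree of PGL_2(F((X))) has BT_vertex as vertices and BT_adj as edges. *)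
Definition BT_vertex : set (set (set 'cV[L]_2)) :=
  [set homothety_class M | M in is_lattice].

Definition BT_adj (v w : set (set 'cV[L]_2)) :=
  [/\ BT_vertex v, BT_vertex w &
      exists M1 M2, [/\ v M1, w M2,
        scale_lattice (laurX F) M1 `<` M2 & M2 `<` M1]].

Definition BT_act (g : 'M[L]_2) (v : set (set 'cV[L]_2)) : set (set 'cV[L]_2) :=
  [set [set g *m x | x in M] | M in v].

End BruhatTits.

Section FundamentalGroup.
Variables (R : realType) (S : topologicalType).
Local Notation I01 := (`[0, 1]%classic : set R).
Implicit Types alpha beta gamma : R -> S.

(* A path is a map on [0, 1]; its values elsewhere are irrelevant. *)
Definition is_path alpha (x y : S) :=
  [/\ {within I01, continuous alpha}, alpha 0 = x & alpha 1 = y].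

Definition homotopic alpha beta :=
  exists H : R * R -> S,
    [/\ {within I01 `*` I01, continuous H},
        (forall s, I01 s -> H (0, s) = alpha s /\ H (1, s) = beta s) &
        (forall r, I01 r -> H (r, 0) = alpha 0 /\ H (r, 1) = alpha 1)].

Definition homotopy_class alpha : set (R -> S) := [set beta | homotopic alpha beta].

Definition path_cat alpha beta : R -> S :=
  fun s => if s <= 2^-1 then alpha (2 * s) else beta (2 * s - 1).

Definition pi1 (s : S) : set (set (R -> S)) :=
  [set c | exists2 alpha, is_path alpha s s & c = homotopy_class alpha].

Definition pi1_mul (c d : set (R -> S)) : set (R -> S) :=
  [set gamma | exists alpha beta,
    [/\ c alpha, d beta & homotopic (path_cat alpha beta) gamma]].

Variables (G : groupType) (act : G -> S -> S).

Definition pi1_orb (s : S) : set (set (R -> S) * G) :=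
  [set p | exists2 alpha, is_path alpha s (act p.2 s) & p.1 = homotopy_class alpha].

Definition pi1_orb_mul (p q : set (R -> S) * G) : set (R -> S) * G :=
  ([set gamma | exists alpha beta,
     [/\ p.1 alpha, q.1 beta &
         homotopic (path_cat alpha (act p.2 \o beta)) gamma]],
   (p.2 * q.2)%g).

End FundamentalGroup.

Arguments pi1 R {S} s.
Arguments pi1_mul R {S} c d.
Arguments pi1_orb R {S G} act s.
Arguments pi1_orb_mul R {S G} act p q.

(* (ev, eh) stands for gamma_v ^ ev * gamma_h ^ eh. *)
Definition V4 := (bool * bool)%type.
HB.instance Definition _ := Choice.on V4.

Definition V4_mul (g h : V4) : V4 := (g.1 (+) h.1, g.2 (+) h.2).
Lemma V4_mulA : associative V4_mul.
Proof. by move=> [? ?] [? ?] [? ?]; rewrite /V4_mul/= !addbA. Qed.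
Lemma V4_mul1g : left_id ((false, false) : V4) V4_mul.
Proof. by case. Qed.
Lemma V4_mulg1 : right_id ((false, false) : V4) V4_mul.
Proof. by move=> [? ?]; rewrite /V4_mul/= !addbF. Qed.
Lemma V4_mulgg : left_inverse ((false, false) : V4) id V4_mul.
Proof. by move=> [? ?]; rewrite /V4_mul/= !addbb. Qed.
HB.instance Definition _ :=
  isGroup.Build V4 V4_mulA V4_mul1g V4_mulg1 V4_mulgg V4_mulgg.

Section SquareComplex.
Variables (R : realType) (G : groupType) (A B : set G).
Local Open Scope group_scope.

(* [(i, j)] is s_ij; [VEdge a i] is (a, i) and [HEdge b j] is (b, j), each    *)
(* standing for an edge and its reverse; [Sq a b' b a'] is [a, b'; b, a'].    *)
Inductive edge := VEdge of G & bool | HEdge of G & bool.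
Inductive square := Sq of G & G & G & G.

Definition sc_vertices : set (bool * bool) := setT.

Definition sc_edges : set edge :=
  [set e | match e with VEdge a _ => A a | HEdge b _ => B b end].

Definition sc_squares : set square :=
  [set q | let: Sq a b' b a' := q in [/\ A a, A a', B b, B b' & a * b' = b * a']].

Definition edge_src e := match e with VEdge _ i => (i, false) | HEdge _ j => (false, j) end.
Definition edge_tgt e := match e with VEdge _ i => (i, true) | HEdge _ j => (true, j) end.

(* The points of the geometric realization: the vertices, and the points of   *)
(* the open cells, which are parametrized by ]0, 1[ and ]0, 1[ x ]0, 1[.      *)
Inductive cell_point :=
| PVertex of bool * bool
| PEdge of edge & R
| PSquare of square & R & R.

HB.instance Definition _ := gen_eqMixin cell_point.
HB.instance Definition _ := gen_choiceMixin cell_point.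

Definition sc_points : set cell_point :=
  [set p | match p with
           | PVertex v => sc_vertices v
           | PEdge e x => sc_edges e /\ (0 < x < 1)%R
           | PSquare q x y =>
               [/\ sc_squares q, (0 < x < 1)%R & (0 < y < 1)%R]
           end].

Local Open Scope ring_scope.
Local Notation I01 := (`[0, 1]%classic : set R).

(* Characteristic maps of the closed cells [0, 1] and [0, 1] x [0, 1].  In a  *)
(* square the first coordinate is horizontal, the second vertical, so that    *)
(* the boundary of [a, b'; b, a'] read from (0, 0) is (a, 0) upwards, (b', 1) *)
(* rightwards, (a', 1) downwards and (b, 0) leftwards.                        *)
Definition edge_chart (e : edge) (x : R) : cell_point :=
  if x <= 0 then PVertex (edge_src e)
  else if 1 <= x then PVertex (edge_tgt e)
  else PEdge e x.

Definition square_chart (q : square) (xy : R * R) : cell_point :=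
  let: Sq a b' b a' := q in let: (x, y) := xy in
  if x <= 0 then edge_chart (VEdge a false) y
  else if 1 <= x then edge_chart (VEdge a' true) y
  else if y <= 0 then edge_chart (HEdge b false) x
  else if 1 <= y then edge_chart (HEdge b' true) x
  else PSquare q x y.

Definition realization := set_type sc_points.
HB.instance Definition _ := Choice.on realization.

(* The weak topology: a set is open when its preimages under all the          *)
(* characteristic maps are open.                                              *)
Definition sc_open (U : set realization) :=
  (forall e, sc_edges e ->
     open ((edge_chart e @^-1` (val @` U)) : set (subspace I01))) /\
  (forall q, sc_squares q ->
     open ((square_chart q @^-1` (val @` U))
           : set (subspace (I01 `*` I01)))).

Lemma sc_openT : sc_open setT.
Proof.
have cover_edge e x : sc_edges e -> I01 x -> sc_points (edge_chart e x).
  move=> he; rewrite /= in_itv /= /edge_chart => /andP[x0 x1].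
  by case: ltgtP x0 => // x0 _; case: ltgtP x1 => // x1 _; split; rewrite ?x0.
have setval (P : cell_point -> Prop) p : sc_points p -> (val @` [set: realization]) p.
  by move=> hp; exists (exist _ p (mem_set hp)).
split=> [e he|q hq].
- rewrite -open_subspaceIT (_ : _ `&` _ = I01); first exact: open_subspaceT.
  rewrite eqEsubset; split=> [x []//|x hx]; split=> //.
  by apply: (setval xpredT); exact: cover_edge.
- rewrite -open_subspaceIT (_ : _ `&` _ = I01 `*` I01); first exact: open_subspaceT.
  rewrite eqEsubset; split=> [x []//|[x y] [/= hx hy]]; split=> //.
  apply: (setval xpredT); case: q hq => a b' b a' hq; have [ha ha' hb hb' _] := hq.
  rewrite /square_chart; case: leP => x0; first by apply: cover_edge.
  case: leP => x1; first by apply: cover_edge.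
  case: leP => y0; first by apply: cover_edge.
  case: leP => y1; first by apply: cover_edge.
  by split; rewrite ?x0 ?y0.
Qed.

Lemma sc_openI : setI_closed sc_open.
Proof.
move=> U V [oU1 oU2] [oV1 oV2].
have E : val @` (U `&` V) = (val @` U) `&` (val @` V).
  rewrite eqEsubset; split=> [p [x [Ux Vx] <-]|p [[x Ux <-] [y Vy /val_inj yx]]].
    by split; exists x.
  by exists x; rewrite // -yx; split=> //; rewrite yx.
split=> [e he|q hq]; rewrite E preimage_setI; apply: openI.
- exact: oU1.
- exact: oV1.
- exact: oU2.
- exact: oV2.
Qed.

Lemma sc_open_bigU (I : Type) (f : I -> set realization) :
  (forall i, sc_open (f i)) -> sc_open (\bigcup_i f i).
Proof.
move=> of_; split=> [e he|q hq]; rewrite image_bigcup preimage_bigcup;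
  apply: bigcup_open => i _.
- by have [+ _] := of_ i; apply.
- by have [_] := of_ i; apply.
Qed.

HB.instance Definition _ :=
  isOpenTopological.Build realization sc_openT sc_openI sc_open_bigU.

Lemma sc_points_vertex v : sc_points (PVertex v). Proof. by []. Qed.

Definition base_vertex : realization :=
  exist _ (PVertex (false, false)) (mem_set (sc_points_vertex _)).

(* The actions of gamma_v (flip_v) and gamma_h (flip_h).  A reversed edge is  *)
(* the same edge with its parameter x replaced by 1 - x; the image of a       *)
(* square is the one with the images of its sides, e.g. gamma_v takes         *)
(* [a, b'; b, a'] to [a^-1, b; b', a'^-1].                                    *)
Definition flip_v (p : cell_point) : cell_point :=
  match p with
  | PVertex (i, j) => PVertex (i, ~~ j)
  | PEdge (VEdge a i) x => PEdge (VEdge a^-1%g i) (1 - x)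
  | PEdge (HEdge b j) x => PEdge (HEdge b (~~ j)) x
  | PSquare (Sq a b' b a') x y => PSquare (Sq a^-1%g b b' a'^-1%g) x (1 - y)
  end.

Definition flip_h (p : cell_point) : cell_point :=
  match p with
  | PVertex (i, j) => PVertex (~~ i, j)
  | PEdge (VEdge a i) x => PEdge (VEdge a (~~ i)) x
  | PEdge (HEdge b j) x => PEdge (HEdge b^-1%g j) (1 - x)
  | PSquare (Sq a b' b a') x y => PSquare (Sq a' b'^-1%g b^-1%g a) (1 - x) y
  end.

Variables (H : set G) (V : V4_structure H A B).

Let itv_flip (x : R) : 0 < x < 1 -> 0 < 1 - x < 1.
Proof. by move=> /andP[x0 x1]; rewrite subr_gt0 x1 gtrBl. Qed.

Lemma flip_v_points p : sc_points p -> sc_points (flip_v p).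
Proof.
case: p => [[i j]//|[a i|b j] x|[a b' b a'] x y] /=.
- by move=> [ha hx]; split; [exact: (V4_invl V)|exact: itv_flip].
- by [].
- move=> [[ha ha' hb hb' e] hx hy]; split=> //; last exact: itv_flip.
  split=> //; [exact: (V4_invl V)|exact: (V4_invl V)|].
  by apply: (mulgI a); rewrite mulgA mulgV mul1g mulgA e mulgK.
Qed.

Lemma flip_h_points p : sc_points p -> sc_points (flip_h p).
Proof.
case: p => [[i j]//|[a i|b j] x|[a b' b a'] x y] /=.
- by [].
- by move=> [ha hx]; split; [exact: (V4_invr V)|exact: itv_flip].
- move=> [[ha ha' hb hb' e] hx hy]; split=> //; last exact: itv_flip.
  split=> //; [exact: (V4_invr V)|exact: (V4_invr V)|].
  by apply: (mulgI b); rewrite !mulgA -e mulgK mulgV mul1g.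
Qed.

Lemma V4_act_points (g : V4) p : sc_points p ->
  sc_points ((if g.1 then flip_v else id) ((if g.2 then flip_h else id) p)).
Proof.
by move=> hp; case: g => -[] [] //=; try apply: flip_v_points;
  try apply: flip_h_points.
Qed.

Definition V4_act (g : V4) (p : realization) : realization :=
  exist _ ((if g.1 then flip_v else id) ((if g.2 then flip_h else id) (val p)))
    (mem_set (V4_act_points g (set_mem (valP p)))).

End SquareComplex.

Arguments V4_act R {G A B H} V g p.

Definition K := {fraction {poly 'F_2}}.
HB.instance Definition _ := GRing.Field.on K.

Definition z : K := tofrac 'X.

(* Since char K = 2, the relations defining [quat] are here I^2 + I = z,      *)
(* J^2 = 1 + z^3 and IJ = J(I + 1).                                           *)
Definition Q := quat z (1 + z ^+ 3).
HB.instance Definition _ := GRing.UnitAlgebra.on Q.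

Definition PQ := pquat z (1 + z ^+ 3).
HB.instance Definition _ := Group.on PQ.

Definition Q_I : Q := qI z (1 + z ^+ 3).
Definition Q_J : Q := qJ z (1 + z ^+ 3).

Lemma K_char2 : 2 = 0 :> K.
Proof.
have -> : (2 : K) = tofrac 2 by rewrite rmorphMn rmorph1.
rewrite -polyC_natr (_ : 2%:R = 0 :> 'F_2); last exact: val_inj.
by rewrite polyC0 rmorph0.
Qed.

Lemma Q_opp (x : Q) : - x = x.
Proof.
by apply/esym/eqP; rewrite -addr_eq0 -mulr2n -scaler_nat K_char2 scale0r.
Qed.

Lemma Q_II : Q_I ^+ 2 + Q_I = z%:A.
Proof. by rewrite -[X in _ + X]Q_opp [Q_I ^+ 2]qII addrC addKr. Qed.
Lemma Q_JJ : Q_J ^+ 2 = (1 + z ^+ 3)%:A.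
Proof. exact: qJJ. Qed.
Lemma Q_IJ : Q_I * Q_J = Q_J * (Q_I + 1).
Proof. by rewrite -[X in X + 1]Q_opp [- Q_I + 1]addrC [LHS]qIJ. Qed.

Definition C1 : Q := (1 + z ^+ 2)%:A + Q_I * Q_J.
Definition C2 : Q := (z + z ^+ 2)%:A + Q_I * Q_J.
Definition B1 : Q := (1 + z) *: Q_I + Q_J.
Definition B2 : Q := (z + z ^+ 2)%:A + (1 + z) *: Q_I + Q_J + Q_I * Q_J.

Section Norms.
Variables (F : fieldType) (x : F).
Hypothesis F_char2 : 2 = 0 :> F.
Local Notation I := (qI x (1 + x ^+ 3)).
Local Notation J := (qJ x (1 + x ^+ 3)).

Lemma qunorm_C1 : qunorm ((1 + x ^+ 2)%:A + I * J) = 1 + x.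
Proof. by rewrite -[RHS]addr0 -(mul0r (x ^+ 2 + x ^+ 4)) -F_char2 /=; ring. Qed.
Lemma qunorm_C2 : qunorm ((x + x ^+ 2)%:A + I * J) = x * (1 + x).
Proof. by rewrite -[RHS]addr0 -(mul0r (x ^+ 3 + x ^+ 4)) -F_char2 /=; ring. Qed.
Lemma qunorm_B1 : qunorm ((1 + x) *: I + J) = 1 + x.
Proof.
by rewrite -[RHS]addr0 -(mul0r (- 1 - x - x ^+ 2 - x ^+ 3)) -F_char2 /=; ring.
Qed.
Lemma qunorm_B2 :
  qunorm ((x + x ^+ 2)%:A + (1 + x) *: I + J + I * J) = x * (1 + x).
Proof. by rewrite -[RHS]addr0 -(mul0r (x ^+ 4 - 1)) -F_char2 /=; ring. Qed.
End Norms.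

Lemma z_neq0 : z != 0. Proof. by rewrite tofrac_eq0 polyX_eq0. Qed.
Lemma z1_neq0 : 1 + z != 0.
Proof.
by rewrite -(tofrac1 {poly 'F_2}) -tofracD tofrac_eq0 addrC -size_poly_eq0 size_XaddC.
Qed.

Lemma C1_unit : C1 \is a GRing.unit.
Proof. by apply: etrans z1_neq0; congr (_ != 0); apply: (qunorm_C1 z K_char2). Qed.
Lemma C2_unit : C2 \is a GRing.unit.
Proof.
apply: etrans (mulf_neq0 z_neq0 z1_neq0); congr (_ != 0).
exact: (qunorm_C2 z K_char2).
Qed.
Lemma B1_unit : B1 \is a GRing.unit.
Proof. by apply: etrans z1_neq0; congr (_ != 0); apply: (qunorm_B1 z K_char2). Qed.
Lemma B2_unit : B2 \is a GRing.unit.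
Proof.
apply: etrans (mulf_neq0 z_neq0 z1_neq0); congr (_ != 0).
exact: (qunorm_B2 z K_char2).
Qed.

Definition c1 : PQ := pclass C1.
Definition c2 : PQ := pclass C2.
Definition b1 : PQ := pclass B1.
Definition b2 : PQ := pclass B2.

Definition setA : set PQ := [set b1; b1^-1%g; c1].
Definition setB : set PQ := [set b2; b2^-1%g; c2].

Definition coord_ring : set K :=
  [set x | exists p n, x = tofrac p / (z * (1 + z ^+ 3)) ^+ n].

Definition order_O : set Q :=
  [set x | [/\ coord_ring (qu1 x), coord_ring (quI x),
               coord_ring (quJ x) & coord_ring (quIJ x)]].

Definition G_R : set PQ :=
  [set g | exists x : Q, [/\ x \is a GRing.unit, order_O x, order_O x^-1
                           & g = pclass x]].

Definition arithmetic_lattice (H : set PQ) := subgroup H /\ commensurable H G_R.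

Definition mx2 (L : Type) (p q r s : L) : 'M[L]_2 :=
  \matrix_(i, j) if i == 0 then if j == 0 then p else q
                 else if j == 0 then r else s.

Local Notation L := (laurent 'F_2).

Definition rho_y : Q -> 'M[L]_2 :=
  let y : L := laurX 'F_2 in let zy := y ^+ 2 + y in
  quat_rep (ratfun_eval zy) (mx2 y 0 0 (1 + y)) (mx2 0 (1 + zy ^+ 3) 1 0).

Definition rho_t : Q -> 'M[L]_2 :=
  let t : L := laurX 'F_2 in let u := t ^+ 2 + t in
  quat_rep (ratfun_eval u^-1)
    (mx2 (1 + u + t) (1 + u ^+ 3) u^-1 (u + t))
    (mx2 0 (u^-1 + u ^+ 2) (u ^- 2) 0).

(* As rho_y and rho_t map K^x to scalar matrices, the actions of a class and  *)
(* of any of its representatives on homothety classes agree.                  *)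
Definition act_0 (g : PQ) := BT_act (rho_y (val (repr g))).
Definition act_oo (g : PQ) := BT_act (rho_t (val (repr g))).

(* Both completions of K being copies of F_2((X)), T_0 and T_oo are the same  *)
(* tree; the actions on them differ.                                          *)
Definition T_vertex : set (set (set 'cV[L]_2)) := @BT_vertex 'F_2.
Definition T_adj := @BT_adj 'F_2.

Definition simply_transitive (H : set PQ) :=
  forall v w v' w', T_vertex v -> T_vertex w -> T_vertex v' -> T_vertex w' ->
    exists! g : PQ, [/\ H g, act_0 g v = v' & act_oo g w = w'].

Inductive gen := Gb1 | Gb2 | Gc1 | Gc2.

Definition gen_val (x : gen) : PQ :=
  match x with Gb1 => b1 | Gb2 => b2 | Gc1 => c1 | Gc2 => c2 end.

Definition relations : set (word gen * word gen) :=
  let b1 := (Gb1, false) in let b2 := (Gb2, false) in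
  let c1 := (Gc1, false) in let c2 := (Gc2, false) in let b2V := (Gb2, true) in
  [set ([:: c1; c1], [::]); ([:: c2; c2], [::]); ([:: c1; c2], [:: c2; c1]);
       ([:: b1; b2; c1; b2], [::]); ([:: b1; c2; b1; b2V], [::])].

(* Main.v *)
(* At the standard vertices v of T_0 and w of T_oo, the elements of A fix v and *)
(* move w to its three neighbours, while those of B fix w and move v to its    *)
(* three neighbours. Since AB = BA, every element of Lambda is alpha beta with *)
(* alpha a reduced word in A and beta a reduced word in B; alpha moves w along *)
(* a walk without backtracking, and beta moves v in the same way. Such walks   *)
(* in a tree are not closed, so the action is simply transitive and the        *)
(* squares are defining relations. Paths of Sigma deform to edge paths by      *)
(* contracting open stars, and the product of the letters of an edge path is   *)
(* invariant under homotopy by a lifting argument, which identifies the        *)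
(* orbispace fundamental group with Lambda and that of Sigma with the kernel   *)
(* Gamma of the type map to V_4. A torsion element fixes a vertex or inverts   *)
(* an edge of each tree; the latter is incompatible with a trivial type.       *)
(* Commensurability with G(R) reduces to the finiteness of the stabilizer of   *)
(* (v, w) in G(R). Represent one of its elements by a primitive quaternion x   *)
(* with coordinates in F_2[z]: fixing v means that z does not divide the norm  *)
(* of x, anisotropy at 1+z and 1+z+z^2 bounds its degree by 3, and then fixing *)
(* w bounds the degrees of the coordinates.                                    *)
Require Import Defs.
From HB Require Import structures.
From mathcomp Require Import all_boot all_order all_algebra generic_quotient.
From mathcomp Require Import all_classical all_reals all_analysis.
From mathcomp Require Import ring lra zify.

Set Implicit Arguments.
Unset Strict Implicit.
Unset Printing Implicit Defensive.

Import Order.TTheory GRing.Theory Num.Theory.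
Import numFieldNormedType.Exports.

Local Open Scope classical_set_scope.
Local Open Scope card_scope.
Local Open Scope ring_scope.

(** * Paths and homotopies *)

(** Everything is read off at the base vertices v of T_0 and w of T_oo, both the class of the
    standard lattice. C_1 and B_1 have norm 1+z, while C_2 and B_2 have norm z(1+z). At z = 0 the
    first norm is a unit and the second a uniformizer times a unit; at infinity, after scaling the
    quaternions by 1/z, the roles are exchanged. So A fixes v and moves w to its neighbours, B does
    the opposite, and residues tell the three neighbours apart ([tree_action_0], [tree_action_oo]).
    A few quaternion identities ([PQ_relations]) imply all nine squares ([nine_squares]), whence AB
    = BA.

    The rest of the group theory uses only two trees. Squares bring every word to the form alpha
    beta with alpha reduced in A and beta reduced in B ([weq_normal]). If such a product fixes v and
    w, then beta moves v and alpha moves w along closed walks without backtracking, so both are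
    empty ([moving_walk], [two_trees_reduced_eval1]). This gives freeness, hence simple transitivity
    ([two_trees_simply_transitive]), and shows that the squares are defining relations
    ([weq_of_eval], [tile_presentation]).

    On the topological side, every path between vertices deforms to an edge path
    ([edge_path_approx]), cancellations and squares are homotopies ([weq_homotopic]), and the
    product of the letters is a homotopy invariant by a lifting argument ([hol_homotopic]). Hence an
    element of Lambda and a class in the orbispace group determine each other
    ([orb_map_isomorphic]). The V_4-component is a homomorphism whose kernel Gamma consists of the
    ordinary loops ([type_kernel_isomorphic]). An element of finite order fixes a vertex or inverts
    an edge in each tree ([torsion_fixes_or_inverts]), and moving a vertex to a neighbour forces a
    nontrivial type ([type_edge1], [type_edge2]); so a torsion element of Gamma fixes a vertex of
    the product and is 1.

    Finally Lambda lies in G(R) and is transitive, so its index is finite once the stabilizer of (v,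
    w) in G(R) is. An element of that stabilizer comes from a primitive quaternion over F_2[z].
    Fixing v makes its norm prime to z ([fix_y_dvd]), anisotropy at the two factors of 1+z^3 bounds
    the degree of the norm by 3 ([size_pnorm_primitive]), and fixing w then bounds the degrees of
    the coordinates ([fix_t_size]). *)

Section Retraction.
Variables (X : topologicalType) (A : set X) (c : X -> X).
Hypotheses (c_cont : continuous c) (c_in : forall x, A (c x))
  (c_id : forall x, A x -> c x = x).

(** Trades subspace continuity, which composes badly, for continuity on the whole space. It is
    applied to the retractions of the line and the plane onto [0, 1] and its square. *)
Lemma within_retractP (S : topologicalType) (f : X -> S) :
  {within A, continuous f} <-> continuous (f \o c).
Proof.
split=> [/subspace_continuousP cf x W Wf|cf].
  have H : nbhs (c x) (fun y => A y -> W (f y)) := cf _ (c_in x) W Wf.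
  have H' : nbhs x (fun y => A (c y) -> W (f (c y))) := c_cont H.
  by apply: filterS H' => y /=; apply; exact: c_in.
apply/subspace_continuousP => x Ax W Wf; rewrite nbhs_simpl /=.
have H : nbhs x (fun y => W (f (c y))) by apply: (cf x W); rewrite /= c_id.
suff : nbhs x (fun y => A y -> W (f y)) by [].
by apply: filterS H => y /= + Ay; rewrite c_id.
Qed.

End Retraction.

Section ContinuousMaps.
Variables X Y Z : topologicalType.
Lemma id_cont : continuous (@id X). Proof. by move=> p; exact: cvg_id. Qed.
Lemma fst_cont : continuous (@fst X Y). Proof. by move=> p; exact: cvg_fst. Qed.
Lemma snd_cont : continuous (@snd X Y). Proof. by move=> p; exact: cvg_snd. Qed.
Lemma comp_cont (f : X -> Y) (g : Y -> Z) :
  continuous f -> continuous g -> continuous (g \o f).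
Proof. by move=> cf cg x; apply: continuous_comp; [exact: cf|exact: cg]. Qed.
Lemma pair_cont (f : X -> Y) (g : X -> Z) :
  continuous f -> continuous g -> continuous (fun x => (f x, g x)).
Proof. by move=> cf cg x; exact: (cvg_pair (cf x) (cg x)). Qed.
End ContinuousMaps.

(** The pasting lemma for the closed sets phi <= 0 and phi >= 0, stated with globally continuous
    pieces so that no subspace topology appears. *)
Lemma continuous_glue (R : realType) (X S : topologicalType) (phi : X -> R) (f g : X -> S) :
  continuous phi -> continuous f -> continuous g ->
  (forall x, phi x = 0 -> f x = g x) ->
  continuous (fun x => if phi x <= 0 then f x else g x).
Proof.
move=> cphi cf cg fg x W; case: ltgtP => [p0|p0|p0] /= WW; rewrite nbhs_simpl /=.
- have H1 : nbhs x (fun y => phi y < 0) := cphi x _ (lt_nbhsl p0).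
  have H2 : nbhs x (fun y => W (f y)) := cf x W WW.
  by apply: filterS2 H1 H2 => y /= /ltW ->.
- have H1 : nbhs x (fun y => 0 < phi y) := cphi x _ (lt_nbhsr p0).
  have H2 : nbhs x (fun y => W (g y)) := cg x W WW.
  by apply: filterS2 H1 H2 => y /=; rewrite ltNge => /negbTE ->.
- have H1 : nbhs x (fun y => W (f y)) := cf x W WW.
  rewrite fg// in WW; have H2 : nbhs x (fun y => W (g y)) := cg x W WW.
  by apply: filterS2 H1 H2 => y /= Wf Wg; case: ifP.
Qed.

Section MinMax.
Variables (R : realType) (X : topologicalType).
Lemma min_cont (f g : X -> R) :
  continuous f -> continuous g -> continuous (fun x => Num.min (f x) (g x)).
Proof. by move=> cf cg x; exact: (@continuous_min R X f g x (cf x) (cg x)). Qed.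
Lemma max_cont (f g : X -> R) :
  continuous f -> continuous g -> continuous (fun x => Num.max (f x) (g x)).
Proof. by move=> cf cg x; exact: (@continuous_max R X f g x (cf x) (cg x)). Qed.
Lemma cst_cont (Y : topologicalType) (c : Y) : continuous (fun _ : X => c).
Proof. by move=> x; exact: cvg_cst. Qed.
End MinMax.

Section Paths.
Variable R : realType.
Local Notation I01 := (`[0, 1]%classic : set R).

(** The retraction of the line onto [0, 1]; precomposition with it extends a path continuously to
    the whole line. *)
Definition clamp (t : R) : R := Num.max 0 (Num.min 1 t).
Definition clamp2 (p : R * R) : R * R := (clamp p.1, clamp p.2).

Lemma clamp_itv t : I01 (clamp t).
Proof. by rewrite /= in_itv /= /clamp le_max lexx /= ge_max ler01 ge_min lexx. Qed.

Lemma clamp_id t : I01 t -> clamp t = t.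
Proof.
rewrite /= in_itv /= /clamp => /andP[t0 t1].
by rewrite (min_idPr t1) (max_idPr t0).
Qed.

Lemma clamp0 : clamp 0 = 0. Proof. by apply: clamp_id; rewrite /= in_itv /= lexx ler01. Qed.
Lemma clamp1 : clamp 1 = 1. Proof. by apply: clamp_id; rewrite /= in_itv /= lexx ler01. Qed.

Lemma clamp_continuous : continuous clamp.
Proof.
exact: (max_cont (@cst_cont R R 0) (min_cont (@cst_cont R R 1) (@id_cont R))).
Qed.

Lemma clamp2_continuous : continuous clamp2.
Proof.
apply: pair_cont; apply: comp_cont clamp_continuous; [exact: fst_cont|exact: snd_cont].
Qed.

Lemma clamp2_itv p : (I01 `*` I01) (clamp2 p).
Proof. by split; exact: clamp_itv. Qed.

Lemma clamp2_id p : (I01 `*` I01) p -> clamp2 p = p.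
Proof. by case: p => x y [/= hx hy]; rewrite /clamp2 /= !clamp_id. Qed.

Variable S : topologicalType.
Implicit Types alpha beta gamma : R -> S.

Lemma within1P alpha : {within I01, continuous alpha} <-> continuous (alpha \o clamp).
Proof. exact: (within_retractP clamp_continuous clamp_itv clamp_id). Qed.

Lemma within2P (H : R * R -> S) :
  {within I01 `*` I01, continuous H} <-> continuous (H \o clamp2).
Proof. exact: (within_retractP clamp2_continuous clamp2_itv clamp2_id). Qed.

Lemma homotopicI (H : R * R -> S) alpha beta : continuous H ->
  (forall s, I01 s -> H (0, s) = alpha s) -> (forall s, I01 s -> H (1, s) = beta s) ->
  (forall r, I01 r -> H (r, 0) = alpha 0) -> (forall r, I01 r -> H (r, 1) = alpha 1) ->
  homotopic alpha beta.
Proof.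
move=> cH H0 H1 Ha Hb; exists H; split.
- by apply: continuous_subspaceT.
- by move=> s hs; split; [exact: H0|exact: H1].
- by move=> s hs; split; [exact: Ha|exact: Hb].
Qed.

Lemma homotopicE alpha beta : homotopic alpha beta -> exists H : R * R -> S,
  [/\ continuous H,
      (forall s, H (0, s) = alpha (clamp s)), (forall s, H (1, s) = beta (clamp s)),
      (forall r, H (r, 0) = alpha 0) & (forall r, H (r, 1) = alpha 1)].
Proof.
move=> [H [/within2P cH Hs Hr]]; exists (H \o clamp2); split=> //.
- by move=> s; rewrite /= /clamp2 /= clamp0; have [] := Hs _ (clamp_itv s).
- by move=> s; rewrite /= /clamp2 /= clamp1; have [] := Hs _ (clamp_itv s).
- by move=> s; rewrite /= /clamp2 /= clamp0; have [] := Hr _ (clamp_itv s).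
- by move=> s; rewrite /= /clamp2 /= clamp1; have [] := Hr _ (clamp_itv s).
Qed.

Let I0 : I01 0. Proof. by rewrite /= in_itv /= lexx ler01. Qed.
Let I1 : I01 1. Proof. by rewrite /= in_itv /= lexx ler01. Qed.

Lemma homotopic_ends alpha beta : homotopic alpha beta ->
  alpha 0 = beta 0 /\ alpha 1 = beta 1.
Proof.
move=> /homotopicE[H [_ H0 H1 Ha Hb]].
by split; [rewrite -(Ha 1) H1 clamp0|rewrite -(Hb 1) H1 clamp1].
Qed.

(** Straight-line homotopy in the vector space of parameters. The groupoid laws use it with
    parameters in the line, the deformations inside a square with parameters in the plane. *)
Lemma homotopic_reparam (X : normedModType R) (F : X -> S) (p q : R -> X) alpha beta :
  continuous F -> continuous p -> continuous q -> p 0 = q 0 -> p 1 = q 1 ->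
  (forall s, I01 s -> alpha s = F (p s)) -> (forall s, I01 s -> beta s = F (q s)) ->
  homotopic alpha beta.
Proof.
move=> cF cp cq pq0 pq1 aE bE.
apply: (@homotopicI (F \o (fun rs : R * R => p rs.2 + rs.1 *: (q rs.2 - p rs.2)))) => /=.
- apply: comp_cont => // -[r s]; apply: cvgD.
    by apply: (comp_cont (@snd_cont _ _) cp).
  apply: cvgZ; first exact: cvg_fst.
  by apply: cvgB; [apply: (comp_cont (@snd_cont _ _) cq)|apply: (comp_cont (@snd_cont _ _) cp)].
- by move=> s hs; rewrite scale0r addr0 aE.
- by move=> s hs; rewrite scale1r addrC subrK bE.
- by move=> r hr; rewrite pq0 subrr scaler0 addr0 aE// pq0.
- by move=> r hr; rewrite pq1 subrr scaler0 addr0 aE// pq1.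
Qed.

Lemma is_pathP alpha x y : is_path alpha x y <->
  [/\ continuous (alpha \o clamp), alpha 0 = x & alpha 1 = y].
Proof. by split=> -[/within1P]. Qed.

Lemma eq_homotopic alpha beta x y : is_path alpha x y ->
  (forall s, I01 s -> alpha s = beta s) -> homotopic alpha beta.
Proof.
move=> /is_pathP[ca _ _] ab.
apply: (@homotopic_reparam R^o (alpha \o clamp) id id) => //.
- by move=> ?; exact: cvg_id.
- by move=> ?; exact: cvg_id.
- by move=> s hs; rewrite /= clamp_id.
- by move=> s hs; rewrite /= clamp_id// ab.
Qed.

Lemma homotopic_refl alpha x y : is_path alpha x y -> homotopic alpha alpha.
Proof. by move=> h; exact: (eq_homotopic h). Qed.

Lemma homotopic_sym alpha beta : homotopic alpha beta -> homotopic beta alpha.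
Proof.
move=> ab; have [e0 e1] := homotopic_ends ab.
have [H [cH H0 H1 Ha Hb]] := homotopicE ab.
apply: (@homotopicI (H \o (fun rs : R * R => (1 - rs.1, rs.2)))) => /=.
- apply: comp_cont => //; apply: pair_cont; last exact: snd_cont.
  by move=> rs; apply: cvgB; [exact: cvg_cst|exact: cvg_fst].
- by move=> s hs; rewrite subr0 H1 clamp_id.
- by move=> s hs; rewrite subrr H0 clamp_id.
- by move=> r hr; rewrite Ha.
- by move=> r hr; rewrite Hb.
Qed.

Lemma mul2_cont (c d : R) : continuous (fun s : R => c * s + d).
Proof.
by move=> s; apply: cvgD; [apply: cvgM; [exact: cvg_cst|exact: cvg_id]|exact: cvg_cst].
Qed.

Lemma homotopic_trans alpha beta gamma :
  homotopic alpha beta -> homotopic beta gamma -> homotopic alpha gamma.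
Proof.
move=> ab bc; have [e0 e1] := homotopic_ends ab; have [e2 e3] := homotopic_ends bc.
have [H [cH H0 H1 Ha Hb]] := homotopicE ab.
have [G [cG G0 G1 Ga Gb]] := homotopicE bc.
apply: (@homotopicI (fun rs : R * R => if rs.1 - 2^-1 <= 0 then H (2 * rs.1 + 0, rs.2)
                               else G (2 * rs.1 + (-1), rs.2))) => /=.
- apply: (@continuous_glue R _ _ (fun rs : R * R => rs.1 - 2^-1)).
  + by move=> rs; apply: cvgB; [exact: cvg_fst|exact: cvg_cst].
  + apply: (@comp_cont _ _ _ (fun rs : R * R => (2 * rs.1 + 0, rs.2))) => //; apply: pair_cont; last exact: snd_cont.
    exact: (comp_cont (@fst_cont R R) (@mul2_cont 2 0)).
  + apply: (@comp_cont _ _ _ (fun rs : R * R => (2 * rs.1 + -1, rs.2))) => //; apply: pair_cont; last exact: snd_cont.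
    exact: (comp_cont (@fst_cont R R) (@mul2_cont 2 (-1))).
  + move=> [r s] /= /eqP; rewrite subr_eq0 => /eqP ->.
    by rewrite mulfV// addr0 subrr H1 G0.
- by move=> s hs; rewrite sub0r oppr_le0 invr_ge0 ler0n mulr0 addr0 H0 clamp_id.
- move=> s hs; rewrite subr_le0 leNgt invf_lt1// ltr1n /=.
  by rewrite mulr1 (_ : 2 - 1 = 1); [rewrite G1 clamp_id|lra].
- by move=> r hr; case: ifP => _; rewrite ?Ha// Ga e0.
- by move=> r hr; case: ifP => _; rewrite ?Hb// Gb e1.
Qed.

Lemma homotopy_class_eq alpha beta x y : is_path alpha x y ->
  homotopy_class alpha = homotopy_class beta <-> homotopic alpha beta.
Proof.
move=> ha; split=> [|ab].
  have /= h : homotopy_class alpha alpha := homotopic_refl ha.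
  by move=> e; move: h; rewrite e => /homotopic_sym.
apply/seteqP; split=> gamma /= h; first exact: homotopic_trans (homotopic_sym ab) h.
exact: homotopic_trans ab h.
Qed.

Let path_catE alpha beta s : alpha 1 = beta 0 -> path_cat alpha beta (clamp s) =
  if s - 2^-1 <= 0 then alpha (clamp (2 * s + 0)) else beta (clamp (2 * s + -1)).
Proof.
move=> e; rewrite /path_cat /clamp subr_le0.
case: (leP s 2^-1) => s2; last first.
  rewrite [X in if X then _ else _](_ : _ = false); last first.
    by apply/negbTE; rewrite -ltNge lt_max lt_min; apply/orP; right; rewrite s2 andbT; lra.
  have s0 : 0 < s by apply: lt_trans s2; rewrite invr_gt0.
  congr beta.
  case: (leP 1 s) => s1.
    rewrite (_ : Num.max 0 1 = 1); last by apply/max_idPr; rewrite ler01.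
    rewrite (_ : Num.min 1 _ = 1); first by rewrite (_ : Num.max 0 1 = 1); [lra|apply/max_idPr; rewrite ler01].
    by apply/min_idPl; lra.
  rewrite (max_idPr _); last exact: ltW.
  rewrite (min_idPr _); last by lra.
  by rewrite (max_idPr _)//; lra.
rewrite [X in if X then _ else _](_ : _ = true); last first.
  by rewrite ge_max ge_min s2 orbT andbT; lra.
congr alpha; rewrite addr0; case: (leP 0 s) => s0; last first.
  by rewrite !(max_idPl _) ?mulr0//; rewrite ge_min; apply/orP; right; lra.
rewrite (min_idPr (_ : s <= 1)); last by lra.
rewrite (max_idPr s0) (min_idPr _); last by lra.
by rewrite (max_idPr _)//; lra.
Qed.

Lemma path_cat_path alpha beta x y w :
  is_path alpha x y -> is_path beta y w -> is_path (path_cat alpha beta) x w.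
Proof.
move=> /is_pathP[ca a0 a1] /is_pathP[cb b0 b1].
have e : alpha 1 = beta 0 by rewrite a1 b0.
apply/is_pathP; split.
- rewrite (_ : _ \o _ = fun s => if s - 2^-1 <= 0 then (alpha \o clamp) (2 * s + 0)
    else (beta \o clamp) (2 * s + -1)); last by apply/funext => s; rewrite /= path_catE.
  apply: (@continuous_glue R R S (fun s => s - 2^-1) (fun s => (alpha \o clamp) (2 * s + 0)) (fun s => (beta \o clamp) (2 * s - 1))).
  + by move=> s; apply: cvgB; [exact: cvg_id|exact: cvg_cst].
  + exact: (comp_cont (@mul2_cont 2 0) ca).
  + exact: (comp_cont (@mul2_cont 2 (-1)) cb).
  + move=> s /eqP; rewrite subr_eq0 => /eqP ->.
    by rewrite mulfV// addr0 subrr /= clamp0 clamp1.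
- by rewrite /path_cat mulr0 invr_ge0 ler0n.
- rewrite /path_cat mulr1 leNgt invf_lt1// ltr1n /=.
  by rewrite (_ : 2 - 1 = 1) //; lra.
Qed.

Lemma path_cat_homotopic alpha alpha' beta beta' :
  alpha 1 = beta 0 ->
  homotopic alpha alpha' -> homotopic beta beta' ->
  homotopic (path_cat alpha beta) (path_cat alpha' beta').
Proof.
move=> e aa bb; have [e0 e1] := homotopic_ends aa; have [e2 e3] := homotopic_ends bb.
have [H [cH H0 H1 Ha Hb]] := homotopicE aa.
have [G [cG G0 G1 Ga Gb]] := homotopicE bb.
apply: (@homotopicI (fun rs : R * R => if rs.2 - 2^-1 <= 0 then H (rs.1, 2 * rs.2 + 0)
                               else G (rs.1, 2 * rs.2 + (-1)))) => /=.
- apply: (@continuous_glue R _ _ (fun rs : R * R => rs.2 - 2^-1)).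
  + by move=> rs; apply: cvgB; [exact: cvg_snd|exact: cvg_cst].
  + apply: (@comp_cont _ _ _ (fun rs : R * R => (rs.1, 2 * rs.2 + 0))) => //; apply: pair_cont; first exact: fst_cont.
    exact: (comp_cont (@snd_cont R R) (@mul2_cont 2 0)).
  + apply: (@comp_cont _ _ _ (fun rs : R * R => (rs.1, 2 * rs.2 + -1))) => //; apply: pair_cont; first exact: fst_cont.
    exact: (comp_cont (@snd_cont R R) (@mul2_cont 2 (-1))).
  + move=> [r s] /= /eqP; rewrite subr_eq0 => /eqP ->.
    by rewrite mulfV// addr0 subrr Hb Ga.
- by move=> s hs; rewrite H0 G0 -path_catE// clamp_id.
- by move=> s hs; rewrite H1 G1 -path_catE -?e1 ?e -?e2// clamp_id.
- by move=> r hr; rewrite sub0r oppr_le0 invr_ge0 ler0n mulr0 addr0 Ha /path_cat mulr0 invr_ge0 ler0n.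
- move=> r hr; rewrite /path_cat subr_le0 leNgt invf_lt1// ltr1n /= mulr1.
  by rewrite (_ : 2 - 1 = 1) ?Gb//; lra.
Qed.

Lemma path_catA alpha beta gamma x y w v :
  is_path alpha x y -> is_path beta y w -> is_path gamma w v ->
  homotopic (path_cat (path_cat alpha beta) gamma) (path_cat alpha (path_cat beta gamma)).
Proof.
move=> /is_pathP[ca a0 a1] /is_pathP[cb b0 b1] /is_pathP[cc c0 c1].
(* [F] runs through the three paths end to end on [0, 3]; the two bracketings are two piecewise
   linear parametrizations of this interval. *)
pose F (s : R) := if s - 1 <= 0 then (alpha \o clamp) s
  else if s - 2 <= 0 then (beta \o clamp) (1 * s + -1) else (gamma \o clamp) (1 * s + -2).
apply: (@homotopic_reparam R^o F (fun s => Num.min (4 * s + 0) (2 * s + 1))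
  (fun s => Num.max (2 * s + 0) (4 * s + -1))).
- apply: (@continuous_glue R R S (fun s => s - 1)) => //.
  + by move=> s; apply: cvgB; [exact: cvg_id|exact: cvg_cst].
  + apply: (@continuous_glue R R S (fun s => s - 2)) => //.
    * by move=> s; apply: cvgB; [exact: cvg_id|exact: cvg_cst].
    * exact: (comp_cont (@mul2_cont 1 (-1)) cb).
    * exact: (comp_cont (@mul2_cont 1 (-2)) cc).
    * move=> s /eqP; rewrite subr_eq0 => /eqP ->.
      by rewrite mul1r subrr (_ : 2 - 1 = 1) /= ?clamp0 ?clamp1 ?b1 ?c0//; lra.
  + move=> s /eqP; rewrite subr_eq0 => /eqP ->.
    by rewrite (_ : 1 - 2 <= 0 = true) ?mul1r ?subrr /= ?clamp0 ?clamp1 ?a1 ?b0//; lra.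
- exact: (min_cont (@mul2_cont 4 0) (@mul2_cont 2 1)).
- exact: (max_cont (@mul2_cont 2 0) (@mul2_cont 4 (-1))).
- by rewrite !mulr0 !add0r; case: (leP 0 1); case: (leP 0 (-1)); lra.
- by rewrite !mulr1 (min_idPr _) ?(max_idPr _); lra.
- move=> s; rewrite /= in_itv /= => /andP[s0 s1]; rewrite /F /path_cat /=.
  have -> : Num.min (4 * s + 0) (2 * s + 1) = if s <= 2^-1 then 4 * s else 2 * s + 1.
    by case: (leP s 2^-1) => h; rewrite ?addr0; [apply/min_idPl|apply/min_idPr]; lra.
  case: (leP s 2^-1) => h.
    rewrite (_ : (2 * s <= 2^-1) = (4 * s - 1 <= 0)); last by apply/idP/idP; lra.
    case: (leP (4 * s - 1) 0) => h4; first by rewrite clamp_id/= ?in_itv/=; [congr alpha; lra|lra].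
    rewrite (_ : (4 * s - 2 <= 0) = true); last by lra.
    by rewrite clamp_id/= ?in_itv/=; [congr beta; lra|lra].
  rewrite (_ : (2 * s + 1 - 1 <= 0) = false); last by apply/negbTE; rewrite -ltNge; lra.
  rewrite (_ : (2 * s + 1 - 2 <= 0) = false); last by apply/negbTE; rewrite -ltNge; lra.
  by rewrite clamp_id/= ?in_itv/=; [congr gamma; lra|lra].
- move=> s; rewrite /= in_itv /= => /andP[s0 s1]; rewrite /F /path_cat /=.
  have -> : Num.max (2 * s + 0) (4 * s + -1) = if s <= 2^-1 then 2 * s else 4 * s - 1.
    by case: (leP s 2^-1) => h; rewrite ?addr0; [apply/max_idPl|apply/max_idPr]; lra.
  case: (leP s 2^-1) => h.
    rewrite (_ : (2 * s - 1 <= 0) = true); last by lra.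
    by rewrite clamp_id/= ?in_itv/=; [congr alpha; lra|lra].
  rewrite (_ : (4 * s - 1 - 1 <= 0) = false); last by apply/negbTE; rewrite -ltNge; lra.
  rewrite (_ : (4 * s - 1 - 2 <= 0) = (2 * s - 1 <= 2^-1)); last by apply/idP/idP; lra.
  case: leP => h2; first by rewrite clamp_id/= ?in_itv/=; [congr beta; lra|lra].
  by rewrite clamp_id/= ?in_itv/=; [congr gamma; lra|lra].
Qed.

Lemma path_cst_cat alpha x y : is_path alpha x y -> homotopic (path_cat (cst x) alpha) alpha.
Proof.
move=> /is_pathP[ca a0 a1].
apply: (@homotopic_reparam R^o (alpha \o clamp) (fun s => Num.max 0 (2 * s + -1)) id) => //.
- exact: (max_cont (@cst_cont R R 0) (@mul2_cont 2 (-1))).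
- by move=> s; exact: cvg_id.
- by rewrite mulr0 add0r; apply/max_idPl; lra.
- by rewrite mulr1 (max_idPr _); lra.
- move=> s; rewrite /= in_itv /= => /andP[s0 s1]; rewrite /path_cat.
  case: (leP s 2^-1) => h.
    by rewrite (max_idPl _); [rewrite clamp0 a0|lra].
  rewrite (max_idPr _); last by lra.
  by rewrite clamp_id /= ?in_itv//=; lra.
- by move=> s hs; rewrite /= clamp_id.
Qed.

Lemma path_cat_cst alpha x y : is_path alpha x y -> homotopic (path_cat alpha (cst y)) alpha.
Proof.
move=> /is_pathP[ca a0 a1].
apply: (@homotopic_reparam R^o (alpha \o clamp) (fun s => Num.min 1 (2 * s + 0)) id) => //.
- exact: (min_cont (@cst_cont R R 1) (@mul2_cont 2 0)).
- by move=> s; exact: cvg_id.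
- by rewrite mulr0 add0r; apply/min_idPr; lra.
- by rewrite mulr1 (min_idPl _); lra.
- move=> s; rewrite /= in_itv /= => /andP[s0 s1]; rewrite /path_cat.
  case: (leP s 2^-1) => h; last first.
    by rewrite (min_idPl _); [rewrite clamp1 a1|lra].
  rewrite (min_idPr _); last by lra.
  by rewrite addr0 clamp_id /= ?in_itv//=; lra.
- by move=> s hs; rewrite /= clamp_id.
Qed.

Definition path_rev alpha : R -> S := fun s => alpha (1 - s).

Lemma path_cat_rev alpha x y : is_path alpha x y ->
  homotopic (path_cat alpha (path_rev alpha)) (cst x).
Proof.
move=> /is_pathP[ca a0 a1].
(* The parameter goes up to 1 and back to 0, and this tent is deformed linearly to the constant
   0. *)
apply: (@homotopic_reparam R^o (alpha \o clamp)
  (fun s => Num.min (2 * s + 0) (-2 * s + 2)) (cst 0)) => //.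
- exact: (min_cont (@mul2_cont 2 0) (@mul2_cont (-2) 2)).
- by move=> s; exact: cvg_cst.
- by rewrite !mulr0 !add0r; apply/min_idPl; lra.
- by rewrite !mulr1 (min_idPr _) /cst /=; lra.
- move=> s; rewrite /= in_itv /= => /andP[s0 s1]; rewrite /path_cat /path_rev.
  case: (leP s 2^-1) => h.
    rewrite (min_idPl _); last by lra.
    by rewrite addr0 clamp_id /= ?in_itv//=; lra.
  rewrite (min_idPr _); last by lra.
  by rewrite clamp_id /= ?in_itv//=; [congr alpha; lra|lra].
- by move=> s hs; rewrite /= clamp0.
Qed.

Lemma cst_path (x : S) : is_path (cst x : R -> S) x x.
Proof. by apply/is_pathP; split=> //; exact: cst_cont. Qed.

End Paths.

(** * The realization of a square complex *)

Lemma open_subspace_eq (T : topologicalType) (D U W : set T) : U `&` D = W `&` D ->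
  open (U : set (subspace D)) -> open (W : set (subspace D)).
Proof. by move=> e; rewrite -open_subspaceIT e open_subspaceIT. Qed.

HB.instance Definition _ (G : groupType) := gen_eqMixin (square G).
HB.instance Definition _ (G : groupType) := gen_choiceMixin (square G).

Section SquareSides.
Variables (G : groupType) (A B H : set G) (V : V4_structure H A B).
Local Open Scope group_scope.

Lemma V4_top_bottom a b' : A a -> B b' -> exists b a', [/\ B b, A a' & a * b' = b * a'].
Proof.
move=> ha hb; have : prod_set A B (a * b') by exists a => //; exists b'.
by rewrite (V4_comm V) => -[b hb' [a' ha' e]]; exists b, a'.
Qed.

Lemma V4_bottom_top b a' : B b -> A a' -> exists a b', [/\ A a, B b' & a * b' = b * a'].
Proof.
move=> hb ha; have : prod_set B A (b * a') by exists b => //; exists a'.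
by rewrite -(V4_comm V) => -[a ha' [b' hb' e]]; exists a, b'.
Qed.

Lemma V4_factorC_uniq a b a' b' : A a -> B b -> A a' -> B b' ->
  b * a = b' * a' -> a = a' /\ b = b'.
Proof.
move=> ha hb ha' hb' e; have [_ inj _] := V4_bijr V.
have /= := inj (a, b) (a', b').
by rewrite !in_setE => /(_ (conj ha hb) (conj ha' hb') e) [-> ->].
Qed.

(** Both squares give factorizations of a^-1 b in BA, namely b' a'^-1 and d c^-1, and such a
    factorization is unique. Geometrically, the link of a vertex has no double edge. *)
Lemma square_inj a b a' b' c d : sc_squares A B (Sq a b' b a') ->
  sc_squares A B (Sq a d b c) -> Sq a b' b a' = Sq a d b c.
Proof.
move=> [ha ha' hb hb' e] [_ hc _ hd f].
have [/invg_inj -> ->//] : a'^-1 = c^-1 /\ b' = d.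
  apply: V4_factorC_uniq => //; [exact: (V4_invl V)|exact: (V4_invl V)|].
  by apply: (mulgI a); rewrite !mulgA e f !mulgK.
Qed.

Lemma square_left a : A a -> B !=set0 -> exists q, sc_squares A B q /\
  let: Sq a1 _ _ _ := q in a1 = a.
Proof.
move=> ha [b hb]; have [b1 [a1 [h1 h2 e]]] := V4_top_bottom ha hb.
by exists (Sq a b b1 a1).
Qed.

Lemma square_right a : A a -> B !=set0 -> exists q, sc_squares A B q /\
  let: Sq _ _ _ a1 := q in a1 = a.
Proof.
move=> ha [b hb]; have [b1 [a1 [h1 h2 e]]] := V4_bottom_top hb ha.
by exists (Sq b1 a1 b a).
Qed.

Lemma square_top b : B b -> A !=set0 -> exists q, sc_squares A B q /\
  let: Sq _ b1 _ _ := q in b1 = b.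
Proof.
move=> hb [a ha]; have [b1 [a1 [h1 h2 e]]] := V4_top_bottom ha hb.
by exists (Sq a b b1 a1).
Qed.

Lemma square_bottom b : B b -> A !=set0 -> exists q, sc_squares A B q /\
  let: Sq _ _ b1 _ := q in b1 = b.
Proof.
move=> hb [a ha]; have [b1 [a1 [h1 h2 e]]] := V4_bottom_top hb ha.
by exists (Sq b1 a1 b a).
Qed.

Lemma sc_squares_finite : finite_set (sc_squares A B).
Proof.
apply: (@sub_finite_set _ _
  [set Sq p.1.1 p.1.2 p.2.1 p.2.2 | p in (A `*` B) `*` (B `*` A)]).
  by move=> [a b' b a'] [ha ha' hb hb' e]; exists ((a, b'), (b, a')).
apply: finite_image; apply: finite_setX; apply: finite_setX;
  by [exact: (V4_finl V)|exact: (V4_finr V)].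
Qed.

End SquareSides.

Section Coordinates.
Variables (R : realType) (G : groupType).
Implicit Types (p : cell_point R G) (e : edge G) (q : square G).

(** The complex folds onto the unit square, with s_ij sent to the corner (i, j); [coord_x] and
    [coord_y] are the coordinates of this folding. *)
Definition coord_x p : R := match p with
  | PVertex (i, _) => i%:R | PEdge (VEdge _ i) _ => i%:R
  | PEdge (HEdge _ _) x => x | PSquare _ x _ => x end.

Definition coord_y p : R := match p with
  | PVertex (_, j) => j%:R | PEdge (VEdge _ _) y => y
  | PEdge (HEdge _ j) _ => j%:R | PSquare _ _ y => y end.

Definition edge_eqb e e' : bool := match e, e' with
  | VEdge a i, VEdge a' i' => (a == a') && (i == i')
  | HEdge b j, HEdge b' j' => (b == b') && (j == j')
  | _, _ => false end.

Definition side e q : bool := let: Sq a b' b a' := q in match e with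
  | VEdge c i => c == (if i then a' else a)
  | HEdge d j => d == (if j then b' else b) end.

Definition in_star e p : bool := match p with
  | PVertex _ => false | PEdge e' _ => edge_eqb e e' | PSquare q _ _ => side e q end.

(** Positive on the open unit square and on the open side of type e, zero on the three other
    sides. *)
Definition edge_weight e (x y : R) : R := match e with
  | VEdge _ i => (if i then x else 1 - x) * (y * (1 - y))
  | HEdge _ j => (if j then y else 1 - y) * (x * (1 - x)) end.

(* These functions, positive exactly on the open stars of the edges, separate  *)
(* the points together with the two coordinates.                              *)
Definition tent e p : R :=
  if in_star e p then edge_weight e (coord_x p) (coord_y p) else 0.

Lemma edge_eqbP e e' : reflect (e = e') (edge_eqb e e').
Proof.
case: e e' => [a i|b j] [a' i'|b' j'] /=; try by constructor.
- by apply: (iffP andP) => [[/eqP-> /eqP->]//|[-> ->]].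
- by apply: (iffP andP) => [[/eqP-> /eqP->]//|[-> ->]].
Qed.

Lemma edge_chart_x e t : coord_x (edge_chart e t) =
  match e with VEdge _ i => i%:R | HEdge _ _ => clamp t end.
Proof.
rewrite /edge_chart /clamp; case: e => [a i|b j] /=.
  by case: ifP => //= _; case: ifP.
case: (leP t 0) => t0 /=; first by rewrite (max_idPl _)// ge_min t0 orbT.
case: (leP 1 t) => t1 /=; first by rewrite (max_idPr _).
by rewrite (max_idPr _)// ltW.
Qed.

Lemma edge_chart_y e t : coord_y (edge_chart e t) =
  match e with VEdge _ _ => clamp t | HEdge _ j => j%:R end.
Proof.
rewrite /edge_chart /clamp; case: e => [a i|b j] /=; last first.
  by case: ifP => //= _; case: ifP.
case: (leP t 0) => t0 /=; first by rewrite (max_idPl _)// ge_min t0 orbT.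
case: (leP 1 t) => t1 /=; first by rewrite (max_idPr _).
by rewrite (max_idPr _)// ltW.
Qed.

Lemma clamp_le0 (t : R) : t <= 0 -> clamp t = 0.
Proof. by move=> t0; rewrite /clamp (max_idPl _)// ge_min t0 orbT. Qed.
Lemma clamp_ge1 (t : R) : 1 <= t -> clamp t = 1.
Proof. by move=> t0; rewrite /clamp (min_idPl _)// (max_idPr _). Qed.

Lemma tent_edge_chart e e' t : tent e (edge_chart e' t) =
  if edge_eqb e e' then clamp t * (1 - clamp t) else 0.
Proof.
rewrite /edge_chart; case: (leP t 0) => t0.
  by rewrite /tent /= clamp_le0// mul0r if_same.
case: (leP 1 t) => t1; first by rewrite /tent /= clamp_ge1// subrr mulr0 if_same.
rewrite /tent /= clamp_id; last by rewrite /= in_itv /= !ltW.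
case: edge_eqbP => // <-; case: e => [a []|b []] /=; ring.
Qed.

Lemma square_chart_x q x y : coord_x (square_chart q (x, y)) = clamp x.
Proof.
case: q => a b' b a' /=; case: (leP x 0) => x0; first by rewrite edge_chart_x clamp_le0.
case: (leP 1 x) => x1; first by rewrite edge_chart_x clamp_ge1.
case: ifP => _; first by rewrite edge_chart_x.
case: ifP => _; first by rewrite edge_chart_x.
by rewrite /= clamp_id// /= in_itv /= !ltW.
Qed.

Lemma square_chart_y q x y : coord_y (square_chart q (x, y)) = clamp y.
Proof.
case: q => a b' b a' /=; case: (leP x 0) => x0; first by rewrite edge_chart_y.
case: (leP 1 x) => x1; first by rewrite edge_chart_y.
case: (leP y 0) => y0; first by rewrite edge_chart_y clamp_le0.
case: (leP 1 y) => y1; first by rewrite edge_chart_y clamp_ge1.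
by rewrite /= clamp_id// /= in_itv /= !ltW.
Qed.

Lemma tent_square_chart e q x y : tent e (square_chart q (x, y)) =
  if side e q then edge_weight e (clamp x) (clamp y) else 0.
Proof.
case: q => a b' b a'; rewrite [square_chart _ _]/=.
case: (leP x 0) => x0.
  rewrite tent_edge_chart (clamp_le0 x0); case: e => [c []|d j] /=.
  - by rewrite andbF mul0r if_same.
  - by rewrite andbT subr0 mul1r.
  - by rewrite mul0r mulr0 if_same.
case: (leP 1 x) => x1.
  rewrite tent_edge_chart (clamp_ge1 x1); case: e => [c []|d j] /=.
  - by rewrite andbT mul1r.
  - by rewrite andbF subrr mul0r if_same.
  - by rewrite subrr !mulr0 if_same.
case: (leP y 0) => y0.
  rewrite tent_edge_chart (clamp_le0 y0); case: e => [c i|d []] /=.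
  - by rewrite mul0r mulr0 if_same.
  - by rewrite andbF mul0r if_same.
  - by rewrite andbT subr0 mul1r.
case: (leP 1 y) => y1.
  rewrite tent_edge_chart (clamp_ge1 y1); case: e => [c i|d []] /=.
  - by rewrite subrr !mulr0 if_same.
  - by rewrite andbT mul1r.
  - by rewrite andbF subrr mul0r if_same.
by rewrite /tent /= !clamp_id// /= in_itv /= !ltW.
Qed.

Variables (A B H : set G) (V : V4_structure H A B).
Hypotheses (A0 : A !=set0) (B0 : B !=set0).
Local Notation pts := (@sc_points R G A B).

Lemma sc_edge_chart e t : sc_edges A B e -> pts (edge_chart e t).
Proof.
move=> he; rewrite /edge_chart; case: leP => t0 //; case: leP => t1 //.
by split; rewrite ?t0.
Qed.

Lemma sc_square_chart q xy : sc_squares A B q -> pts (square_chart q xy).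
Proof.
case: q xy => a b' b a' [x y] hq; have [ha ha' hb hb' e] := hq.
rewrite /square_chart; case: leP => x0; first exact: sc_edge_chart.
case: leP => x1; first exact: sc_edge_chart.
case: leP => y0; first exact: sc_edge_chart.
case: leP => y1; first exact: sc_edge_chart.
by split; rewrite ?x0 ?y0.
Qed.

Lemma coord_x_itv p : pts p -> 0 <= coord_x p <= 1.
Proof.
case: p => [[i j] _|[a i|b j] t [_ /andP[t0 t1]]|q x y [_ /andP[x0 x1] _]] /=; try by rewrite !ltW.
- by case: i; rewrite /= lexx ler01.
- by case: i; rewrite /= lexx ler01.
Qed.

Lemma coord_y_itv p : pts p -> 0 <= coord_y p <= 1.
Proof.
case: p => [[i j] _|[a i|b j] t [_ /andP[t0 t1]]|q x y [_ _ /andP[x0 x1]]] /=; try by rewrite !ltW.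
- by case: j; rewrite /= lexx ler01.
- by case: j; rewrite /= lexx ler01.
Qed.

Lemma tent_gt0 e p : pts p -> (0 < tent e p) = in_star e p.
Proof.
rewrite /tent; case: ifP => [|_ _]; last exact: ltxx.
case: p => [//|e' t /edge_eqbP <- [_ /andP[t0 t1]]|q x y _ [_ /andP[x0 x1] /andP[y0 y1]]].
  by case: e => [a []|b []] /=; rewrite ?subr0 mul1r mulr_gt0// subr_gt0.
by case: e => [a []|b []] /=; rewrite !mulr_gt0// subr_gt0.
Qed.

(** The tents tell which open stars of edges contain the point. This identifies the edge of an edge
    point, and for an interior point the left and bottom sides of its square, which determine the
    square by [square_inj]; the coordinates do the rest. *)
Lemma coord_inj p p' : pts p -> pts p' -> coord_x p = coord_x p' -> coord_y p = coord_y p' ->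
  (forall e, sc_edges A B e -> tent e p = tent e p') -> p = p'.
Proof.
have nat01 (i : bool) (x : R) : 0 < x < 1 -> i%:R = x -> False.
  by move=> + e; rewrite -e; case: i {e}; rewrite /= ltxx ?andbF.
have bool_inj (i j : bool) : i%:R = j%:R :> R -> i = j.
  by move=> /eqP; rewrite eqr_nat => /eqP; case: i j => [] [].
have star e (r r' : cell_point R G) : pts r -> pts r' ->
    (forall e, sc_edges A B e -> tent e r = tent e r') ->
    sc_edges A B e -> in_star e r -> in_star e r'.
  by move=> hr hr' E he; rewrite -!tent_gt0// E.
move=> hp hp'; case: p hp => [[i j]|e t|q x y] hp ex ey et.
- case: p' hp' ex ey et => [[i' j'] _ /= /bool_inj-> /bool_inj->//|[a k|b k] t [_ ht] /= ex ey _|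
    q x y [_ hx hy] /= /(nat01 _ _ hx)//].
  + by case: (nat01 _ _ ht ey).
  + by case: (nat01 _ _ ht ex).
- have [he ht] := hp.
  have := star e _ _ hp hp' et he; rewrite /= => /(_ (introT (edge_eqbP _ _) erefl)).
  case: p' hp' ex ey et => [//|e' t' hp' ex ey et /= /edge_eqbP ee'|q x y [_ hx hy] ex ey et _].
    subst e'; congr PEdge; by case: e he hp ex ey {hp' et} => //=.
  case: e he hp ex ey {et} => [a i|b j] he hp /= ex ey.
    by case: (nat01 _ _ hx ex).
  by case: (nat01 _ _ hy ey).
- have [hq hx hy] := hp; case: q ex ey hp hq et => a b' b a' ex ey hp hq et; have [ha ha' hb hb' eq] := hq.
  have := star (VEdge a false) _ _ hp hp' et ha; rewrite /= eqxx => /(_ isT).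
  have := star (HEdge b false) _ _ hp hp' et hb; rewrite /= eqxx => /(_ isT).
  case: p' hp' ex ey et => [//|[?|?] ? ? //|[c d' d c'] x' y' [hq' _ _] /= -> -> _].
  by move=> /eqP ed /eqP ec; subst c d; rewrite (square_inj V hq hq').
Qed.

Lemma square_chart_cover p : pts p ->
  exists2 q, sc_squares A B q & p = square_chart q (coord_x p, coord_y p).
Proof.
case: p => [[i j] _|[a i|b j] t|q x y].
- have [a ha] := A0; have [q [hq _]] := square_left V ha B0.
  exists q => //; case: q hq => c d' d c' _; case: i j => [] []; rewrite /= /edge_chart ?lexx ?ler10 //.
- move=> [/= ha ht]; have /andP[t0 t1] := ht.
  have E c k : PEdge (VEdge c k) t = edge_chart (VEdge c k) t by rewrite /edge_chart !leNgt t0 t1.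
  case: i.
    have [[c d' d c'] [hq /= e]] := square_right V ha B0; subst c'.
    by exists (Sq c d' d a) => //=; rewrite ler10 lexx -E.
  have [[c d' d c'] [hq /= e]] := square_left V ha B0; subst c.
  by exists (Sq a d' d c') => //=; rewrite lexx -E.
- move=> [/= hb ht]; have /andP[t0 t1] := ht.
  have E c k : PEdge (HEdge c k) t = edge_chart (HEdge c k) t by rewrite /edge_chart !leNgt t0 t1.
  case: j.
    have [[c d' d c'] [hq /= e]] := square_top V hb A0; subst d'.
    by exists (Sq c b d c') => //=; rewrite !leNgt t0 t1 ltr01 ltxx /= -E.
  have [[c d' d c'] [hq /= e]] := square_bottom V hb A0; subst d.
  by exists (Sq c d' b c') => //=; rewrite !leNgt t0 t1 ltxx /= -E.
- move=> [hq /andP[x0 x1] /andP[y0 y1]]; exists q => //.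
  by case: q hq => c d' d c' _ /=; rewrite !leNgt x0 x1 y0 y1.
Qed.

Local Notation X := (realization R A B).

Definition to_real (p : cell_point R G) : X :=
  if pselect (pts p) is left h then exist _ p (mem_set h) else base_vertex R A B.

Lemma to_realK p : pts p -> val (to_real p) = p.
Proof. by move=> hp; rewrite /to_real; case: pselect. Qed.
Lemma valK' (p : X) : to_real (val p) = p.
Proof. by apply: val_inj; rewrite to_realK//; exact/set_mem/(valP p). Qed.
Lemma val_pts (p : X) : pts (val p). Proof. exact/set_mem/(valP p). Qed.

Lemma to_real_continuous q : sc_squares A B q -> continuous (to_real \o square_chart q \o @clamp2 R).
Proof.
move=> hq; apply/(within2P (to_real \o square_chart q))/continuousP => U /= [_ /(_ q hq)].
apply: open_subspace_eq; apply/seteqP; split=> xy [/= h1 h2]; split=> //.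
  by have [p Up pE] := h1; rewrite /from_subspace/= -pE; have := valK' p; rewrite /= => ->.
by exists (to_real (square_chart q xy)) => //; rewrite to_realK//; exact: sc_square_chart.
Qed.

Lemma edge_to_real_continuous e : sc_edges A B e -> continuous (to_real \o edge_chart e \o @clamp R).
Proof.
move=> he; apply/(within1P (to_real \o edge_chart e))/continuousP => U /= [/(_ e he) + _].
apply: open_subspace_eq; apply/seteqP; split=> xy [/= h1 h2]; split=> //.
  by have [p Up pE] := h1; rewrite /from_subspace/= -pE; have := valK' p; rewrite /= => ->.
by exists (to_real (edge_chart e xy)) => //; rewrite to_realK//; exact: sc_edge_chart.
Qed.

(** The universal property of the weak topology, for maps given on points of cells. *)
Lemma continuous_from (T : topologicalType) (f : cell_point R G -> T) :
  (forall e, sc_edges A B e -> continuous (f \o @edge_chart R G e \o @clamp R)) ->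
  (forall q, sc_squares A B q -> continuous (f \o @square_chart R G q \o @clamp2 R)) ->
  continuous (fun p : X => f (val p)).
Proof.
move=> fe fq; apply/continuousP => U oU; split=> [e he|q hq].
- have /within1P/continuousP/(_ U oU) := fe e he.
  apply: open_subspace_eq; apply/seteqP; split=> t [/= h1 h2]; split=> //.
    exists (to_real (edge_chart e t)); rewrite ?to_realK//; exact: sc_edge_chart.
  by have [p Up pE] := h1; rewrite /from_subspace/= -pE.
- have /within2P/continuousP/(_ U oU) := fq q hq.
  apply: open_subspace_eq; apply/seteqP; split=> t [/= h1 h2]; split=> //.
    exists (to_real (square_chart q t)); rewrite ?to_realK//; exact: sc_square_chart.
  by have [p Up pE] := h1; rewrite /from_subspace/= -pE.
Qed.

Let clampK (t : R) : clamp (clamp t) = clamp t. Proof. exact/clamp_id/clamp_itv. Qed.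
Let contx : continuous (fun xy : R * R => clamp xy.1).
Proof. exact: (comp_cont (@fst_cont R R) (@clamp_continuous R)). Qed.
Let conty : continuous (fun xy : R * R => clamp xy.2).
Proof. exact: (comp_cont (@snd_cont R R) (@clamp_continuous R)). Qed.

Lemma coord_x_continuous : continuous (fun p : X => coord_x (val p)).
Proof.
apply: continuous_from => [e he|q hq].
  case: e he => [a i|b j] he.
    rewrite (_ : _ \o _ = fun=> i%:R); first exact: cst_cont.
    by apply/funext => t /=; rewrite edge_chart_x.
  rewrite (_ : _ \o _ = @clamp R); first exact: clamp_continuous.
  by apply/funext => t /=; rewrite edge_chart_x.
rewrite (_ : _ \o _ = fun xy => clamp xy.1)//.
by apply/funext => -[x y]; rewrite /= /clamp2 /= square_chart_x clampK.
Qed.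

Lemma coord_y_continuous : continuous (fun p : X => coord_y (val p)).
Proof.
apply: continuous_from => [e he|q hq].
  case: e he => [a i|b j] he.
    rewrite (_ : _ \o _ = @clamp R); first exact: clamp_continuous.
    by apply/funext => t /=; rewrite edge_chart_y.
  rewrite (_ : _ \o _ = fun=> j%:R); first exact: cst_cont.
  by apply/funext => t /=; rewrite edge_chart_y.
rewrite (_ : _ \o _ = fun xy => clamp xy.2)//.
by apply/funext => -[x y]; rewrite /= /clamp2 /= square_chart_y clampK.
Qed.

Lemma tent_continuous e : continuous (fun p : X => tent e (val p)).
Proof.
have contM (T : topologicalType) (f g : T -> R) : continuous f -> continuous g ->
    continuous (fun x => f x * g x).
  by move=> cf cg x; exact: (cvgM (cf x) (cg x)).
have contB (T : topologicalType) (f : T -> R) : continuous f -> continuous (fun x => 1 - f x).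
  by move=> cf x; exact: (cvgB (cvg_cst _) (cf x)).
apply: continuous_from => [e' he|q hq].
  rewrite (_ : _ \o _ = fun t => if edge_eqb e e' then clamp t * (1 - clamp t) else 0); last first.
    by apply/funext => t /=; rewrite tent_edge_chart clampK.
  case: (edge_eqb e e'); last exact: cst_cont.
  by apply: contM; [|apply: contB]; exact: clamp_continuous.
rewrite (_ : _ \o _ = fun xy => if side e q then edge_weight e (clamp xy.1) (clamp xy.2) else 0); last first.
  by apply/funext => -[x y]; rewrite /= /clamp2 /= tent_square_chart !clampK.
case: (side e q); last exact: cst_cont.
have cx1 := contB _ _ contx; have cy1 := contB _ _ conty.
case: e => [a []|b []] /=.
- exact: (contM _ _ _ contx (contM _ _ _ conty cy1)).
- exact: (contM _ _ _ cx1 (contM _ _ _ conty cy1)).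
- exact: (contM _ _ _ conty (contM _ _ _ contx cx1)).
- exact: (contM _ _ _ cy1 (contM _ _ _ contx cx1)).
Qed.

(** Finitely many closed squares cover: as A and B are nonempty, each vertex and each edge lies on a
    square. *)
Lemma realization_compact : compact [set: X].
Proof.
have [s sE] := (finite_seqP _).1 (sc_squares_finite V).
have inS q : (q \in s) = `[< sc_squares A B q >].
  by apply/idP/asboolP => [|]; rewrite sE.
have -> : [set: X] = \big[setU/set0]_(q <- s)
    ((to_real \o square_chart q \o @clamp2 R) @` (`[0, 1]%classic `*` `[0, 1]%classic)).
  rewrite -bigcup_seq; apply/esym/seteqP; split=> // p _.
  have [q hq pE] := square_chart_cover (val_pts p).
  exists q; first by rewrite /= inS; exact/asboolP.
  exists (coord_x (val p), coord_y (val p)) => /=.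
    by rewrite !in_itv/= coord_x_itv ?coord_y_itv//; exact: val_pts.
  rewrite clamp2_id /= -?pE ?valK'//.
  by split; rewrite /= in_itv/= ?coord_x_itv ?coord_y_itv//; exact: val_pts.
rewrite big_seq_cond; apply: bigsetU_compact => q; rewrite andbT inS => /asboolP hq.
apply: continuous_compact; last by apply: compact_setX; exact: segment_compact.
by apply: continuous_subspaceT; exact: to_real_continuous.
Qed.

(* A continuous injection of the compact realization into a Hausdorff space   *)
(* is an embedding.                                                           *)
Lemma continuous_to (T : topologicalType) (f : T -> X) :
  continuous (fun z => coord_x (val (f z))) -> continuous (fun z => coord_y (val (f z))) ->
  (forall e, sc_edges A B e -> continuous (fun z => tent e (val (f z)))) ->
  continuous f.
Proof.
move=> fx fy fe; apply/continuous_closedP => C cC z clz.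
have cptC : compact C by exact: (subclosed_compact cC realization_compact).
pose F := within (f @^-1` C) (nbhs z).
have PF : ProperFilter F := within_nbhs_proper clz.
have FC : (f @ F) C by exact: withinT.
have [p [Cp clp]] := cptC (f @ F) _ FC.
suff e : p = f z by rewrite /preimage /= -e.
have key (phi : X -> R) : continuous phi -> continuous (phi \o f) -> phi p = phi (f z).
  move=> cphi cphif; apply: (@Rhausdorff R) => U W nU nW.
  have h1 : (f @ F) (phi @^-1` W).
    by apply: cvg_within; exact: (cphif z W nW).
  have [y [/= y1 y2]] := clp _ _ h1 (cphi p U nU).
  by exists (phi y).
apply: val_inj; apply: coord_inj; try exact: val_pts.
- exact: (key _ coord_x_continuous).
- exact: (key _ coord_y_continuous).
- by move=> e he; exact: (key _ (tent_continuous (e := e)) (fe e he)).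
Qed.

End Coordinates.

Section ConnectedLine.
Variable R : realType.

(** Connectedness of the line takes the place of a subdivision with a Lebesgue number. As t1 and t2
    can be exchanged, the hypothesis makes both P and its negation open. *)
Lemma locally_constant_line (P : R -> Prop) :
  (forall t0, exists2 e, 0 < e & forall t1 t2, `|t1 - t0| < e -> `|t2 - t0| < e -> P t1 -> P t2) ->
  forall s t, P s -> P t.
Proof.
move=> loc s t Ps.
have oQ (Q : R -> Prop) : (forall t0, exists2 e, 0 < e & forall t1 t2,
    `|t1 - t0| < e -> `|t2 - t0| < e -> Q t1 -> Q t2) -> open [set t | Q t].
  move=> locQ; rewrite openE => t0 /= Qt; have [e e0 he] := locQ t0.
  rewrite /interior -nbhs_ballE; exists e => //= t1; rewrite /ball /= distrC => t1e.
  by apply: (he t0) => //; rewrite subrr normr0.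
have cR : connected [set: R] by apply/connected_intervalP.
have -> // : P = setT; apply: cR.
- by exists s.
- by exists [set t | P t]; [exact: oQ|rewrite setTI].
- exists [set t | P t]; last by rewrite setTI.
  rewrite -[X in closed X]setCK; apply: open_closedC; apply: (oQ (fun t => ~ P t)) => t0.
  have [e e0 he] := loc t0; exists e => // t1 t2 h1 h2 nP /(he _ _ h2 h1).
  exact: nP.
Qed.

End ConnectedLine.

Section PathMaps.
Variables (R : realType) (S T : topologicalType) (f : S -> T).
Hypothesis cf : continuous f.
Implicit Types alpha beta : R -> S.

Lemma path_cat_map alpha beta : f \o path_cat alpha beta = path_cat (f \o alpha) (f \o beta).
Proof. by apply/funext => s; rewrite /path_cat /=; case: ifP. Qed.

Lemma is_path_map alpha x y : is_path alpha x y -> is_path (f \o alpha) (f x) (f y).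
Proof.
move=> /is_pathP[ca <- <-]; apply/is_pathP; split=> //.
exact: (comp_cont ca cf).
Qed.

Lemma homotopic_map alpha beta : homotopic alpha beta -> homotopic (f \o alpha) (f \o beta).
Proof.
move=> /homotopicE[H [cH H0 H1 Ha Hb]]; apply: (@homotopicI _ _ (f \o H)).
- exact: comp_cont.
- by move=> s hs; rewrite /= H0 clamp_id.
- by move=> s hs; rewrite /= H1 clamp_id.
- by move=> r hr; rewrite /= Ha.
- by move=> r hr; rewrite /= Hb.
Qed.

End PathMaps.

(** * Contraction of the open stars and continuity of the V_4-action *)

Section Contraction.
Variables (R : realType) (G : groupType) (A B H : set G) (V : V4_structure H A B).
Hypotheses (A0 : A !=set0) (B0 : B !=set0).
Local Notation pts := (@sc_points R G A B).
Local Notation X := (realization R A B).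
Local Notation to_real := (@to_real R G A B).
Local Notation act := (V4_act R V).
Local Notation s00 := (base_vertex R A B).
Implicit Types (p : cell_point R G) (e : edge G) (q : square G) (g : V4).

(* Linear contraction of the open star of s_00. *)
Definition scale (r : R) p : cell_point R G := match p with
  | PVertex v => PVertex R G v
  | PEdge e t => edge_chart e (r * t)
  | PSquare q x y => square_chart q (r * x, r * y) end.

Lemma scale_chart q x y r : 0 <= r <= 1 -> 0 <= x < 1 -> 0 <= y < 1 ->
  scale r (square_chart q (x, y)) = square_chart q (r * x, r * y).
Proof.
move=> /andP[r0 r1] /andP[x0 x1] /andP[y0 y1].
have PE e (t : R) : 0 < t -> t < 1 -> edge_chart e t = PEdge e t by move=> t0 t1; rewrite /edge_chart !leNgt t0 t1.
have E0 e : edge_chart e (0 : R) = PVertex R G (edge_src e) by rewrite /edge_chart lexx.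
case: q => a b' b a'; case: (ltgtP x 0) x0 => // [x0|->] _ /=.
  rewrite (leNgt x 0) x0 (leNgt 1 x) x1 /=.
  case: (ltgtP y 0) y0 => // [y0|->] _ /=.
    by rewrite (leNgt 1 y) y1.
  rewrite mulr0 lexx PE//=.
  case: (ltgtP r 0) r0 => // [r0|->] _; last by rewrite !mul0r ?lexx !E0.
  have rx0 : 0 < r * x by exact: mulr_gt0.
  have rx1 : r * x < 1 by apply: le_lt_trans x1; rewrite ler_piMl// ltW.
  by rewrite !leNgt rx0 rx1.
rewrite mulr0 lexx.
case: (ltgtP y 0) y0 => // [y0|->] _; first by rewrite PE.
by rewrite mulr0 E0.
Qed.

Definition in_corner p := coord_x p < 1 /\ coord_y p < 1.

Lemma corner_cover p : pts p -> in_corner p -> exists2 q, sc_squares A B q &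
  [/\ p = square_chart q (coord_x p, coord_y p), 0 <= coord_x p < 1 & 0 <= coord_y p < 1].
Proof.
move=> hp [x1 y1]; have [q hq pE] := square_chart_cover V A0 B0 hp.
exists q => //; split => //; rewrite ?x1 ?y1 andbT.
  by have /andP[] := coord_x_itv hp.
by have /andP[] := coord_y_itv hp.
Qed.

Lemma scale_pts r p : pts p -> in_corner p -> 0 <= r <= 1 -> pts (scale r p).
Proof.
move=> hp hc hr; have [q hq [pE hx hy]] := corner_cover hp hc.
by rewrite pE scale_chart//; exact: sc_square_chart.
Qed.

Let clampM (r x : R) : 0 <= r <= 1 -> 0 <= x < 1 -> clamp (r * x) = r * x.
Proof.
move=> /andP[r0 r1] /andP[x0 x1]; rewrite clamp_id//= in_itv /= mulr_ge0//=.
by rewrite mulr_ile1// ltW.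
Qed.

Let clampI (x : R) : 0 <= x < 1 -> clamp x = x.
Proof. by move=> /andP[x0 x1]; rewrite clamp_id//= in_itv /= x0 ltW. Qed.

Lemma scale_x r p : pts p -> in_corner p -> 0 <= r <= 1 -> coord_x (scale r p) = r * coord_x p.
Proof.
move=> hp hc hr; have [q hq [pE hx hy]] := corner_cover hp hc.
by rewrite [in LHS]pE scale_chart// square_chart_x clampM.
Qed.

Lemma scale_y r p : pts p -> in_corner p -> 0 <= r <= 1 -> coord_y (scale r p) = r * coord_y p.
Proof.
move=> hp hc hr; have [q hq [pE hx hy]] := corner_cover hp hc.
by rewrite [in LHS]pE scale_chart// square_chart_y clampM.
Qed.

Definition scale_factor e (r x y : R) := match e with
  | VEdge _ i => (if i then r else (1 - r * x) / (1 - x)) * (r * ((1 - r * y) / (1 - y)))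
  | HEdge _ j => (if j then r else (1 - r * y) / (1 - y)) * (r * ((1 - r * x) / (1 - x)))
  end.

(** The tents of the contracted point are continuous multiples of the original tents, since both
    coordinates stay below 1. With [continuous_to] this makes the contraction continuous across
    cells, without any discussion of the cells themselves. *)
Lemma scale_tent e r p : pts p -> in_corner p -> 0 <= r <= 1 ->
  tent e (scale r p) = scale_factor e r (coord_x p) (coord_y p) * tent e p.
Proof.
move=> hp hc hr; have [q hq [pE hx hy]] := corner_cover hp hc.
rewrite [in LHS]pE scale_chart// [X in _ = _ * tent e X]pE !tent_square_chart.
case: ifP => _; last by rewrite mulr0.
rewrite !clampM// !clampI//.
have nx : 1 - coord_x p != 0 by rewrite subr_eq0; case/andP: hx => _ /lt_eqF; rewrite eq_sym => ->.
have ny : 1 - coord_y p != 0 by rewrite subr_eq0; case/andP: hy => _ /lt_eqF; rewrite eq_sym => ->.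
move: (coord_x p) (coord_y p) nx ny => cx cy nx ny.
by case: e => [a []|b []] /=; field; rewrite ?nx ?ny.
Qed.

Lemma scale1 p : pts p -> in_corner p -> scale 1 p = p.
Proof.
move=> hp hc; have [q hq [pE hx hy]] := corner_cover hp hc.
by rewrite pE scale_chart ?mul1r// ler01 lexx.
Qed.

Lemma scale0 p : pts p -> in_corner p -> scale 0 p = PVertex R G (false, false).
Proof.
move=> hp hc; have [[a b' b a'] hq [pE hx hy]] := corner_cover hp hc.
by rewrite pE scale_chart ?mul0r ?ler01 ?lexx//= /edge_chart lexx.
Qed.

Lemma scale_continuous (T : topologicalType) (f : T -> X) (rho : T -> R) :
  continuous f -> continuous rho -> (forall z, 0 <= rho z <= 1) ->
  (forall z, in_corner (val (f z))) ->
  continuous (fun z => to_real (scale (rho z) (val (f z)))).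
Proof.
move=> cf crho hrho hf.
have vp z := val_pts (f z).
have sp z : pts (scale (rho z) (val (f z))) by exact: scale_pts.
have cx : continuous (fun z => coord_x (val (f z))) := comp_cont cf (@coord_x_continuous R G A B).
have cy : continuous (fun z => coord_y (val (f z))) := comp_cont cf (@coord_y_continuous R G A B).
have contM (g h : T -> R) : continuous g -> continuous h -> continuous (fun x => g x * h x).
  by move=> cg ch x; exact: (cvgM (cg x) (ch x)).
have contB (g : T -> R) : continuous g -> continuous (fun x => 1 - g x).
  by move=> cg x; exact: (cvgB (cvg_cst _) (cg x)).
have contV (g : T -> R) : continuous g -> (forall z, g z < 1) -> continuous (fun x => (1 - g x)^-1).
  move=> cg g1 x; apply: (cvgV _ (contB g cg x)).
  by rewrite subr_eq0 eq_sym lt_eqF.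
have cfr (g : T -> R) : continuous g -> (forall z, g z < 1) ->
    continuous (fun z => (1 - rho z * g z) / (1 - g z)).
  by move=> cg g1; exact: (contM _ _ (contB _ (contM _ _ crho cg)) (contV g cg g1)).
have cfx := cfr _ cx (fun z => (hf z).1); have cfy := cfr _ cy (fun z => (hf z).2).
apply: (continuous_to V A0 B0).
- rewrite (_ : (fun z => _) = fun z => rho z * coord_x (val (f z))); first exact: contM.
  by apply/funext => z; rewrite to_realK// scale_x.
- rewrite (_ : (fun z => _) = fun z => rho z * coord_y (val (f z))); first exact: contM.
  by apply/funext => z; rewrite to_realK// scale_y.
- move=> e he; rewrite (_ : (fun z => _) = fun z =>
      scale_factor e (rho z) (coord_x (val (f z))) (coord_y (val (f z))) * tent e (val (f z))); last first.
    by apply/funext => z; rewrite to_realK// scale_tent.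
  apply: (contM); last exact: (comp_cont cf (@tent_continuous R G A B e)).
  case: e he => [a []|b []] _ /=.
  + exact: (contM _ _ crho (contM _ _ crho cfy)).
  + exact: (contM _ _ cfx (contM _ _ crho cfy)).
  + exact: (contM _ _ crho (contM _ _ crho cfx)).
  + exact: (contM _ _ cfy (contM _ _ crho cfx)).
Qed.

Local Open Scope group_scope.

Lemma flip_vK : involutive (@flip_v R G).
Proof.
by case=> [[i j]|[a i|b j] t|[a b' b a'] x y] /=; rewrite ?negbK ?invgK ?subKr.
Qed.
Lemma flip_hK : involutive (@flip_h R G).
Proof.
by case=> [[i j]|[a i|b j] t|[a b' b a'] x y] /=; rewrite ?negbK ?invgK ?subKr.
Qed.
Lemma flip_vh p : flip_v (flip_h p) = flip_h (flip_v p).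
Proof. by case: p => [[i j]|[a i|b j] t|[a b' b a'] x y]. Qed.

Lemma V4_actM g h (p : X) : act (g * h) p = act g (act h p).
Proof.
apply: val_inj => /=; case: g h => [[] []] [[] []] /=;
  by rewrite ?flip_vh ?flip_vK ?flip_hK ?flip_vh ?flip_vK ?flip_hK.
Qed.

Lemma V4_act1 (p : X) : act 1 p = p.
Proof. exact: val_inj. Qed.

Lemma V4_mulg2 (g : V4) : g * g = 1.
Proof. by case: g => [] [] []. Qed.

Lemma V4_mulC (g h : V4) : g * h = h * g.
Proof. by case: g h => [[] []] [[] []]. Qed.

Lemma V4_actK g : involutive (act g).
Proof. by move=> p; rewrite -V4_actM V4_mulg2 V4_act1. Qed.

Local Open Scope ring_scope.

Lemma flip_v_x p : coord_x (flip_v p) = coord_x p.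
Proof. by case: p => [[i j]|[a i|b j] t|[a b' b a'] x y]. Qed.
Lemma flip_v_y p : coord_y (flip_v p) = 1 - coord_y p.
Proof.
case: p => [[i j]|[a i|b j] t|[a b' b a'] x y] //=; by case: j; rewrite /= ?subrr ?subr0.
Qed.
Lemma flip_h_y p : coord_y (flip_h p) = coord_y p.
Proof. by case: p => [[i j]|[a i|b j] t|[a b' b a'] x y]. Qed.
Lemma flip_h_x p : coord_x (flip_h p) = 1 - coord_x p.
Proof.
case: p => [[i j]|[a i|b j] t|[a b' b a'] x y] //=; by case: i; rewrite /= ?subrr ?subr0.
Qed.

Definition edge_flip_v e := match e with
  | VEdge a i => VEdge (a^-1)%g i | HEdge b j => HEdge b (~~ j) end.
Definition edge_flip_h e := match e with
  | VEdge a i => VEdge a (~~ i) | HEdge b j => HEdge (b^-1)%g j end.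

Definition square_flip_v q := let: Sq a b' b a' := q in Sq (a^-1)%g b b' (a'^-1)%g.
Definition square_flip_h q := let: Sq a b' b a' := q in Sq a' (b'^-1)%g (b^-1)%g a.

Let eq_inv (x y : G) : (x == y^-1)%g = ((x^-1)%g == y).
Proof. by apply/eqP/eqP => [->|<-]; rewrite invgK. Qed.

Lemma side_flip_v e q : side e (square_flip_v q) = side (edge_flip_v e) q.
Proof. by case: q => a b' b a'; case: e => [c []|d []] //=; rewrite eq_inv. Qed.
Lemma side_flip_h e q : side e (square_flip_h q) = side (edge_flip_h e) q.
Proof. by case: q => a b' b a'; case: e => [c []|d []] //=; rewrite eq_inv. Qed.

Lemma flip_v_tent e p : tent e (flip_v p) = tent (edge_flip_v e) p.
Proof.
rewrite /tent flip_v_x flip_v_y.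
have -> : in_star e (flip_v p) = in_star (edge_flip_v e) p.
  case: p => [[i j]//|[a i|b j] t|q x y].
  - by case: e => [c k|c k] //=; rewrite eq_inv.
  - by case: e => [c k|c k] //=; case: k j => [] [].
  - by rewrite [RHS]/= -side_flip_v; case: q.
by case: ifP => // _; case: e => [a []|b []] /=; ring.
Qed.
Lemma flip_h_tent e p : tent e (flip_h p) = tent (edge_flip_h e) p.
Proof.
rewrite /tent flip_h_x flip_h_y.
have -> : in_star e (flip_h p) = in_star (edge_flip_h e) p.
  case: p => [[i j]//|[a i|b j] t|q x y].
  - by case: e => [c k|c k] //=; case: k i => [] [].
  - by case: e => [c k|c k] //=; rewrite eq_inv.
  - by rewrite [RHS]/= -side_flip_h; case: q.
by case: ifP => // _; case: e => [a []|b []] /=; ring.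
Qed.

Lemma sc_square_flip_v q : sc_squares A B q -> sc_squares A B (square_flip_v q).
Proof.
move=> hq; have h : pts (PSquare q 2^-1 2^-1) by split=> //; lra.
by case: q hq h => a b' b a' hq /(flip_v_points V)[].
Qed.
Lemma sc_square_flip_h q : sc_squares A B q -> sc_squares A B (square_flip_h q).
Proof.
move=> hq; have h : pts (PSquare q 2^-1 2^-1) by split=> //; lra.
by case: q hq h => a b' b a' hq /(flip_h_points V)[].
Qed.

Let clampB (x : R) : clamp (1 - x) = 1 - clamp x.
Proof.
case: (leP x 0) => x0; first by rewrite (clamp_le0 x0) clamp_ge1 ?subr0//; lra.
case: (leP 1 x) => x1; first by rewrite (clamp_ge1 x1) clamp_le0 ?subrr//; lra.
by rewrite !clamp_id//= in_itv/=; lra.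
Qed.

(** A comparison of coordinates and tents through [coord_inj] avoids a case analysis over the
    boundary of the square. *)
Lemma flip_v_chart q (x y : R) : sc_squares A B q ->
  flip_v (square_chart q (x, y)) = square_chart (square_flip_v q) (x, 1 - y).
Proof.
move=> hq; apply: (coord_inj V) => //.
- exact/(flip_v_points V)/sc_square_chart.
- exact/sc_square_chart/sc_square_flip_v.
- by rewrite flip_v_x !square_chart_x.
- by rewrite flip_v_y !square_chart_y clampB.
- move=> e _; rewrite flip_v_tent !tent_square_chart side_flip_v clampB.
  by case: ifP => // _; case: e => [a []|b []] /=; ring.
Qed.
Lemma flip_h_chart q (x y : R) : sc_squares A B q ->
  flip_h (square_chart q (x, y)) = square_chart (square_flip_h q) (1 - x, y).
Proof.
move=> hq; apply: (coord_inj V) => //.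
- exact/(flip_h_points V)/sc_square_chart.
- exact/sc_square_chart/sc_square_flip_h.
- by rewrite flip_h_x !square_chart_x clampB.
- by rewrite flip_h_y !square_chart_y.
- move=> e _; rewrite flip_h_tent !tent_square_chart side_flip_h clampB.
  by case: ifP => // _; case: e => [a []|b []] /=; ring.
Qed.

Lemma V4_act_continuous g : continuous (act g).
Proof.
have contB (h : X -> R) : continuous h -> continuous (fun x => 1 - h x).
  by move=> ch x; exact: (cvgB (cvg_cst _) (ch x)).
have cv : continuous (act (true, false)).
  apply: (continuous_to V A0 B0) => [||e _].
  - rewrite (_ : (fun z => _) = fun z => coord_x (val z)); first exact: coord_x_continuous.
    by apply/funext => z /=; rewrite flip_v_x.
  - rewrite (_ : (fun z => _) = fun z => 1 - coord_y (val z)); first exact/contB/coord_y_continuous.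
    by apply/funext => z /=; rewrite flip_v_y.
  - rewrite (_ : (fun z => _) = fun z => tent (edge_flip_v e) (val z)); first exact: tent_continuous.
    by apply/funext => z /=; rewrite flip_v_tent.
have ch : continuous (act (false, true)).
  apply: (continuous_to V A0 B0) => [||e _].
  - rewrite (_ : (fun z => _) = fun z => 1 - coord_x (val z)); first exact/contB/coord_x_continuous.
    by apply/funext => z /=; rewrite flip_h_x.
  - rewrite (_ : (fun z => _) = fun z => coord_y (val z)); first exact: coord_y_continuous.
    by apply/funext => z /=; rewrite flip_h_y.
  - rewrite (_ : (fun z => _) = fun z => tent (edge_flip_h e) (val z)); first exact: tent_continuous.
    by apply/funext => z /=; rewrite flip_h_tent.
case: g => [[] []].
- have -> : act (true, true) = act (true, false) \o act (false, true).
    by apply/funext => p; rewrite /= -V4_actM.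
  exact: comp_cont.
- exact: cv.
- exact: ch.
- rewrite (_ : act _ = id); first exact: id_cont.
  by apply/funext => p; exact: V4_act1.
Qed.

End Contraction.

(** * Edge paths *)

Section EdgePaths.
Variables (R : realType) (G : groupType) (A B H : set G) (V : V4_structure H A B).
Hypotheses (A0 : A !=set0) (B0 : B !=set0).
Local Notation pts := (@sc_points R G A B).
Local Notation X := (realization R A B).
Local Notation to_real := (@to_real R G A B).
Local Notation act := (V4_act R V).
Local Notation s00 := (base_vertex R A B).
Local Notation I01 := (`[0, 1]%classic : set R).
Implicit Types (p : X) (q : square G) (g : V4).

(** The open star of the vertex [act g s00], moved back to that of s_00 by the involution
    [act g]. *)
Definition star g : set X := [set p | in_corner (val (act g p))].

(** The straight path from the centre of the star to p. *)
Definition ray g p : R -> X := fun r => act g (to_real (scale (clamp r) (val (act g p)))).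

Let clamp01 (t : R) : 0 <= clamp t <= 1.
Proof. by have := clamp_itv t; rewrite /= in_itv. Qed.

Let min_lo (s : R) : s <= 2^-1 -> Num.min 1 (2 * s + 0) = 2 * s.
Proof. by move=> h; rewrite addr0; apply/min_idPr; lra. Qed.
Let min_hi (s : R) : 2^-1 < s -> Num.min 1 (2 * s + 0) = 1.
Proof. by move=> h; apply/min_idPl; lra. Qed.
Let max_lo (s : R) : s <= 2^-1 -> Num.max 0 (2 * s + -1) = 0.
Proof. by move=> h; apply/max_idPl; lra. Qed.
Let max_hi (s : R) : 2^-1 < s -> Num.max 0 (2 * s + -1) = 2 * s - 1.
Proof. by move=> h; apply/max_idPr; lra. Qed.

Let act_cont g : continuous (act g). Proof. exact: V4_act_continuous. Qed.
Let actK g p : act g (act g p) = p. Proof. exact: V4_actK. Qed.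
Let actM g h p : act (g * h)%g p = act g (act h p). Proof. exact: V4_actM. Qed.

Lemma ray0 g p t : star g p -> clamp t = 0 -> ray g p t = act g s00.
Proof.
move=> sp t0; rewrite /ray t0 (scale0 V A0 B0)//; last exact: val_pts.
by congr act; apply: val_inj; rewrite to_realK.
Qed.

Lemma ray1 g p t : star g p -> clamp t = 1 -> ray g p t = p.
Proof.
move=> sp t0; rewrite /ray t0 (scale1 V A0 B0)//; last exact: val_pts.
by rewrite valK' actK.
Qed.

Lemma ray_path g p : star g p -> is_path (ray g p) (act g s00) p.
Proof.
move=> sp; apply/is_pathP; split; last 2 first.
- by rewrite ray0// clamp0.
- by rewrite ray1// clamp1.
apply: comp_cont (@clamp_continuous R) _; apply: (@comp_cont _ _ _ _ (act g)) => //.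
apply: (@scale_continuous R G A B H V A0 B0 R (fun=> act g p) (@clamp R)) => //.
- exact: cst_cont.
- exact: clamp_continuous.
Qed.

(* The contraction of the star maps a square with one side collapsed onto the *)
(* triangle swept out by the rays to the points of [alpha].                   *)
Lemma ray_cat g p p' alpha : is_path alpha p p' -> (forall s, I01 s -> star g (alpha s)) ->
  homotopic (path_cat (ray g p) alpha) (ray g p').
Proof.
move=> hal sal; have [cal a0 a1] := (is_pathP _ _ _).1 hal.
have I0 : I01 0 by rewrite /= in_itv /= lexx ler01.
have I1 : I01 1 by rewrite /= in_itv /= lexx ler01.
have sp' : star g p' by rewrite -a1; exact: sal.
pose F (rs : R * R) := act g (to_real (scale (clamp rs.1) (val (act g (alpha (clamp rs.2)))))).
have FE r s : F (r, s) = act g (to_real (scale (clamp r) (val (act g (alpha (clamp s)))))) by [].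
have cF : continuous F.
  apply: (@comp_cont _ _ _ _ (act g)) => //.
  apply: (@scale_continuous R G A B H V A0 B0 (R * R)%type (fun rs => act g (alpha (clamp rs.2)))
    (fun rs => clamp rs.1)) => //.
  - apply: (@comp_cont _ _ _ _ (act g)) => //.
    exact: (comp_cont (@snd_cont R R) cal).
  - exact: (comp_cont (@fst_cont R R) (@clamp_continuous R)).
  - by move=> rs; exact/sal/clamp_itv.
apply: (homotopic_trans (beta := path_cat (cst (act g s00)) (ray g p'))); last first.
  exact: path_cst_cat (ray_path sp').
have c1 := min_cont (@cst_cont R R 1) (@mul2_cont R 2 0).
have c2 := max_cont (@cst_cont R R 0) (@mul2_cont R 2 (-1)).
apply: (homotopic_reparam cF (pair_cont c1 c2) (pair_cont c2 c1)).
- by rewrite mulr0 !add0r (min_idPr _) ?(max_idPl _)//; lra.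
- by rewrite mulr1 (min_idPl _) ?(max_idPr _); [congr (_, _); lra|lra|lra].
- move=> s /=; rewrite in_itv /= => /andP[s0 s1]; rewrite /path_cat FE.
  case: (leP s 2^-1) => h; first by rewrite min_lo// max_lo// clamp0 a0.
  have hs : I01 (2 * s - 1) by rewrite /= in_itv/=; lra.
  rewrite min_hi// max_hi// clamp1 [in RHS]clamp_id// (scale1 V A0 B0); first by rewrite valK' actK.
    exact: val_pts.
  exact: sal.
- move=> s /=; rewrite in_itv /= => /andP[s0 s1]; rewrite /path_cat FE.
  case: (leP s 2^-1) => h; last by rewrite min_hi// max_hi// clamp1 a1.
  rewrite min_lo// max_lo// clamp0 (scale0 V A0 B0).
  - by congr act; apply: val_inj; rewrite to_realK.
  - exact: val_pts.
  - exact/sal/clamp_itv.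
Qed.

Lemma ray_base g : ray g (act g s00) = cst (act g s00).
Proof.
apply/funext => t; rewrite /ray actK /=; congr act.
by apply: val_inj; rewrite to_realK.
Qed.

Lemma star_base g h : star g (act h s00) -> g = h.
Proof.
by case: g h => [[] []] [[] []] //; rewrite /star /in_corner /= ?ltxx => -[].
Qed.

(* (true, a) is the letter a of [A], (false, b) the letter b of [B].           *)
Definition lvalid (l : bool * G) : Prop := if l.1 then A l.2 else B l.2.
Definition wvalid (w : seq (bool * G)) : Prop := foldr (fun l P => lvalid l /\ P) True w.
Definition ltype (l : bool * G) : V4 := if l.1 then (true, false) else (false, true).
Definition wtype (w : seq (bool * G)) : V4 := foldr (fun l g => ltype l * g)%g 1%g w.

Definition ledge (l : bool * G) : edge G :=
  if l.1 then VEdge l.2 false else HEdge l.2 false.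
Definition lpath1 (l : bool * G) : R -> X := fun s => to_real (edge_chart (ledge l) (clamp s)).

(** After each letter the rest of the path is translated by the type of that letter, as in the
    product of the orbispace group. So every word names a path from s_00 to [act (wtype w) s00], and
    concatenation of words matches that product. *)
Fixpoint lpath (w : seq (bool * G)) : R -> X :=
  if w is l :: w' then path_cat (lpath1 l) (act (ltype l) \o lpath w') else cst s00.

Lemma wvalid_cat w w' : wvalid (w ++ w') <-> wvalid w /\ wvalid w'.
Proof. by elim: w => [|l w IH] /=; rewrite ?IH; tauto. Qed.

Lemma wtype_cat w w' : wtype (w ++ w') = (wtype w * wtype w')%g.
Proof. by elim: w => [|l w IH] /=; rewrite ?mul1g// IH mulgA. Qed.

Lemma ledge_valid l : lvalid l -> sc_edges A B (ledge l).
Proof. by case: l => [[] c]. Qed.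

Lemma lpath1_path l : lvalid l -> is_path (lpath1 l) s00 (act (ltype l) s00).
Proof.
move=> hl; have he := ledge_valid hl; apply/is_pathP; split.
- rewrite (_ : _ \o _ = to_real \o edge_chart (ledge l) \o @clamp R); last first.
    by apply/funext => t; rewrite /lpath1 /= clamp_id//; exact: clamp_itv.
  exact: edge_to_real_continuous.
- apply: val_inj; rewrite /lpath1 clamp0 to_realK; last exact: sc_edge_chart.
  by rewrite /edge_chart lexx; case: l {hl he} => [[] c].
- apply: val_inj; rewrite /lpath1 clamp1 to_realK; last exact: sc_edge_chart.
  by rewrite /edge_chart leNgt ltr01 /= lexx; case: l {hl he} => [[] c].
Qed.

Lemma lpath_path w : wvalid w -> is_path (lpath w) s00 (act (wtype w) s00).
Proof.
elim: w => [_|l w IH] /=; first by rewrite V4_act1; exact: cst_path.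
move=> [hl hw]; rewrite actM; apply: path_cat_path (lpath1_path hl) _.
exact/is_path_map/IH.
Qed.

Lemma lpath1E l : lvalid l -> homotopic (lpath [:: l]) (lpath1 l).
Proof.
move=> hl; rewrite /= (_ : _ \o _ = cst (act (ltype l) s00))//.
exact: (path_cat_cst (lpath1_path hl)).
Qed.

Lemma lpath_cat w w' : wvalid w -> wvalid w' ->
  homotopic (lpath (w ++ w')) (path_cat (lpath w) (act (wtype w) \o lpath w')).
Proof.
move=> + hw'; elim: w => [_|l w IH [hl hw]].
  rewrite /= (_ : _ \o _ = lpath w'); last by apply/funext => s; rewrite /= V4_act1.
  apply: homotopic_sym; exact: path_cst_cat (lpath_path hw').
rewrite [lpath _]/= [lpath (l :: w)]/= [wtype _]/=.
have ha := @act_cont (ltype l).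
have p1 := lpath1_path hl; have p2 := lpath_path hw; have p3 := lpath_path hw'.
have p3' := is_path_map (@act_cont (wtype w)) p3.
have -> : act (ltype l * wtype w)%g \o lpath w' = act (ltype l) \o (act (wtype w) \o lpath w').
  by apply/funext => s; rewrite /= actM.
apply: homotopic_trans (homotopic_sym (path_catA p1 (is_path_map ha p2) (is_path_map ha p3'))).
apply: path_cat_homotopic; last 1 first.
- rewrite -path_cat_map; exact/homotopic_map/IH.
- have [_ _ ->] := p1.
  have hww : wvalid (w ++ w') by apply/wvalid_cat.
  by have [_ <- _] := is_path_map ha (lpath_path hww).
- exact: homotopic_refl p1.
Qed.

Lemma square_chart_bottom q (s : R) : let: Sq _ _ b _ := q in
  square_chart q (clamp s, 0) = edge_chart (HEdge b false) (clamp s).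
Proof.
case: q => a b' b a' /=; have /andP[] := clamp01 s; move: (clamp s) => {}s s0 s1.
case: (ltgtP s 0) s0 => // [s0|->] _; last by rewrite /edge_chart lexx.
case: (ltgtP 1 s) s1 => // [s1|<-] _; last by rewrite /edge_chart lexx leNgt ltr01 lexx.
by rewrite lexx.
Qed.

Let lpath1_v q : let: Sq a _ _ _ := q in
  forall s, lpath1 (true, a) s = to_real (square_chart q (0, clamp s)).
Proof. by case: q => a b' b a' s; rewrite /lpath1 /= lexx. Qed.

Let lpath1_h q : let: Sq _ _ b _ := q in
  forall s, lpath1 (false, b) s = to_real (square_chart q (clamp s, 0)).
Proof.
by case: q => a b' b a' s; rewrite (square_chart_bottom (Sq a b' b a')).
Qed.

Let contA (f g : R -> R) : continuous f -> continuous g -> continuous (fun s => f s + g s).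
Proof. by move=> cf cg s; exact: (cvgD (cf s) (cg s)). Qed.
Let contZ (f : R -> R) c : continuous f -> continuous (fun s => f s * c).
Proof. by move=> cf s; exact: (cvgM (cf s) (cvg_cst _)). Qed.

Let to_real_square q : sc_squares A B q -> continuous (fun xy : R * R => to_real (square_chart q (clamp2 xy))).
Proof. by move=> hq; exact: (to_real_continuous hq). Qed.

Let mulI (s x : R) : 0 <= s <= 1 -> 0 <= x <= 1 -> 0 <= s * x <= 1.
Proof. by move=> /andP[s0 s1] /andP[x0 x1]; rewrite mulr_ge0//= mulr_ile1. Qed.

Let corner_ray q (x y s : R) : sc_squares A B q -> 0 <= x < 1 -> 0 <= y < 1 ->
  scale (clamp s) (square_chart q (x, y)) = square_chart q (clamp s * x, clamp s * y).
Proof. by move=> hq hx hy; rewrite scale_chart. Qed.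

Let sqv q : sc_squares A B q -> sc_squares A B (square_flip_v q).
Proof. exact: (sc_square_flip_v R V). Qed.
Let sqh q : sc_squares A B q -> sc_squares A B (square_flip_h q).
Proof. exact: (sc_square_flip_h R V). Qed.

Let reparam2 (F : R * R -> X) (p1 p2 q1 q2 : R -> R) (alpha beta : R -> X) :
  continuous F -> continuous p1 -> continuous p2 -> continuous q1 -> continuous q2 ->
  p1 0 = q1 0 -> p2 0 = q2 0 -> p1 1 = q1 1 -> p2 1 = q2 1 ->
  (forall s, I01 s -> alpha s = F (p1 s, p2 s)) ->
  (forall s, I01 s -> beta s = F (q1 s, q2 s)) -> homotopic alpha beta.
Proof.
move=> cF cp1 cp2 cq1 cq2 e1 e2 e3 e4 h1 h2.
apply: (homotopic_reparam cF (pair_cont cp1 cp2) (pair_cont cq1 cq2)) => //.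
  by rewrite e1 e2.
by rewrite e3 e4.
Qed.

(** The point p lies in the stars of s_00 and s_01, hence in a closed square with left side a.
    Inside this convex square the segment from s_00 to p deforms to the left side followed by the
    segment from s_01 to p. *)
Lemma ray_step_v p : star 1%g p -> star (true, false) p ->
  exists2 a, A a & homotopic (ray 1%g p) (path_cat (lpath1 (true, a)) (ray (true, false) p)).
Proof.
rewrite /star /= => h1 h2; have h1' : in_corner (val p) := h1.
have [q hq [pE hx hy]] := corner_cover V A0 B0 (val_pts p) h1'.
have hy1 : 0 < coord_y (val p) by have := h2.2; rewrite flip_v_y gtrBl.
have hyV : 0 <= 1 - coord_y (val p) < 1 by move: hy hy1; lra.
have pV : val (act (true, false) p) = square_chart (square_flip_v q) (coord_x (val p), 1 - coord_y (val p)).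
  by rewrite /= {1}pE (flip_v_chart V).
move: (coord_x (val p)) (coord_y (val p)) => x y in pE hx hy hy1 hyV pV *.
have /andP[x0 x1] := hx; have /andP[y0 y1] := hy.
have hx' : 0 <= x <= 1 by rewrite x0 ltW.
have hy' : 0 <= y <= 1 by rewrite y0 ltW.
have r1E s : ray 1%g p s = to_real (square_chart q (clamp s * x, clamp s * y)).
  by rewrite /ray !V4_act1 {1}pE corner_ray.
have r2E s : ray (true, false) p s = to_real (square_chart q (clamp s * x, 1 - clamp s * (1 - y))).
  rewrite /ray pV corner_ray//; last exact: sqv.
  apply: val_inj => /=; rewrite !to_realK; [|exact: sc_square_chart|exact/sc_square_chart/sqv].
  rewrite (flip_v_chart V); last exact: sqv.
  by congr square_chart; case: (q) => a b' b a' /=; rewrite !invgK.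
have [a [ha lE]] : exists a, A a /\ forall s, lpath1 (true, a) s = to_real (square_chart q (0, clamp s)).
  case: q hq {pE pV r1E r2E} => a b' b a' hq; exists a; split; first by case: hq.
  exact: (lpath1_v (Sq a b' b a')).
exists a => //.
have c1 := min_cont (@cst_cont R R 1) (@mul2_cont R 2 0).
have c2 := max_cont (@cst_cont R R 0) (@mul2_cont R 2 (-1)).
apply: (reparam2 (to_real_square hq) (@contZ _ x (@id_cont R)) (@contZ _ y (@id_cont R))
  (@contZ _ x c2) (contA c1 (@contZ _ (y - 1) c2))) => /=.
- by rewrite mulr0 add0r (max_idPl _) ?mul0r//; lra.
- by rewrite !mulr0 !add0r (min_idPr _) ?(max_idPl _) ?mul0r ?addr0//; lra.
- by rewrite mulr1 (max_idPr _); lra.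
- by rewrite !mulr1 (min_idPl _) ?(max_idPr _); lra.
- move=> s hs; rewrite r1E clamp_id//; congr (to_real (square_chart _ _)).
  move: hs; rewrite /= in_itv /= => hs.
  by rewrite clamp2_id //; split; rewrite /= in_itv /= mulI.
- move=> s /=; rewrite in_itv /= => /andP[s0 s1]; rewrite /path_cat.
  case: (leP s 2^-1) => h.
    by rewrite lE max_lo// min_lo// !mul0r addr0 /clamp2 /= clamp0.
  rewrite r2E max_hi// min_hi// clamp_id/=; last by rewrite in_itv/=; lra.
  have h3 : 0 <= 2 * s - 1 <= 1 by lra.
  have h4 := mulI h3 (_ : 0 <= 1 - y <= 1).
  rewrite clamp2_id; first by congr (to_real (square_chart _ (_, _))); lra.
  split; rewrite /= in_itv /=; first by rewrite mulI.
  by move: (h4 ltac:(lra)); rewrite !mulrBr !mulr1; lra.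
Qed.

Lemma ray_step_h p : star 1%g p -> star (false, true) p ->
  exists2 b, B b & homotopic (ray 1%g p) (path_cat (lpath1 (false, b)) (ray (false, true) p)).
Proof.
rewrite /star /= => h1 h2; have h1' : in_corner (val p) := h1.
have [q hq [pE hx hy]] := corner_cover V A0 B0 (val_pts p) h1'.
have hx1 : 0 < coord_x (val p) by have := h2.1; rewrite flip_h_x gtrBl.
have hxV : 0 <= 1 - coord_x (val p) < 1 by move: hx hx1; lra.
have pV : val (act (false, true) p) = square_chart (square_flip_h q) (1 - coord_x (val p), coord_y (val p)).
  by rewrite /= {1}pE (flip_h_chart V).
move: (coord_x (val p)) (coord_y (val p)) => x y in pE hx hy hx1 hxV pV *.
have /andP[x0 x1] := hx; have /andP[y0 y1] := hy.
have hx' : 0 <= x <= 1 by rewrite x0 ltW.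
have hy' : 0 <= y <= 1 by rewrite y0 ltW.
have r1E s : ray 1%g p s = to_real (square_chart q (clamp s * x, clamp s * y)).
  by rewrite /ray !V4_act1 {1}pE corner_ray.
have r2E s : ray (false, true) p s = to_real (square_chart q (1 - clamp s * (1 - x), clamp s * y)).
  rewrite /ray pV corner_ray//; last exact: sqh.
  apply: val_inj => /=; rewrite !to_realK; [|exact: sc_square_chart|exact/sc_square_chart/sqh].
  rewrite (flip_h_chart V); last exact: sqh.
  by congr square_chart; case: (q) => a b' b a' /=; rewrite !invgK.
have [b [hb lE]] : exists b, B b /\ forall s, lpath1 (false, b) s = to_real (square_chart q (clamp s, 0)).
  case: q hq {pE pV r1E r2E} => a b' b a' hq; exists b; split; first by case: hq.
  exact: (lpath1_h (Sq a b' b a')).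
exists b => //.
have c1 := min_cont (@cst_cont R R 1) (@mul2_cont R 2 0).
have c2 := max_cont (@cst_cont R R 0) (@mul2_cont R 2 (-1)).
apply: (reparam2 (to_real_square hq) (@contZ _ x (@id_cont R)) (@contZ _ y (@id_cont R))
  (contA c1 (@contZ _ (x - 1) c2)) (@contZ _ y c2)) => /=.
- by rewrite !mulr0 !add0r (min_idPr _) ?(max_idPl _) ?mul0r ?addr0//; lra.
- by rewrite mulr0 add0r (max_idPl _) ?mul0r//; lra.
- by rewrite !mulr1 (min_idPl _) ?(max_idPr _); lra.
- by rewrite mulr1 (max_idPr _); lra.
- move=> s hs; rewrite r1E clamp_id//; congr (to_real (square_chart _ _)).
  move: hs; rewrite /= in_itv /= => hs.
  by rewrite clamp2_id //; split; rewrite /= in_itv /= mulI.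
- move=> s /=; rewrite in_itv /= => /andP[s0 s1]; rewrite /path_cat.
  case: (leP s 2^-1) => h.
    by rewrite lE max_lo// min_lo// !mul0r addr0 /clamp2 /= clamp0.
  rewrite r2E max_hi// min_hi// clamp_id/=; last by rewrite in_itv/=; lra.
  have h3 : 0 <= 2 * s - 1 <= 1 by lra.
  have h4 := mulI h3 (_ : 0 <= 1 - x <= 1).
  rewrite clamp2_id; first by congr (to_real (square_chart _ (_, _))); lra.
  split; rewrite /= in_itv /=; last by rewrite mulI.
  by move: (h4 ltac:(lra)); rewrite !mulrBr !mulr1; lra.
Qed.

(** The previous two lemmas transported by the symmetry [wtype w]. The letter c0 serves only to name
    the kind of step, as [ltype] depends on k alone; the proof finds the actual letter c. *)
Lemma ray_step w p (k : bool) c0 : wvalid w -> star (wtype w) p ->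
  star (wtype w * ltype (k, c0))%g p ->
  exists c, [/\ lvalid (k, c), ltype (k, c) = ltype (k, c0) &
    homotopic (path_cat (lpath w) (ray (wtype w) p))
      (path_cat (lpath (w ++ [:: (k, c)])) (ray (wtype w * ltype (k, c0))%g p))].
Proof.
move=> hw h1 h2; set g := wtype w in h1 h2 *; pose p' := act g p.
have h1' : star 1%g p' by change (in_corner (val (act 1%g p'))); rewrite V4_act1.
have h2' : star (ltype (k, c0)) p'.
  by change (in_corner (val (act (ltype (k, c0)) p'))); rewrite /p' -actM V4_mulC.
have [c hc hom] : exists2 c, lvalid (k, c) & homotopic (ray 1%g p')
    (path_cat (lpath1 (k, c)) (ray (ltype (k, c0)) p')).
  by case: k h2 h2' => h2 h2'; [exact: ray_step_v|exact: ray_step_h].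
exists c; split=> //.
have := homotopic_map (@act_cont g) hom; rewrite path_cat_map.
have -> : act g \o ray 1%g p' = ray g p.
  by apply/funext => s; rewrite /ray /p' /= !V4_act1.
have -> : act g \o ray (ltype (k, c0)) p' = ray (g * ltype (k, c0))%g p.
  have e : act (ltype (k, c0)) p' = act (g * ltype (k, c0))%g p by rewrite /p' -actM V4_mulC.
  by apply/funext => s; change (act g (ray (ltype (k, c0)) p' s) = ray (g * ltype (k, c0))%g p s); rewrite /ray e -actM.
move=> hom'.
have pw := lpath_path hw; have pr := ray_path h1; have pr2 := ray_path h2.
have p1 := is_path_map (@act_cont g) (lpath1_path hc).
have hwl : wvalid (w ++ [:: (k, c)]) by apply/wvalid_cat.
have pwl := lpath_path hwl; rewrite wtype_cat /= mulg1 -/g in pwl.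
have e2 : act g (act (ltype (k, c)) s00) = act (g * ltype (k, c0))%g s00 by rewrite actM.
rewrite e2 in p1.
have step1 := path_cat_homotopic (_ : lpath w 1 = ray g p 0) (homotopic_refl pw) hom'.
apply: (homotopic_trans (step1 _)).
  by have [_ _ ->] := pw; have [_ -> _] := pr.
apply: (homotopic_trans (homotopic_sym (path_catA pw p1 pr2))).
apply: path_cat_homotopic; last exact: (homotopic_refl pr2).
  have [_ -> _] := pr2; have [_ _ ->] := path_cat_path pw p1; by [].
apply: homotopic_sym; apply: (homotopic_trans (lpath_cat hw (_ : wvalid [:: (k, c)]))) => //.
apply: path_cat_homotopic; last exact/homotopic_map/lpath1E.
  have [_ _ ->] := pw; have h : wvalid [:: (k, c)] by [].
  by have [_ -> _] := is_path_map (@act_cont g) (lpath_path h).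
exact: (homotopic_refl pw).
Qed.

Lemma ray_change w p g : wvalid w -> star (wtype w) p -> star g p ->
  exists w', [/\ wvalid w', wtype w' = g &
    homotopic (path_cat (lpath w) (ray (wtype w) p)) (path_cat (lpath w') (ray g p))].
Proof.
have [c0 _] := A0.
move=> hw h1 h2; pose d := (wtype w * g)%g.
have gE : g = (wtype w * d)%g by rewrite /d mulgA V4_mulg2 mul1g.
have one (k : bool) : g = (wtype w * ltype (k, c0))%g -> exists w', [/\ wvalid w', wtype w' = g &
    homotopic (path_cat (lpath w) (ray (wtype w) p)) (path_cat (lpath w') (ray g p))].
  move=> e; rewrite e in h2 *; have [c [hc tc hom]] := ray_step hw h1 h2.
  exists (w ++ [:: (k, c)]); split=> //; first exact/wvalid_cat.
  by rewrite wtype_cat /= mulg1 tc.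
case dE : d gE => [[] []] gE.
(* The two centres are diagonally opposite. A point in both stars has coordinates strictly between 0
   and 1, so it also lies in the star of an intermediate vertex, and two steps suffice. *)
- have h3 : star (wtype w * ltype (true, c0))%g p.
    move: h1 h2; rewrite gE /star /in_corner /= => -[+ +] [+ +].
    by case: (wtype w) => [[] []] /=; rewrite ?flip_v_x ?flip_v_y ?flip_h_x ?flip_h_y
      ?flip_v_x ?flip_v_y ?flip_h_x ?flip_h_y.
  have [c [hc tc hom]] := ray_step hw h1 h3.
  have hw2 : wvalid (w ++ [:: (true, c)]) by apply/wvalid_cat.
  have t2 : wtype (w ++ [:: (true, c)]) = (wtype w * ltype (true, c0))%g.
    by rewrite wtype_cat /= mulg1 tc.
  have g2 : g = (wtype (w ++ [:: (true, c)]) * ltype (false, c0))%g by rewrite t2 -mulgA gE.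
  rewrite -t2 in h3; rewrite g2 in h2.
  have [c' [hc' tc' hom']] := ray_step hw2 h3 h2.
  exists ((w ++ [:: (true, c)]) ++ [:: (false, c')]); split.
  + exact/wvalid_cat.
  + by rewrite wtype_cat /= mulg1 tc' g2.
  + rewrite -g2 in hom'; rewrite -t2 in hom; exact: homotopic_trans hom hom'.
- exact: (one true).
- exact: (one false).
- exists w; rewrite (_ : g = wtype w); last by rewrite gE mulg1.
  split=> //; have pw := lpath_path hw.
  exact: homotopic_refl (path_cat_path pw (ray_path h1)).
Qed.

Lemma star_cover p : exists g, star g p.
Proof.
have /andP[x0 x1] := coord_x_itv (val_pts p); have /andP[y0 y1] := coord_y_itv (val_pts p).
exists ((coord_y (val p) == 1), (coord_x (val p) == 1)); rewrite /star /in_corner /=.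
case: eqP => ey; case: eqP => ex /=;
  rewrite ?flip_v_x ?flip_v_y ?flip_h_x ?flip_h_y ?ex ?ey ?subrr ?ltr01; split=> //.
- by rewrite lt_neqAle x1 andbT; apply/eqP.
- by rewrite lt_neqAle y1 andbT; apply/eqP.
- by rewrite lt_neqAle x1 andbT; apply/eqP.
- by rewrite lt_neqAle y1 andbT; apply/eqP.
Qed.

Lemma star_nbhs g p : star g p -> nbhs p (star g).
Proof.
move=> [hx hy].
have nx : nbhs p (fun q : X => coord_x (val (act g q)) < 1).
  exact: (comp_cont (@act_cont g) (@coord_x_continuous R G A B) (lt_nbhsl hx)).
have ny : nbhs p (fun q : X => coord_y (val (act g q)) < 1).
  exact: (comp_cont (@act_cont g) (@coord_y_continuous R G A B) (lt_nbhsl hy)).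
exact: filterI nx ny.
Qed.

Lemma star_near g (f : R -> X) t : continuous f -> star g (f t) ->
  exists2 e, 0 < e & forall s, `|s - t| < e -> star g (f s).
Proof.
move=> cf sg; have [e /= e0 he] := (nbhs_ballP _ _).1 (cf t _ (star_nbhs sg)).
by exists e => // s hs; apply: he; rewrite /ball /= distrC.
Qed.

(* Along a path, the property of being homotopic to an edge path followed by  *)
(* a ray is locally constant.                                                 *)
Theorem edge_path_approx alpha g : is_path alpha s00 (act g s00) ->
  exists w, [/\ wvalid w, wtype w = g & homotopic alpha (lpath w)].
Proof.
move=> /is_pathP[ca a0 a1]; pose f := alpha \o @clamp R.
have f0 : f 0 = s00 by rewrite /f /= clamp0.
have segP t1 t2 : is_path (fun s => f (t1 + s * (t2 - t1))) (f t1) (f t2).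
  apply/is_pathP; split; last 2 first.
  - by rewrite mul0r addr0.
  - by rewrite mul1r addrC subrK.
  apply: comp_cont (@clamp_continuous R) _.
  have c : continuous (fun s : R => t1 + s * (t2 - t1)).
    exact: (@contA (fun=> t1) (fun s => s * (t2 - t1)) (@cst_cont R R t1) (@contZ id (t2 - t1) (@id_cont R))).
  exact: (comp_cont c ca).
pose P t := exists w, [/\ wvalid w, star (wtype w) (f t) &
  homotopic (fun s => f (0 + s * (t - 0))) (path_cat (lpath w) (ray (wtype w) (f t)))].
suff : P 1.
  move=> [w [hw sw hom]]; have e1 : f 1 = act g s00 by rewrite /f /= clamp1.
  rewrite e1 in sw hom; have wg := star_base sw; exists w; split=> //.
  rewrite wg ray_base in hom; have pw := lpath_path hw; rewrite wg in pw.
  apply: homotopic_trans (path_cat_cst pw); apply: homotopic_trans hom.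
  have pa : is_path alpha s00 (act g s00) by apply/is_pathP.
  by apply: (eq_homotopic pa) => s hs; rewrite add0r subr0 mulr1 /f /= clamp_id.
have P0 : P 0.
  have rb : ray 1%g s00 = cst s00 by rewrite -[X in ray _ X](V4_act1 V) ray_base V4_act1.
  exists [::]; rewrite f0; split=> //.
  rewrite [wtype _]/= rb.
  have p0 : is_path (cst s00 : R -> X) s00 s00 by exact: cst_path.
  apply: homotopic_trans (homotopic_sym (path_cst_cat p0)).
  apply: homotopic_sym; apply: (eq_homotopic p0) => s _ /=.
  by rewrite subr0 mulr0 addr0 f0.
suff loc : forall s t, P s -> P t by exact: (loc 0 1 P0).
apply: locally_constant_line => t0.
have [g0 sg0] := star_cover (f t0); have [e e0 he] := star_near ca sg0.
exists e => // t1 t2 h1 h2 [w [hw sw hom]].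
have s1 := he _ h1; have s2 := he _ h2.
have [w' [hw' tw' hom']] := ray_change hw sw s1.
exists w'; split=> //; first by rewrite tw'.
have q1 := segP 0 t1; have q2 := segP t1 t2; have q3 := segP 0 t2.
have pw' := lpath_path hw'; have pr := ray_path s1; have pr2 := ray_path s2.
rewrite tw' in pw' *.
apply: (homotopic_trans (beta := path_cat (fun s => f (0 + s * (t1 - 0))) (fun s => f (t1 + s * (t2 - t1))))).
  have c1 := min_cont (@cst_cont R R 1) (@mul2_cont R 2 0).
  have c2 := max_cont (@cst_cont R R 0) (@mul2_cont R 2 (-1)).
  apply: (@homotopic_reparam R X R^o f (fun s => s * t2)
    (fun s => Num.min 1 (2 * s + 0) * t1 + Num.max 0 (2 * s + -1) * (t2 - t1))) => //.
  - exact: (@contZ id t2 (@id_cont R)).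
  - exact: (contA (@contZ _ t1 c1) (@contZ _ (t2 - t1) c2)).
  - by rewrite !mulr0 !add0r (min_idPr _) ?(max_idPl _); lra.
  - by rewrite !mulr1 (min_idPl _) ?(max_idPr _); lra.
  - by move=> s hs; rewrite add0r subr0.
  - move=> s /=; rewrite in_itv /= => /andP[r0 r1]; rewrite /path_cat add0r subr0.
    case: (leP s 2^-1) => h; congr f.
      by rewrite min_lo// max_lo//; lra.
    by rewrite min_hi// max_hi//; lra.
have homw := homotopic_trans hom hom'.
have step : homotopic (path_cat (fun s => f (0 + s * (t1 - 0))) (fun s => f (t1 + s * (t2 - t1))))
    (path_cat (path_cat (lpath w') (ray g0 (f t1))) (fun s => f (t1 + s * (t2 - t1)))).
  apply: path_cat_homotopic homw (homotopic_refl q2).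
  by have [_ _ ->] := q1; have [_ -> _] := q2.
apply: (homotopic_trans step); apply: (homotopic_trans (path_catA pw' pr q2)).
apply: path_cat_homotopic; last 1 first.
- apply: (ray_cat q2) => s hs; apply: he.
  have -> : t1 + s * (t2 - t1) - t0 = (1 - s) * (t1 - t0) + s * (t2 - t0) by ring.
  move: hs; rewrite /= in_itv /= => /andP[r0 r1].
  apply: le_lt_trans (ler_normD _ _) _; rewrite !normrM (ger0_norm r0) ger0_norm; last by lra.
  have m1 : (1 - s) * `|t1 - t0| <= (1 - s) * Num.max `|t1 - t0| `|t2 - t0|.
    by rewrite ler_wpM2l ?le_max ?lexx//; lra.
  have m2 : s * `|t2 - t0| <= s * Num.max `|t1 - t0| `|t2 - t0|.
    by rewrite ler_wpM2l ?le_max ?lexx ?orbT.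
  have m3 : Num.max `|t1 - t0| `|t2 - t0| < e by rewrite gt_max h1 h2.
  by lra.
- have [_ _ ->] := pw'; by have [_ -> _] := path_cat_path pr q2.
- exact: (homotopic_refl pw').
Qed.

End EdgePaths.

(** * Holonomy *)

Section Within.
Variables (T : topologicalType) (d : T).
Implicit Types (D : set T) (P Q : T -> Prop).

Lemma within_imp D D' P Q : within D (nbhs d) P ->
  (forall d', D' d' -> (D d' -> P d') -> Q d') -> within D' (nbhs d) Q.
Proof.
move=> n PQ; have n' : nbhs d (fun d' => D d' -> P d') := n.
suff : nbhs d (fun d' => D' d' -> Q d') by [].
by apply: filterS n' => d' /= h D'd'; exact: PQ.
Qed.

Lemma within_imp2 D D' P P' Q : within D (nbhs d) P -> within D (nbhs d) P' ->
  (forall d', D' d' -> (D d' -> P d') -> (D d' -> P' d') -> Q d') -> within D' (nbhs d) Q.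
Proof.
move=> n n' PQ; have m : nbhs d (fun d' => D d' -> P d') := n.
have m' : nbhs d (fun d' => D d' -> P' d') := n'.
suff : nbhs d (fun d' => D' d' -> Q d') by [].
by apply: filterS2 m m' => d' /= h h' D'd'; exact: PQ.
Qed.

Lemma nbhs_within D P Q : nbhs d P -> (forall d', D d' -> P d' -> Q d') -> within D (nbhs d) Q.
Proof.
move=> n PQ; suff : nbhs d (fun d' => D d' -> Q d') by [].
by apply: filterS n => d' /= h Dd'; exact: PQ.
Qed.

End Within.

Section Holonomy.
Variables (R : realType) (G : groupType) (A B H : set G) (V : V4_structure H A B).
Hypotheses (A0 : A !=set0) (B0 : B !=set0).
Local Notation pts := (@sc_points R G A B).
Local Notation X := (realization R A B).
Local Notation to_real := (@to_real R G A B).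
Local Notation act := (V4_act R V).
Local Notation s00 := (base_vertex R A B).
Local Notation I01 := (`[0, 1]%classic : set R).
Local Notation star := (star V).
Local Open Scope group_scope.
Implicit Types (p : cell_point R G) (g : V4).

(* The corners of a cell are labelled by elements of [G]: [pos p g] is read    *)
(* off an edge path from the corner [corner p] of the cell of [p] to the       *)
(* corner [g s_00]. It is junk when [g s_00] is not a corner of that cell.     *)
Definition pos p g : G := match p with
  | PVertex _ => 1
  | PEdge (VEdge a _) _ => if g.1 then a else 1
  | PEdge (HEdge b _) _ => if g.2 then b else 1
  | PSquare (Sq a b' b _) _ _ =>
      if g.2 then if g.1 then a * b' else b else if g.1 then a else 1
  end.

Definition corner p : V4 := match p with
  | PVertex (i, j) => (j, i)
  | PEdge (VEdge _ i) _ => (false, i)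
  | PEdge (HEdge _ j) _ => (j, false)
  | PSquare _ _ _ => (false, false)
  end.

Lemma pos_corner p : pos p (corner p) = 1.
Proof. by case: p => [[i j]|[a i|b j] t|[a b' b a'] x y]. Qed.

Lemma star_coord g (p : X) : star g p ->
  ((if g.2 then 1 - coord_x (val p) else coord_x (val p)) < 1)%R /\
  ((if g.1 then 1 - coord_y (val p) else coord_y (val p)) < 1)%R.
Proof.
by case: g => [[] []]; rewrite /star /in_corner /= ?flip_v_x ?flip_v_y ?flip_h_x ?flip_h_y.
Qed.

Let bool01 (i j : bool) : ((if i then 1 - j%:R else j%:R) < 1 :> R)%R -> i = j.
Proof. by case: i j => [] [] //=; rewrite ?subr0 ltxx. Qed.

(** A cocycle rule. Near p the cell of p is a face of the cell of p', so the route from the corner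
    of p' to g s_00 may pass through the corner of p; for a square this uses a b' = b a'. Positivity
    of the tents ensures that the cells are incident. *)
Lemma pos_star_near g (p : X) : star g p -> nbhs p (fun p' : X =>
  pos (val p') g = pos (val p') (corner (val p)) * pos (val p) g).
Proof.
move=> /star_coord.
have tent_near e : in_star e (val p) -> nbhs p (fun p' : X => in_star e (val p')).
  rewrite -(tent_gt0 e (val_pts p)) => h.
  have n : nbhs p (fun p' : X => (0 < tent e (val p'))%R) := @tent_continuous R G A B e p _ (lt_nbhsr h).
  by apply: (filterS _ n) => p' /= h'; rewrite -(tent_gt0 e (val_pts p')).
have := val_pts p; case pE : (val p) => [[i j]|[a i|b j] t|[a b' b a'] x y] hp /= [gx gy].
- have e : g = (j, i) by case: (g) gx gy => g1 g2 /= /bool01 -> /bool01 ->.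
  by apply: filterE => p'; rewrite e mulg1.
- have e : g.2 = i := bool01 gx.
  have := tent_near (VEdge a i); rewrite pE /= !eqxx => /(_ isT).
  apply: filterS => p'; have /= := val_pts p'.
  case: (sval p') => [//|[a1 i1|b1 j1] t1|[c d' d c'] x' y'] hp' //=.
    by move=> /andP[/eqP<- _]; rewrite mul1g.
  rewrite e => /eqP ->; case: i {gx pE hp} e => e; last by rewrite mul1g.
  by have [[_ _ _ _ ->] _ _] := hp'; case: ifP => //; rewrite mulg1.
- have e : g.1 = j := bool01 gy.
  have := tent_near (HEdge b j); rewrite pE /= !eqxx => /(_ isT).
  apply: filterS => p'; have /= := val_pts p'.
  case: (sval p') => [//|[a1 i1|b1 j1] t1|[c d' d c'] x' y'] hp' //=.
    by move=> /andP[/eqP<- _]; rewrite mul1g.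
  rewrite e => /eqP ->; case: j {gy pE hp} e => e; last by rewrite mul1g; case: ifP.
  by case: ifP => //; rewrite mulg1.
- have h1 := tent_near (VEdge a false); rewrite pE /= eqxx in h1.
  have h2 := tent_near (HEdge b false); rewrite pE /= eqxx in h2.
  apply: filterS2 (h1 isT) (h2 isT) => p'; have /= := val_pts p'.
  case: (sval p') => [//|[a1 i1|b1 j1] t1|[c d' d c'] x' y'] hp' //=.
  move=> /eqP ea /eqP eb; subst c d.
  have [hq _ _] := hp; have [hq' _ _] := hp'.
  by have [<- _] := square_inj V hq hq'; rewrite mul1g.
Qed.

Section Lifts.
Variable T : topologicalType.
Implicit Types (D : set T) (f : T -> X) (h : T -> G).

(* [h] is the position of a lift of [f] to the covering defined by [pos].      *)
Definition is_lift D f h := forall d, D d ->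
  within D (nbhs d) (fun d' => h d = h d' * pos (val (f d')) (corner (val (f d)))).

Lemma is_lift_sub D D' f h : D' `<=` D -> is_lift D f h -> is_lift D' f h.
Proof.
move=> sD lh d Dd; apply: (within_imp (lh d (sD _ Dd))) => d' D'd' e; exact/e/sD.
Qed.

Lemma is_lift_eq D f f' h h' : (forall d, D d -> f d = f' d) -> (forall d, D d -> h d = h' d) ->
  is_lift D f h -> is_lift D f' h'.
Proof.
move=> ef eh lh d Dd; apply: (within_imp (lh d Dd)) => d' D'd' e.
by rewrite -!eh// -!ef//; exact: e.
Qed.

Lemma is_lift_mul D f h c : is_lift D f h -> is_lift D f (fun d => c * h d).
Proof.
by move=> lh d Dd; apply: (within_imp (lh d Dd)) => d' D'd' e; rewrite e// mulgA.
Qed.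

Lemma is_lift_cst D (p : X) c : is_lift D (fun=> p) (fun=> c).
Proof.
move=> d Dd; apply: (nbhs_within (P := fun=> True)); first exact: filterT.
by move=> d' _ _; rewrite pos_corner mulg1.
Qed.

(** Over a star a lift is explicit: give the centre the label 1, and the label of the corner of each
    cell is then forced. *)
Lemma is_lift_star D f g : continuous f -> (forall d, D d -> star g (f d)) ->
  is_lift D f (fun d => (pos (val (f d)) g)^-1).
Proof.
move=> cf sf d Dd.
apply: (nbhs_within (cf d _ (pos_star_near (sf d Dd)))) => d' _ /= e; by rewrite e invgM -mulgA mulVg mulg1.
Qed.

Lemma locally_constant_connected D (k : T -> G) d0 : connected D -> D d0 ->
  (forall d, D d -> within D (nbhs d) (fun d' => k d' = k d)) ->
  forall d, D d -> k d = k d0.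
Proof.
move=> cD D0 lk; have -> // : D = D `&` [set d | k d = k d0].
  apply/esym/cD; first by exists d0.
  - exists ([set d | D d -> k d = k d0])°; first exact: open_interior.
    apply/seteqP; split=> d /= [Dd h]; split=> //; last by have := interior_subset h; exact.
    apply: (within_imp (lk d Dd)) => d' D'd' -> //.
  - exists (~` ([set d | D d -> k d <> k d0])°).
      by apply: open_closedC; exact: open_interior.
    apply/seteqP; split=> d /= [Dd h]; split=> //.
      by move=> /interior_subset /= /(_ Dd).
    apply: contrapT => nh; apply: h.
    by apply: (within_imp (lk d Dd)) => d' D'd' ->.
by move=> d [].
Qed.

(** Nearby values of h and h' differ by the same right factor, so h' h^-1 is locally constant. *)
Lemma is_lift_uniq D f h h' d0 : connected D -> D d0 -> is_lift D f h -> is_lift D f h' ->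
  forall d, D d -> h' d = h' d0 * (h d0)^-1 * h d.
Proof.
move=> cD D0 lh lh' d Dd.
suff <- : h' d * (h d)^-1 = h' d0 * (h d0)^-1 by rewrite -mulgA mulVg mulg1.
apply: (@locally_constant_connected D (fun d => h' d * (h d)^-1) d0 cD D0) => // {Dd}d Dd.
 apply: (within_imp2 (lh d Dd) (lh' d Dd)) => d' D'd' e e'.
by rewrite e// e'// invgM mulgA mulgK.
Qed.

(** On the connected overlap the two lifts differ by a left constant, which is absorbed into the
    second one. *)
Lemma is_lift_glue D1 D2 f h1 h2 d0 : closed D1 -> closed D2 -> connected (D1 `&` D2) ->
  (D1 `&` D2) d0 -> is_lift D1 f h1 -> is_lift D2 f h2 -> exists h,
  [/\ is_lift (D1 `|` D2) f h, (forall d, D1 d -> h d = h1 d) &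
      (forall d, D2 d -> h d = h1 d0 * (h2 d0)^-1 * h2 d)].
Proof.
move=> cl1 cl2 c12 D0 l1 l2.
pose h d := if `[< D1 d >] then h1 d else h1 d0 * (h2 d0)^-1 * h2 d.
have hE1 d : D1 d -> h d = h1 d by move=> Dd; rewrite /h asboolT.
have hE2 d : D2 d -> h d = h1 d0 * (h2 d0)^-1 * h2 d.
  move=> Dd; rewrite /h; case: asboolP => // D1d.
  have s1 : D1 `&` D2 `<=` D1 by move=> ? [].
  have s2 : D1 `&` D2 `<=` D2 by move=> ? [].
  exact: (is_lift_uniq c12 D0 (is_lift_sub s2 l2) (is_lift_sub s1 l1)).
have L1 : is_lift D1 f h by apply: is_lift_eq l1 => // d /hE1.
have L2 : is_lift D2 f h.
  by apply: (@is_lift_eq _ f f (fun d => h1 d0 * (h2 d0)^-1 * h2 d)) (is_lift_mul _ l2) => // d /hE2.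
exists h; split=> //.
have loc D d : closed D -> is_lift D f h ->
    nbhs d (fun d' => D d' -> h d = h d' * pos (val (f d')) (corner (val (f d)))).
  move=> cl L; have [Dd|nDd] := pselect (D d); first exact: L.
  have : nbhs d (~` D) by apply: open_nbhs_nbhs; split=> //; exact: closed_openC.
  by apply: filterS.
move=> d _; suff : nbhs d (fun d' => (D1 `|` D2) d' -> h d = h d' * pos (val (f d')) (corner (val (f d)))) by [].
by apply: filterS2 (loc D1 d cl1 L1) (loc D2 d cl2 L2) => d' /= e1 e2 [].
Qed.

End Lifts.

Lemma is_lift_comp (T T' : topologicalType) (D : set T) (D' : set T') (f : T -> X) h
    (phi : T' -> T) : continuous phi -> (forall d, D' d -> D (phi d)) ->
  is_lift D f h -> is_lift D' (f \o phi) (h \o phi).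
Proof.
move=> cphi sub lh d Dd.
by apply: (nbhs_within (cphi d _ (lh _ (sub _ Dd)))) => d' D'd' /= e; exact/e/sub.
Qed.

Section Strips.
Local Open Scope ring_scope.

(** Compactness of intervals as an induction principle: a property that is hereditary, local and
    stable under gluing holds for every interval. Empty intervals are included so that no order
    between a and b has to be assumed. *)
Lemma strip_induction (L : R -> R -> Prop) :
  (forall a b, b < a -> L a b) ->
  (forall a a' b' b, a <= a' -> b' <= b -> L a b -> L a' b') ->
  (forall a b c, a <= b -> b <= c -> L a b -> L b c -> L a c) ->
  (forall t, exists2 e, 0 < e & L (t - e) (t + e)) -> forall a b, L a b.
Proof.
move=> L0 Lsub Lglue Lloc a b.
suff h : forall s t, L a s -> L a t by apply: (h (a - 1)); apply: L0; rewrite gtrBl.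
apply: locally_constant_line => t0; have [e e0 he] := Lloc t0.
exists e => // t1 t2; rewrite !ltr_norml => /andP[u1 u2] /andP[v1 v2] La.
have [t21|t12] := leP t2 t1; first exact: Lsub La.
have L12 : L t1 t2 by apply: Lsub he; lra.
have [at1|t1a] := leP a t1; first by apply: Lglue La L12 => //; exact: ltW.
by apply: Lsub L12 => //; exact: ltW.
Qed.

Let cseg (a b : R) : closed `[a, b]%classic. Proof. exact: interval_closed. Qed.

Let rect_closed (a b c d : R) : closed (`[a, b]%classic `*` `[c, d]%classic : set (R * R)).
Proof.
apply: (@closedI _ (fst @^-1` `[a, b]%classic) (snd @^-1` `[c, d]%classic)).
  by apply: (continuous_closedP _).1; [exact: fst_cont|exact: cseg].
by apply: (continuous_closedP _).1; [exact: snd_cont|exact: cseg].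
Qed.

Let fiber_connected (t c d : R) : connected ([set t] `*` `[c, d]%classic : set (R * R)).
Proof.
have -> : [set t] `*` `[c, d]%classic = (fun s => (t, s)) @` `[c, d]%classic.
  by apply/seteqP; split=> [[x y] /= [-> h]|[x y] [s h [<- <-]]]; [exists y|split].
apply: connected_continuous_connected; first exact: segment_connected.
by apply: continuous_subspaceT; exact: (pair_cont (@cst_cont R R t) (@id_cont R)).
Qed.

Let fiber_connected' (t c d : R) : connected (`[c, d]%classic `*` [set t] : set (R * R)).
Proof.
have -> : `[c, d]%classic `*` [set t] = (fun s => (s, t)) @` `[c, d]%classic.
  by apply/seteqP; split=> [[x y] /= [h ->]|[x y] [s h [<- <-]]]; [exists x|split].
apply: connected_continuous_connected; first exact: segment_connected.
by apply: continuous_subspaceT; exact: (pair_cont (@id_cont R) (@cst_cont R R t)).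
Qed.

(** Homotopy lifting. Small squares mapped into a single star have lifts; these are glued along a
    thin row, and then the rows are stacked. All overlaps are segments, hence connected. *)
Lemma square_lift (F : R * R -> X) : continuous F -> exists h, is_lift (I01 `*` I01) F h.
Proof.
move=> cF.
have rows (s0 a b : R) : exists2 e, 0 < e &
    exists h, is_lift (`[a, b]%classic `*` `[s0 - e, s0 + e]%classic) F h.
  apply: (@strip_induction (fun a b => exists2 e, 0 < e &
    exists h, is_lift (`[a, b]%classic `*` `[s0 - e, s0 + e]%classic) F h)).
  - move=> {a}a {b}b ba; exists 1 => //; exists (fun=> 1%g) => d [/= +] _.
    by rewrite in_itv /= => /andP[/le_trans h /h]; rewrite leNgt ba.
  - move=> c c' d' d cc' dd' [e e0 [h lh]]; exists e => //; exists h; apply: is_lift_sub lh.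
    by move=> [x y] /=; rewrite !in_itv /= => -[/andP[x1 x2] ?]; split=> //; lra.
  - move=> x y w xy yw [e1 e10 [h1 l1]] [e2 e20 [h2 l2]]; pose e := Num.min e1 e2.
    have e0 : 0 < e by rewrite lt_min e10.
    have le1 : e <= e1 by rewrite ge_min lexx.
    have le2 : e <= e2 by rewrite ge_min lexx orbT.
    exists e => //.
    have l1' : is_lift (`[x, y]%classic `*` `[s0 - e, s0 + e]%classic) F h1.
      apply: is_lift_sub l1 => -[u v] /=; rewrite !in_itv /= => -[? /andP[v1 v2]]; split=> //; lra.
    have l2' : is_lift (`[y, w]%classic `*` `[s0 - e, s0 + e]%classic) F h2.
      apply: is_lift_sub l2 => -[u v] /=; rewrite !in_itv /= => -[? /andP[v1 v2]]; split=> //; lra.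
    have E : (`[x, y]%classic `*` `[s0 - e, s0 + e]%classic) `&` (`[y, w]%classic `*` `[s0 - e, s0 + e]%classic)
        = [set y] `*` `[s0 - e, s0 + e]%classic.
      apply/seteqP; split=> -[u v] /=; rewrite !in_itv /=.
        by move=> [[/andP[u1 u2] hv] [/andP[u3 u4] _]]; split=> //; apply/le_anti; rewrite u2.
      by move=> [-> hv]; rewrite lexx xy yw.
    have [||h [lh _ _]] := @is_lift_glue _ _ _ _ _ _ (y, s0) (@rect_closed x y _ _) (@rect_closed y w _ _) _ _ l1' l2'.
    + by rewrite E; exact: fiber_connected.
    + by rewrite E; split=> //=; rewrite in_itv /=; lra.
    exists h; apply: is_lift_sub lh => -[u v] /=; rewrite !in_itv /= => -[/andP[u1 u2] hv].
    by case: (leP u y) => h3; [left|right]; rewrite ?u1 ?u2 ?andbT//= (ltW h3).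
  - move=> t; have [g sg] := star_cover V (F (t, s0)).
    have [e /= e0 he] := (nbhs_ballP _ _).1 (cF (t, s0) _ (star_nbhs A0 B0 sg)).
    have e2 : 0 < e / 2 by rewrite divr_gt0.
    exists (e / 2) => //; exists (e / 2) => //.
    exists (fun d => (pos (val (F d)) g)^-1%g); apply: is_lift_star => // -[u v] /=.
    rewrite !in_itv /= => -[/andP[u1 u2] /andP[v1 v2]]; apply: he.
    by split; rewrite /ball /= ltr_norml; lra.
apply: (@strip_induction (fun a b : R => exists h, is_lift (I01 `*` `[a, b]%classic) F h)).
- move=> a b ba; exists (fun=> 1%g) => d [/= _].
  by rewrite in_itv /= => /andP[/le_trans h /h]; rewrite leNgt ba.
- move=> c c' d' d cc' dd' [h lh]; exists h; apply: is_lift_sub lh.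
  by move=> [x y] /=; rewrite !in_itv /= => -[? /andP[x1 x2]]; split=> //; lra.
- move=> x y w xy yw [h1 l1] [h2 l2].
  have E : (I01 `*` `[x, y]%classic) `&` (I01 `*` `[y, w]%classic) = I01 `*` [set y].
    apply/seteqP; split=> -[u v] /=; rewrite !in_itv /=.
      by move=> [[hv /andP[u1 u2]] [_ /andP[u3 u4]]]; split=> //; apply/le_anti; rewrite u2.
    by move=> [hv ->]; rewrite lexx xy yw.
  have [||h [lh _ _]] := @is_lift_glue _ _ _ _ _ _ (0, y) (@rect_closed _ _ x y) (@rect_closed _ _ y w) _ _ l1 l2.
  + by rewrite E; exact: fiber_connected'.
  + by rewrite E; split=> //=; rewrite in_itv /= lexx ler01.
  exists h; apply: is_lift_sub lh => -[u v] /=; rewrite !in_itv /= => -[hv /andP[u1 u2]].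
  by case: (leP v y) => h3; [left|right]; rewrite ?u1 ?u2 ?andbT//= (ltW h3).
- by move=> t; exact: rows.
Qed.

End Strips.

(** The endpoint label of a lift starting at 1. It is a relation, functional by [hol_uniq]. *)
Definition hol (alpha : R -> X) (c : G) := exists h,
  [/\ is_lift I01 (alpha \o @clamp R) h, h 0%R = 1 & h 1%R = c].

Let I0 : I01 0%R. Proof. by rewrite /= in_itv /= lexx ler01. Qed.
Let I1 : I01 1%R. Proof. by rewrite /= in_itv /= lexx ler01. Qed.

Lemma hol_uniq alpha c c' : hol alpha c -> hol alpha c' -> c = c'.
Proof.
move=> [h [lh h0 <-]] [h' [lh' h0' <-]].
by rewrite (is_lift_uniq (@segment_connected R 0 1) I0 lh lh' I1) h0 h0' invg1 !mul1g.
Qed.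

(** A lift over the whole square of the homotopy is constant along the two sides where the endpoints
    stay fixed, so the lifts along the other two sides end at the same label. *)
Lemma hol_homotopic alpha beta c : homotopic alpha beta -> hol alpha c -> hol beta c.
Proof.
move=> /homotopicE[F [cF F0 F1 Fa Fb]] [h [lh h0 h1]].
have [k' lk'] := square_lift cF.
pose k d := (k' (0, 0)%R)^-1 * k' d; have lk : is_lift (I01 `*` I01) F k := is_lift_mul _ lk'.
have k00 : k (0, 0)%R = 1 by rewrite /k mulVg.
have seg := @segment_connected R 0 1.
have line (phi : R -> R * R) d : continuous phi -> (forall s, I01 s -> (I01 `*` I01) (phi s)) ->
    is_lift I01 (F \o phi) d -> k (phi 1%R) = k (phi 0%R) * (d 0%R)^-1 * d 1%R.
  move=> cphi sphi ld.
  exact: (is_lift_uniq seg I0 ld (is_lift_comp cphi sphi lk) I1).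
have cl (s : R) : continuous (fun r : R => (r, s)) := pair_cont (@id_cont R) (@cst_cont R R s).
have cr (s : R) : continuous (fun r : R => (s, r)) := pair_cont (@cst_cont R R s) (@id_cont R).
have k01 : k (0, 1)%R = c.
  rewrite (line (fun s => (0, s)%R) h) ?k00 ?h0 ?h1 ?invg1 ?mul1g//.
  by apply: is_lift_eq lh => // s hs; rewrite /= F0.
have kcst s : I01 s -> (exists p : X, forall r, F (r, s) = p) -> k (1%R, s) = k (0%R, s).
  move=> hs [p Fp]; rewrite (line (fun r => (r, s)) (fun=> 1)) ?invg1 ?mulg1//.
  by apply: (is_lift_eq _ _ (@is_lift_cst _ I01 p 1)) => // r _; rewrite /= Fp.
have k11 : k (1, 1)%R = c by rewrite kcst// ?k01//; exists (alpha 1%R).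
have k10 : k (1, 0)%R = 1 by rewrite kcst// ?k00//; exists (alpha 0%R).
exists (k \o (fun s => (1%R, s))); split=> //.
have := @is_lift_comp _ _ (I01 `*` I01) I01 F k (fun s => (1%R, s)) (cr 1%R) _ lk.
by move=> /(_ (fun s hs => conj I1 hs)); apply: is_lift_eq => // s hs; rewrite /= F1.
Qed.

Lemma hol_cst (p : X) : hol (cst p) 1.
Proof. by exists (fun=> 1); split=> //; exact: is_lift_cst. Qed.

Lemma hol_cat alpha beta c d : alpha 1%R = beta 0%R -> hol alpha c -> hol beta d ->
  hol (path_cat alpha beta) (c * d).
Proof.
move=> e [h [lh h0 h1]] [k [lk k0 k1]]; pose f := path_cat alpha beta \o @clamp R.
have c2 (x : R) : continuous (fun s : R => 2 * s + x)%R := mul2_cont (d := x).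
have half : (2 * 2^-1 = 1 :> R)%R by rewrite mulfV.
have l1 : is_lift (`[0, 2^-1]%classic : set R)%R f (h \o (fun s => 2 * s + 0)%R).
  apply: (is_lift_eq _ _ (is_lift_comp (c2 0%R) _ lh)) => //; last first.
    by move=> s /=; rewrite !in_itv /=; lra.
  move=> s; rewrite /= in_itv /= => /andP[s0 s1].
  rewrite /f /= [in RHS]clamp_id /path_cat ?s1; last by rewrite /= in_itv /=; lra.
  by rewrite addr0 clamp_id//= in_itv /=; lra.
have l2 : is_lift (`[2^-1, 1]%classic : set R)%R f (k \o (fun s => 2 * s + -1)%R).
  apply: (is_lift_eq _ _ (is_lift_comp (c2 (-1)%R) _ lk)) => //; last first.
    by move=> s /=; rewrite !in_itv /=; lra.
  move=> s; rewrite /= in_itv /= => /andP[s0 s1].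
  rewrite /f /= [in RHS]clamp_id /path_cat; last by rewrite /= in_itv /=; lra.
  rewrite clamp_id; last by rewrite /= in_itv /=; lra.
  case: (leP s 2^-1%R) => // h3; have -> : s = 2^-1%R by apply/le_anti; rewrite h3.
  by rewrite half subrr e.
have E : (`[0, 2^-1]%classic `&` `[2^-1, 1]%classic = [set 2^-1] :> set R)%R.
  apply/seteqP; split=> s /=; rewrite !in_itv /=.
    by move=> [/andP[? s1] /andP[s2 ?]]; apply/le_anti; rewrite s1.
  by move=> ->; lra.
have cseg (a b : R) : closed (`[a, b]%classic : set R) by exact: interval_closed.
have [||w [lw w1 w2]] := @is_lift_glue R _ _ _ _ _ (2^-1 : R)%R (cseg _ _) (cseg _ _) _ _ l1 l2.
- by rewrite E; exact: connected1.
- by rewrite E.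
exists w; split.
- apply: is_lift_sub lw => s /=; rewrite !in_itv /= => /andP[s0 s1].
  by case: (leP s 2^-1%R) => h3; [left|right]; rewrite ?s0 ?s1//= (ltW h3).
- by rewrite w1 /= ?mulr0 ?addr0// in_itv /=; lra.
- rewrite w2 /=; last by rewrite in_itv /=; lra.
  rewrite half addr0 subrr h1 k0 invg1 mulg1 mulr1.
  by rewrite (_ : 2 - 1 = 1)%R ?k1//; lra.
Qed.

Lemma hol_edge alpha (e : edge G) (phi : R -> R) (v0 v1 : bool * bool) :
  val (alpha 0%R) = PVertex R G v0 -> val (alpha 1%R) = PVertex R G v1 ->
  (forall s, (0 < s < 1)%R -> val (alpha s) = PEdge e (phi s)) ->
  (* The components are exchanged because an element of V_4 lists the vertical flip first, while
     s_ij lists the horizontal coordinate first. The parameter 0 is a dummy, as [pos] depends only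
     on the cell. *)
  hol alpha ((pos (PEdge e 0%R) (v0.2, v0.1))^-1 * pos (PEdge e 0%R) (v1.2, v1.1)).
Proof.
move=> a0 a1 as'; set P0 := pos _ _; set P1 := pos _ (v1.2, _).
(* On the open edge the label refers to the corner of the edge, which is its end when the edge is
   run backwards; hence the lift may jump at the endpoints. *)
exists (fun s => if s == 0%R then 1 else if s == 1%R then P0^-1 * P1 else P0^-1).
rewrite eqxx oner_eq0 eqxx; split=> // s; rewrite /= in_itv /= => /andP[s0 s1].
have pe t g : pos (PEdge e t) g = pos (PEdge e 0%R) g by case: e {as' P0 P1}.
have ce t : corner (PEdge e t) = corner (PEdge e 0%R) by case: e {as' P0 P1 pe}.
have near_itv (a b : R) : (a < s < b)%R -> nbhs s (fun t => (a < t < b)%R).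
  move=> /andP[h1 h2]; by apply: filterS2 (lt_nbhsr h1) (lt_nbhsl h2) => t /= -> ->.
have vc (v : bool * bool) : corner (PVertex R G v) = (v.2, v.1) by case: v.
have [->|ns0] := eqVneq s 0%R; [|have [->|ns1] := eqVneq s 1%R].
- have n : nbhs (0%R : R) (fun t : R => (t < 1)%R) by exact: lt_nbhsl.
  apply: (nbhs_within n) => t; rewrite /= in_itv /= => /andP[t0 _] t1.
  rewrite clamp0 a0 clamp_id; last by rewrite /= in_itv /= t0 ltW.
  have [->|nt] := eqVneq t 0%R; first by rewrite a0 /= mul1g.
  rewrite (lt_eqF t1) as' ?t1 ?andbT ?lt_neqAle ?t0 ?andbT 1?eq_sym//.
  by rewrite pe vc mulVg.
- have n : nbhs (1%R : R) (fun t : R => (0 < t)%R) by exact: lt_nbhsr.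
  apply: (nbhs_within n) => t; rewrite /= in_itv /= => /andP[_ t1] t0.
  rewrite clamp1 a1 clamp_id; last by rewrite /= in_itv /= t1 ltW.
  have [->|nt] := eqVneq t 1%R; first by rewrite oner_eq0 a1 /= mulg1.
  rewrite (gt_eqF t0) as' ?t0 ?lt_neqAle ?t1 ?andbT//.
  by rewrite pe vc.
- have s01 : (0 < s < 1)%R by rewrite !lt_neqAle s0 s1 ns1 eq_sym ns0.
  apply: (nbhs_within (near_itv _ _ s01)) => t _ t01 /=; have /andP[t0 t1] := t01.
  rewrite (gt_eqF t0) (lt_eqF t1) !clamp_id /= ?in_itv /= ?ltW//; try by case/andP: s01.
  by rewrite !as'// pe ce pos_corner mulg1.
Qed.

(** A flip that reverses the edge also inverts its letter, so the holonomy is the same for all four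
    translates. *)
Lemma hol_lpath1 g l : lvalid A B l -> hol (act g \o @lpath1 R G A B l) l.2.
Proof.
move=> hl; have he := ledge_valid hl.
have E s : val ((act g \o @lpath1 R G A B l) s) =
    (if g.1 then @flip_v R G else id) ((if g.2 then @flip_h R G else id) (edge_chart (ledge l) (clamp s))).
  by rewrite /lpath1 /= to_realK//; exact: sc_edge_chart.
have Es s : (0 < s < 1)%R -> edge_chart (ledge l) (clamp s) = PEdge (ledge l) s.
  move=> /andP[s0 s1]; rewrite clamp_id /edge_chart ?leNgt ?s0 ?s1//.
  by rewrite /= in_itv /= !ltW.
have E0 : edge_chart (ledge l) (clamp (0%R : R)) = PVertex R G (false, false).
  by rewrite clamp0 /edge_chart lexx; case: l {hl he E Es} => [[] c].
have E1 : edge_chart (ledge l) (clamp (1%R : R)) = PVertex R G ((ltype l).2, (ltype l).1).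
  by rewrite clamp1 /edge_chart lexx leNgt ltr01; case: l {hl he E Es E0} => [[] c].
have E0' := E 0%R; rewrite E0 in E0'; have E1' := E 1%R; rewrite E1 in E1'.
have E' s : (0 < s < 1)%R -> val ((act g \o @lpath1 R G A B l) s) =
    (if g.1 then @flip_v R G else id) ((if g.2 then @flip_h R G else id) (PEdge (ledge l) s)).
  by move=> hs; rewrite E Es.
move: E0' E1' E'; case: l {hl he E Es E0 E1} => [k c]; move: (act g \o _) => alpha.
by case: g k => [[] []] [] /= E0 E1 E'; have := hol_edge E0 E1 E';
  rewrite /= ?invgK ?invg1 ?mulg1 ?mul1g.
Qed.

Definition weval (w : seq (bool * G)) : G := \prod_(l <- w) l.2.

Lemma hol_lpath g w : wvalid A B w -> hol (act g \o lpath V w) (weval w).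
Proof.
elim: w g => [|l w IH] g /=.
  by move=> _; rewrite /weval big_nil; exact: (@hol_cst (act g s00)).
move=> [hl hw]; rewrite path_cat_map /weval big_cons; apply: hol_cat; last 1 first.
- have -> : act g \o (act (ltype l) \o lpath V w) = act (g * ltype l) \o lpath V w.
    by apply/funext => s; rewrite /= -V4_actM.
  exact: IH.
- have [_ _ e1] := @lpath1_path R G A B H V l hl; have [_ e0 _] := @lpath_path R G A B H V A0 B0 w hw.
  by change (act g (lpath1 A B l 1%R) = act g (act (ltype l) (lpath V w 0%R))); rewrite e1 e0.
- exact: hol_lpath1.
Qed.

Lemma hol_edge_path alpha w : wvalid A B w -> homotopic alpha (lpath V w) -> hol alpha (weval w).
Proof.
move=> hw hom; apply: (hol_homotopic (homotopic_sym hom)).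
rewrite (_ : lpath V w = act 1 \o lpath V w); first exact: hol_lpath.
by apply/funext => s; rewrite /= V4_act1.
Qed.

End Holonomy.

(** * Words and the orbispace fundamental group *)

Section Words.
Variables (G : groupType) (A B H : set G) (V : V4_structure H A B).
Local Open Scope group_scope.
Local Notation word := (seq (bool * G)).
Implicit Types (w : word) (la lb : seq G).
Local Notation lvalid := (lvalid A B).
Local Notation wvalid := (wvalid A B).

(** Combinatorial homotopy of edge paths: free cancellation and pushing across a square. It turns
    out to coincide, on valid words, both with equality of values in the group ([weq_of_eval]) and
    with homotopy of paths. *)
Inductive weq : word -> word -> Prop :=
| WRefl w : weq w w
| WSym w w' : weq w w' -> weq w' w
| WTrans w w' w'' : weq w w' -> weq w' w'' -> weq w w''
| WCancel k c : lvalid (k, c) -> weq [:: (k, c); (k, c^-1)] [::]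
| WSquare a b' b a' : sc_squares A B (Sq a b' b a') ->
    weq [:: (true, a); (false, b')] [:: (false, b); (true, a')]
| WCat u u' v v' : weq u u' -> weq v v' -> weq (u ++ v) (u' ++ v').

Lemma lvalid_inv k c : lvalid (k, c) -> lvalid (k, c^-1).
Proof. by case: k; [exact: (V4_invl V)|exact: (V4_invr V)]. Qed.

Lemma weq_valid w w' : weq w w' -> wvalid w <-> wvalid w'.
Proof.
elim=> {w w'} [//|w w' _ IH|w w' w'' _ -> _ //|k c h|a b' b a' [ha ha' hb hb' _]|u u' v v' _ h1 _ h2].
- by split=> /IH.
- by split=> // _; split=> //; split=> //; exact: lvalid_inv.
- by split.
- by split=> /wvalid_cat[/h1 h3 /h2 h4]; apply/wvalid_cat.
Qed.

Lemma weq_type w w' : weq w w' -> wtype w = wtype w'.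
Proof.
elim=> {w w'} // [w w' w'' _ -> _ -> //|k c h|u u' v v' _ h1 _ h2].
- by case: k {h}.
- by rewrite !wtype_cat h1 h2.
Qed.

Lemma weval_cat w w' : weval (w ++ w') = weval w * weval w'.
Proof. by rewrite /weval big_cat. Qed.

Lemma weq_eval w w' : weq w w' -> weval w = weval w'.
Proof.
elim=> {w w'} // [w w' w'' _ -> _ -> //|k c h|a b' b a' [_ _ _ _ e]|u u' v v' _ h1 _ h2].
- by rewrite /weval !big_cons big_nil mulg1 mulgV.
- by rewrite /weval !big_cons big_nil !mulg1.
- by rewrite !weval_cat h1 h2.
Qed.

Definition vword la : word := [seq (true, a) | a <- la].
Definition hword lb : word := [seq (false, b) | b <- lb].
Definition reduced la := sorted (fun x y => y != x^-1) la.
Definition all_in (S : set G) la := forall x, x \in la -> S x.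

Lemma all_in_cons (S : set G) x la : all_in S (x :: la) <-> S x /\ all_in S la.
Proof.
split=> [h|[h1 h2] y]; first by split=> [|y hy]; apply: h; rewrite inE ?eqxx// hy orbT.
by rewrite inE => /orP[/eqP->|/h2].
Qed.

Lemma weq_cons l w w' : weq w w' -> weq (l :: w) (l :: w').
Proof. by move=> h; exact: (WCat (WRefl [:: l]) h). Qed.

Lemma weq_swap b la : B b -> all_in A la -> exists la' b',
  [/\ all_in A la', B b' & weq ((false, b) :: vword la) (vword la' ++ [:: (false, b')])].
Proof.
elim: la b => [|a la IH] b hb hla; first by exists [::], b; split=> //; exact: WRefl.
have [ha {}hla] := (all_in_cons _ _ _).1 hla.
have [a1 [b1 [ha1 hb1 e]]] := V4_bottom_top V hb ha.
have [la' [b' [hla' hb' h]]] := IH b1 hb1 hla.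
exists (a1 :: la'), b'; split=> //; first exact/all_in_cons.
have h1 : weq [:: (false, b); (true, a)] [:: (true, a1); (false, b1)] by apply/WSym/WSquare.
exact: (WTrans (WCat h1 (WRefl (vword la))) (weq_cons _ h)).
Qed.

Lemma weq_factor w : wvalid w -> exists la lb,
  [/\ all_in A la, all_in B lb & weq w (vword la ++ hword lb)].
Proof.
elim: w => [_|[k c] w IH [hc /IH[la [lb [hla hlb h]]]]].
  by exists [::], [::]; split=> //; exact: WRefl.
case: k hc => hc.
  by exists (c :: la), lb; split=> //; [exact/all_in_cons|exact: weq_cons].
have [la' [b' [hla' hb' h']]] := weq_swap hc hla.
exists la', (b' :: lb); split=> //; first exact/all_in_cons.
apply: WTrans (weq_cons _ h) _.
have := WCat h' (WRefl (hword lb)); by rewrite -catA.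
Qed.

Lemma weq_reduce k (S : set G) la : (forall c, S c -> lvalid (k, c)) -> all_in S la ->
  exists la', [/\ all_in S la', reduced la' &
    weq [seq (k, a) | a <- la] [seq (k, a) | a <- la']].
Proof.
move=> SV; elim: la => [|a la IH] hla; first by exists [::]; split=> //; exact: WRefl.
have [ha {}hla] := (all_in_cons _ _ _).1 hla.
have [[|x r] [hr rr h]] := IH hla.
  by exists [:: a]; split=> //; [exact/all_in_cons|exact: weq_cons].
have [xa|xa] := eqVneq x a^-1; last first.
  exists (a :: x :: r); split; [exact/all_in_cons|by rewrite /reduced /= xa|exact: weq_cons].
exists r; split.
- by have [] := (all_in_cons _ _ _).1 hr.
- exact: path_sorted rr.
- apply: WTrans (weq_cons _ h) _ => /=; rewrite xa.
  by have := WCat (WCancel (SV _ ha)) (WRefl [seq (k, a0) | a0 <- r]).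
Qed.

(** Squares move the letters of A to the left past those of B, and each of the two halves is then
    freely reduced. *)
Theorem weq_normal w : wvalid w -> exists la lb, [/\ all_in A la, all_in B lb,
  reduced la, reduced lb & weq w (vword la ++ hword lb)].
Proof.
move=> /weq_factor[la [lb [hla hlb h]]].
have [la' [hla' rla' h1]] := @weq_reduce true A la (fun c h => h) hla.
have [lb' [hlb' rlb' h2]] := @weq_reduce false B lb (fun c h => h) hlb.
by exists la', lb'; split=> //; exact: (WTrans h (WCat h1 h2)).
Qed.

Definition winv w : word := rev [seq (l.1, l.2^-1) | l <- w].

Lemma winv_cons l w : winv (l :: w) = winv w ++ [:: (l.1, l.2^-1)].
Proof. by rewrite /winv /= rev_cons -cats1. Qed.

Lemma winv_valid w : wvalid w -> wvalid (winv w).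
Proof.
elim: w => [//|[k c] w IH [hc hw]]; rewrite winv_cons; apply/wvalid_cat.
by split; [exact: IH|split=> //; exact: lvalid_inv].
Qed.

Lemma winv_eval w : weval (winv w) = (weval w)^-1.
Proof.
elim: w => [|l w IH]; first by rewrite /weval big_nil invg1.
by rewrite winv_cons weval_cat IH /weval !big_cons big_nil mulg1 invgM.
Qed.

Lemma weq_winv w : wvalid w -> weq (winv w ++ w) [::].
Proof.
elim: w => [_|[k c] w IH [hc hw]]; first exact: WRefl.
rewrite winv_cons -catA /=.
have h := WCat (WCancel (lvalid_inv hc)) (WRefl w); rewrite invgK in h.
exact: (WTrans (WCat (WRefl (winv w)) h) (IH hw)).
Qed.

(** The only input from the trees: the identity has no nontrivial normal form. It makes the squares
    and cancellations defining relations. *)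
Hypothesis reduced_eval1 : forall la lb, all_in A la -> all_in B lb -> reduced la -> reduced lb ->
  weval (vword la) * weval (hword lb) = 1 -> la = [::] /\ lb = [::].

Lemma weq_eval1 w : wvalid w -> weval w = 1 -> weq w [::].
Proof.
move=> /weq_normal[la [lb [hla hlb rla rlb h]]] e.
have [e1 e2] : la = [::] /\ lb = [::].
  by apply: reduced_eval1 => //; rewrite -weval_cat -(weq_eval h).
by rewrite e1 e2 in h.
Qed.

Lemma weq_of_eval w w' : wvalid w -> wvalid w' -> weval w = weval w' -> weq w w'.
Proof.
move=> hw hw' e.
have h1 : weq w (w ++ winv w' ++ w').
  by apply: WSym; have := WCat (WRefl w) (weq_winv hw'); rewrite cats0.
apply: (WTrans h1); rewrite catA.
have h2 : weq (w ++ winv w') [::].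
  by apply: weq_eval1; [apply/wvalid_cat; split=> //; exact: winv_valid|rewrite weval_cat winv_eval e mulgV].
exact: (WCat h2 (WRefl w')).
Qed.

Lemma generated_words : H = [set weval w | w in wvalid].
Proof.
rewrite -(V4_gen V); apply/seteqP; split=> [x|_ [w hw <-]].
  apply; split; first split.
  - by exists [::] => //; rewrite /weval big_nil.
  - by move=> _ _ [w hw <-] [w' hw' <-]; exists (w ++ w'); [exact/wvalid_cat|rewrite weval_cat].
  - by move=> _ [w hw <-]; exists (winv w); [exact: winv_valid|rewrite winv_eval].
  - by move=> c [hc|hc]; [exists [:: (true, c)]|exists [:: (false, c)]] => //=;
      rewrite /weval big_cons big_nil mulg1.
move=> S [[S1 SM _] sS]; elim: w hw => [_|[k c] w IH [hc hw]].
  by rewrite /weval big_nil.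
rewrite /weval big_cons; apply: SM; last exact: IH.
by apply: sS; case: k hc; [left|right].
Qed.

Lemma in_words x : H x <-> exists2 w, wvalid w & weval w = x.
Proof. by rewrite generated_words. Qed.

(** * Identification of the group with the orbispace fundamental group *)

Section OrbispaceGroup.
Variable R : realType.
Hypotheses (A0 : A !=set0) (B0 : B !=set0).
Local Notation X := (realization R A B).
Local Notation act := (V4_act R V).
Local Notation s00 := (base_vertex R A B).
Local Notation I01 := (`[0%R, 1%R]%classic : set R).
Local Notation lpath := (@lpath R G A B H V).
Local Notation to_real := (@to_real R G A B).
Local Notation letter_path := (@lpath1 R G A B).

Let lp w (hw : wvalid w) : is_path (lpath w) s00 (act (wtype w) s00) := lpath_path R V A0 B0 hw.
Let ac g : continuous (act g). Proof. exact: V4_act_continuous. Qed.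

Let lpath1_act g l s : lvalid l -> I01 s -> val (act g (letter_path l s)) =
  (if g.1 then @flip_v R G else id) ((if g.2 then @flip_h R G else id) (edge_chart (ledge l) s)).
Proof.
move=> hl hs; rewrite /lpath1 clamp_id//= to_realK//.
by apply: sc_edge_chart; exact: ledge_valid.
Qed.

Let edge_flip_v (c : G) (s : R) : (0 <= s <= 1)%R ->
  flip_v (edge_chart (VEdge c^-1 false) s) = edge_chart (VEdge c false) (1 - s)%R.
Proof.
move=> /andP[s0 s1]; rewrite /edge_chart.
case: (leP s 0%R) => h1; case: (leP (1 - s)%R 0%R) => h2; case: (leP 1%R s) => h3;
  case: (leP 1%R (1 - s)%R) => h4; rewrite /= ?invgK //; exfalso; lra.
Qed.

Let edge_flip_h (c : G) (s : R) : (0 <= s <= 1)%R ->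
  flip_h (edge_chart (HEdge c^-1 false) s) = edge_chart (HEdge c false) (1 - s)%R.
Proof.
move=> /andP[s0 s1]; rewrite /edge_chart.
case: (leP s 0%R) => h1; case: (leP (1 - s)%R 0%R) => h2; case: (leP 1%R s) => h3;
  case: (leP 1%R (1 - s)%R) => h4; rewrite /= ?invgK //; exfalso; lra.
Qed.

(** The path of c^-1, translated by the type of c, is the edge of c run backwards. *)
Lemma lpath_cancel k c : lvalid (k, c) -> homotopic (lpath [:: (k, c); (k, c^-1)]) (cst s00).
Proof.
move=> hc; have hV := lvalid_inv hc.
have p1 := lpath1_path R V hc; have p2 := lp (conj hV I : wvalid [:: (k, c^-1)]).
apply: (homotopic_trans _ (path_cat_rev p1)).
apply: path_cat_homotopic; last 1 first.
- apply: homotopic_trans (homotopic_map (@ac _) (lpath1E R V hV)) _.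
  have p3 := is_path_map (@ac (ltype (k, c))) (lpath1_path R V hV).
  apply: (eq_homotopic p3) => s hs; apply: val_inj.
  have hs' : I01 (1 - s)%R by move: hs; rewrite /= !in_itv /=; lra.
  have /andP hs2 : (0 <= s <= 1)%R by move: hs; rewrite /= in_itv.
  have E := lpath1_act 1 hc hs'; rewrite V4_act1 in E.
  rewrite [LHS](lpath1_act _ hV hs) /path_rev [RHS]E.
  by case: k {hc hV p1 p2 p3 E} => /=; [rewrite edge_flip_v|rewrite edge_flip_h] => //; apply/andP.
- have [_ _ ->] := p1; by have [_ <- _] := is_path_map (@ac (ltype (k, c))) p2.
- exact: homotopic_refl p1.
Qed.

Let chart_top (a b' b a' : G) (s : R) : (0 <= s <= 1)%R ->
  square_chart (Sq a b' b a') (s, 1%R) = edge_chart (HEdge b' true) s.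
Proof.
move=> _; rewrite /= /edge_chart ler10 lexx.
by case: (s <= 0)%R => //; case: (1 <= s)%R.
Qed.

Let chart_right (a b' b a' : G) (s : R) :
  square_chart (Sq a b' b a') (1%R, s) = edge_chart (VEdge a' true) s.
Proof. by rewrite /= ler10 lexx. Qed.

Let flip_v_edge (b : G) (s : R) : flip_v (edge_chart (HEdge b false) s) = edge_chart (HEdge b true) s.
Proof. by rewrite /edge_chart; case: ifP => // _; case: ifP. Qed.
Let flip_h_edge (a : G) (s : R) : flip_h (edge_chart (VEdge a false) s) = edge_chart (VEdge a true) s.
Proof. by rewrite /edge_chart; case: ifP => // _; case: ifP. Qed.

(** Left side then top, and bottom then right side, have the same endpoints in the convex parameter
    square. *)
Lemma lpath_square a b' b a' : sc_squares A B (Sq a b' b a') ->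
  homotopic (lpath [:: (true, a); (false, b')]) (lpath [:: (false, b); (true, a')]).
Proof.
move=> hq; have [ha ha' hb hb' e] := hq.
have v1 : lvalid (true, a) := ha. have v2 : lvalid (false, b') := hb'.
have v3 : lvalid (false, b) := hb. have v4 : lvalid (true, a') := ha'.
have two l l' : lvalid l -> lvalid l' ->
    homotopic (lpath [:: l; l']) (path_cat (letter_path l) (act (ltype l) \o letter_path l')).
  move=> hl hl'; have p1 := lpath1_path R V hl.
  have p2 := lp (conj hl' I : wvalid [:: l']).
  have h := homotopic_map (@ac (ltype l)) (lpath1E R V hl').
  apply: path_cat_homotopic; last exact: h.
    have [_ _ ->] := p1; by have [_ <- _] := is_path_map (@ac (ltype l)) p2.
  exact: homotopic_refl p1.
apply: (homotopic_trans (two _ _ v1 v2)).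
apply: homotopic_trans (homotopic_sym (two _ _ v3 v4)).
have cF := to_real_continuous (R := R) hq.
have c1 := min_cont (@cst_cont R R 1%R) (@mul2_cont R 2%R 0%R).
have c2 := max_cont (@cst_cont R R 0%R) (@mul2_cont R 2%R (-1)%R).
have to_realE (x : X) p : val x = p -> x = to_real p by move=> <-; rewrite valK'.
have m1 (s : R) : (s <= 2^-1 -> Num.min 1 (2 * s + 0) = 2 * s)%R.
  by move=> h; rewrite addr0; apply/min_idPr; lra.
have m2 (s : R) : (2^-1 < s -> Num.min 1 (2 * s + 0) = 1)%R by move=> h; apply/min_idPl; lra.
have m3 (s : R) : (s <= 2^-1 -> Num.max 0 (2 * s + -1) = 0)%R by move=> h; apply/max_idPl; lra.
have m4 (s : R) : (2^-1 < s -> Num.max 0 (2 * s + -1) = 2 * s - 1)%R by move=> h; apply/max_idPr; lra.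
have i01 s : I01 s -> (0 <= s)%R /\ (s <= 1)%R by rewrite /= in_itv /= => /andP.
have i01' s : (0 <= s <= 1)%R -> I01 s by rewrite /= in_itv.
have L1 g l s : lvalid l -> I01 s -> act g (letter_path l s) = to_real
    ((if g.1 then @flip_v R G else id) ((if g.2 then @flip_h R G else id) (edge_chart (ledge l) s))).
  by move=> hl hs; apply: to_realE; exact: lpath1_act.
have L0 l s : lvalid l -> I01 s -> letter_path l s = to_real (edge_chart (ledge l) s).
  by move=> hl hs; have := L1 1 l s hl hs; rewrite V4_act1.
have cl2 (x y : R) : (0 <= x <= 1)%R -> (0 <= y <= 1)%R -> clamp2 (x, y) = (x, y).
  by move=> hx hy; rewrite clamp2_id//; split; rewrite /= in_itv.
apply: (homotopic_reparam cF (pair_cont c2 c1) (pair_cont c1 c2)).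
- by rewrite mulr0 !add0r (min_idPr _) ?(max_idPl _)//; lra.
- by rewrite mulr1 (min_idPl _) ?(max_idPr _); [congr (_, _); lra|lra|lra].
- move=> s hs; have [s0 s1] := i01 _ hs.
  suff -> : path_cat (letter_path (true, a)) (act (ltype (true, a)) \o letter_path (false, b')) s =
    to_real (square_chart (Sq a b' b a') (clamp2 (Num.max 0 (2 * s + -1), Num.min 1 (2 * s + 0))%R)) by [].
  rewrite /path_cat; have [h|h] := leP s 2^-1%R.
    rewrite m1// m3// L0//; last by apply: i01'; lra.
    by rewrite cl2 ?lexx ?ler01//; [rewrite /= lexx|lra].
  rewrite m2// m4// [LHS]L1//; last by apply: i01'; lra.
  rewrite cl2 ?lexx ?ler01//; last by lra.
  rewrite chart_top; last by lra.
  by congr to_real; exact: flip_v_edge.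
- move=> s hs; have [s0 s1] := i01 _ hs.
  suff -> : path_cat (letter_path (false, b)) (act (ltype (false, b)) \o letter_path (true, a')) s =
    to_real (square_chart (Sq a b' b a') (clamp2 (Num.min 1 (2 * s + 0), Num.max 0 (2 * s + -1))%R)) by [].
  rewrite /path_cat; have [h|h] := leP s 2^-1%R.
    rewrite m1// m3// L0//; last by apply: i01'; lra.
    rewrite cl2 ?lexx ?ler01//; last by lra.
    have hs2 : clamp (2 * s)%R = (2 * s)%R :> R by apply/clamp_id/i01'; lra.
    by have := square_chart_bottom (Sq a b' b a') (2 * s)%R; rewrite hs2 => ->.
  rewrite m2// m4// [LHS]L1//; last by apply: i01'; lra.
  rewrite cl2 ?lexx ?ler01//; last by lra.
  by rewrite chart_right; congr to_real; exact: flip_h_edge.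
Qed.

Lemma weq_homotopic w w' : weq w w' -> wvalid w -> homotopic (lpath w) (lpath w').
Proof.
elim=> {w w'} [w hw|w w' h IH hw|w w' w'' h1 IH1 h2 IH2 hw|k c h _|a b' b a' hq _|u u' v v' h1 IH1 h2 IH2 huv].
- exact: homotopic_refl (lp hw).
- by apply/homotopic_sym/IH/(weq_valid h).
- by apply: homotopic_trans (IH1 hw) (IH2 _); apply/(weq_valid h1).
- exact: lpath_cancel.
- exact: lpath_square.
- have [hu hv] := (wvalid_cat _ _ _ _).1 huv.
  have hu' := (weq_valid h1).1 hu; have hv' := (weq_valid h2).1 hv.
  apply: homotopic_trans (lpath_cat R V A0 B0 hu hv) _.
  apply: homotopic_trans (homotopic_sym (lpath_cat R V A0 B0 hu' hv')).
  rewrite -(weq_type h1); apply: path_cat_homotopic.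
  + have [_ _ ->] := lp hu; by have [_ -> _] := is_path_map (@ac (wtype u)) (lp hv).
  + exact: IH1.
  + exact/homotopic_map/IH2.
Qed.

(** Uses an arbitrary word for x; [orb_mapE] shows independence of the choice. The value outside H
    is junk. *)
Definition orb_map (x : G) : set (R -> X) * V4 :=
  if pselect (exists2 w, wvalid w & weval w = x) is left e
  then (homotopy_class (lpath (s2val (cid2 e))), wtype (s2val (cid2 e))) else (set0, 1).

Lemma orb_mapE w : wvalid w -> orb_map (weval w) = (homotopy_class (lpath w), wtype w).
Proof.
move=> hw; rewrite /orb_map; case: pselect => [e|]; last by case; exists w.
case: cid2 => w' hw' /= e'; have h := weq_of_eval hw' hw e'.
by rewrite (weq_type h); congr (_, _); apply/(homotopy_class_eq _ (lp hw'))/weq_homotopic.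
Qed.

Lemma class_mul g (alpha beta : R -> X) p q : is_path alpha s00 p -> is_path beta s00 q ->
  p = act g s00 ->
  homotopy_class (path_cat alpha (act g \o beta)) = [set gamma | exists alpha' beta',
    [/\ homotopy_class alpha alpha', homotopy_class beta beta' &
        homotopic (path_cat alpha' (act g \o beta')) gamma]].
Proof.
move=> ha hb pE; apply/seteqP; split=> gamma /=.
  by move=> h; exists alpha, beta; split=> //; [exact: homotopic_refl ha|exact: homotopic_refl hb].
move=> [alpha' [beta' [h1 h2 h3]]]; apply: homotopic_trans h3.
apply: path_cat_homotopic => //; last exact: homotopic_map.
by have [_ _ ->] := ha; have [_ -> _] := is_path_map (@ac g) hb.
Qed.

Lemma orb_mapM x y : H x -> H y -> orb_map (x * y) = pi1_orb_mul R act (orb_map x) (orb_map y).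
Proof.
move=> /in_words[w hw <-] /in_words[w' hw' <-].
rewrite -weval_cat !orb_mapE//; last exact/wvalid_cat.
rewrite /pi1_orb_mul /= wtype_cat; congr (_, _).
rewrite -(class_mul (lp hw) (lp hw') erefl).
have hc : wvalid (w ++ w') by apply/wvalid_cat.
by apply/(homotopy_class_eq _ (lp hc))/lpath_cat.
Qed.

(** Injectivity is the homotopy invariance of the holonomy, which recovers the value of a word;
    surjectivity is the approximation by edge paths. *)
Lemma orb_map_bij : set_bij H (pi1_orb R act s00) orb_map.
Proof.
split=> [x|x y|[c g] [alpha ha /= ->]].
- move=> /in_words[w hw <-]; rewrite orb_mapE//.
  by exists (lpath w) => //; exact: lp.
- rewrite !in_setE => /in_words[w hw <-] /in_words[w' hw' <-]; rewrite !orb_mapE// => -[e _].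
  have h := (homotopy_class_eq _ (lp hw)).1 e.
  have h' := hol_edge_path A0 B0 hw (homotopic_refl (lp hw)).
  exact: hol_uniq h' (hol_edge_path A0 B0 hw' h).
- have [w [hw tw hom]] := edge_path_approx A0 B0 ha.
  exists (weval w); first by apply/in_words; exists w.
  by rewrite orb_mapE// tw; congr (_, _); apply/esym/(homotopy_class_eq _ ha).
Qed.

Theorem orb_map_isomorphic : isomorphic H (fun x y => x * y)
  (pi1_orb R act s00) (pi1_orb_mul R act).
Proof. by exists orb_map; [exact: orb_map_bij|exact: orb_mapM]. Qed.

Definition type_of x : V4 := (orb_map x).2.
Definition type_kernel : set G := [set x | H x /\ type_of x = 1].

Lemma type_ofE w : wvalid w -> type_of (weval w) = wtype w.
Proof. by move=> hw; rewrite /type_of orb_mapE. Qed.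

Lemma type_ofM x y : H x -> H y -> type_of (x * y) = type_of x * type_of y.
Proof. by move=> hx hy; rewrite /type_of orb_mapM. Qed.

Lemma V4_subgroup : subgroup H.
Proof.
rewrite generated_words; split.
- by exists [::] => //; rewrite /weval big_nil.
- by move=> _ _ [w hw <-] [w' hw' <-]; exists (w ++ w'); [exact/wvalid_cat|rewrite weval_cat].
- by move=> _ [w hw <-]; exists (winv w); [exact: winv_valid|rewrite winv_eval].
Qed.

Lemma type_of1 : type_of 1 = 1.
Proof. by have := type_ofE (w := [::]) I; rewrite /weval big_nil. Qed.

Lemma type_ofV x : H x -> type_of x^-1 = type_of x.
Proof.
have [_ _ HV] := V4_subgroup; move=> hx.
have := type_ofM hx (HV _ hx); rewrite mulgV type_of1 => e.
by rewrite -[RHS]mulg1 e mulgA V4_mulg2 mul1g.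
Qed.

Lemma type_kernel_normal : normal_subgroup type_kernel H.
Proof.
have [H1 HM HV] := V4_subgroup.
split; [split| |].
- by split=> //; exact: type_of1.
- by move=> x y [hx tx] [hy ty]; split; [exact: HM|rewrite type_ofM// tx ty].
- by move=> x [hx tx]; split; [exact: HV|rewrite type_ofV].
- by move=> x [].
- move=> x n hx [hn tn]; split; first by apply: (HM); [exact: HM|exact: HV].
  rewrite !type_ofM ?type_ofV//; try exact: HV; try exact: HM.
  by rewrite tn mulg1 V4_mulg2.
Qed.

(** Trivial type means a pair [alpha; 1], whose path is a loop at s_00, and on such pairs the
    twisted product is the usual concatenation. *)
Theorem type_kernel_isomorphic :
  isomorphic type_kernel (fun x y => x * y) (pi1 R s00) (pi1_mul R).
Proof.
have [bf bi bs] := orb_map_bij.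
have orb1 x : type_kernel x -> orb_map x = ((orb_map x).1, 1).
  by move=> [_]; rewrite /type_of; case: (orb_map x) => c g /= ->.
exists (fun x => (orb_map x).1); last first.
  move=> x y hx hy; rewrite orb_mapM; [|by case: hx|by case: hy].
  rewrite (orb1 x hx) /=; congr mkset; apply/funext => gamma.
  have E (beta : R -> X) : act 1 \o beta = beta by apply/funext => s /=; exact: V4_act1.
  by apply/propext; split=> -[a [b [h1 h2 h3]]]; exists a, b; split=> //; rewrite E in h3 *.
split=> [x hx|x y|c [alpha ha ->]].
- have /bf[alpha ha e] : H x by case: hx.
  exists alpha; last exact: e.
  by move: ha; rewrite (orb1 x hx) /= V4_act1.
- rewrite !in_setE => hx hy e; apply: bi; rewrite ?in_setE; [by case: hx|by case: hy|].
  by rewrite (orb1 x hx) (orb1 y hy) e.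
- have [x hx e] : (orb_map @` H) (homotopy_class alpha, 1).
    by apply: bs; exists alpha => //=; rewrite V4_act1.
  by exists x; [split=> //; rewrite /type_of e|rewrite e].
Qed.

Theorem type_cosets_isomorphic :
  isomorphic (lcosets type_kernel H) (@prod_set _) [set: V4] (fun x y => x * y).
Proof.
have [H1 HM HV] := V4_subgroup; have [[N1 NM NV] NH _] := type_kernel_normal.
(* The type is constant on a coset, so any chosen element of the coset gives it; the empty set
   receives the junk value 1. *)
pose F (C : set G) : V4 := if pselect (C !=set0) is left e then type_of (projT1 (cid e)) else 1.
have FE C x : C x -> (forall y, C y -> type_of y = type_of x) -> F C = type_of x.
  move=> Cx hC; rewrite /F; case: pselect => [e|[]]; last by exists x.
  by case: cid => y /= /hC.
have cosetT x y : H x -> prod_set [set x] type_kernel y -> H y /\ type_of y = type_of x.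
  move=> hx [_ -> [n [hn tn] <-]]; split; first exact: HM.
  by rewrite type_ofM// tn mulg1.
have coset1 x : prod_set [set x] type_kernel x by exists x => //; exists 1; rewrite ?mulg1.
have Fcoset x : H x -> F (prod_set [set x] type_kernel) = type_of x.
  by move=> hx; apply: FE => // y /(cosetT _ _ hx)[].
exists F.
- split=> // [C D|g _].
    rewrite !in_setE => -[x hx <-] [y hy <-]; rewrite !Fcoset// => e.
    have sub u v : H u -> H v -> type_of u = type_of v ->
        prod_set [set u] type_kernel `<=` prod_set [set v] type_kernel.
      move=> hu hv e' _ [_ -> [n hn <-]]; exists v => //; exists (v^-1 * u * n); last first.
        by rewrite !mulgA mulgV mul1g.
      apply: (NM) => //; split; first by apply: (HM) => //; exact: HV.
      by rewrite type_ofM// ?type_ofV// ?e' ?V4_mulg2//; exact: HV.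
    by apply/seteqP; split; apply: sub.
  have [a ha] := A0; have [b hb] := B0.
  have ex w : wvalid w -> wtype w = g -> [set: V4] (F (prod_set [set weval w] type_kernel)) ->
     exists2 C, lcosets type_kernel H C & F C = g.
    move=> hw tw _; have hx : H (weval w) by apply/in_words; exists w.
    by exists (prod_set [set weval w] type_kernel); [exists (weval w)|rewrite Fcoset// type_ofE].
  case: g ex => [[] []] ex.
  + exact: (ex [:: (true, a); (false, b)]).
  + exact: (ex [:: (true, a)]).
  + exact: (ex [:: (false, b)]).
  + exact: (ex [::]).
- move=> C D [x hx <-] [y hy <-]; rewrite !Fcoset// -type_ofM//.
  apply: FE; first by exists x => //; exists y.
  by move=> _ [u /(cosetT _ _ hx)[hu tu] [v /(cosetT _ _ hy)[hv tv] <-]]; rewrite !type_ofM// tu tv.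
Qed.

End OrbispaceGroup.

End Words.

(** * Laurent series *)

Section PowerSeriesUnits.
Variable F : fieldType.
Implicit Types f g h : powser F.

Lemma powserD f g n : (f + g) n = f n + g n. Proof. by []. Qed.
Lemma powserN f n : (- f) n = - f n. Proof. by []. Qed.
Lemma powserM f g n : (f * g) n = \sum_(i < n.+1) f i * g (n - i)%N. Proof. by []. Qed.

Lemma powser_sum (I : Type) (r : seq I) (P : pred I) (f_ : I -> powser F) n :
  (\sum_(i <- r | P i) f_ i) n = \sum_(i <- r | P i) f_ i n.
Proof. by elim/big_rec2: _ => // i x y _ <-. Qed.

Lemma powserXM f n : (psX F * f) n = if n is m.+1 then f m else 0.
Proof.
rewrite powserM; case: n => [|n]; first by rewrite big_ord1 /= mul0r.
rewrite !big_ord_recl /= mul0r add0r mul1r subSS subn0 big1 ?addr0// => i _.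
by rewrite mul0r.
Qed.

Lemma powserXnM f k n : (psX F ^+ k * f) n = if (n < k)%N then 0 else f (n - k)%N.
Proof.
elim: k f n => [|k IH] f n; first by rewrite expr0 mul1r subn0.
rewrite exprS -mulrA powserXM; case: n => [|n]; first by rewrite ltn0Sn.
by rewrite IH ltnS subSS.
Qed.

Lemma powser_tail f : f 0%N = 0 -> f = psX F * PowSer (fun n => f n.+1).
Proof. by move=> f0; apply: powserP => -[|n]; rewrite powserXM. Qed.

Lemma powser_factor f : f != 0 -> exists n g, f = psX F ^+ n * g /\ g 0%N != 0.
Proof.
move=> fn0; have [n Hn] : exists n, f n != 0.
  apply: contrapT => Hf; move/eqP: fn0; apply; apply: powserP => n.
  by apply/eqP; apply: contrapT => /negP E; apply: Hf; exists n.
have ex : exists n, (fun n => f n != 0) n by exists n.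
pose m := ex_minn ex; exists m, (PowSer (fun k => f (k + m)%N)).
rewrite /m; case: ex_minnP => {}m Hm min; split=> //.
apply: powserP => k; rewrite powserXnM; case: ltnP => km; last by rewrite /= subnK.
by apply/eqP; apply: contraTT km => /min; rewrite -leqNgt.
Qed.

Lemma powser_expn_lt h k n : h 0%N = 0 -> (n < k)%N -> (h ^+ k) n = 0.
Proof.
by move=> /powser_tail -> nk; rewrite exprMn powserXnM nk.
Qed.

(* The inverse of 1 - h is the geometric series in h. *)
Lemma powser_inv f : f 0%N != 0 -> exists g, g * f = 1.
Proof.
move=> f0; pose c := psC (f 0%N)^-1; pose h := 1 - c * f.
have h0 : h 0%N = 0.
  by rewrite powserD powserN powserM big_ord1 /= mulVf// subrr.
have hE : c * f = 1 - h by rewrite /h opprB addrC subrK.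
pose s : powser F := PowSer (fun n => \sum_(k < n.+1) (h ^+ k) n).
exists (s * c); rewrite -mulrA hE mulrC; apply: powserP => n.
have sE k : (k <= n)%N -> s k = (\sum_(i < n.+1) h ^+ i) k.
  move=> kn; rewrite powser_sum /= (big_ord_widen n.+1 (fun i => (h ^+ i) k))// big_mkcond.
  apply: eq_bigr => i _; case: ltnP => // ki; first by rewrite powser_expn_lt.
have -> : ((1 - h) * s) n = ((1 - h) * \sum_(i < n.+1) h ^+ i) n.
  by rewrite !powserM; apply: eq_bigr => i _; rewrite sE// leq_subr.
have -> : (1 - h) * \sum_(i < n.+1) h ^+ i = 1 - h ^+ n.+1.
  by rewrite -opprB mulNr -subrX1 opprB.
by rewrite powserD powserN powser_expn_lt// subr0.
Qed.

End PowerSeriesUnits.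

Lemma fraction_divE (R : idomainType) (x : {fraction R}) :
  exists n d : R, d != 0 /\ x = tofrac n / tofrac d.
Proof.
exists (frac (repr x)).1, (frac (repr x)).2; have d0 := denom_ratioP (repr x).
split=> //; set n := (frac (repr x)).1; set d := (frac (repr x)).2 in d0 *.
have -> : x = \pi_({fraction R})%qT (Ratio n d) by rewrite /n /d Ratio_numden reprK.
apply: (mulIf (x := tofrac d)); rewrite ?tofrac_eq0// mulfVK ?tofrac_eq0//.
rewrite /tofrac; unlock FracField.tofrac.
rewrite -[LHS](FracField.pi_mul (Ratio n d) (Ratio d 1)).
apply/eqmodP; rewrite /= FracField.equivfE /FracField.mulf.
by rewrite !numden_Ratio ?mulf_neq0 ?oner_eq0// !mulr1 mulrC.
Qed.

Section LaurentValuation.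
Variable F : fieldType.
Local Notation L := (laurent F).
Local Notation O := (@laur_int F).
Local Notation X := (laurX F).
Implicit Types x y u : L.

Definition laur_max : set L := [set x | O (x / X)].
Local Notation m := laur_max.
Definition laur_unit x := O x /\ O x^-1.

Lemma laurX_neq0 : X != 0.
Proof. by rewrite tofrac_eq0; apply/eqP => /(congr1 (fun f : powser F => f 1%N)) /eqP; rewrite /= oner_eq0. Qed.
Lemma laur_int1 : O 1. Proof. by exists 1 => //; rewrite rmorph1. Qed.
Lemma laur_intX : O X. Proof. by exists (psX F). Qed.
Lemma laur_intC c : O (laurC c). Proof. by exists (psC c). Qed.
Lemma laur_intD x y : O x -> O y -> O (x + y).
Proof. by move=> [f _ <-] [g _ <-]; exists (f + g) => //; rewrite rmorphD. Qed.
Lemma laur_intN x : O x -> O (- x).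
Proof. by move=> [f _ <-]; exists (- f) => //; rewrite rmorphN. Qed.
Lemma laur_intM x y : O x -> O y -> O (x * y).
Proof. by move=> [f _ <-] [g _ <-]; exists (f * g) => //; rewrite rmorphM. Qed.

Lemma laur_maxP x : m x <-> exists2 y, O y & x = X * y.
Proof.
split=> [h|[y hy ->]]; first by exists (x / X) => //; rewrite mulrC mulfVK// laurX_neq0.
by rewrite /laur_max /= mulrAC divff ?laurX_neq0// mul1r.
Qed.

Lemma laur_int_max (f : powser F) : m (tofrac f) <-> f 0%N = 0.
Proof.
split=> [/laur_maxP[_ [g _ <-]]|f0].
  rewrite /laurX -rmorphM => /eqP; rewrite tofrac_eq => /eqP ->.
  by rewrite powserXM.
by apply/laur_maxP; rewrite (powser_tail f0) rmorphM /=; eexists; [eexists|].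
Qed.

Lemma laur_max1 : ~ m 1.
Proof.
by rewrite -(rmorph1 (@tofrac (powser F))) => /laur_int_max /eqP; rewrite /= oner_eq0.
Qed.

Lemma laur_unitP x : O x -> ~ m x -> laur_unit x.
Proof.
move=> [f _ <-] /laur_int_max f0; split; first by exists f.
have [|g gf] := @powser_inv F f; first by apply/eqP.
exists g => //; apply: (mulIf (x := tofrac f)).
  by rewrite tofrac_eq0; apply/eqP => f00; apply: f0; rewrite f00.
by rewrite -rmorphM gf rmorph1 mulVf// tofrac_eq0; apply/eqP => f00; apply: f0; rewrite f00.
Qed.

Lemma laur_residue x : O x -> exists c, m (x - laurC c).
Proof.
move=> [f _ <-]; exists (f 0%N); rewrite /laurC -rmorphB; apply/laur_int_max.
by rewrite powserD powserN /= subrr.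
Qed.

Lemma laur_cases x : x != 0 -> exists n u, [/\ u != 0, laur_unit u & x = X ^+ n * u \/ x = X ^- n * u].
Proof.
have fac (f : powser F) : f != 0 -> exists n u, [/\ u != 0, laur_unit u & tofrac f = X ^+ n * u].
  move=> /powser_factor[n [g [-> g0]]]; exists n, (tofrac g).
  have gn0 : g != 0 by apply: contraNneq g0 => ->.
  split; [by rewrite tofrac_eq0| |by rewrite rmorphM rmorphXn].
  by apply: laur_unitP; [exists g|move=> /laur_int_max e; rewrite e eqxx in g0].
have [f [g [g0 ->]]] := fraction_divE x => x0.
have f0 : f != 0 by apply: contraNneq x0 => ->; rewrite rmorph0 mul0r.
have [n [u [u0 [hu hu'] ->]]] := fac f f0; have [k [v [v0 [hv hv'] ->]]] := fac g g0.
have huv : laur_unit (u / v).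
  by split; [exact: laur_intM|rewrite invfM invrK mulrC; exact: laur_intM].
have vV0 : v^-1 != 0 by rewrite invr_eq0.
have uv0 : u / v != 0 := mulf_neq0 u0 vV0.
have X0 i : X ^+ i != 0 := expf_neq0 i laurX_neq0.
have E : X ^+ n * u / (X ^+ k * v) = (X ^+ n / X ^+ k) * (u / v) by rewrite invfM mulrACA.
rewrite E; have [kn|nk] := leqP k n.
  exists (n - k)%N, (u / v); split; [exact: uv0|exact: huv|left].
  by congr (_ * _); rewrite -{1}(subnK kn) exprD (mulfK (X0 k)).
exists (k - n)%N, (u / v); split; [exact: uv0|exact: huv|right].
congr (_ * _); rewrite -{1}(subnK (ltnW nk)) exprD invfM mulrCA (mulfV (X0 n)).
exact: mulr1.
Qed.

End LaurentValuation.

(** * The Bruhat-Tits tree *)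

Lemma unitmx_scale (R : fieldType) n (c : R) (g : 'M[R]_n) :
  c != 0 -> g \in unitmx -> c *: g \in unitmx.
Proof. by move=> c0 ug; rewrite unitmxZ// unitfE. Qed.

Lemma unitmx_mulV (R : fieldType) n (g h : 'M[R]_n) :
  g \in unitmx -> h \in unitmx -> g *m h \in unitmx.
Proof. by rewrite unitmx_mul => -> ->. Qed.

Lemma mulf_divf_neq0 (R : fieldType) (c d : R) : c != 0 -> d != 0 -> c / d != 0.
Proof. by move=> c0 d0; rewrite mulf_neq0// invr_eq0. Qed.

(** What is used of F_2[[X]] inside F_2((X)): a discrete valuation ring with uniformizer X and
    residue field of two elements. *)
Record dvr_F2 (L : fieldType) (O : set L) (X : L) : Prop := DvrF2 {
  dvr1 : O 1;
  dvrD : forall x y, O x -> O y -> O (x + y);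
  dvrN : forall x, O x -> O (- x);
  dvrM : forall x y, O x -> O y -> O (x * y);
  dvrX : O X;
  dvrX0 : X != 0;
  dvrXV : ~ O X^-1;
  dvr_cases : forall x, x != 0 -> exists n u, [/\ u != 0, O u /\ O u^-1
    & x = X ^+ n * u \/ x = X ^- n * u];
  dvr_res : forall x, O x -> O (x / X) \/ O ((x - 1) / X)
}.

Lemma cycle_nth (T : eqType) (e : rel T) (x0 : T) c i : cycle e c -> (i < size c)%N ->
  e (nth x0 c i) (nth x0 c (i.+1 %% size c)).
Proof.
case: c => [//|a s] /=; rewrite rcons_path => /andP[/(pathP x0) hp hl]; rewrite ltnS.
rewrite leq_eqVlt => /orP[/eqP->|hi]; last by rewrite modn_small//; exact: hp.
by rewrite modnn /= (_ : nth x0 (a :: s) (size s) = last a s)// (last_nth x0).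
Qed.

Lemma card_uniq_seq (T : eqType) (s : seq T) : uniq s -> ([set` s] #= `I_(size s))%card.
Proof.
case: s => [|x0 s] us.
  by rewrite (_ : [set` [::]] = set0) ?II0//; apply/seteqP; split.
have -> : [set` (x0 :: s)] = (fun i => nth x0 (x0 :: s) i) @` `I_(size (x0 :: s)).
  apply/seteqP; split=> [x xs|_ [i hi <-]]; last exact: mem_nth.
  by exists (index x (x0 :: s)); [rewrite /mkset index_mem|rewrite nth_index].
apply: inj_card_eq => i j; rewrite !inE => hi hj /eqP.
by rewrite nth_uniq// => /eqP.
Qed.

Section BTTree.
Variables (L : fieldType) (O : set L) (X : L).
Hypothesis dvr : dvr_F2 O X.
Implicit Types (x y c : L) (v w : 'cV[L]_2) (g h k : 'M[L]_2) (M N : set 'cV[L]_2).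

Definition dvr_max : set L := [set x | O (x / X)].
Local Notation m := dvr_max.
Definition dvr_unit x := O x /\ O x^-1.

Let X0 : X != 0 := dvrX0 dvr.
Let X0n n : X ^+ n != 0 := expf_neq0 n X0.

Lemma dvr_int1 : O 1. Proof. exact: dvr1 dvr. Qed.
Lemma dvr_intX : O X. Proof. exact: dvrX dvr. Qed.
Lemma dvr_intD x y : O x -> O y -> O (x + y). Proof. exact: (dvrD dvr). Qed.
Lemma dvr_intN x : O x -> O (- x). Proof. exact: (dvrN dvr). Qed.
Lemma dvr_intM x y : O x -> O y -> O (x * y). Proof. exact: (dvrM dvr). Qed.
Lemma dvr_int0 : O 0. Proof. by rewrite -(subrr 1); apply: dvr_intD dvr_int1 (dvr_intN dvr_int1). Qed.
Lemma dvr_intB x y : O x -> O y -> O (x - y).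
Proof. by move=> hx hy; apply: dvr_intD hx (dvr_intN hy). Qed.
Lemma dvr_intXn x n : O x -> O (x ^+ n).
Proof.
by move=> hx; elim: n => [|n IH]; [exact: dvr_int1|rewrite exprS; exact: dvr_intM].
Qed.

Lemma dvr_maxP x : m x <-> exists2 y, O y & x = X * y.
Proof.
split=> [h|[y hy ->]]; first by exists (x / X) => //; rewrite mulrC mulfVK.
by rewrite /dvr_max /= mulrAC divff// mul1r.
Qed.
Lemma dvr_max_int x : m x -> O x.
Proof. by move=> /dvr_maxP[y hy ->]; exact: dvr_intM dvr_intX hy. Qed.
Lemma dvr_max0 : m 0. Proof. by rewrite /dvr_max /= mul0r; exact: dvr_int0. Qed.
Lemma dvr_maxX : m X. Proof. by rewrite /dvr_max /= divff//; exact: dvr_int1. Qed.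
Lemma dvr_maxD x y : m x -> m y -> m (x + y).
Proof. by rewrite /dvr_max /= mulrDl; exact: dvr_intD. Qed.
Lemma dvr_maxN x : m x -> m (- x).
Proof. by rewrite /dvr_max /= mulNr; exact: dvr_intN. Qed.
Lemma dvr_maxB x y : m x -> m y -> m (x - y).
Proof. by move=> hx hy; apply: dvr_maxD hx (dvr_maxN hy). Qed.
Lemma dvr_maxMl x y : O x -> m y -> m (x * y).
Proof. by rewrite /dvr_max /= -mulrA; exact: dvr_intM. Qed.
Lemma dvr_maxMr x y : m x -> O y -> m (x * y).
Proof. by move=> hx hy; rewrite mulrC; exact: dvr_maxMl. Qed.
Lemma dvr_max1 : ~ m 1.
Proof. by rewrite /dvr_max /= mul1r; exact: dvrXV dvr. Qed.

Lemma dvr_int_or x : x != 0 -> [\/ m x, dvr_unit x | m x^-1].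
Proof.
move=> /(dvr_cases dvr)[n [u [u0 [hu hu'] e]]]; case: n e => [|n] e.
  by constructor 2; case: e => ->; rewrite ?expr0 ?invr1 mul1r.
have mX y : O y -> m (X ^+ n.+1 * y).
  by move=> hv; rewrite exprS -mulrA; apply: dvr_maxMr dvr_maxX _; apply: dvr_intM hv; exact/dvr_intXn/dvr_intX.
case: e => ->; first by constructor 1; exact: mX.
by constructor 3; rewrite invfM invrK; exact: mX.
Qed.

Lemma dvr_unit_max x : x != 0 -> dvr_unit x -> ~ m x.
Proof. by move=> x0 [hx hV] mx; apply: dvr_max1; rewrite -(mulfV x0); exact: dvr_maxMr. Qed.

Lemma dvr_unitP x : O x -> ~ m x -> x != 0 /\ dvr_unit x.
Proof.
move=> hx nx; have x0 : x != 0 by apply/eqP => x0; apply: nx; rewrite x0; exact: dvr_max0.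
split=> //; have [//|//|/dvr_max_int hV] := dvr_int_or x0; by split.
Qed.

(** If x were not integral, x^-1 would be in the maximal ideal, and so would 1 = x^2 x^-2. *)
Lemma dvr_int_sqrt x : O (x ^+ 2) -> O x.
Proof.
have [->|x0] := eqVneq x 0; first by move=> _; exact: dvr_int0.
have [/dvr_max_int//|[]//|mV h] := dvr_int_or x0; exfalso; apply: dvr_max1.
have -> : (1 : L) = x ^+ 2 * x^-1 ^+ 2 by rewrite -exprMn (mulfV x0) expr1n.
by apply: dvr_maxMl h _; rewrite expr2; exact: dvr_maxMr mV (dvr_max_int mV).
Qed.

Lemma dvr_denominator x : exists n, O (X ^+ n * x).
Proof.
have [->|x0] := eqVneq x 0; first by exists 0%N; rewrite mulr0; exact: dvr_int0.
have [n [u [u0 [hu hu'] [->|->]]]] := dvr_cases dvr x0.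
  exists 0%N; rewrite expr0 mul1r; apply: dvr_intM hu; exact/dvr_intXn/dvr_intX.
by exists n; rewrite mulrA mulfV ?mul1r.
Qed.

Lemma dvr_dich x : O x -> m x \/ m (x - 1). Proof. exact: (dvr_res dvr). Qed.

Lemma dvr_max2 : m 2.
Proof.
have [//|] : m 2 \/ m (2 - 1) by apply/dvr_dich/dvr_intD/dvr_int1/dvr_int1.
by rewrite addrK => /dvr_max1.
Qed.

(** The definitions of lattices and of the tree restated over an abstract valuation ring; for
    F_2[[X]] they are convertible to the original ones. *)
Definition std : set 'cV[L]_2 := [set v | forall i, O (v i 0)].
Definition scale_lat c M : set 'cV[L]_2 := [set c *: v | v in M].
Definition act_lat g (V : set (set 'cV[L]_2)) : set (set 'cV[L]_2) :=
  [set [set g *m x | x in M] | M in V].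
Definition lat_vertex : set (set (set 'cV[L]_2)) :=
  [set [set scale_lat c M | c in [set c | c != 0]] |
    M in [set M | exists2 g, g \in unitmx & M = [set g *m v | v in std]]].
Definition lat_adj (V W : set (set 'cV[L]_2)) :=
  [/\ lat_vertex V, lat_vertex W & exists M1 M2, [/\ V M1, W M2,
    scale_lat X M1 `<` M2 & M2 `<` M1]].

Lemma dvr_add1 x : ~ m x -> O x -> m (x - 1).
Proof. by move=> nx /dvr_dich[]. Qed.

(** The residue in F_2 of an integral element, as a boolean, so that addition becomes exclusive
    or. *)
Definition rs x : bool := ~~ `[< m x >].

Lemma rsP x : rs x = false <-> m x.
Proof. by rewrite /rs; split=> [/negbFE/asboolP//|h]; apply/negbTE; rewrite negbK; exact/asboolP. Qed.

Lemma rs_true x : rs x = true <-> ~ m x.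
Proof. by rewrite /rs; split=> [/asboolPn//|h]; apply/asboolPn. Qed.

Lemma rsD x y : O x -> O y -> rs (x + y) = rs x (+) rs y.
Proof.
move=> hx hy; case ex : (rs x); case ey : (rs y) => /=.
- apply/rsP; move/rs_true/dvr_add1 : ex => /(_ hx) h1; move/rs_true/dvr_add1 : ey => /(_ hy) h2.
  rewrite (_ : x + y = (x - 1) + (y - 1) + 2); first by exact: dvr_maxD (dvr_maxD h1 h2) dvr_max2.
  by ring.
- apply/rs_true => h; move/rs_true : ex; apply; move/rsP : ey => ey.
  by rewrite -(addrK y x); exact: dvr_maxB.
- apply/rs_true => h; move/rs_true : ey; apply; move/rsP : ex => ex.
  by rewrite -(addKr x y) addrC; exact: dvr_maxB.
- by apply/rsP; move/rsP : ex => ex; move/rsP : ey => ey; exact: dvr_maxD.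
Qed.

Lemma rsN x : rs (- x) = rs x.
Proof.
case e : (rs x); last by apply/rsP/dvr_maxN/rsP.
by apply/rs_true => h; move/rs_true : e; apply; rewrite -(opprK x); exact: dvr_maxN.
Qed.

Definition col2 x y : 'cV[L]_2 := \col_i if i == 0 then x else y.

Lemma ord2 (i : 'I_2) : i = 0 \/ i = 1.
Proof. by case: i => -[|[|//]] hi; [left|right]; apply: val_inj. Qed.

Lemma col2E v : v = col2 (v 0 0) (v 1 0).
Proof.
by apply/colP => i; rewrite mxE; case: (ord2 i) => ->.
Qed.

Lemma mx2_col2 p q r s x y : mx2 p q r s *m col2 x y = col2 (p * x + q * y) (r * x + s * y).
Proof.
apply/colP => i; rewrite !mxE !big_ord_recl big_ord0 !mxE /= addr0.
by case: (ord2 i) => ->.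
Qed.

Lemma std_col2 x y : std (col2 x y) <-> O x /\ O y.
Proof.
split=> [h|[hx hy] i]; first by have := h 0; have := h 1; rewrite !mxE.
by rewrite mxE; case: ifP.
Qed.

Definition resv v : bool * bool := (rs (v 0 0), rs (v 1 0)).

Definition bxor (r r' : bool * bool) := (r.1 (+) r'.1, r.2 (+) r'.2).

Lemma stdD v w : std v -> std w -> std (v + w).
Proof. by move=> hv hw i; rewrite mxE; exact: dvr_intD. Qed.
Lemma stdN v : std v -> std (- v).
Proof. by move=> hv i; rewrite mxE; exact: dvr_intN. Qed.
Lemma std0 : std 0. Proof. by move=> i; rewrite mxE; exact: dvr_int0. Qed.
Lemma stdZ c v : O c -> std v -> std (c *: v).
Proof. by move=> hc hv i; rewrite mxE; exact: dvr_intM. Qed.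

Lemma resvD v w : std v -> std w -> resv (v + w) = bxor (resv v) (resv w).
Proof. by move=> hv hw; rewrite /resv /bxor !mxE !rsD. Qed.

Lemma resv0 v : resv v = (false, false) <-> scale_lat X std v.
Proof.
split=> [[/rsP/dvr_maxP[x hx e1] /rsP/dvr_maxP[y hy e2]]|[w hw <-]].
  exists (col2 x y); first exact/std_col2.
  by apply/colP => i; rewrite [v]col2E !mxE e1 e2; case: ifP.
by congr (_, _); apply/rsP; rewrite mxE; exact: dvr_maxMr dvr_maxX (hw _).
Qed.

Lemma resvN v : std v -> resv (- v) = resv v.
Proof.
by move=> _; rewrite /resv !mxE !rsN.
Qed.

Definition lat g : set 'cV[L]_2 := [set g *m v | v in std].

Lemma latP g v : g \in unitmx -> lat g v <-> std (invmx g *m v).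
Proof.
move=> ug; split=> [[w hw <-]|h]; first by rewrite mulKmx.
by exists (invmx g *m v) => //; rewrite mulKVmx.
Qed.

Lemma lat1 : lat 1%:M = std.
Proof. by apply/seteqP; split=> v; [move=> [w hw <-]; rewrite mul1mx|exists v; rewrite ?mul1mx]. Qed.

Lemma lat_mul a g : [set a *m x | x in lat g] = lat (a *m g).
Proof.
apply/seteqP; split=> v.
  by move=> [_ [w hw <-] <-]; exists w; rewrite ?mulmxA.
by move=> [w hw <-]; exists (g *m w); [exists w|rewrite mulmxA].
Qed.

Lemma lat_scale c g : scale_lat c (lat g) = lat (c *: g).
Proof.
apply/seteqP; split=> v.
  by move=> [_ [w hw <-] <-]; exists w; rewrite ?scalemxAl.
by move=> [w hw <-]; exists (g *m w); [exists w|rewrite scalemxAl].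
Qed.

Lemma scale_scale c d M : scale_lat c (scale_lat d M) = scale_lat (c * d) M.
Proof.
apply/seteqP; split=> v.
  by move=> [_ [w hw <-] <-]; exists w => //; rewrite scalerA.
by move=> [w hw <-]; exists (d *: w); [exists w|rewrite scalerA].
Qed.

Lemma scale_lat1 M : scale_lat 1 M = M.
Proof.
by apply/seteqP; split=> v; [move=> [w hw <-]; rewrite scale1r|exists v; rewrite ?scale1r].
Qed.

Lemma scale_sub c M N : M `<=` N -> scale_lat c M `<=` scale_lat c N.
Proof. by move=> MN v [w hw <-]; exists w => //; exact: MN. Qed.

Lemma scale_subK c M N : c != 0 -> scale_lat c M `<=` scale_lat c N -> M `<=` N.
Proof.
move=> c0 /(scale_sub (c := c^-1)); rewrite !scale_scale (mulVf c0) !scale_lat1; exact.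
Qed.

Lemma scale_mono c M N : c != 0 -> M `<` N -> scale_lat c M `<` scale_lat c N.
Proof.
move=> c0 [MN NM]; split; first exact: scale_sub.
by move=> /(scale_subK c0).
Qed.

Lemma lat_mono (a : 'M[L]_2) M N : M `<=` N -> [set a *m x | x in M] `<=` [set a *m x | x in N].
Proof. by move=> MN _ [x hx <-]; exists x => //; exact: MN. Qed.

Lemma lat_monoK (a : 'M[L]_2) M N : a \in unitmx -> [set a *m x | x in M] `<=` [set a *m x | x in N] -> M `<=` N.
Proof.
move=> ua h v Mv; have [w Nw /(congr1 (mulmx (invmx a)))] := h _ (ex_intro2 _ _ v Mv erefl).
by rewrite !mulKmx// => <-.
Qed.

Lemma scale_mulmx (a : 'M[L]_2) c M : [set a *m x | x in scale_lat c M] = scale_lat c [set a *m x | x in M].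
Proof.
apply/seteqP; split=> v.
  by move=> [_ [w hw <-] <-]; exists (a *m w); [exists w|rewrite scalemxAr].
by move=> [_ [w hw <-] <-]; exists (c *: w); [exists w|rewrite scalemxAr].
Qed.

Lemma lat_sub_int c g : O c -> scale_lat c (lat g) `<=` lat g.
Proof.
by move=> hc _ [_ [w hw <-] <-]; exists (c *: w); [exact: stdZ|rewrite scalemxAr].
Qed.

Lemma lat_max_sub c g : m c -> scale_lat c (lat g) `<=` scale_lat X (lat g).
Proof.
by move=> /dvr_maxP[d hd ->]; rewrite -scale_scale; apply: scale_sub; exact: lat_sub_int.
Qed.

Lemma lat_scale_unit c g : dvr_unit c -> c != 0 -> scale_lat c (lat g) = lat g.
Proof.
move=> [hc hV] c0; apply/seteqP; split; first exact: lat_sub_int.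
rewrite -{1}[lat g]scale_lat1 -(mulfV c0) -scale_scale; apply: scale_sub.
exact: lat_sub_int.
Qed.

Lemma latD g v w : lat g v -> lat g w -> lat g (v + w).
Proof. by move=> [v' hv <-] [w' hw <-]; exists (v' + w'); [exact: stdD|rewrite mulmxDr]. Qed.

Lemma std_nmax : ~ (std `<=` scale_lat X std).
Proof.
move=> /(_ (col2 1 0)) h; have /h/resv0 : std (col2 1 0) by apply/std_col2; split; [exact: dvr_int1|exact: dvr_int0].
by rewrite /resv !mxE /= => -[/rsP/dvr_max1].
Qed.

Lemma lat_nmax g : g \in unitmx -> ~ (lat g `<=` scale_lat X (lat g)).
Proof.
move=> ug h; apply: std_nmax; apply: (lat_monoK ug).
by rewrite scale_mulmx.
Qed.

(* Sublattices between [X std] and [std] are given by a line of F_2^2. *)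
Definition line_lattice (r : bool * bool) : set 'cV[L]_2 :=
  [set v | std v /\ (resv v = (false, false) \/ resv v = r)].

(** The columns form a basis of the lattice attached to the line r. The last case is meant for
    (true, true); its value at (false, false) is junk. *)
Definition line_mx (r : bool * bool) : 'M[L]_2 :=
  match r with (true, false) => mx2 1 0 0 X | (false, true) => mx2 X 0 0 1 | _ => mx2 1 0 1 X end.

Lemma resv_col2 x y : resv (col2 x y) = (rs x, rs y).
Proof. by rewrite /resv !mxE. Qed.

Lemma lat_line r : r != (false, false) -> lat (line_mx r) = line_lattice r.
Proof.
have max_mul y : O y -> m (X * y) by move=> hy; exact: dvr_maxMr dvr_maxX hy.
move=> r0; apply/seteqP; split=> v.
  move=> [w hw <-]; rewrite [w]col2E; have hx := hw 0; have hy := hw 1.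
  move: (w 0 0) (w 1 0) hx hy => x y hx hy {w hw}.
  have hXx := max_mul _ hx; have hXy := max_mul _ hy.
  case: r r0 => [[] []] // _; rewrite /line_mx mx2_col2 !(mul1r, mul0r, addr0, add0r).
  - split; first by apply/std_col2; split=> //; apply: dvr_intD => //; exact: dvr_max_int.
    rewrite resv_col2 rsD ?(rsP (X * y)).2 ?addbF//; last exact: dvr_max_int.
    by case: (rs x); [right|left].
  - split; first by apply/std_col2; split=> //; exact: dvr_max_int.
    by rewrite resv_col2 (rsP (X * y)).2//; case: (rs x); [right|left].
  - split; first by apply/std_col2; split=> //; exact: dvr_max_int.
    by rewrite resv_col2 (rsP (X * x)).2//; case: (rs y); [right|left].
rewrite [v]col2E => -[/std_col2[hx hy]]; move: (v 0 0) (v 1 0) hx hy => x y hx hy {v}.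
rewrite resv_col2; case: r r0 => [[] []] // _ h; rewrite /line_mx.
- have /dvr_maxP[y' hy' e] : m (y - x).
    case: h => -[h1 h2]; first by apply: dvr_maxB; exact/rsP.
    by apply/rsP; rewrite rsD ?rsN ?h1 ?h2//; exact: dvr_intN.
  exists (col2 x y'); first exact/std_col2.
  by rewrite mx2_col2 -e mul1r mul0r addr0 addrC subrK.
- have /dvr_maxP[y' hy' e] : m y by apply/rsP; case: h => -[].
  exists (col2 x y'); first exact/std_col2.
  by rewrite mx2_col2 -e mul1r !mul0r addr0 add0r.
- have /dvr_maxP[x' hx' e] : m x by apply/rsP; case: h => -[].
  exists (col2 x' y); first exact/std_col2.
  by rewrite mx2_col2 -e mul1r !mul0r addr0 add0r.
Qed.

Lemma line_mx_unit r : line_mx r \in unitmx.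
Proof.
rewrite unitmxE unitfE (expand_det_row _ 0) !big_ord_recl big_ord0 /cofactor !det_mx11 !mxE /=.
by case: r => [[] []]; rewrite !mxE /= !expr0 ?expr1 !(mul1r, mul0r, mulr1, mulr0, addr0, add0r) //;
  exact: X0.
Qed.

Definition addClosed N := forall v w, N v -> N w -> N (v + w).

Lemma res_lattice N : addClosed N -> scale_lat X std `<=` N -> N `<=` std ->
  forall v w, N v -> std w -> resv w = resv v -> N w.
Proof.
move=> addN subN Nsub v w Nv hw e; rewrite -(subrK v w); apply: addN => //.
apply/subN/resv0; rewrite resvD ?resvN ?e//; try exact: Nsub; last exact/stdN/Nsub.
by rewrite /bxor !addbb.
Qed.

(** The image of N in F_2^2 is a proper nonzero subgroup, hence consists of 0 and one vector. *)
Lemma between_line N : addClosed N -> scale_lat X std `<` N -> N `<` std ->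
  exists2 r, r != (false, false) & N = line_lattice r.
Proof.
move=> addN [subN N0] [Nsub N1]; have R := res_lattice addN subN Nsub.
have [v [Nv v0]] : exists v, N v /\ resv v != (false, false).
  apply: contrapT => h; apply: N0 => v Nv; apply/resv0; apply: contrapT => h'.
  by apply: h; exists v; split=> //; apply/eqP.
exists (resv v) => //; apply/seteqP; split=> w; last first.
  move=> [hw [/resv0/subN//|e]]; exact: (R v).
move=> Nw; split; first exact: Nsub.
have [h|h] := eqVneq (resv w) (false, false); first by left.
have [h'|h'] := eqVneq (resv w) (resv v); first by right.
exfalso; apply: N1 => u hu.
(* Two different nonzero residues v and w would give, with 0 and v+w, all of F_2^2, and N would be
   everything. *)
have Nvw := addN _ _ Nv Nw; have evw := resvD (Nsub _ Nv) (Nsub _ Nw).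
have : [\/ resv u = (false, false), resv u = resv v, resv u = resv w | resv u = resv (v + w)].
  rewrite evw; move: (resv u) (resv v) (resv w) v0 h h' => [[] []] [[] []] [[] []] //= _ _ _;
  by [constructor 1|constructor 2|constructor 3|constructor 4].
by case=> [/resv0/subN//|e|e|e]; [exact: (R v)|exact: (R w)|exact: (R (v + w))].
Qed.

Lemma line_lattice_inj r r' : r != (false, false) -> line_lattice r = line_lattice r' -> r = r'.
Proof.
move=> r0 e; pose v := col2 (if r.1 then 1 else 0) (if r.2 then 1 else 0).
have h b : O (if b then 1 else 0) by case: b; [exact: dvr_int1|exact: dvr_int0].
have rb b : rs (if b then 1 else 0) = b.
  by case: b; [exact/rs_true/dvr_max1|exact/rsP/dvr_max0].
have ev : resv v = r by rewrite resv_col2 !rb; case: (r).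
have : line_lattice r v by split; [exact/std_col2|right].
by rewrite e => -[_]; rewrite ev => -[e0|//]; rewrite e0 eqxx in r0.
Qed.

Lemma line_lattice_sum r r' : r != (false, false) -> r' != (false, false) -> r <> r' ->
  forall v, std v -> exists u w, [/\ line_lattice r u, line_lattice r' w & v = u + w].
Proof.
move=> r0 r0' rr v hv.
have h b : O (if b then 1 else 0) by case: b; [exact: dvr_int1|exact: dvr_int0].
have rb b : rs (if b then 1 else 0) = b.
  by case: b; [exact/rs_true/dvr_max1|exact/rsP/dvr_max0].
pose w := col2 (if r'.1 then 1 else 0) (if r'.2 then 1 else 0).
have ew : resv w = r' by rewrite resv_col2 !rb; case: (r').
have hw : std w by apply/std_col2.
have hN : line_lattice r' w by split=> //; right.
have h0 : line_lattice r' 0.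
  by split; [exact: std0|left]; rewrite /resv !mxE (rsP 0).2//; exact: dvr_max0.
have hvw : std (v - w) by apply/stdD/stdN.
have evw : resv (v - w) = bxor (resv v) r' by rewrite resvD ?resvN ?ew//; exact: stdN.
have : (resv v = (false, false) \/ resv v = r) \/ (bxor (resv v) r' = (false, false) \/ bxor (resv v) r' = r).
  move: (resv v) r r' r0 r0' rr {w ew hw hN h0 hvw evw} => [[] []] [[] []] [[] []] //= _ _ rr;
  by [left; left|left; right|right; left|right; right|case: rr].
case=> e; first by exists v, 0; rewrite addr0.
by exists (v - w), w; rewrite subrK; split=> //; split=> //; rewrite evw.
Qed.

Lemma line_lattice_sub r : line_lattice r `<=` std. Proof. by move=> v []. Qed.
Lemma line_lattice_sup r : scale_lat X std `<=` line_lattice r.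
Proof.
move=> v hv; split; last by left; exact/resv0.
by have [w hw <-] := hv; apply: stdZ hw; exact: dvr_intX.
Qed.

Lemma line_lattice_between r : r != (false, false) ->
  scale_lat X std `<` line_lattice r /\ line_lattice r `<` std.
Proof.
move=> r0.
have h b : O (if b then 1 else 0) by case: b; [exact: dvr_int1|exact: dvr_int0].
have rb b : rs (if b then 1 else 0) = b.
  by case: b; [exact/rs_true/dvr_max1|exact/rsP/dvr_max0].
pose w (r' : bool * bool) := col2 (if r'.1 then 1 else 0) (if r'.2 then 1 else 0).
have ew r' : resv (w r') = r' by rewrite resv_col2 !rb; case: (r').
have hw r' : std (w r') by apply/std_col2.
split; split; [exact: line_lattice_sup| |exact: line_lattice_sub|].
- move=> /(_ (w r)) h'; have /h'/resv0 : line_lattice r (w r) by split=> //; right.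
  by rewrite ew => e; rewrite e eqxx in r0.
- have [r' [n1 n2]] : exists r', r' <> (false, false) /\ r' <> r.
    by exists (if r == (true, false) then (false, true) else (true, false)); case: (r) => [[] []].
  by move=> /(_ (w r') (hw r'))[_]; rewrite ew => -[].
Qed.

Definition hclass g := [set scale_lat c (lat g) | c in [set c | c != 0]].

Lemma vertexP V : lat_vertex V <-> exists2 g, g \in unitmx & V = hclass g.
Proof.
split=> [[_ [g ug ->] <-]|[g ug ->]]; first by exists g.
by exists (lat g) => //; exists g.
Qed.

Lemma hclass_scale c g : c != 0 -> hclass (c *: g) = hclass g.
Proof.
move=> c0; rewrite /hclass -lat_scale; apply/seteqP; split=> _ [d /= d0 <-].
  by exists (d * c); [exact: mulf_neq0|rewrite scale_scale].
by exists (d / c); [exact: mulf_divf_neq0|rewrite scale_scale (mulfVK c0)].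
Qed.

Lemma hclass_mem g M : hclass g M -> exists2 c, c != 0 & M = lat (c *: g).
Proof. by move=> [c /= c0 <-]; exists c => //; rewrite lat_scale. Qed.

Lemma hclass_self g : hclass g (lat g).
Proof. by exists 1; [rewrite /= oner_eq0|rewrite scale_lat1]. Qed.

Lemma hclass_eq g h : lat g = lat h -> hclass g = hclass h.
Proof. by rewrite /hclass => ->. Qed.

Lemma hclassP g h : hclass g = hclass h <-> exists2 c, c != 0 & lat h = lat (c *: g).
Proof.
split=> [e|[c c0 /hclass_eq ->]]; last by rewrite hclass_scale.
by have := hclass_self h; rewrite -e => /hclass_mem.
Qed.

Lemma hclass_act (a : 'M[L]_2) g : act_lat a (hclass g) = hclass (a *m g).
Proof.
apply/seteqP; split=> M.
  move=> [_ [c /= c0 <-] <-]; exists c => //.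
  by rewrite scale_mulmx lat_mul.
move=> [c /= c0 <-]; exists (scale_lat c (lat g)); first by exists c.
by rewrite scale_mulmx lat_mul.
Qed.

Lemma neighbor_step g M' : g \in unitmx -> (exists2 h, h \in unitmx & M' = lat h) ->
  scale_lat X (lat g) `<` M' -> M' `<` lat g ->
  exists2 r, r != (false, false) & M' = lat (g *m line_mx r).
Proof.
move=> ug [h uh ->] [s1 n1] [s2 n2].
have e : lat h = [set g *m x | x in lat (invmx g *m h)] by rewrite lat_mul mulKVmx.
have eX : scale_lat X (lat g) = [set g *m x | x in scale_lat X std].
  by rewrite scale_mulmx.
have [r r0 er] : exists2 r, r != (false, false) & lat (invmx g *m h) = line_lattice r.
  apply: between_line; first by move=> v w; exact: latD.
  - split; first by apply: (lat_monoK ug); rewrite -e -eX.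
    by move=> h'; apply: n1; rewrite e eX; exact: lat_mono.
  - split; first by apply: (lat_monoK ug); rewrite -e.
    by move=> h'; apply: n2; rewrite e; exact: lat_mono.
by exists r => //; rewrite e er -(lat_line r0) lat_mul.
Qed.

Lemma step_neighbor g r : g \in unitmx -> r != (false, false) ->
  scale_lat X (lat g) `<` lat (g *m line_mx r) /\ lat (g *m line_mx r) `<` lat g.
Proof.
move=> ug r0; have [[s1 n1] [s2 n2]] := line_lattice_between r0.
rewrite -lat_mul (lat_line r0).
have eX : scale_lat X (lat g) = [set g *m x | x in scale_lat X std] by rewrite scale_mulmx.
rewrite eX; split; split; try exact: lat_mono.
- by move=> /(lat_monoK ug).
- by move=> /(lat_monoK ug).
Qed.

(** The neighbours of the class of g correspond to the lines of F_2^2. Adjacency is handled in this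
    form from here on. *)
Lemma adjP g V : g \in unitmx -> lat_adj (hclass g) V <->
  exists2 r, r != (false, false) & V = hclass (g *m line_mx r).
Proof.
move=> ug; split=> [[_ /vertexP[h uh ->]]|[r r0 ->]].
  move=> [_ [_ [/hclass_mem[c c0 ->] /hclass_mem[d d0 ->] h1 h2]]].
  have [|r r0 e] := neighbor_step (unitmx_scale c0 ug) _ h1 h2.
    by exists (d *: h) => //; exact: unitmx_scale.
  exists r => //; rewrite -(hclass_scale h d0) (hclass_eq e) -scalemxAl.
  exact: hclass_scale.
have [h1 h2] := step_neighbor ug r0.
split; [by apply/vertexP; exists g|apply/vertexP; exists (g *m line_mx r) => //|].
  exact: unitmx_mulV ug (line_mx_unit r).
by exists (lat g), (lat (g *m line_mx r)); split=> //; exact: hclass_self.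
Qed.

Lemma adj_step V W M : lat_adj V W -> V M ->
  exists M', [/\ W M', scale_lat X M `<` M' & M' `<` M].
Proof.
move=> [/vertexP[g ug ->] /vertexP[h uh ->] [M1 [M2 [h1 h2 h3 h4]]]].
have [c /= c0 e1] := h1; have [d /= d0 e2] := h2.
move=> [f /= f0 e3].
have E : M = scale_lat (f / c) M1 by rewrite -e1 scale_scale (mulfVK c0).
have fc0 : f / c != 0 := mulf_divf_neq0 f0 c0.
exists (scale_lat (f / c) M2); split.
- by rewrite -e2 scale_scale; exists (f / c * d) => //; exact: mulf_neq0.
- have -> : scale_lat X M = scale_lat (f / c) (scale_lat X M1) by rewrite E !scale_scale [X * _]mulrC.
  exact: scale_mono.
- by rewrite E; exact: scale_mono.
Qed.

Lemma adj_sym V W : lat_adj V W -> lat_adj W V.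
Proof.
move=> [hV hW [M1 [M2 [h1 h2 h3 h4]]]]; split=> //.
have /vertexP[g ug eg] := hV.
exists M2, (scale_lat X M1); split=> //; last exact: scale_mono.
move: h1; rewrite eg => -[c /= c0 <-]; rewrite scale_scale.
by exists (X * c) => //; exact: mulf_neq0.
Qed.

Lemma lat_scale_strict c g : g \in unitmx -> c != 0 -> lat (c *: g) `<` lat g ->
  lat (c *: g) `<=` scale_lat X (lat g).
Proof.
move=> ug c0 [s n]; rewrite -lat_scale.
have [mc|uc|mV] := dvr_int_or c0; first exact: lat_max_sub.
  by case: n; rewrite -lat_scale lat_scale_unit.
case: n; rewrite -lat_scale -{1}[lat g]scale_lat1 -(mulfV c0) -scale_scale.
by apply: scale_sub; apply: lat_sub_int; exact: dvr_max_int.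
Qed.

Lemma adj_irr V : ~ lat_adj V V.
Proof.
move=> [/vertexP[g ug ->] _ [M1 [M2 [/hclass_mem[c c0 ->] /hclass_mem[d d0 ->] [_ h3] h4]]]].
apply: h3; have e : d *: g = (d / c) *: (c *: g) by rewrite scalerA (mulfVK c0).
rewrite e; apply: lat_scale_strict; first exact: unitmx_scale.
  exact: mulf_divf_neq0.
by rewrite -e.
Qed.

(* If M_{n+1} is in X M_0 then so is M_n = M_{n+1} + X M_{n-1}. *)
Lemma nonbacktracking_chain (M : nat -> set 'cV[L]_2) n :
  (forall i, (i <= n)%N -> exists2 g, g \in unitmx & M i = lat g) ->
  (forall i, (i < n)%N -> scale_lat X (M i) `<` M i.+1 /\ M i.+1 `<` M i) ->
  (forall i, (i.+1 < n)%N -> M i.+2 <> scale_lat X (M i)) ->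
  ~ (M n `<=` scale_lat X (M 0%N)).
Proof.
elim: n => [|[|n] IH] latM step nb.
- by have [g ug ->] := latM 0%N isT; exact: lat_nmax.
- by have [[_ +] _] := step 0%N isT.
have sub0 i : (i <= n.+2)%N -> M i `<=` M 0%N.
  elim: i => [_ //|i IHi hi]; apply: subset_trans (IHi (ltnW hi)).
  by have [_ []] := step i hi.
move=> h; apply: IH => [i hi|i hi|i hi|].
- by apply: latM; exact: leqW.
- by apply: step; exact: leqW.
- by apply: nb; exact: leqW.
have [g ug eg] := latM n (leqW (leqnSn n)).
have [s1 s2] := step n (leqnSn n.+1).
have [s3 s4] := step n.+1 (leqnn n.+2).
have latMn i : (i <= n.+2)%N -> exists2 h, h \in unitmx & M i = lat h by exact: latM.
have [k uk ek] := latM n.+1 (leqnSn n.+1).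
rewrite ek in s3 s4 *.
have [r r0 er] : exists2 r, r != (false, false) & M n.+2 = lat (k *m line_mx r).
  by apply: neighbor_step => //; exact: latM.
have [r' r0' er'] : exists2 r, r != (false, false) & scale_lat X (M n) = lat (k *m line_mx r).
  rewrite ek in s1 s2; apply: neighbor_step => //; last exact: scale_mono.
  by rewrite eg; exists (X *: g); [exact: unitmx_scale|rewrite lat_scale].
have rr : r <> r' by move=> e; apply: (nb n (leqnn _)); rewrite er er' e.
move=> _ [v hv <-]; have [u [w [hu hw ->]]] := line_lattice_sum r0 r0' rr hv.
have [g0 ug0 eg0] := latM 0%N isT.
rewrite mulmxDr eg0 lat_scale; apply: latD; rewrite -lat_scale -eg0.
  by apply: h; rewrite er -lat_mul (lat_line r0); exists u.
apply: (scale_sub (sub0 n _)); first by rewrite !leqW.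
by rewrite er' -lat_mul (lat_line r0'); exists w.
Qed.

(** The walk lifts to a descending chain of lattices, each containing X times the previous one. If
    the walk were closed, the last lattice would be a proper multiple of the first contained in it,
    hence inside X times the first, against [nonbacktracking_chain]. *)
Lemma nonbacktracking_open (f : nat -> set (set 'cV[L]_2)) n : (0 < n)%N ->
  (forall i, (i < n)%N -> lat_adj (f i) (f i.+1)) ->
  (forall i, (i.+1 < n)%N -> f i <> f i.+2) -> f n <> f 0%N.
Proof.
move=> n0 adj nb fn.
have [/vertexP[g0 ug0 eg0] _ _] := adj 0%N n0.
pose next i (M : set 'cV[L]_2) : set 'cV[L]_2 :=
  if pselect (exists M', [/\ f i.+1 M', scale_lat X M `<` M' & M' `<` M]) is left e
  then projT1 (cid e) else M.
pose M := fix M i := if i is j.+1 then next j (M j) else lat g0.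
have nextP i N : (i < n)%N -> f i N -> [/\ f i.+1 (next i N), scale_lat X N `<` next i N & next i N `<` N].
  move=> hi hN; rewrite /next; case: pselect => [e|[]]; first by case: cid.
  exact: adj_step (adj i hi) hN.
have fM i : (i <= n)%N -> f i (M i).
  elim: i => [_|i IH hi]; first by rewrite eg0; exact: hclass_self.
  by have [] := nextP i (M i) hi (IH (ltnW hi)).
have vert i : (i <= n)%N -> exists2 g, g \in unitmx & f i = hclass g.
  case: i => [_|i hi]; first by exists g0.
  by have [_ /vertexP] := adj i hi.
have latM i : (i <= n)%N -> exists2 g, g \in unitmx & M i = lat g.
  move=> hi; have [g ug eg] := vert i hi; have := fM i hi.
  by rewrite eg => /hclass_mem[c c0 ->]; exists (c *: g) => //; exact: unitmx_scale.
have step i : (i < n)%N -> scale_lat X (M i) `<` M i.+1 /\ M i.+1 `<` M i.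
  by move=> hi; have [] := nextP i (M i) hi (fM i (ltnW hi)).
have nbM i : (i.+1 < n)%N -> M i.+2 <> scale_lat X (M i).
  move=> hi e; apply: (nb i hi).
  have [g ug eg] := vert i (ltnW (ltnW hi)); have [h uh eh] := vert i.+2 hi.
  have := fM i (ltnW (ltnW hi)); have := fM i.+2 hi; rewrite e eg eh.
  move=> /hclass_mem[c c0 ec] /hclass_mem[d d0 ed]; rewrite ed lat_scale in ec.
  by rewrite -(hclass_scale h c0) -(hclass_eq ec) scalerA hclass_scale//; exact: mulf_neq0.
have nX := nonbacktracking_chain latM step nbM.
have := fM n (leqnn n); rewrite fn eg0 => /hclass_mem[c c0 ec].
apply: nX; rewrite ec; apply: lat_scale_strict => //.
have sub i : (i.+1 <= n)%N -> M i.+1 `<` lat g0.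
  elim: i => [|i IH] hi; first by have [] := step 0%N hi.
  have [_ [s1 s2]] := step i.+1 hi; have [t1 t2] := IH (ltnW hi).
  split; first exact: subset_trans t1.
  by move=> h; apply: t2; apply: subset_trans h s1.
by rewrite -ec; have := sub n.-1; rewrite (prednK n0) => /(_ (leqnn n)).
Qed.

(** Induction on n for X^n g <= k <= g. If k lies in X g, divide k by X. Otherwise k + X g is either
    g, so that n drops at once, or a neighbour of g that still contains k, for which n drops too. *)
Lemma connect_lattices n g k : g \in unitmx -> k \in unitmx -> lat k `<=` lat g ->
  scale_lat (X ^+ n) (lat g) `<=` lat k ->
  exists2 p, path (fun V W => `[< lat_adj V W >]) (hclass g) p & last (hclass g) p = hclass k.
Proof.
elim: n g k => [|n IH] g k ug uk s1.
  by rewrite expr0 scale_lat1 => s2; exists [::] => //; apply: hclass_eq; exact/seteqP.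
move=> s2.
have [h|h] := pselect (lat k `<=` scale_lat X (lat g)).
  have XV0 : X^-1 != 0 by rewrite invr_eq0.
  rewrite -(hclass_scale k XV0); apply: IH => //; first exact: unitmx_scale.
    apply: (scale_subK X0); rewrite -lat_scale scale_scale (mulfV X0) scale_lat1.
    exact: h.
  rewrite -lat_scale; apply: (scale_subK X0).
  by rewrite !scale_scale -exprS (mulfV X0) scale_lat1.
(* The preimage of k + X g under g. *)
pose N : set 'cV[L]_2 := [set v | std v /\ exists u w, [/\ lat k u, scale_lat X (lat g) w & g *m v = u + w]].
have addN : addClosed N.
  move=> v v' [hv [u [w [hu hw e]]]] [hv' [u' [w' [hu' hw' e']]]].
  split; first exact: stdD.
  exists (u + u'), (w + w'); split; first exact: latD.
    by rewrite lat_scale in hw hw' *; exact: latD.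
  by rewrite mulmxDr e e' addrACA.
have k0 : lat k 0 by exists 0; [exact: std0|rewrite mulmx0].
have g0 : scale_lat X (lat g) 0.
  by exists 0; [exists 0; [exact: std0|rewrite mulmx0]|rewrite scaler0].
have XN : scale_lat X std `<=` N.
  move=> _ [v hv <-]; split; first by apply: stdZ hv; exact: dvr_intX.
  by exists 0, (g *m (X *: v)); rewrite add0r -scalemxAr; split=> //; exists (g *m v) => //; exists v.
have kN u : lat k u -> exists2 v, N v & u = g *m v.
  move=> hu; have [v hv e] := s1 _ hu; exists v => //; split=> //.
  by exists u, 0; rewrite addr0.
have strictN : scale_lat X std `<` N.
  split=> // h'; apply: h => u /kN[v /h' [w hw <-] ->].
  by exists (g *m w); [exists w|rewrite scalemxAr].
have key (l : 'M[L]_2) : lat l `<=` [set g *m v | v in N] -> scale_lat (X ^+ n) (lat l) `<=` lat k.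
  move=> hl _ [_ /hl[v [hv [u [w [hu [w' hw' <-] ->]]]] <-] <-]; rewrite scalerDr scalerA -exprSr.
  apply: latD; last by apply: s2; exists w'.
  by apply: (lat_sub_int (c := X ^+ n)); [exact/dvr_intXn/dvr_intX|exists u].
have [h'|h'] := pselect (std `<=` N).
  by apply: IH => //; apply: key => _ [v hv <-]; exists v => //; exact: h'.
have [|r r0 er] := between_line addN strictN; first by split=> // v [].
have ug' : g *m line_mx r \in unitmx := unitmx_mulV ug (line_mx_unit r).
have eN : lat (g *m line_mx r) = [set g *m v | v in N] by rewrite er -(lat_line r0) lat_mul.
have [||p hp lp] := IH (g *m line_mx r) k ug' uk.
- by rewrite eN => u /kN[v hv ->]; exists v.
- by apply: key; rewrite eN.
exists (hclass (g *m line_mx r) :: p) => //=; rewrite hp andbT.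
by apply/asboolP/(adjP _ ug); exists r.
Qed.

Lemma mx_denominator g : exists n, forall i j, O (X ^+ n * g i j).
Proof.
have [a ha] := dvr_denominator (g 0 0); have [b hb] := dvr_denominator (g 0 1).
have [c hc] := dvr_denominator (g 1 0); have [d hd] := dvr_denominator (g 1 1).
have up (e e' : nat) x : O (X ^+ e * x) -> O (X ^+ (e' + e) * x).
  by move=> h; rewrite exprD -mulrA; apply: dvr_intM h; exact/dvr_intXn/dvr_intX.
exists (a + b + c + d)%N => i j.
case: (ord2 i) => ->; case: (ord2 j) => ->.
- by rewrite -!addnA addnC; exact: up.
- by rewrite (_ : (a + b + c + d = (a + c + d) + b)%N); [exact: up|lia].
- by rewrite (_ : (a + b + c + d = (a + b + d) + c)%N); [exact: up|lia].
- exact: up.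
Qed.

Lemma std_mul_int k v : (forall i j, O (k i j)) -> std v -> std (k *m v).
Proof.
move=> hk hv i; rewrite mxE !big_ord_recl big_ord0 addr0.
by apply: dvr_intD; exact: dvr_intM.
Qed.

Lemma vertices_connected V W : lat_vertex V -> lat_vertex W ->
  exists2 p, path (fun V W => `[< lat_adj V W >]) V p & last V p = W.
Proof.
move=> /vertexP[g ug ->] /vertexP[k uk ->].
have [a ha] := mx_denominator (invmx g *m k).
have [b hb] := mx_denominator (invmx k *m g).
rewrite -(hclass_scale k (X0n a)).
apply: (@connect_lattices (a + b)) => //; first exact: unitmx_scale.
  move=> _ [v hv <-]; apply/(latP _ ug); rewrite mulmxA; apply: std_mul_int hv => i j.
  by rewrite -scalemxAr mxE.
rewrite exprD -scale_scale -lat_scale; apply: scale_sub => _ [_ [v hv <-] <-].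
apply/(latP _ uk); rewrite -scalemxAr mulmxA scalemxAl; apply: std_mul_int hv => i j.
by rewrite mxE.
Qed.

Lemma hclass_line_inj g r r' : g \in unitmx -> r != (false, false) -> r' != (false, false) ->
  hclass (g *m line_mx r) = hclass (g *m line_mx r') -> r = r'.
Proof.
move=> ug r0 r0' /hclassP[c c0]; rewrite scalemxAr -!lat_mul => e.
have {}e : line_lattice r' = scale_lat c (line_lattice r).
  rewrite -(lat_line r0') -(lat_line r0) lat_scale; apply/seteqP.
  by split; apply: (lat_monoK ug); rewrite e.
have [[_ n1] [s2 _]] := line_lattice_between r0; have [[_ n1'] [s2' _]] := line_lattice_between r0'.
have [mc|uc|mV] := dvr_int_or c0.
- case: n1'; rewrite e => v hv; rewrite -lat1; apply: (lat_max_sub mc).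
  by rewrite lat1; apply: scale_sub hv; exact: line_lattice_sub.
- apply: line_lattice_inj => //; rewrite e -(lat_line r0) lat_scale_unit//.
- case: n1; have -> : line_lattice r = scale_lat c^-1 (line_lattice r').
    by rewrite e scale_scale (mulVf c0) scale_lat1.
  move=> v hv; rewrite -lat1; apply: (lat_max_sub mV).
  by rewrite lat1; apply: scale_sub hv; exact: line_lattice_sub.
Qed.

Theorem BT_tree_regular : regular_tree (lat_vertex) (lat_adj) 3.
Proof.
split.
- exists (hclass 1%:M); apply/vertexP; exists 1%:M => //; exact: unitmx1.
- by move=> V W [].
- exact: adj_sym.
- exact: adj_irr.
- exact: vertices_connected.
- move=> c sc uc hc; pose n := size c.
  have n0 : (0 < n)%N by apply: leq_trans sc.
  have x0 : set (set 'cV[L]_2) by exact: set0.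
  (* The cycle is read as a periodic walk; as it has more than two distinct vertices, f i and f
     (i+2) differ. *)
  pose f i := nth x0 c (i %% n)%N.
  apply: (@nonbacktracking_open f n n0); last by rewrite /f modnn mod0n.
  + move=> i hi; rewrite /f (modn_small hi).
    by have /asboolP := cycle_nth x0 hc hi.
  + move=> i hi; rewrite /f => /eqP; rewrite nth_uniq ?ltn_mod// (modn_small (ltnW hi)).
    have [h|h] := ltnP i.+2 n; first by rewrite (modn_small h) => /eqP; lia.
    have -> : i.+2 = n by apply/eqP; rewrite eqn_leq hi h.
    by rewrite modnn => /eqP i0; rewrite i0 in h; move: sc; rewrite -/n; lia.
- move=> V /vertexP[g ug ->].
  have -> : [set W | lat_adj (hclass g) W] = (fun r => hclass (g *m line_mx r)) @` [set r | r != (false, false)].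
    by apply/seteqP; split=> [W /(adjP _ ug)[r r0 ->]|_ [r r0 <-]]; [exists r|apply/(adjP _ ug); exists r].
  apply: (card_eq_trans (inj_card_eq _)).
    by move=> r r'; rewrite !inE => r0 r0'; exact: hclass_line_inj.
  have -> : [set r : bool * bool | r != (false, false)] = [set` [:: (true, true); (true, false); (false, true)]].
    by apply/seteqP; split=> -[[] []].
  exact: card_uniq_seq.
Qed.

End BTTree.

(** * Quaternions acting on the tree *)

Lemma laurent_dvr : dvr_F2 (@laur_int 'F_2) (laurX 'F_2).
Proof.
split.
- exact: laur_int1.
- exact: laur_intD.
- exact: laur_intN.
- exact: laur_intM.
- exact: laur_intX.
- exact: laurX_neq0.
- by move=> h; apply: (@laur_max1 'F_2); rewrite /laur_max /= mul1r.
- exact: laur_cases.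
- move=> x /laur_residue[c]; have [-> | ->] : c = 0 \/ c = 1.
  + by case: c => -[|[|//]] i; [left|right]; apply: val_inj.
  + by rewrite rmorph0 subr0; left.
  + by rewrite rmorph1; right.
Qed.

Lemma BT_vertexE : @BT_vertex 'F_2 = lat_vertex (@laur_int 'F_2).
Proof. by []. Qed.
Lemma BT_adjE : @BT_adj 'F_2 = lat_adj (@laur_int 'F_2) (laurX 'F_2).
Proof. by []. Qed.
Lemma BT_actE : @BT_act 'F_2 = @act_lat (laurent 'F_2).
Proof. by []. Qed.

Lemma T_vertexE : T_vertex = lat_vertex (@laur_int 'F_2).
Proof. exact BT_vertexE. Qed.
Lemma T_adjE : T_adj = lat_adj (@laur_int 'F_2) (laurX 'F_2).
Proof. exact BT_adjE. Qed.

Lemma T_regular : regular_tree T_vertex T_adj 3.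
Proof. by rewrite T_vertexE T_adjE; apply: BT_tree_regular laurent_dvr. Qed.

Section ProjectiveQuaternions.
Variables (F : fieldType) (a b : F).
Local Notation Q := (quat a b).
Implicit Types (x y : Q) (g : pquat a b).

Lemma pclassE (u : qunits a b) : pclass (val u) = (\pi_(pquat a b) u)%qT.
Proof. by rewrite /pclass valKd. Qed.

Lemma pclass_repr g : pclass (val (repr g)) = g.
Proof. by rewrite pclassE reprK. Qed.

Lemma repr_unit g : val (repr g) \is a GRing.unit. Proof. exact: valP. Qed.

Lemma pclass_eq x y : x \is a GRing.unit -> y \is a GRing.unit ->
  pclass x = pclass y <-> exists2 c, c != 0 & x = c *: y.
Proof.
move=> ux uy; rewrite -[x]/(val (exist _ x ux : qunits a b)) -[y]/(val (exist _ y uy : qunits a b)).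
rewrite !pclassE; split=> [/eqmodP/asboolP//|h]; exact/eqmodP/asboolP.
Qed.

Lemma repr_pclass x : x \is a GRing.unit -> exists2 c, c != 0 & val (repr (pclass x)) = c *: x.
Proof. by move=> ux; apply/(pclass_eq (repr_unit _) ux); rewrite pclass_repr. Qed.

Lemma pclassM x y : x \is a GRing.unit -> y \is a GRing.unit ->
  (pclass x * pclass y)%g = pclass (x * y).
Proof.
move=> ux uy; rewrite -[x]/(val (exist _ x ux : qunits a b)) -[y]/(val (exist _ y uy : qunits a b)).
rewrite -[val _ * val _]/(val (qu_mul (exist _ x ux) (exist _ y uy))) !pclassE.
by rewrite pi_pq_mul.
Qed.

Lemma pclass1 : pclass (1 : Q) = 1%g.
Proof. by rewrite -[1]/(val (@qu_one F a b)) pclassE. Qed.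

Lemma pclassV x : x \is a GRing.unit -> (pclass x)^-1%g = pclass x^-1.
Proof.
move=> ux; rewrite -[x]/(val (exist _ x ux : qunits a b)).
rewrite -[(val _)^-1]/(val (qu_inv (exist _ x ux))) !pclassE.
by rewrite pi_pq_inv.
Qed.

Lemma pclass_surj g : exists2 x, x \is a GRing.unit & g = pclass x.
Proof. by exists (val (repr g)); [exact: repr_unit|rewrite pclass_repr]. Qed.

Variables (L : fieldType) (e : {rmorphism F -> L}) (mI mJ : 'M[L]_2).
Hypothesis mII : mI *m mI = mI + (e a)%:M.
Hypothesis mJJ : mJ *m mJ = (e b)%:M.
Hypothesis mJI : mJ *m mI = mJ - mI *m mJ.
Local Notation rep := (quat_rep e mI mJ : Q -> _).

Lemma quat_repM x y : rep (x * y) = rep x *m rep y.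
Proof.
case: x y => [x0 x1 x2 x3] [y0 y1 y2 y3]; rewrite /quat_rep /=.
have e1 : mI *m (mI *m mJ) = mI *m mJ + e a *: mJ by rewrite mulmxA mII mulmxDl mul_scalar_mx.
have e2 : mJ *m (mI *m mJ) = (e b)%:M - e b *: mI.
  by rewrite mulmxA mJI mulmxBl -mulmxA !mJJ mul_mx_scalar.
have e3 : mI *m mJ *m mI = - (e a *: mJ) by rewrite -mulmxA mJI mulmxBr e1 opprD addrA subrr add0r.
have e4 : mI *m mJ *m mJ = e b *: mI by rewrite -mulmxA mJJ mul_mx_scalar.
have e5 : mI *m mJ *m (mI *m mJ) = - (e a * e b)%:M.
  by rewrite mulmxA e3 mulNmx -scalemxAl mJJ scale_scalar_mx.
rewrite !mulmxDl !mulmxDr -!scalemxAl -!scalemxAr !mul_scalar_mx !mul_mx_scalar.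
rewrite !mII !mJJ !mJI e1 e2 e3 e4 e5 !(rmorphD e, rmorphN e, rmorphM e).
move: (mI *m mJ) (e a) (e b) => P a' b'.
move: (e x0) (e x1) (e x2) (e x3) (e y0) (e y1) (e y2) (e y3) => u0 u1 u2 u3 v0 v1 v2 v3.
by apply/matrixP => i j; rewrite !mxE; case: (i == j); rewrite !(mulr1n, mulr0n); ring.
Qed.

Lemma quat_rep1 : rep 1 = 1%:M.
Proof.
by rewrite /quat_rep /= (rmorph1 e) (rmorph0 e) !scale0r !addr0.
Qed.

Lemma quat_repZ c x : rep (c *: x) = e c *: rep x.
Proof.
by rewrite /quat_rep /= !(rmorphM e) !scalerDr scale_scalar_mx !scalerA.
Qed.

Lemma quat_repD x y : rep (x + y) = rep x + rep y.
Proof.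
rewrite /quat_rep /= !(rmorphD e); move: (mI *m mJ) => mIJ.
by apply/matrixP => i j; rewrite !mxE; case: (i == j); rewrite !(mulr1n, mulr0n); ring.
Qed.

Lemma quat_rep_unit x : x \is a GRing.unit -> rep x \in unitmx.
Proof.
move=> ux; have : rep x *m rep x^-1 = 1%:M by rewrite -quat_repM divrr// quat_rep1.
by case/mulmx1_unit.
Qed.

Variables (O : set L) (X : L) (dvr : dvr_F2 O X).
Implicit Types V W : set (set 'cV[L]_2).

Definition act g := act_lat (rep (val (repr g))).

(** The chosen representative of the class is a scalar multiple of x, and scalars act trivially on
    homothety classes. *)
Lemma act_pclass x h : x \is a GRing.unit ->
  act (pclass x) (hclass O h) = hclass O (rep x *m h).
Proof.
move=> ux; have [c c0 e'] := repr_pclass ux.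
by rewrite /act (hclass_act) e' quat_repZ -scalemxAl hclass_scale// fmorph_eq0.
Qed.

Lemma act_vertex g V : lat_vertex O V -> lat_vertex O (act g V).
Proof.
have [x ux ->] := pclass_surj g.
move=> /vertexP[h uh ->]; rewrite act_pclass//; apply/vertexP; exists (rep x *m h) => //.
by apply: unitmx_mulV uh; exact: quat_rep_unit.
Qed.

Lemma actM g h V : lat_vertex O V -> act (g * h)%g V = act g (act h V).
Proof.
have [x ux ->] := pclass_surj g; have [y uy ->] := pclass_surj h.
move=> /vertexP[k uk ->]; rewrite pclassM// !act_pclass ?unitrMl//.
by rewrite quat_repM mulmxA.
Qed.

Lemma act1 V : lat_vertex O V -> act 1%g V = V.
Proof.
by move=> /vertexP[k uk ->]; rewrite -pclass1 act_pclass ?unitr1// quat_rep1 mul1mx.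
Qed.

Lemma actK g V : lat_vertex O V -> act g^-1%g (act g V) = V.
Proof. by move=> hV; rewrite -actM// mulVg act1. Qed.

Lemma act_adj g V W : lat_adj O X V W -> lat_adj O X (act g V) (act g W).
Proof.
have [x ux ->] := pclass_surj g => -[/[dup] /vertexP[h uh ->] hV hW adj].
have : lat_adj O X (hclass O h) W by [].
move=> /(adjP dvr _ uh)[r r0 ->]; rewrite !act_pclass//; apply/(adjP dvr).
  by apply: unitmx_mulV uh; exact: quat_rep_unit.
by exists r => //; rewrite mulmxA.
Qed.

End ProjectiveQuaternions.

(** * Evaluation of rational functions at elements transcendental over the constants *)

Section RationalEvaluation.
Variables (R : idomainType) (K L : fieldType) (i : {rmorphism R -> K}) (j : {rmorphism R -> L}).
Variable e : K -> L.
Hypothesis fracP : forall x, exists n d : R, d != 0 /\ x = i n / i d.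
Hypothesis i0 : forall r, r != 0 -> i r != 0.
Hypothesis j0 : forall r, r != 0 -> j r != 0.
Hypothesis eE : forall n d, d != 0 -> e (i n / i d) = j n / j d.

Lemma frac_eval_zmod_morphism : zmod_morphism e.
Proof.
move=> x y; have [n [d [d0 ->]]] := fracP x; have [n' [d' [d0' ->]]] := fracP y.
rewrite !eE// -!mulNr -!rmorphN !addf_div ?i0 ?j0// -!rmorphM -!rmorphD eE//.
exact: mulf_neq0.
Qed.

Lemma frac_eval_monoid_morphism : monoid_morphism e.
Proof.
split; first by rewrite -[1](divr1 1) -(rmorph1 i) eE ?oner_neq0// !rmorph1 divr1.
move=> x y; have [n [d [d0 ->]]] := fracP x; have [n' [d' [d0' ->]]] := fracP y.
by rewrite !eE// !mulf_div -!rmorphM eE// mulf_neq0.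
Qed.
End RationalEvaluation.

Section Transcendence.
Variables (L : fieldType) (O : set L) (X : L) (dvr : dvr_F2 O X).
Variables (F : fieldType) (c : {rmorphism F -> L}).
Hypothesis Oc : forall x, O (c x).
Implicit Types (a u : L) (r : {poly F}).
Local Notation m := (dvr_max O X).

Let c_unit x : x != 0 -> ~ m (c x).
Proof.
move=> x0; apply: (dvr_unit_max dvr); first by rewrite fmorph_eq0.
by split; rewrite -?fmorphV.
Qed.

Lemma dvr_int_horner a r : O a -> O (map_poly c r).[a].
Proof.
move=> ha; elim/poly_ind: r => [|r x IH].
  by rewrite rmorph0 horner0; exact: (dvr_int0 dvr).
rewrite rmorphD rmorphM /= map_polyX map_polyC hornerMXaddC.
by apply: (dvr_intD dvr) (Oc _); apply: (dvr_intM dvr).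
Qed.

(** The value is congruent to the nonzero constant term, which is a unit. *)
Lemma dvr_horner_max a r : m a -> r.[0] != 0 -> ~ m (map_poly c r).[a].
Proof.
move=> ma; elim/poly_ind: r => [|r x _]; first by rewrite horner0 eqxx.
rewrite hornerMXaddC mulr0 add0r => x0; rewrite rmorphD rmorphM /= map_polyX map_polyC hornerMXaddC.
have mr : m ((map_poly c r).[a] * a).
  exact: (dvr_maxMl dvr (dvr_int_horner r (dvr_max_int dvr ma)) ma).
by move=> h; apply: (c_unit x0); rewrite -(addKr ((map_poly c r).[a] * a) (c x));
  apply: (dvr_maxD dvr) h; exact: (dvr_maxN dvr).
Qed.

Lemma horner_rev_poly a r n : a != 0 -> size r = n.+1 ->
  (map_poly c r).[a^-1] * a ^+ n = (map_poly c (\poly_(k < n.+1) r`_(n - k))).[a].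
Proof.
move=> a0 sr; have le : leq (size (map_poly c (\poly_(k < n.+1) r`_(n - k)))) n.+1.
  by rewrite size_map_poly size_poly.
rewrite (horner_coef_wide _ le) horner_coef size_map_poly sr mulr_suml.
rewrite (reindex_inj rev_ord_inj) /=; apply: eq_bigr => k _.
rewrite subSS !coef_map /= coef_poly ltn_ord -mulrA; congr (_ * _).
by rewrite -[in X in _ * X](subnK (leq_ord k)) exprD mulrA -exprMn (mulVf a0) expr1n mul1r.
Qed.

Lemma dvr_transcendental a r : m a -> a != 0 -> r != 0 -> (map_poly c r).[a] != 0.
Proof.
move=> ma a0 r0; have [k [q]] := multiplicity_XsubC r 0; rewrite r0 subr0 /= => q0 ->.
rewrite rmorphM rmorphXn /= map_polyX hornerM hornerXn mulf_neq0 ?expf_neq0//.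
by apply/eqP => h; apply: (dvr_horner_max ma q0); rewrite h; exact: (dvr_max0 dvr).
Qed.

(** Up to a power of a this is the value at a of the reversed polynomial, whose constant term is the
    leading coefficient of r. *)
Lemma dvr_transcendentalV a r : m a -> a != 0 -> r != 0 -> (map_poly c r).[a^-1] != 0.
Proof.
move=> ma a0 r0; apply/eqP => h.
have sr : size r = (size r).-1.+1 by rewrite prednK// size_poly_gt0.
have := horner_rev_poly a0 sr; rewrite h mul0r => /esym e.
have := @dvr_horner_max a (\poly_(k < (size r).-1.+1) r`_((size r).-1 - k)) ma.
rewrite e; apply; last exact: (dvr_max0 dvr).
by rewrite horner_coef0 coef_poly /= subn0 -lead_coefE lead_coef_eq0.
Qed.

End Transcendence.

(** * The generators at the two places *)

Section Matrix2.
Variable L : fieldType.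
Implicit Types p q r s : L.

Lemma mx2M p q r s p' q' r' s' : mx2 p q r s *m mx2 p' q' r' s' =
  mx2 (p * p' + q * r') (p * q' + q * s') (r * p' + s * r') (r * q' + s * s').
Proof.
by apply/matrixP => i j; rewrite !mxE !big_ord_recl big_ord0 !mxE /= addr0;
  case: (ord2 i) => ->; case: (ord2 j) => ->.
Qed.
Lemma mx2D p q r s p' q' r' s' :
  mx2 p q r s + mx2 p' q' r' s' = mx2 (p + p') (q + q') (r + r') (s + s').
Proof. by apply/matrixP => i j; rewrite !mxE; do 2?case: ifP. Qed.
Lemma mx2N p q r s : - mx2 p q r s = mx2 (- p) (- q) (- r) (- s).
Proof. by apply/matrixP => i j; rewrite !mxE; do 2?case: ifP. Qed.
Lemma mx2Z c p q r s : c *: mx2 p q r s = mx2 (c * p) (c * q) (c * r) (c * s).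
Proof. by apply/matrixP => i j; rewrite !mxE; do 2?case: ifP. Qed.
Lemma mx2C c : c%:M = mx2 c 0 0 c :> 'M[L]_2.
Proof.
by apply/matrixP => i j; rewrite !mxE; case: (ord2 i) => ->; case: (ord2 j) => ->.
Qed.
Lemma mx2_unit p q r s : p * s - q * r != 0 -> mx2 p q r s \in unitmx.
Proof.
move=> d0; have : mx2 p q r s *m ((p * s - q * r)^-1 *: mx2 s (- q) (- r) p) = 1%:M.
  rewrite -scalemxAr mx2M mx2Z mx2C; congr mx2; field => //.
by case/mulmx1_unit.
Qed.
Lemma mx2_invmx p q r s : p * s - q * r != 0 ->
  invmx (mx2 p q r s) = (p * s - q * r)^-1 *: mx2 s (- q) (- r) p.
Proof.
move=> d0; rewrite -[RHS](mulKmx (mx2_unit d0)) -scalemxAr mx2M.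
rewrite (_ : mx2 (p * s + _) _ _ _ = (p * s - q * r)%:M); last by rewrite mx2C; congr mx2; ring.
by rewrite scale_scalar_mx mulVf// mulmx1.
Qed.

End Matrix2.

Section Steps.
Variables (L : fieldType) (O : set L) (X : L) (dvr : dvr_F2 O X).
Local Notation m := (dvr_max O X).
Local Notation rs := (rs O X).
Local Notation hclass := (hclass O).
Implicit Types p q r s : L.

Lemma mx2_std p q r s : O p -> O q -> O r -> O s -> O (p * s - q * r)^-1 ->
  p * s - q * r != 0 -> hclass (mx2 p q r s) = hclass 1%:M.
Proof.
move=> hp hq hr hs hd d0; have uk := mx2_unit d0; apply: hclass_eq; rewrite lat1.
apply/seteqP; split=> v; last first.
  move=> hv; apply/(latP O _ uk); rewrite mx2_invmx// mx2Z [v]col2E mx2_col2.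
  have := hv 0; have := hv 1; move: (v 0 0) (v 1 0) => x y hy hx.
  apply/std_col2; split; apply: (dvr_intD dvr); apply: (dvr_intM dvr) => //;
    apply: (dvr_intM dvr) => //; exact: (dvr_intN dvr).
move=> [w hw <-]; rewrite [w]col2E mx2_col2.
by apply/std_col2; split; apply: (dvr_intD dvr); apply: (dvr_intM dvr).
Qed.

(** An integral matrix whose determinant is a uniformizer times a unit maps the standard lattice
    onto a neighbour, and the residue of a column that is nonzero names the line. *)
Lemma mx2_neighbor p q r s (l : bool * bool) : O p -> O q -> O r -> O s ->
  m (p * s - q * r) -> ~ m ((p * s - q * r) / X) -> l != (false, false) ->
  (rs p, rs r) = l \/ (rs q, rs s) = l ->
  hclass (mx2 p q r s) = hclass (line_mx X l).
Proof.
move=> hp hq hr hs md nd l0 hl.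
have X0 := dvrX0 dvr.
have /(dvr_unitP dvr) /(_ nd)[d0' ud] : O ((p * s - q * r) / X) by [].
have d0 : p * s - q * r != 0 by apply: contraNneq d0' => ->; rewrite mul0r.
have uk := mx2_unit d0; set k := mx2 p q r s in uk *.
have kint i j : O (k i j) by rewrite mxE; do 2?case: ifP.
have sub1 : lat O k `<=` std O by move=> _ [v hv <-]; exact: (std_mul_int dvr).
have [c [hc lc resc]] : exists c, [/\ std O c, lat O k c & resv O X c = l].
  have [e|e] := hl; [exists (col2 p r)|exists (col2 q s)]; split; try exact/std_col2; rewrite ?resv_col2//.
  - exists (col2 1 0); first by apply/std_col2; split; [exact: (dvr_int1 dvr)|exact: (dvr_int0 dvr)].
    by rewrite mx2_col2 !mulr1 !mulr0 !addr0.
  - exists (col2 0 1); first by apply/std_col2; split; [exact: (dvr_int0 dvr)|exact: (dvr_int1 dvr)].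
    by rewrite mx2_col2 !mulr1 !mulr0 !add0r.
have eD : X * (p * s - q * r)^-1 = ((p * s - q * r) / X)^-1 by rewrite invfM invrK mulrC.
have supX : scale_lat X (std O) `<=` lat O k.
  move=> _ [v hv <-]; apply/(latP O _ uk); rewrite mx2_invmx// -scalemxAr -scalemxAl scalerA eD.
  apply: (stdZ dvr); first by case: ud.
  apply: (std_mul_int dvr) hv => i j; rewrite mxE; do 2?case: ifP => //; by move=> *; apply: (dvr_intN dvr).
have nstd : ~ (std O `<=` lat O k).
  move=> hs'; have /hs'/(latP O _ uk) := (std_col2 O 1 0).2 (conj (dvr_int1 dvr) (dvr_int0 dvr)).
  have /hs'/(latP O _ uk) := (std_col2 O 0 1).2 (conj (dvr_int0 dvr) (dvr_int1 dvr)).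
  rewrite mx2_invmx// mx2Z !mx2_col2 !(mulr0, mulr1, addr0, add0r).
  move=> /std_col2[h1 h2] /std_col2[h3 h4].
  apply: (dvr_max1 dvr); rewrite -(mulfV d0).
  apply: (dvr_maxMr dvr) md _.
  (* If the image were the whole standard lattice, the inverse matrix would be integral, and so
     would its determinant D^-1. *)
  set D := p * s - q * r in d0 h1 h2 h3 h4 *.
  have -> : D^-1 = D^-1 * p * (D^-1 * s) - D^-1 * - q * (D^-1 * - r).
    rewrite (_ : _ - _ = D^-1 * D^-1 * D); last by rewrite /D; ring.
    by rewrite -mulrA mulVf// mulr1.
  by apply: (dvr_intB dvr); apply: (dvr_intM dvr).
have [|||l' l0' el'] := @between_line L O X dvr (lat O k).
- by move=> v w; exact: (latD dvr).
- split=> // h; move: (h c lc) => /(resv0 dvr); rewrite resc => e; by rewrite e eqxx in l0.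
- by split.
apply: hclass_eq; rewrite el' (lat_line dvr l0); congr line_lattice.
have : line_lattice O X l' c by rewrite -el'.
by move=> [_]; rewrite resc => -[e|//]; rewrite e eqxx in l0.
Qed.

End Steps.

Section GeneratorCoordinates.
Variables (F : fieldType) (x : F).
Local Notation I := (qI x (1 + x ^+ 3)).
Local Notation J := (qJ x (1 + x ^+ 3)).
Local Notation mkQ := (Quat x (1 + x ^+ 3)).

Lemma C1_coord : (1 + x ^+ 2)%:A + I * J = mkQ (1 + x ^+ 2) 0 0 1.
Proof. by congr Quat => /=; ring. Qed.
Lemma C2_coord : (x + x ^+ 2)%:A + I * J = mkQ (x + x ^+ 2) 0 0 1.
Proof. by congr Quat => /=; ring. Qed.
Lemma B1_coord : (1 + x) *: I + J = mkQ 0 (1 + x) 1 0.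
Proof. by congr Quat => /=; ring. Qed.
Lemma B2_coord : (x + x ^+ 2)%:A + (1 + x) *: I + J + I * J = mkQ (x + x ^+ 2) (1 + x) 1 1.
Proof. by congr Quat => /=; ring. Qed.
End GeneratorCoordinates.

Section Places.
Variables (L : fieldType) (O : set L) (X : L) (dvr : dvr_F2 O X).
Hypothesis char2 : (2 : L) = 0.
Variables (F : fieldType) (x : F) (e : {rmorphism F -> L}).
Local Notation m := (dvr_max O X).
Local Notation rs := (rs O X).
Local Notation hclass := (hclass O).
Local Notation Q := (quat x (1 + x ^+ 3)).
Local Notation mkQ := (Quat x (1 + x ^+ 3)).

Lemma rsM a b : O a -> O b -> rs (a * b) = rs a && rs b.
Proof.
move=> ha hb; have [ea|na] := boolP (rs a); last first.
  by apply/(rsP O X); apply: (dvr_maxMr dvr) hb; apply/rsP; exact: negbTE.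
have [eb|nb] := boolP (rs b); last first.
  by apply/(rsP O X); apply: (dvr_maxMl dvr) ha _; apply/rsP; exact: negbTE.
have [a0 [_ ua]] := dvr_unitP dvr ha ((rs_true O X a).1 ea).
apply/(rs_true O X) => h; apply: ((rs_true O X b).1 eb).
by rewrite -(mulKf a0 b); exact: (dvr_maxMl dvr).
Qed.

Lemma rsX : rs X = false. Proof. by apply/(rsP O X); exact: dvr_maxX. Qed.
Lemma rs1 : rs 1 = true. Proof. by apply/(rs_true O X); exact: dvr_max1. Qed.
Lemma rs0 : rs 0 = false. Proof. by apply/(rsP O X); exact: dvr_max0. Qed.

Lemma rs_unit a : O a -> rs a -> a != 0 /\ O a^-1.
Proof. by move=> ha /(rs_true O X) /(dvr_unitP dvr ha)[a0 []]. Qed.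

(** The [ring] and [field] tactics do not know the characteristic, so the two sides are compared
    over the integers; the witness q is half of their difference. *)
Lemma eq_char2 (q a b : L) : a = b + 2 * q -> a = b.
Proof. by rewrite char2 mul0r addr0. Qed.
Arguments eq_char2 q {a b}.

Lemma mx2_neighbor_rs (p q r s d : L) l : O p -> O q -> O r -> O s -> O d -> rs d ->
  p * s - q * r = X * d -> l != (false, false) -> (rs p, rs r) = l \/ (rs q, rs s) = l ->
  hclass (mx2 p q r s) = hclass (line_mx X l).
Proof.
move=> hp hq hr hs hd /(rs_true O X) rd e' l0; have X0 := dvrX0 dvr.
apply: (mx2_neighbor dvr) => //; first by rewrite e'; apply/dvr_maxP => //; exists d.
by rewrite e' mulrAC divff// mul1r.
Qed.

Ltac dvr_int := first [assumption | exact: (dvr_int1 dvr) | exact: (dvr_int0 dvr) | exact: (dvr_intX dvr)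
  | apply: (dvr_intXn dvr); dvr_int | apply: (dvr_intN dvr); dvr_int
  | apply: (dvr_intD dvr); dvr_int | apply: (dvr_intM dvr); dvr_int].
Ltac dvr_rs := rewrite ?expr2 ?exprS ?expr0; repeat first
  [ rewrite (rsD dvr); [|dvr_int|dvr_int] | rewrite (rsN dvr) | rewrite rsM; [|dvr_int|dvr_int]];
  rewrite ?rsX ?rs1 ?rs0.

Section PlaceY.
Hypothesis ex : e x = X ^+ 2 + X.
Let y := X.
Let zy := y ^+ 2 + y.
Let mI := mx2 y 0 0 (1 + y).
Let mJ := mx2 0 (1 + zy ^+ 3) 1 0.
Local Notation rep := (quat_rep e mI mJ : Q -> _).

Lemma repy_II : mI *m mI = mI + (e x)%:M.
Proof.
rewrite ex mx2M mx2C mx2D; congr mx2; try (rewrite /y; ring).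
by apply: (eq_char2 (- X)); rewrite /y; ring.
Qed.
Lemma repy_JJ : mJ *m mJ = (e (1 + x ^+ 3))%:M.
Proof. by rewrite rmorphD rmorph1 rmorphXn /= ex mx2M mx2C; congr mx2; rewrite /zy /y; ring. Qed.
Lemma repy_JI : mJ *m mI = mJ - mI *m mJ.
Proof.
rewrite !mx2M mx2N mx2D; congr mx2; try ring.
  by apply: (eq_char2 (y * (1 + zy ^+ 3))); ring.
by apply: (eq_char2 y); ring.
Qed.

Let b := 1 + zy ^+ 3.

Lemma repy_E x0 x1 x2 x3 : rep (mkQ x0 x1 x2 x3) =
  mx2 (e x0 + e x1 * y) (e x2 * b + e x3 * (y * b)) (e x2 + e x3 * (1 + y)) (e x0 + e x1 * (1 + y)).
Proof.
rewrite /quat_rep /= mx2M mx2C !mx2Z !mx2D; congr mx2; rewrite /b; ring.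
Qed.

Lemma repy_1 : rep (mkQ (1 + x ^+ 2) 0 0 1) = mx2 (1 + zy ^+ 2) (y * b) (1 + y) (1 + zy ^+ 2).
Proof. by rewrite repy_E !(rmorphD e, rmorphXn e) rmorph1 rmorph0 /= ex; congr mx2; rewrite -/zy; ring. Qed.
Lemma repy_2 : rep (mkQ (x + x ^+ 2) 0 0 1) = mx2 (zy + zy ^+ 2) (y * b) (1 + y) (zy + zy ^+ 2).
Proof. by rewrite repy_E !(rmorphD e, rmorphXn e) rmorph1 rmorph0 /= ex; congr mx2; rewrite -/zy; ring. Qed.
Lemma repy_3 : rep (mkQ 0 (1 + x) 1 0) = mx2 ((1 + zy) * y) b 1 ((1 + zy) * (1 + y)).
Proof. by rewrite repy_E !(rmorphD e, rmorphXn e) rmorph1 rmorph0 /= ex; congr mx2; rewrite -/zy; ring. Qed.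
Lemma repy_4 : rep (mkQ (x + x ^+ 2) (1 + x) 1 1) =
  mx2 (zy + zy ^+ 2 + (1 + zy) * y) (b + y * b) y (zy + zy ^+ 2 + (1 + zy) * (1 + y)).
Proof.
rewrite repy_E !(rmorphD e, rmorphXn e) rmorph1 /= ex; congr mx2; try by rewrite -/zy; ring.
by apply: (eq_char2 1); ring.
Qed.
(** The quaternion is the trace 1 + x minus B2, i.e. the conjugate of B2, which represents
    b_2^-1. *)
Lemma repy_5 : rep (mkQ (1 + x) 0 0 0 - mkQ (x + x ^+ 2) (1 + x) 1 1) =
  mx2 (1 + zy - (zy + zy ^+ 2 + (1 + zy) * y)) (- (b + y * b)) (- y)
    (- (zy + zy ^+ 2 + (1 + zy) * y)).
Proof.
rewrite quat_repD; have -> : rep (- mkQ (x + x ^+ 2) (1 + x) 1 1) = - rep (mkQ (x + x ^+ 2) (1 + x) 1 1).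
  by rewrite -scaleN1r quat_repZ rmorphN1 scaleN1r.
rewrite repy_4 repy_E !(rmorphD e) rmorph1 rmorph0 ex mx2N mx2D; congr mx2; rewrite -/zy; ring.
Qed.

(** C1 and B1 have norm 1 + z, a unit at z = 0, so their integral matrices preserve the standard
    lattice. *)
Lemma hclass_y1 : hclass (rep (mkQ (1 + x ^+ 2) 0 0 1) *m 1%:M) = hclass 1%:M.
Proof.
rewrite mulmx1 repy_1.
have [d0 dV] : (1 + zy ^+ 2) * (1 + zy ^+ 2) - y * b * (1 + y) != 0 /\ O ((1 + zy ^+ 2) * (1 + zy ^+ 2) - y * b * (1 + y))^-1.
  apply: rs_unit; first by rewrite /b /zy /y; dvr_int.
  by rewrite /b /zy /y; dvr_rs.
by apply: (mx2_std dvr) => //; rewrite /b /zy /y; dvr_int.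
Qed.

Lemma hclass_y3 : hclass (rep (mkQ 0 (1 + x) 1 0) *m 1%:M) = hclass 1%:M.
Proof.
rewrite mulmx1 repy_3.
have [d0 dV] : (1 + zy) * y * ((1 + zy) * (1 + y)) - b * 1 != 0 /\ O ((1 + zy) * y * ((1 + zy) * (1 + y)) - b * 1)^-1.
  apply: rs_unit; first by rewrite /b /zy /y; dvr_int.
  by rewrite /b /zy /y; dvr_rs.
by apply: (mx2_std dvr) => //; rewrite /b /zy /y; dvr_int.
Qed.

(** C2, B2 and the conjugate of B2 have norm z(1 + z), with z = y(1 + y), so the determinant has
    valuation 1 and a column residue gives the line; the witness d is the determinant divided by
    y. *)
Lemma hclass_y2 : hclass (rep (mkQ (x + x ^+ 2) 0 0 1) *m 1%:M) = hclass (line_mx X (false, true)).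
Proof.
rewrite mulmx1 repy_2.
apply: (mx2_neighbor_rs (d := y * (1 + y) ^+ 2 * (1 + zy) ^+ 2 - b * (1 + y))) => //;
  rewrite /b /zy /y; try dvr_int; try (by dvr_rs); first by ring.
by left; dvr_rs.
Qed.

Lemma hclass_y4 : hclass (rep (mkQ (x + x ^+ 2) (1 + x) 1 1) *m 1%:M) = hclass (line_mx X (true, true)).
Proof.
rewrite mulmx1 repy_4.
apply: (mx2_neighbor_rs (d := ((1 + y) * (1 + zy) + (1 + zy)) * (zy + zy ^+ 2 + (1 + zy) * (1 + y)) - (b + y * b))) => //;
  rewrite /b /zy /y; try dvr_int; try (by dvr_rs); first by ring.
by right; dvr_rs.
Qed.

Lemma hclass_y5 : hclass (rep (mkQ (1 + x) 0 0 0 - mkQ (x + x ^+ 2) (1 + x) 1 1) *m 1%:M) =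
  hclass (line_mx X (true, false)).
Proof.
rewrite mulmx1 repy_5.
apply: (mx2_neighbor_rs (d := - ((1 + y) * (1 + zy) + (1 + zy)) * (1 + zy - (zy + zy ^+ 2 + (1 + zy) * y)) - (b + y * b))) => //;
  rewrite /b /zy /y; try dvr_int; try (by dvr_rs); first by ring.
by left; dvr_rs.
Qed.
End PlaceY.

Section PlaceT.
Let t := X.
Let u := t ^+ 2 + t.
Hypothesis ex : e x = u^-1.
Let v := u^-1.
Let mI := mx2 (1 + u + t) (1 + u ^+ 3) v (u + t).
Let mJ := mx2 0 (v + u ^+ 2) (u ^- 2) 0.
Local Notation rep := (quat_rep e mI mJ : Q -> _).

Lemma rt1 : 1 + t != 0 /\ O (1 + t)^-1.
Proof. by apply: rs_unit; rewrite /t; [dvr_int|dvr_rs]. Qed.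

Lemma ut0 : u != 0.
Proof.
have [t10 _] := rt1; rewrite /u (_ : t ^+ 2 + t = t * (1 + t)); last by ring.
by rewrite mulf_neq0//; exact: dvrX0 dvr.
Qed.
Let u0 := ut0.
Let tE : t ^+ 2 = u - t. Proof. by rewrite /u addrK. Qed.

Lemma rept_II : mI *m mI = mI + (e x)%:M.
Proof.
rewrite ex -/v mx2M mx2C mx2D; congr mx2.
- by apply: (eq_char2 (u ^+ 2 + u + u * t)); rewrite /v; field: tE.
- by apply: (eq_char2 ((1 + u ^+ 3) * (u + t))); rewrite /v; field.
- by apply: (eq_char2 (v * (u + t))); rewrite /v; field.
- by apply: (eq_char2 (u ^+ 2 + u * t - t)); rewrite /v; field: tE.
Qed.
Lemma rept_JJ : mJ *m mJ = (e (1 + x ^+ 3))%:M.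
Proof.
by rewrite rmorphD rmorph1 rmorphXn /= ex mx2M mx2C; congr mx2; rewrite /v; field.
Qed.
Lemma rept_JI : mJ *m mI = mJ - mI *m mJ.
Proof.
rewrite !mx2M mx2N mx2D; congr mx2.
- by apply: (eq_char2 (v ^+ 2 + u)); rewrite /v; field.
- by apply: (eq_char2 ((v + u ^+ 2) * (u + t))); rewrite /v; field.
- by apply: (eq_char2 (v ^+ 2 * (u + t))); rewrite /v; field.
- by apply: (eq_char2 (v ^+ 2 + u)); rewrite /v; field.
Qed.

Lemma rept_E x0 x1 x2 x3 : rep (mkQ x0 x1 x2 x3) =
  mx2 (e x0 + e x1 * (1 + u + t) + e x3 * (v ^+ 2 + u))
      (e x1 * (1 + u ^+ 3) + e x2 * (v + u ^+ 2) + e x3 * ((1 + u + t) * (v + u ^+ 2)))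
      (e x1 * v + e x2 * v ^+ 2 + e x3 * ((u + t) * v ^+ 2))
      (e x0 + e x1 * (u + t) + e x3 * (v ^+ 2 + u)).
Proof.
by rewrite /quat_rep /= mx2M mx2C !mx2Z !mx2D; congr mx2; rewrite /v; field.
Qed.

(* The representing matrices are only integral after scaling by u. *)
Let w := (1 + t)^-1.
Let s := t * w.
Let beta := (1 + t ^+ 2) * (1 + u ^+ 3).

Let sE : s = t ^+ 2 * v.
Proof.
have [t10 _] := rt1; have t0 : t != 0 := dvrX0 dvr.
by rewrite /s /w /v (_ : u = t * (1 + t)); [field; rewrite t10|rewrite /u; ring].
Qed.

Lemma rept_1 : u *: rep (mkQ (1 + x ^+ 2) 0 0 1) = mx2 (u + u ^+ 2) beta s (u + u ^+ 2).
Proof.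
rewrite rept_E mx2Z !(rmorphD e, rmorphXn e) rmorph1 rmorph0 /= ex -/v sE; congr mx2.
- by apply: (eq_char2 v); rewrite /v; field.
- by apply: (eq_char2 (t * (1 + u ^+ 3))); rewrite /beta /v; field: tE.
- by apply: (eq_char2 (t * v)); rewrite /v; field: tE.
- by apply: (eq_char2 v); rewrite /v; field.
Qed.
Lemma rept_2 : u *: rep (mkQ (x + x ^+ 2) 0 0 1) = mx2 (1 + u ^+ 2) beta s (1 + u ^+ 2).
Proof.
rewrite rept_E mx2Z !(rmorphD e, rmorphXn e) rmorph1 rmorph0 /= ex -/v sE; congr mx2.
- by apply: (eq_char2 v); rewrite /v; field.
- by apply: (eq_char2 (t * (1 + u ^+ 3))); rewrite /beta /v; field: tE.
- by apply: (eq_char2 (t * v)); rewrite /v; field: tE.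
- by apply: (eq_char2 v); rewrite /v; field.
Qed.
Lemma rept_3 : u *: rep (mkQ 0 (1 + x) 1 0) =
  mx2 ((1 + u) * (1 + t ^+ 2)) (u * (1 + u ^+ 3)) 1 ((1 + u) * t ^+ 2).
Proof.
rewrite rept_E mx2Z !(rmorphD e, rmorphXn e) rmorph1 rmorph0 /= ex -/v; congr mx2.
- by apply: (eq_char2 ((1 + u) * t)); rewrite /v; field: tE.
- by apply: (eq_char2 (1 + u ^+ 3)); rewrite /v; field.
- by apply: (eq_char2 v); rewrite /v; field.
- by apply: (eq_char2 ((1 + u) * t)); rewrite /v; field: tE.
Qed.
Lemma rept_4 : u *: rep (mkQ (x + x ^+ 2) (1 + x) 1 1) =
  mx2 (1 + u ^+ 2 + (1 + u) * (1 + t ^+ 2)) (beta + u * (1 + u ^+ 3)) (s + 1)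
      (1 + u ^+ 2 + (1 + u) * t ^+ 2).
Proof.
rewrite -mx2D -rept_2 -rept_3 -scalerDr -quat_repD; congr (_ *: rep _).
by congr Quat => /=; ring.
Qed.
Lemma rept_5 : u *: rep (mkQ (1 + x) 0 0 0 - mkQ 0 (1 + x) 1 0) =
  mx2 (1 + u - (1 + u) * (1 + t ^+ 2)) (- (u * (1 + u ^+ 3))) (- 1) (1 + u - (1 + u) * t ^+ 2).
Proof.
rewrite quat_repD; have -> : rep (- mkQ 0 (1 + x) 1 0) = - rep (mkQ 0 (1 + x) 1 0).
  by rewrite -scaleN1r quat_repZ rmorphN1 scaleN1r.
rewrite scalerDr scalerN rept_3 rept_E !(rmorphD e) rmorph1 rmorph0 ex mx2N mx2Z mx2D.
by congr mx2; rewrite /v; field.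
Qed.

Let scale_hclass g l : hclass (u *: g) = l -> hclass (g *m 1%:M) = l.
Proof. by rewrite mulmx1 (hclass_scale _ _ u0). Qed.

(** After scaling by u = 1/z the norm z(1+z) of C2 and B2 becomes 1 + u, a unit, while the norm 1+z
    of C1 and B1 becomes u + u^2, of valuation 1. This is the reverse of the situation at z = 0. *)
Lemma hclass_t2 : hclass (rep (mkQ (x + x ^+ 2) 0 0 1) *m 1%:M) = hclass 1%:M.
Proof.
have [_ Ow] := rt1; rewrite -/w in Ow; apply: scale_hclass; rewrite rept_2.
have [d0 dV] : (1 + u ^+ 2) * (1 + u ^+ 2) - beta * s != 0 /\ O ((1 + u ^+ 2) * (1 + u ^+ 2) - beta * s)^-1.
  by apply: rs_unit; rewrite /beta /s /u /t; [dvr_int|dvr_rs].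
by apply: (mx2_std dvr) => //; rewrite /beta /s /u /t; dvr_int.
Qed.

Lemma hclass_t4 : hclass (rep (mkQ (x + x ^+ 2) (1 + x) 1 1) *m 1%:M) = hclass 1%:M.
Proof.
have [_ Ow] := rt1; rewrite -/w in Ow; apply: scale_hclass; rewrite rept_4.
set p := 1 + u ^+ 2 + _; set q := beta + _; set r := s + 1; set d := 1 + u ^+ 2 + _.
have [d0 dV] : p * d - q * r != 0 /\ O (p * d - q * r)^-1.
  by apply: rs_unit; rewrite /p /q /r /d /beta /s /u /t; [dvr_int|dvr_rs].
by apply: (mx2_std dvr) => //; rewrite /p /q /r /d /beta /s /u /t; dvr_int.
Qed.

Lemma hclass_t1 : hclass (rep (mkQ (1 + x ^+ 2) 0 0 1) *m 1%:M) = hclass (line_mx X (true, false)).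
Proof.
have [_ Ow] := rt1; rewrite -/w in Ow; apply: scale_hclass; rewrite rept_1.
have rw : rs w = true.
  apply/(rs_true O X) => /(dvr_maxMl dvr (x := 1 + t)) h; apply: (dvr_max1 dvr).
  by rewrite -(mulfV rt1.1); apply: h; rewrite /t; dvr_int.
apply: (mx2_neighbor_rs (d := t * (1 + t) ^+ 2 * (1 + u) ^+ 2 - beta * w)) => //;
  rewrite /beta /s /u /t; try dvr_int; try ring.
- by dvr_rs; rewrite rw.
- by right; dvr_rs.
Qed.

Lemma hclass_t3 : hclass (rep (mkQ 0 (1 + x) 1 0) *m 1%:M) = hclass (line_mx X (true, true)).
Proof.
apply: scale_hclass; rewrite rept_3.
apply: (mx2_neighbor_rs (d := (1 + u) ^+ 2 * (1 + t ^+ 2) * t - (1 + t) * (1 + u ^+ 3))) => //;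
  rewrite /u /t; try dvr_int; try (by dvr_rs); first by ring.
by left; dvr_rs.
Qed.

Lemma hclass_t5 : hclass (rep (mkQ (1 + x) 0 0 0 - mkQ 0 (1 + x) 1 0) *m 1%:M) =
  hclass (line_mx X (false, true)).
Proof.
apply: scale_hclass; rewrite rept_5.
apply: (mx2_neighbor_rs (d := - (1 + u) * t * (1 + u - (1 + u) * t ^+ 2) - (1 + t) * (1 + u ^+ 3))) => //;
  rewrite /u /t; try dvr_int; try (by dvr_rs); first by ring.
by right; dvr_rs.
Qed.
End PlaceT.
End Places.

Section PlaceMatrices.
Variables (L : fieldType) (X : L).
Let u := X ^+ 2 + X.
Definition yI := mx2 X 0 0 (1 + X).
Definition yJ := mx2 0 (1 + u ^+ 3) 1 0.
Definition tI := mx2 (1 + u + X) (1 + u ^+ 3) u^-1 (u + X).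
Definition tJ := mx2 0 (u^-1 + u ^+ 2) (u ^- 2) 0.
End PlaceMatrices.

Section EmbedK.
Variables (F : fieldType) (a : laurent F).
Hypothesis tr : forall r : {poly F}, r != 0 -> (map_poly (@laurC F) r).[a] != 0.

Let ev : {rmorphism {poly F} -> laurent F} := horner_eval a \o map_poly (@laurC F).

Lemma ratfun_eval_zmod_morphism : zmod_morphism (ratfun_eval a).
Proof.
apply: (@frac_eval_zmod_morphism _ _ _ (@tofrac {poly F}) ev).
- exact: fraction_divE.
- by move=> r r0; rewrite tofrac_eq0.
- exact: tr.
- by move=> n d d0; exact: ratfun_evalE.
Qed.

Lemma ratfun_eval_monoid_morphism : monoid_morphism (ratfun_eval a).
Proof.
apply: (@frac_eval_monoid_morphism _ _ _ (@tofrac {poly F}) ev).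
- exact: fraction_divE.
- by move=> n d d0; exact: ratfun_evalE.
Qed.

Lemma ratfun_eval_poly (r : {poly F}) : ratfun_eval a (tofrac r) = (map_poly (@laurC F) r).[a].
Proof.
rewrite -[tofrac r]divr1 -(rmorph1 (@tofrac {poly F})) (ratfun_evalE _ tr) ?oner_neq0//.
by rewrite rmorph1 hornerC divr1.
Qed.
End EmbedK.

Local Notation L := (laurent 'F_2).

Lemma laurent_char2 : (2 : L) = 0.
Proof.
rewrite -(rmorph0 (@laurC 'F_2)) (_ : (0 : 'F_2) = 2%:R); last exact: val_inj.
by rewrite rmorph_nat.
Qed.

Lemma dvr_max_XX (M : fieldType) (O : set M) X : dvr_F2 O X -> dvr_max O X (X ^+ 2 + X).
Proof.
move=> d; apply: (dvr_maxD d); last exact: (dvr_maxX d).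
by rewrite expr2; apply: (dvr_maxMl d); [exact: (dvr_intX d)|exact: (dvr_maxX d)].
Qed.

Lemma laurent_transcendental (X : L) (dvr : dvr_F2 (@laur_int 'F_2) X) (r : {poly 'F_2}) : r != 0 ->
  (map_poly (@laurC 'F_2) r).[X ^+ 2 + X] != 0 /\ (map_poly (@laurC 'F_2) r).[(X ^+ 2 + X)^-1] != 0.
Proof.
move=> r0; have mX := dvr_max_XX dvr; have X0 := ut0 dvr; have C := @laur_intC 'F_2.
split; first exact: (dvr_transcendental dvr C mX X0 r0).
exact: (dvr_transcendentalV dvr C mX X0 r0).
Qed.

Lemma tr_y (r : {poly 'F_2}) : r != 0 -> (map_poly (@laurC 'F_2) r).[laurX 'F_2 ^+ 2 + laurX 'F_2] != 0.
Proof. by move=> r0; exact (laurent_transcendental laurent_dvr r0).1. Qed.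

Lemma tr_t (r : {poly 'F_2}) :
  r != 0 -> (map_poly (@laurC 'F_2) r).[(laurX 'F_2 ^+ 2 + laurX 'F_2)^-1] != 0.
Proof. by move=> r0; exact (laurent_transcendental laurent_dvr r0).2. Qed.

Definition emb_y : K -> L := ratfun_eval (laurX 'F_2 ^+ 2 + laurX 'F_2).
Definition emb_t : K -> L := ratfun_eval (laurX 'F_2 ^+ 2 + laurX 'F_2)^-1.

HB.instance Definition _ := GRing.isZmodMorphism.Build K L emb_y (ratfun_eval_zmod_morphism tr_y).
HB.instance Definition _ := GRing.isMonoidMorphism.Build K L emb_y (ratfun_eval_monoid_morphism tr_y).
HB.instance Definition _ := GRing.isZmodMorphism.Build K L emb_t (ratfun_eval_zmod_morphism tr_t).
HB.instance Definition _ := GRing.isMonoidMorphism.Build K L emb_t (ratfun_eval_monoid_morphism tr_t).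

Lemma emb_y_poly r : emb_y (tofrac r) = (map_poly (@laurC 'F_2) r).[laurX 'F_2 ^+ 2 + laurX 'F_2].
Proof. exact: ratfun_eval_poly tr_y r. Qed.
Lemma emb_t_poly r : emb_t (tofrac r) = (map_poly (@laurC 'F_2) r).[(laurX 'F_2 ^+ 2 + laurX 'F_2)^-1].
Proof. exact: ratfun_eval_poly tr_t r. Qed.

Lemma emb_y_z : emb_y z = laurX 'F_2 ^+ 2 + laurX 'F_2.
Proof. by rewrite emb_y_poly map_polyX hornerX. Qed.
Lemma emb_t_z : emb_t z = (laurX 'F_2 ^+ 2 + laurX 'F_2)^-1.
Proof. by rewrite emb_t_poly map_polyX hornerX. Qed.




Lemma laurent_yJ (t : L) : mx2 0 (1 + (t ^+ 2 + t) ^+ 3) 1 0 = yJ t. Proof. by []. Qed.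
Lemma laurent_yI (t : L) : mx2 t 0 0 (1 + t) = yI t. Proof. by []. Qed.
Lemma laurent_tI (t : L) (u := t ^+ 2 + t) : mx2 (1 + u + t) (1 + u ^+ 3) u^-1 (u + t) = tI t.
Proof. by []. Qed.
Lemma laurent_tJ (t : L) (u := t ^+ 2 + t) : mx2 0 (u^-1 + u ^+ 2) (u ^- 2) 0  = tJ t.
Proof. by []. Qed.
Lemma rho_yE : rho_y = quat_rep emb_y (yI (laurX 'F_2)) (yJ (laurX 'F_2)).
Proof. by rewrite -laurent_yI -laurent_yJ. Qed.
Lemma rho_tE : rho_t = quat_rep emb_t (tI (laurX 'F_2)) (tJ (laurX 'F_2)).
Proof. rewrite -laurent_tI. rewrite -laurent_tJ. by []. Qed.
Lemma act_0E : act_0 = act emb_y (yI (laurX 'F_2)) (yJ (laurX 'F_2)).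
Proof. apply/funext => g. rewrite /act_0 rho_yE BT_actE. by []. Qed.
Lemma act_ooE : act_oo = act emb_t (tI (laurX 'F_2)) (tJ (laurX 'F_2)).
Proof. apply/funext => g. rewrite /act_oo rho_tE BT_actE. by []. Qed.

(** All that the group theory needs from one place: a tree with a base vertex, a set of elements
    fixing it and a set moving it bijectively to its neighbours. A and B exchange these two roles
    between the two places. *)
Record tree_action (G : groupType) (T : Type) (V : set T) (adj : T -> T -> Prop)
    (act : G -> T -> T) (v0 : T) (fixing moving : set G) : Prop := TreeAction {
  ta_base : V v0;
  ta_vertex : forall g v, V v -> V (act g v);
  ta_actM : forall g h v, V v -> act (g * h)%g v = act g (act h v);
  ta_act1 : forall v, V v -> act 1%g v = v;
  ta_adj : forall g v w, adj v w -> adj (act g v) (act g w);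
  ta_adj_vertex : forall v w, adj v w -> V v /\ V w;
  ta_sym : forall v w, adj v w -> adj w v;
  ta_conn : forall v w, V v -> V w -> exists2 p, path (fun x y => `[< adj x y >]) v p & last v p = w;
  ta_open : forall f n, (0 < n)%N -> (forall i, (i < n)%N -> adj (f i) (f i.+1)) ->
    (forall i, (i.+1 < n)%N -> f i <> f i.+2) -> f n <> f 0%N;
  ta_fix : forall g, fixing g -> act g v0 = v0;
  ta_nbr : forall w, adj v0 w -> exists2 g, moving g & w = act g v0;
  ta_mv : forall g, moving g -> adj v0 (act g v0);
  ta_inj : forall g h, moving g -> moving h -> act g v0 = act h v0 -> g = h
}.

Lemma F2_lines (l l1 l2 l3 : bool * bool) :
  uniq [:: (false, false); l1; l2; l3] -> l != (false, false) -> l \in [:: l1; l2; l3].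
Proof. by case: l1 l2 l3 l => [[] []] [[] []] [[] []] [[] []]. Qed.

Section PlaceActions.
Variables (L : fieldType) (O : set L) (X : L) (dvr : dvr_F2 O X).
Hypothesis char2 : (2 : L) = 0.
Variables (F : fieldType) (x : F) (e : {rmorphism F -> L}).
Hypothesis F_char2 : (2 : F) = 0.
Local Notation Q := (quat x (1 + x ^+ 3)).
Local Notation mkQ := (Quat x (1 + x ^+ 3)).
Local Notation hclass := (hclass O).
Let C1 : Q := mkQ (1 + x ^+ 2) 0 0 1.
Let C2 : Q := mkQ (x + x ^+ 2) 0 0 1.
Let B1 : Q := mkQ 0 (1 + x) 1 0.
Let B2 : Q := mkQ (x + x ^+ 2) (1 + x) 1 1.
Hypotheses (uC1 : C1 \is a GRing.unit) (uC2 : C2 \is a GRing.unit)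
  (uB1 : B1 \is a GRing.unit) (uB2 : B2 \is a GRing.unit).
Let A1 : set (pquat x (1 + x ^+ 3)) := [set pclass B1; (pclass B1)^-1%g; pclass C1].
Let A2 : set (pquat x (1 + x ^+ 3)) := [set pclass B2; (pclass B2)^-1%g; pclass C2].

(** The conjugate represents the inverse, and it is the trace minus y; the condition 2 qu1 y = 0
    makes the trace equal to [quI y]. *)
Lemma pclassV_sub (y : Q) c : y \is a GRing.unit -> 2 * qu1 y = 0 -> quI y = c ->
  (pclass y)^-1%g = pclass (mkQ c 0 0 0 - y) /\ mkQ c 0 0 0 - y \is a GRing.unit.
Proof.
move=> uy y1 <-.
have E : mkQ (quI y) 0 0 0 - y = quconj y.
  case: y y1 {uy} => y0 y1 y2 y3 /= h; congr Quat => /=; rewrite ?add0r//.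
  by rewrite -[LHS]addr0 -h; ring.
rewrite E pclassV//; have ny : qunorm y != 0 := uy.
have -> : quconj y = qunorm y *: y^-1.
  have -> : y^-1 = (qunorm y)^-1 *: quconj y by rewrite -[y^-1]/(quV y) /quV (negPf ny).
  by rewrite scalerA (mulfV ny) scale1r.
have uz : qunorm y *: y^-1 \is a GRing.unit.
  by rewrite scaler_unit ?unitrV// unitfE.
split=> //; apply/esym/(pclass_eq uz); first by rewrite unitrV.
by exists (qunorm y).
Qed.

Section Moving.
Variables (mI mJ : 'M[L]_2).
Hypothesis mII : mI *m mI = mI + (e x)%:M.
Hypothesis mJJ : mJ *m mJ = (e (1 + x ^+ 3))%:M.
Hypothesis mJI : mJ *m mI = mJ - mI *m mJ.
Local Notation act := (@act F x (1 + x ^+ 3) L e mI mJ).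
Variables (fixing : set (pquat x (1 + x ^+ 3))) (b b' c : pquat x (1 + x ^+ 3)).
Variables lb lb' lc : bool * bool.
Hypothesis fixP : forall g, fixing g -> act g (hclass 1%:M) = hclass 1%:M.
Hypothesis eb : act b (hclass 1%:M) = hclass (line_mx X lb).
Hypothesis eb' : act b' (hclass 1%:M) = hclass (line_mx X lb').
Hypothesis ec : act c (hclass 1%:M) = hclass (line_mx X lc).
Hypothesis uniq_lines : uniq [:: (false, false); lb; lb'; lc].

Lemma tree_action_of_lines :
  tree_action (lat_vertex O) (lat_adj O X) act (hclass 1%:M) fixing [set b; b'; c].
Proof.
have u1 : (1%:M : 'M[L]_2) \in unitmx := unitmx1 _ _.
have /and5P[] := uniq_lines; rewrite !inE !negb_or => /and3P[b0 b0' c0] /andP[bb' bc] b'c _ _.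
split.
- by apply/vertexP; exists 1%:M.
- by move=> g v; exact: (act_vertex mII mJJ mJI).
- by move=> g h v; exact: (actM mII mJJ mJI).
- by move=> v; exact: act1.
- by move=> g v w; exact: (act_adj mII mJJ mJI dvr).
- by move=> v w [].
- by move=> v w; exact: (adj_sym dvr).
- by move=> v w; exact: (vertices_connected dvr).
- by move=> f n; exact: (nonbacktracking_open dvr).
- exact: fixP.
- move=> w /(adjP dvr _ u1)[l l0 ->]; rewrite mul1mx.
  have : l \in [:: lb; lb'; lc].
    exact: F2_lines uniq_lines l0.
  rewrite !inE => /or3P[] /eqP ->.
  + by exists b => //; left; left.
  + by exists b' => //; left; right.
  + by exists c => //; right.
- move=> g [[]|] ->; rewrite ?eb ?eb' ?ec; apply/(adjP dvr _ u1).
  + by exists lb; rewrite 1?eq_sym// mul1mx.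
  + by exists lb'; rewrite 1?eq_sym// mul1mx.
  + by exists lc; rewrite 1?eq_sym// mul1mx.
- have inj l l' : (false, false) != l -> (false, false) != l' ->
    hclass (line_mx X l) = hclass (line_mx X l') -> l = l'.
    rewrite ![(false, false) == _]eq_sym => l0 l0' E; apply: (hclass_line_inj dvr u1 l0 l0').
    by rewrite !mul1mx.
  move=> g h [[]|] -> [[]|] -> //; rewrite ?eb ?eb' ?ec => /inj E.
  + by move: bb'; rewrite E ?eqxx.
  + by move: bc; rewrite E ?eqxx.
  + by move: bb'; rewrite E ?eqxx.
  + by move: b'c; rewrite E ?eqxx.
  + by move: bc; rewrite E ?eqxx.
  + by move: b'c; rewrite E ?eqxx.
Qed.

End Moving.

Lemma tree_action_y (ey : e x = X ^+ 2 + X) :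
  tree_action (lat_vertex O) (lat_adj O X)
    (@act F x (1 + x ^+ 3) L e (yI X) (yJ X))
    (hclass 1%:M) A1 A2.
Proof.
have II : yI X *m yI X = yI X + (e x)%:M := repy_II char2 ey.
have JJ : yJ X *m yJ X = (e (1 + x ^+ 3))%:M := repy_JJ ey.
have JI : yJ X *m yI X = yJ X - yI X *m yJ X := repy_JI X char2.
have v1 : lat_vertex O (hclass 1%:M) by apply/vertexP; exists 1%:M; rewrite ?unitmx1.
have [eV uV] : (pclass B2)^-1%g = pclass (mkQ (1 + x) 0 0 0 - B2) /\ mkQ (1 + x) 0 0 0 - B2 \is a GRing.unit.
  by apply: pclassV_sub; rewrite // F_char2 mul0r.
apply: (tree_action_of_lines II JJ JI (lb := (true, true)) (lb' := (true, false)) (lc := (false, true))) => //.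
- have fB1 : act e (yI X) (yJ X) (pclass B1) (hclass 1%:M) = hclass 1%:M.
    by rewrite act_pclass//; exact: (hclass_y3 dvr ey).
  move=> g [[]|] ->; first exact: fB1.
    by rewrite -{1}fB1 (actK II JJ JI _ v1).
  by rewrite act_pclass//; exact: (hclass_y1 dvr ey).
- by rewrite act_pclass//; exact: (hclass_y4 dvr char2 ey).
- by rewrite eV act_pclass//; exact: (hclass_y5 dvr char2 ey).
- by rewrite act_pclass//; exact: (hclass_y2 dvr ey).
Qed.

Lemma tree_action_t (et : e x = (X ^+ 2 + X)^-1) :
  tree_action (lat_vertex O) (lat_adj O X)
    (@act F x (1 + x ^+ 3) L e (tI X) (tJ X))
    (hclass 1%:M) A2 A1.
Proof.
have II : tI X *m tI X = tI X + (e x)%:M := rept_II dvr char2 et.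
have JJ : tJ X *m tJ X = (e (1 + x ^+ 3))%:M := rept_JJ dvr et.
have JI : tJ X *m tI X = tJ X - tI X *m tJ X := rept_JI dvr char2.
have v1 : lat_vertex O (hclass 1%:M) by apply/vertexP; exists 1%:M; rewrite ?unitmx1.
have [eV uV] : (pclass B1)^-1%g = pclass (mkQ (1 + x) 0 0 0 - B1) /\ mkQ (1 + x) 0 0 0 - B1 \is a GRing.unit.
  by apply: pclassV_sub; rewrite // mulr0.
apply: (tree_action_of_lines II JJ JI (lb := (true, true)) (lb' := (false, true)) (lc := (true, false))) => //.
- have fB2 : act e (tI X) (tJ X)
      (pclass B2) (hclass 1%:M) = hclass 1%:M.
    by rewrite act_pclass//; exact: (hclass_t4 dvr char2 et).
  move=> g [[]|] ->; first exact: fB2.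
    by rewrite -{1}fB2 (actK II JJ JI _ v1).
  by rewrite act_pclass//; exact: (hclass_t2 dvr char2 et).
- by rewrite act_pclass//; exact: (hclass_t3 dvr char2 et).
- by rewrite eV act_pclass//; exact: (hclass_t5 dvr char2 et).
- by rewrite act_pclass//; exact: (hclass_t1 dvr char2 et).
Qed.

End PlaceActions.

Definition base : set (set 'cV[laurent 'F_2]_2) := hclass (@laur_int 'F_2) 1%:M.

Lemma C1E : C1 = Quat z (1 + z ^+ 3) (1 + z ^+ 2) 0 0 1. Proof. exact (C1_coord z). Qed.
Lemma C2E : C2 = Quat z (1 + z ^+ 3) (z + z ^+ 2) 0 0 1. Proof. exact (C2_coord z). Qed.
Lemma B1E : B1 = Quat z (1 + z ^+ 3) 0 (1 + z) 1 0. Proof. exact (B1_coord z). Qed.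
Lemma B2E : B2 = Quat z (1 + z ^+ 3) (z + z ^+ 2) (1 + z) 1 1. Proof. exact (B2_coord z). Qed.

Lemma tree_action_0 : tree_action T_vertex T_adj act_0 base setA setB.
Proof.
rewrite T_vertexE T_adjE act_0E.
have U1 := C1_unit; have U2 := C2_unit; have U3 := B1_unit; have U4 := B2_unit.
rewrite /setA /setB /b1 /b2 /c1 /c2.
rewrite C1E in U1 *; rewrite C2E in U2 *; rewrite B1E in U3 *; rewrite B2E in U4 *.
have H := tree_action_y laurent_dvr laurent_char2 K_char2 U1 U2 U3 U4 emb_y_z.
exact: H.
Qed.

Lemma tree_action_oo : tree_action T_vertex T_adj act_oo base setB setA.
Proof.
rewrite T_vertexE T_adjE act_ooE.
have U1 := C1_unit; have U2 := C2_unit; have U3 := B1_unit; have U4 := B2_unit.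
rewrite /setA /setB /b1 /b2 /c1 /c2.
rewrite C1E in U1 *; rewrite C2E in U2 *; rewrite B1E in U3 *; rewrite B2E in U4 *.
have H := tree_action_t laurent_dvr laurent_char2 U1 U2 U3 U4 emb_t_z.
exact: H.
Qed.

(** * The relations between the generators *)

Section GeneratorRelations.
Variables (F : fieldType) (x : F).
Hypothesis F_char2 : (2 : F) = 0.
Local Notation Q := (quat x (1 + x ^+ 3)).
Local Notation mkQ := (Quat x (1 + x ^+ 3)).
Let C1 : Q := mkQ (1 + x ^+ 2) 0 0 1.
Let C2 : Q := mkQ (x + x ^+ 2) 0 0 1.
Let B1 : Q := mkQ 0 (1 + x) 1 0.
Let B2 : Q := mkQ (x + x ^+ 2) (1 + x) 1 1.

Lemma quat_C1C1 : C1 * C1 = (1 + x) *: 1.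
Proof.
congr Quat => /=; try ring.
- by apply: (eq_char2 F_char2 (q := x ^+ 2 - x)); ring.
- by apply: (eq_char2 F_char2 (q := x ^+ 2 + 1)); ring.
Qed.
Lemma quat_C2C2 : C2 * C2 = (x * (1 + x)) *: 1.
Proof.
congr Quat => /=; try ring.
- by apply: (eq_char2 F_char2 (q := x ^+ 3 - x)); ring.
- by apply: (eq_char2 F_char2 (q := x + x ^+ 2)); ring.
Qed.
Lemma quat_C1C2 : C1 * C2 = C2 * C1.
Proof. by congr Quat => /=; ring. Qed.
Lemma quat_B1B2C1B2 : B1 * B2 * C1 * B2 = (x * (1 + x) ^+ 2) *: 1.
Proof.
congr Quat => /=.
- by apply: (eq_char2 F_char2 (q := 6 * x ^+ 6 + x ^+ 7 + 8 * x ^+ 4 + 9 * x ^+ 5 + 8 * x ^+ 3 + 5 * x ^+ 2 + 2 * x + 1)); ring.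
- by apply: (eq_char2 F_char2 (q := 4 * x ^+ 5 + 7 * x ^+ 4 + 7 * x ^+ 3 + 4 * x ^+ 2 + 3 * x + 2 - 2 * x ^+ 7 - x ^+ 6)); ring.
- by apply: (eq_char2 F_char2 (q := 5 * x ^+ 5 + 8 * x ^+ 3 + 8 * x ^+ 4 + 5 * x ^+ 2 + 2 * x + 2)); ring.
- by apply: (eq_char2 F_char2 (q := 4 * x ^+ 3 + 3 * x ^+ 4 + 3 * x ^+ 2 + x + x ^+ 5)); ring.
Qed.
Lemma quat_B1C2B1 : B1 * C2 * B1 = (1 + x) *: B2.
Proof.
congr Quat => /=.
- by apply: (eq_char2 F_char2 (q := 2 * x ^+ 4 + x ^+ 3 + x ^+ 5)); ring.
- by apply: (eq_char2 F_char2 (q := x ^+ 4 + 2 * x ^+ 3 + x ^+ 2)); ring.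
- by apply: (eq_char2 F_char2 (q := x ^+ 3 + x ^+ 2)); ring.
- by apply: (eq_char2 F_char2 (q := - x ^+ 2 - x - 1 - x ^+ 3)); ring.
Qed.

Hypotheses (uC1 : C1 \is a GRing.unit) (uC2 : C2 \is a GRing.unit)
  (uB1 : B1 \is a GRing.unit) (uB2 : B2 \is a GRing.unit).
Hypotheses (x0 : x != 0) (x1 : 1 + x != 0).
Let c1 := pclass C1.
Let c2 := pclass C2.
Let b1 := pclass B1.
Let b2 := pclass B2.

Lemma pclass_scale (y y' : Q) c : c != 0 -> y' \is a GRing.unit -> y = c *: y' -> pclass y = pclass y'.
Proof.
move=> c0 uy ->; apply/(pclass_eq _ uy); last by exists c.
by rewrite scaler_unit// unitfE.
Qed.

Lemma pclass_relations :
  [/\ (c1 * c1)%g = 1%g, (c2 * c2)%g = 1%g, (c1 * c2)%g = (c2 * c1)%g,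
      (b1 * b2 * c1 * b2)%g = 1%g & (b1 * c2 * b1)%g = b2].
Proof.
have u1 : (1 : Q) \is a GRing.unit := unitr1 _.
rewrite /b1 /b2 /c1 /c2 !pclassM ?unitrMl// -pclass1; split.
- exact: pclass_scale x1 u1 quat_C1C1.
- exact: pclass_scale (mulf_neq0 x0 x1) u1 quat_C2C2.
- by rewrite quat_C1C2.
- exact: pclass_scale (mulf_neq0 x0 (expf_neq0 2 x1)) u1 quat_B1B2C1B2.
- exact: pclass_scale x1 uB2 quat_B1C2B1.
Qed.
End GeneratorRelations.

Lemma PQ_relations :
  [/\ (c1 * c1)%g = 1%g, (c2 * c2)%g = 1%g, (c1 * c2)%g = (c2 * c1)%g,
      (b1 * b2 * c1 * b2)%g = 1%g & (b1 * c2 * b1)%g = b2].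
Proof.
have U1 := C1_unit; have U2 := C2_unit; have U3 := B1_unit; have U4 := B2_unit.
rewrite /b1 /b2 /c1 /c2.
rewrite C1E in U1 *; rewrite C2E in U2 *; rewrite B1E in U3 *; rewrite B2E in U4 *.
have H := pclass_relations K_char2 U1 U2 U3 U4 z_neq0 z1_neq0.
exact: H.
Qed.

(** * Groups acting on trees *)

Section OneTree.
Local Open Scope group_scope.
Variables (G : groupType) (T : Type) (V : set T) (adj : T -> T -> Prop).
Variables (act : G -> T -> T) (v0 : T) (F M : set G).
Hypothesis ta : tree_action V adj act v0 F M.
Hypothesis invM : forall g, M g -> M g^-1.

Lemma ta_actK g v : V v -> act g^-1 (act g v) = v.
Proof. by move=> hv; rewrite -(ta_actM ta)// mulVg (ta_act1 ta). Qed.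
Lemma ta_actKV g v : V v -> act g (act g^-1 v) = v.
Proof. by move=> hv; rewrite -(ta_actM ta)// mulgV (ta_act1 ta). Qed.

Lemma fixing_prod s : all_in F s -> act (\prod_(g <- s) g) v0 = v0.
Proof.
have base := ta_base ta; elim: s => [|g s IH]; first by rewrite big_nil (ta_act1 ta).
by rewrite all_in_cons => -[Fg Fs]; rewrite big_cons (ta_actM ta)// IH// (ta_fix ta).
Qed.

(** The partial products move the base vertex along a walk. A backtrack would mean that s_(i+1) and
    s_i^-1 send the base vertex to the same neighbour, hence are equal, contrary to reducedness; so
    the walk cannot close up. *)
Lemma moving_walk s : all_in M s -> reduced s -> act (\prod_(g <- s) g) v0 = v0 -> s = [::].
Proof.
move=> Ms rs; case: (posnP (size s)) => [/size0nil//|s0 E].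
pose f i := act (\prod_(g <- take i s) g) v0.
have base := ta_base ta; have Vg g v : V v -> V (act g v) := @ta_vertex _ _ _ _ _ _ _ _ ta g v.
have fS i : (i < size s)%N -> f i.+1 = act (\prod_(g <- take i s) g) (act (nth 1 s i) v0).
  move=> hi; by rewrite /f (take_nth 1 hi) -cats1 big_cat big_seq1 /= (ta_actM ta).
have Mi i : (i < size s)%N -> M (nth 1 s i) by move=> hi; apply/Ms/mem_nth.
exfalso; apply: (@ta_open _ _ _ _ _ _ _ _ ta f (size s) s0).
- by move=> i hi; rewrite fS//; apply: (ta_adj ta); apply: (ta_mv ta); exact: Mi.
- move=> i hi e; have hi' : (i < size s)%N := ltnW hi.
  have : nth 1 s i.+1 = (nth 1 s i)^-1.
    apply: (ta_inj ta); [exact: Mi|exact/invM/Mi|].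
    move: e; rewrite fS// (take_nth 1 hi') -cats1 big_cat big_seq1 /f.
    have V1 h : V (act h v0) by exact: Vg.
    have V2 h h' : V (act h (act h' v0)) by exact: Vg.
    rewrite (ta_actM ta)// => /(congr1 (act (\prod_(g <- take i s) g)^-1)).
    rewrite (ta_actK _ base) (ta_actK _ (V2 _ _)) => /(congr1 (act (nth 1 s i)^-1)).
    by rewrite (ta_actK _ (V1 _)).
  by have /(sortedP 1)/(_ i hi)/eqP := rs.
- by rewrite /f take_size take0 big_nil (ta_act1 ta).
Qed.

Definition walk f n := forall i, (i < n)%N -> adj (f i) (f i.+1).

Lemma walk_ex v w : V v -> V w -> exists n f, [/\ f 0%N = v, f n = w & walk f n].
Proof.
move=> hv hw; have [p hp lp] := ta_conn ta hv hw.
exists (size p), (fun i => nth v (v :: p) i); split=> //; first by rewrite -lp (last_nth v).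
by move=> i hi; move/(pathP v) : hp => /(_ i hi)/asboolP.
Qed.

Lemma walk_shorten f n i : walk f n -> (i.+1 < n)%N -> f i = f i.+2 ->
  walk (fun j => if (j <= i)%N then f j else f j.+2) n.-2.
Proof.
move=> wf hi e j hj; have [h|h] := leqP j i; last by rewrite leqNgt (leqW h) /=; apply: wf; lia.
have [h'|h'] := leqP j.+1 i; first by apply: wf; lia.
have <- : i = j by lia.
by rewrite e; apply: wf; lia.
Qed.

(* A shortest walk from u to g u, followed by its translates, cannot backtrack. *)
Lemma torsion_fixes_or_inverts g n : (0 < n)%N -> g ^+ n = 1 ->
  exists2 u, V u & act g u = u \/ (adj u (act g u) /\ act g (act g u) = u).
Proof.
move=> n0 gn; pose P m := `[< exists f, [/\ V (f 0%N), walk f m & f m = act g (f 0%N)] >].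
have exP : exists m, P m.
  have [m [f [e0 em wf]]] := walk_ex (ta_base ta) (ta_vertex ta g (ta_base ta)).
  exists m; apply/asboolP; exists f; split; rewrite ?e0//; exact: (ta_base ta).
case: (ex_minnP exP) => m /asboolP[f [V0 wf fm]] minm.
have [m0|m0] := posnP m; first by exists (f 0%N) => //; left; rewrite -fm m0.
apply: contrapT => H.
have Vf i : (i <= m)%N -> V (f i).
  by case: i => // i hi; have [] := ta_adj_vertex ta (wf i hi).
have nP k : (k < m)%N -> ~ (exists f, [/\ V (f 0%N), walk f k & f k = act g (f 0%N)]).
  by move=> hk /asboolP/minm; rewrite leqNgt hk.
have nb i : (i.+1 < m)%N -> f i <> f i.+2.
  move=> hi e; apply: (nP m.-2); first by lia.
  exists (fun j => if (j <= i)%N then f j else f j.+2).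
  split=> //; first exact: walk_shorten.
  rewrite leq0n -fm; case: leqP => h'; last by congr f; lia.
  by rewrite (_ : m.-2 = i) ?e; [congr f; lia|lia].
(* A backtrack where the walk meets its translate would give a shorter walk from f 1 to g (f 1), or
   an inverted edge when m = 1. *)
have junction : f m.-1 <> act g (f 1%N).
  move=> e; have [m1|m1] := leqP m 1.
    apply: H; have m_1 : m = 1%N by lia.
    exists (f 0%N) => //; right; split; first by rewrite -fm m_1; apply: wf; lia.
    by rewrite -fm m_1 -e m_1.
  apply: (nP m.-2); first by lia.
  exists (fun j => f j.+1); split.
  - by apply: Vf; lia.
  - by move=> i hi; apply: wf; lia.
  - by rewrite -e; congr f; lia.
have expS k v : V v -> act (g ^+ k.+1) v = act (g ^+ k) (act g v).
  by move=> hv; rewrite expgSr (ta_actM ta).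
have actI k v w : V v -> V w -> act k v = act k w -> v = w.
  by move=> hv hw /(congr1 (act k^-1)); rewrite !ta_actK.
(* The walk continued by its translates under the powers of g; after n m steps it closes up because
   g^n = 1. *)
pose F' i := act (g ^+ (i %/ m)) (f (i %% m)%N).
have FS i j : (j <= m)%N -> (i = i %/ m * m + j)%N -> F' i = act (g ^+ (i %/ m)) (f j).
  move=> hj e; congr (act _ (f _)); have := divn_eq i m; lia.
have F'E q j : (j <= m)%N -> F' (q * m + j)%N = act (g ^+ q) (f j).
  rewrite leq_eqVlt => /orP[/eqP->|hj]; last by rewrite /F' divnMDl// divn_small// addn0 modnMDl modn_small.
  by rewrite fm -expS// /F' -mulSnr mulnK// modnMl.
apply: (@ta_open _ _ _ _ _ _ _ _ ta F' (n * m)).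
- by rewrite muln_gt0 n0.
- move=> i _; have hr := ltn_pmod i m0; rewrite (divn_eq i m) -addnS !F'E//; last exact: ltnW.
  by apply: (ta_adj ta); exact: wf.
- move=> i _; have hr := ltn_pmod i m0; rewrite (divn_eq i m); set q := (i %/ m)%N; set r := (i %% m)%N in hr *.
  have [h|h] := ltnP r.+1 m.
    rewrite -!addnS !F'E ?(ltnW hr)// => /actI e; apply: (nb r h); apply: e; apply: Vf; lia.
  have er : r = m.-1 by lia.
  rewrite (_ : (q * m + r).+2 = q.+1 * m + 1)%N; last by rewrite mulSnr; lia.
  rewrite !F'E ?(ltnW hr)// expS; last by apply: Vf.
  move=> /actI e; apply: junction; rewrite -er; apply: e; first by apply: Vf; lia.
  by apply: (ta_vertex ta); exact: Vf.
- have -> : F' (n * m)%N = act (g ^+ n) (f 0%N) by rewrite -[(n * m)%N]addn0 F'E.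
  by rewrite gn (ta_act1 ta)// -(addn0 0%N) -(mul0n m) F'E// (ta_act1 ta).
Qed.

End OneTree.

Section TwoTrees.
Local Open Scope group_scope.
Variables (G : groupType) (A B : set G).
Variables (T1 : Type) (V1 : set T1) (adj1 : T1 -> T1 -> Prop) (act1 : G -> T1 -> T1) (v0 : T1).
Variables (T2 : Type) (V2 : set T2) (adj2 : T2 -> T2 -> Prop) (act2 : G -> T2 -> T2) (w0 : T2).
Hypothesis ta1 : tree_action V1 adj1 act1 v0 A B.
Hypothesis ta2 : tree_action V2 adj2 act2 w0 B A.
Hypotheses (finA : finite_set A) (finB : finite_set B).
Hypotheses (invA : forall a, A a -> A a^-1) (invB : forall b, B b -> B b^-1).
Hypothesis commAB : prod_set A B = prod_set B A.
Variable H : set G.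
Hypothesis genH : generated (A `|` B) = H.

(** Letters of B fix w0, so the product ab takes w0 to a w0, and the neighbour a w0 determines a.
    Letters of A fix v0, which gives the other bijection. *)
Lemma two_trees_V4 : V4_structure H A B.
Proof.
have base1 := ta_base ta1; have base2 := ta_base ta2.
split=> //.
- split.
  + by move=> [a b] [/= ha hb]; exists a => //; exists b.
  + move=> [a b] [a' b'] /set_mem[/= ha hb] /set_mem[/= ha' hb'] E.
    have ea : a = a'.
      apply: (ta_inj ta2) => //; have := congr1 (act2^~ w0) E.
      by rewrite !(ta_actM ta2)// (ta_fix ta2 hb) (ta_fix ta2 hb').
    by move: E; rewrite ea => /mulgI ->.
  + by move=> _ [a ha [b hb <-]]; exists (a, b).
- split.
  + by move=> [a b] [/= ha hb]; rewrite commAB; exists b => //; exists a.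
  + move=> [a b] [a' b'] /set_mem[/= ha hb] /set_mem[/= ha' hb'] E.
    have eb : b = b'.
      apply: (ta_inj ta1) => //; have := congr1 (act1^~ v0) E.
      by rewrite !(ta_actM ta1)// (ta_fix ta1 ha) (ta_fix ta1 ha').
    by move: E; rewrite eb => /mulgI ->.
  + by rewrite commAB => _ [b hb [a ha <-]]; exists (a, b).
Qed.
Let V := two_trees_V4.

Let weval_vword (la : seq G) : weval (vword la) = \prod_(a <- la) a.
Proof. by rewrite /weval /vword big_map. Qed.
Let weval_hword (lb : seq G) : weval (hword lb) = \prod_(b <- lb) b.
Proof. by rewrite /weval /hword big_map. Qed.

(** On the first tree the part in A fixes v0, so the part in B must return v0 to itself and
    [moving_walk] applies; the second tree is symmetric. *)
Lemma stabilizer_normal (la lb : seq G) : all_in A la -> all_in B lb -> reduced la -> reduced lb ->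
  (act1 (weval (vword la) * weval (hword lb)) v0 = v0 -> lb = [::]) /\
  (act2 (weval (vword la) * weval (hword lb)) w0 = w0 -> la = [::]).
Proof.
have base1 := ta_base ta1; have base2 := ta_base ta2.
move=> hla hlb ra rb; rewrite weval_vword weval_hword; split; rewrite ?(ta_actM ta1)// ?(ta_actM ta2)//.
- move=> e; apply: (moving_walk ta1 invB hlb rb).
  have := congr1 (act1 (\prod_(a <- la) a)^-1) e; rewrite (ta_actK ta1); last exact: (ta_vertex ta1).
  by move=> ->; rewrite -[in LHS](fixing_prod ta1 hla) (ta_actK ta1).
- by rewrite (fixing_prod ta2 hlb) => e; apply: (moving_walk ta2 invA hla ra).
Qed.

Lemma two_trees_reduced_eval1 (la lb : seq G) : all_in A la -> all_in B lb -> reduced la -> reduced lb ->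
  weval (vword la) * weval (hword lb) = 1 -> la = [::] /\ lb = [::].
Proof.
move=> hla hlb ra rb E; have [h1 h2] := stabilizer_normal hla hlb ra rb.
split; [apply: h2|apply: h1]; rewrite E.
  exact: (ta_act1 ta2 (ta_base ta2)).
exact: (ta_act1 ta1 (ta_base ta1)).
Qed.

Lemma two_trees_normal g : H g -> exists la lb, [/\ all_in A la, all_in B lb, reduced la,
  reduced lb & g = weval (vword la) * weval (hword lb)].
Proof.
move=> /(in_words V)[w vw <-].
have [la [lb [hla hlb ra rb E]]] := weq_normal V vw.
by exists la, lb; split=> //; rewrite (weq_eval E) weval_cat.
Qed.

Lemma two_trees_subgroup : subgroup H.
Proof. exact: (V4_subgroup V). Qed.

Lemma subA : A `<=` H.
Proof. by rewrite -genH => a ha; apply: sub_gen_smallest; left. Qed.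
Lemma subB : B `<=` H.
Proof. by rewrite -genH => a ha; apply: sub_gen_smallest; right. Qed.

Lemma two_trees_stabilizer g : H g -> act1 g v0 = v0 -> act2 g w0 = w0 -> g = 1.
Proof.
move=> /two_trees_normal[la [lb [hla hlb ra rb ->]]] e1 e2.
have [h1 h2] := stabilizer_normal hla hlb ra rb.
by rewrite (h1 e1) (h2 e2) /weval !big_nil mulg1.
Qed.

(** Right multiplication by a letter of B moves the first vertex one step and keeps the second, and
    a letter of A does the reverse. The two coordinates are therefore reached one after the
    other. *)
Lemma two_trees_transitive v w : V1 v -> V2 w -> exists g, [/\ H g, act1 g v0 = v & act2 g w0 = w].
Proof.
have base1 := ta_base ta1; have base2 := ta_base ta2.
have [H1 HM HV] := two_trees_subgroup.
have step1 g : H g -> forall v', adj1 (act1 g v0) v' ->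
    exists g', [/\ H g', act1 g' v0 = v' & act2 g' w0 = act2 g w0].
  move=> Hg v' adj.
  have := ta_adj ta1 g^-1 adj; rewrite (ta_actK ta1)// => /(ta_nbr ta1)[b hb eb].
  exists (g * b); split; first by apply: HM => //; exact: subB.
    by rewrite (ta_actM ta1)// -eb (ta_actKV ta1)//; case: (ta_adj_vertex ta1 adj).
  by rewrite (ta_actM ta2)// (ta_fix ta2 hb).
have step2 g : H g -> forall w', adj2 (act2 g w0) w' ->
    exists g', [/\ H g', act1 g' v0 = act1 g v0 & act2 g' w0 = w'].
  move=> Hg w' adj.
  have := ta_adj ta2 g^-1 adj; rewrite (ta_actK ta2)// => /(ta_nbr ta2)[b hb eb].
  exists (g * b); split; first by apply: HM => //; exact: subA.
    by rewrite (ta_actM ta1)// (ta_fix ta1 hb).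
  by rewrite (ta_actM ta2)// -eb (ta_actKV ta2)//; case: (ta_adj_vertex ta2 adj).
move=> hv hw.
have [g [Hg e1 e2]] : exists g, [/\ H g, act1 g v0 = v & act2 g w0 = w0].
  have [n [f [f0 <- wf]]] := walk_ex ta1 base1 hv; elim: n wf => [|n IH] wf.
    by exists 1; rewrite (ta_act1 ta1)// (ta_act1 ta2)// f0.
  have [|g [Hg e1 e2]] := IH; first by move=> i hi; apply: wf; exact: ltnW.
  have := wf n (leqnn _); rewrite -e1 => /(step1 _ Hg)[g' [Hg' e1' e2']].
  by exists g'; split=> //; rewrite e2'.
have [n [f [f0 <- wf]]] := walk_ex ta2 base2 hw; elim: n wf => [|n IH] wf.
  by exists g; rewrite e2 f0.
have [|g' [Hg' e1' e2']] := IH; first by move=> i hi; apply: wf; exact: ltnW.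
have := wf n (leqnn _); rewrite -e2' => /(step2 _ Hg')[g'' [Hg'' e1'' e2'']].
by exists g''; split=> //; rewrite e1''.
Qed.

Lemma two_trees_simply_transitive v w v' w' : V1 v -> V2 w -> V1 v' -> V2 w' ->
  exists! g, [/\ H g, act1 g v = v' & act2 g w = w'].
Proof.
have base1 := ta_base ta1; have base2 := ta_base ta2.
have [H1 HM HV] := two_trees_subgroup.
move=> hv hw hv' hw'.
have [g [Hg <- <-]] := two_trees_transitive hv hw.
have [g' [Hg' <- <-]] := two_trees_transitive hv' hw'.
have VV1 h : V1 (act1 h v0) by exact: (ta_vertex ta1).
have VV2 h : V2 (act2 h w0) by exact: (ta_vertex ta2).
exists (g' * g^-1); split.
  split; first by apply: HM => //; exact: HV.
    by rewrite (ta_actM ta1)// (ta_actK ta1).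
  by rewrite (ta_actM ta2)// (ta_actK ta2).
move=> h [Hh e1 e2].
have : g'^-1 * (h * g) = 1.
  apply: two_trees_stabilizer.
  - by apply: HM (HV _ Hg') (HM _ _ Hh Hg).
  - by rewrite !(ta_actM ta1)// ?e1 ?(ta_actK ta1)//; rewrite (ta_actM ta1)// e1.
  - by rewrite !(ta_actM ta2)// ?e2 ?(ta_actK ta2)//; rewrite (ta_actM ta2)// e2.
by move=> /(canRL (mulKg _)); rewrite invgK mulg1 => <-; rewrite mulgK.
Qed.

Section TorsionFree.
Variable R : realType.
Hypotheses (A0 : A !=set0) (B0 : B !=set0).
Local Notation type_of := (type_of V R).

Lemma type_of_letter k c : (if k then A c else B c) -> type_of c = (k, ~~ k).
Proof.
move=> hc; have -> : c = weval [:: (k, c)] by rewrite /weval big_seq1.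
by rewrite (type_ofE V two_trees_reduced_eval1 R A0 B0)//; case: k hc.
Qed.

Let typeJ g h : H g -> H h -> type_of (h^-1 * g * h) = type_of g.
Proof.
have [H1 HM HV] := two_trees_subgroup => Hg Hh.
have M := type_ofM V two_trees_reduced_eval1 R A0 B0.
rewrite !M//; try by [apply: HV|apply: (HM) => //; apply: HV].
rewrite (type_ofV V two_trees_reduced_eval1 R A0 B0)// [_ * type_of g]V4_mulC -mulgA.
by rewrite V4_mulg2 mulg1.
Qed.

Let wtype_vword (la : seq G) : (wtype (vword la)).2 = false.
Proof. by elim: la => //= a la IH; rewrite [LHS]IH. Qed.
Let wtype_hword (lb : seq G) : (wtype (hword lb)).1 = false.
Proof. by elim: lb => //= a la IH; rewrite [LHS]IH. Qed.

Let wvalid_vword (la : seq G) : all_in A la -> wvalid A B (vword la).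
Proof. by elim: la => //= a la IH; rewrite all_in_cons => -[? ?]; split=> //; exact: IH. Qed.
Let wvalid_hword (lb : seq G) : all_in B lb -> wvalid A B (hword lb).
Proof. by elim: lb => //= a la IH; rewrite all_in_cons => -[? ?]; split=> //; exact: IH. Qed.

(** After conjugation, which keeps the type, u is v0 and g is a letter of B times an element fixing
    v0. By [stabilizer_normal] the latter is a word in A, so the horizontal component of the type of
    g is that of one letter of B. *)
Lemma type_edge1 g u : H g -> V1 u -> adj1 u (act1 g u) -> type_of g <> 1.
Proof.
have [H1 HM HV] := two_trees_subgroup; have base1 := ta_base ta1; have base2 := ta_base ta2.
move=> Hg hu; have [h [Hh <- _]] := two_trees_transitive hu base2 => /(ta_adj ta1 h^-1).
have Hg' : H (h^-1 * g * h) by exact: (HM _ _ (HM _ _ (HV _ Hh) Hg) Hh).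
rewrite (ta_actK ta1)// -!(ta_actM ta1) ?mulgA//; last exact: (ta_vertex ta1).
move=> /(ta_nbr ta1)[b hb e]; have Hb := subB hb.
have : act1 (b^-1 * (h^-1 * g * h)) v0 = v0 by rewrite (ta_actM ta1)// e (ta_actK ta1).
have /two_trees_normal[la [lb [hla hlb ra rb E]]] : H (b^-1 * (h^-1 * g * h)) by apply: HM => //; exact: HV.
rewrite {1}E => /(stabilizer_normal hla hlb ra rb).1 lb0.
have M := type_ofM V two_trees_reduced_eval1 R A0 B0.
rewrite -(typeJ Hg Hh) => T; have := congr1 type_of E.
rewrite lb0 [weval (hword [::])]/weval big_nil mulg1 (type_ofE V two_trees_reduced_eval1 R A0 B0 (wvalid_vword hla)).
rewrite M//; last exact: HV.
rewrite T (type_ofV V two_trees_reduced_eval1 R A0 B0)// (@type_of_letter false)// => /(congr1 snd).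
by rewrite wtype_vword.
Qed.

Lemma type_edge2 g u : H g -> V2 u -> adj2 u (act2 g u) -> type_of g <> 1.
Proof.
have [H1 HM HV] := two_trees_subgroup; have base1 := ta_base ta1; have base2 := ta_base ta2.
move=> Hg hu; have [h [Hh _ <-]] := two_trees_transitive base1 hu => /(ta_adj ta2 h^-1).
have Hg' : H (h^-1 * g * h) by exact: (HM _ _ (HM _ _ (HV _ Hh) Hg) Hh).
rewrite (ta_actK ta2)// -!(ta_actM ta2) ?mulgA//; last exact: (ta_vertex ta2).
move=> /(ta_nbr ta2)[b hb e]; have Hb := subA hb.
have : act2 (b^-1 * (h^-1 * g * h)) w0 = w0 by rewrite (ta_actM ta2)// e (ta_actK ta2).
have /two_trees_normal[la [lb [hla hlb ra rb E]]] : H (b^-1 * (h^-1 * g * h)) by apply: HM => //; exact: HV.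
rewrite {1}E => /(stabilizer_normal hla hlb ra rb).2 la0.
have M := type_ofM V two_trees_reduced_eval1 R A0 B0.
rewrite -(typeJ Hg Hh) => T; have := congr1 type_of E.
rewrite la0 [weval (vword [::])]/weval big_nil mul1g (type_ofE V two_trees_reduced_eval1 R A0 B0 (wvalid_hword hlb)).
rewrite M//; last exact: HV.
rewrite T (type_ofV V two_trees_reduced_eval1 R A0 B0)// (@type_of_letter true)// => /(congr1 fst).
by rewrite wtype_hword.
Qed.

(** Edge inversions are excluded by the type, so a torsion element fixes a vertex in each tree,
    hence a vertex of the product. *)
Theorem two_trees_torsion_free : torsion_free (type_kernel V R).
Proof.
have [H1 HM HV] := two_trees_subgroup; have base1 := ta_base ta1; have base2 := ta_base ta2.
move=> g n [Hg tg] n0 gn.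
have [u1 Vu1 [e1|[e1 _]]] := torsion_fixes_or_inverts ta1 n0 gn; last by case: (type_edge1 Hg Vu1 e1).
have [u2 Vu2 [e2|[e2 _]]] := torsion_fixes_or_inverts ta2 n0 gn; last by case: (type_edge2 Hg Vu2 e2).
have [x [_ U]] := two_trees_simply_transitive Vu1 Vu2 Vu1 Vu2.
by rewrite -(U g)//; apply: U; split=> //; [exact: (ta_act1 ta1)|exact: (ta_act1 ta2)].
Qed.
End TorsionFree.
End TwoTrees.

(** * The presentation *)

Section PresentedGroup.
Local Open Scope group_scope.
Local Open Scope quotient_scope.
Variables (X : choiceType) (rels : set (word X * word X)).
Implicit Types u v w : word X.
Local Notation peq := (pres_eq rels).

Definition pres_eqb u v := `[< peq u v >].
Lemma pres_eqb_refl : reflexive pres_eqb.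
Proof. by move=> w; apply/asboolP; exact: PresRefl. Qed.
Lemma pres_eqb_sym : symmetric pres_eqb.
Proof. by move=> u v; apply/idP/idP => /asboolP h; apply/asboolP; exact: PresSym. Qed.
Lemma pres_eqb_trans : transitive pres_eqb.
Proof. by move=> v u w /asboolP h /asboolP h'; apply/asboolP; exact: PresTrans h h'. Qed.
Canonical pres_equiv := EquivRel pres_eqb pres_eqb_refl pres_eqb_sym pres_eqb_trans.

Definition pgroup := {eq_quot pres_eqb}.
HB.instance Definition _ := Choice.on pgroup.
HB.instance Definition _ := EqQuotient.on pgroup.

Definition word_inv w : word X := rev [seq (l.1, ~~ l.2) | l <- w].

Lemma word_invK : involutive word_inv.
Proof.
move=> w; rewrite /word_inv map_rev revK -map_comp -[RHS]map_id.
by apply: eq_map => -[x b]; rewrite /= negbK.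
Qed.

Lemma pres_word_invl w : peq (word_inv w ++ w) [::].
Proof.
elim: w => [|[x b] w IH]; first exact: PresRefl.
rewrite /word_inv /= rev_cons cat_rcons -/(word_inv w).
apply: PresTrans IH; apply: PresCat (PresRefl _ _) _.
rewrite -[w in X in pres_eq _ _ X]cat0s -[_ :: _]/([:: (x, ~~ b); (x, b)] ++ w).
apply: PresCat (PresRefl _ _); rewrite -[in (x, b)](negbK b); exact: PresFree.
Qed.

Lemma pres_word_invr w : peq (w ++ word_inv w) [::].
Proof. by rewrite -{1}[w]word_invK; exact: pres_word_invl. Qed.

Lemma pres_word_inv u v : peq u v -> peq (word_inv u) (word_inv v).
Proof.
move=> uv; apply: (@PresTrans _ _ _ (word_inv u ++ (v ++ word_inv v))).
  rewrite -{1}[word_inv u]cats0; apply: PresCat (PresRefl _ _) _.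
  exact/PresSym/pres_word_invr.
rewrite catA -{2}[word_inv v]cat0s; apply: PresCat (PresRefl _ _).
apply: PresTrans (pres_word_invl u); apply: PresCat (PresRefl _ _) _; exact: PresSym.
Qed.

Lemma pgroupP u v : \pi_pgroup u = \pi_pgroup v <-> peq u v.
Proof. by split=> [/eqmodP/asboolP//|h]; exact/eqmodP/asboolP. Qed.

Definition pgroup_one : pgroup := \pi_pgroup [::].
Definition pgroup_inv := lift_op1 pgroup word_inv.
Definition pgroup_mul := lift_op2 pgroup (@cat (X * bool)).

Lemma pi_pgroup_inv : {morph \pi_pgroup : u / word_inv u >-> pgroup_inv u}.
Proof. by move=> u; unlock pgroup_inv; apply/pgroupP/pres_word_inv/pgroupP; rewrite reprK. Qed.
Lemma pi_pgroup_mul : {morph \pi_pgroup : u v / u ++ v >-> pgroup_mul u v}.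
Proof. by move=> u v; unlock pgroup_mul; apply/pgroupP/PresCat; apply/pgroupP; rewrite reprK. Qed.
Canonical pi_pgroup_inv_morph := PiMorph1 pi_pgroup_inv.
Canonical pi_pgroup_mul_morph := PiMorph2 pi_pgroup_mul.

Lemma pgroup_mulA : associative pgroup_mul.
Proof. by elim/quotW=> u; elim/quotW=> v; elim/quotW=> w; rewrite !piE catA. Qed.
Lemma pgroup_mul1g : left_id pgroup_one pgroup_mul.
Proof. by elim/quotW=> u; rewrite /pgroup_one !piE. Qed.
Lemma pgroup_mulg1 : right_id pgroup_one pgroup_mul.
Proof. by elim/quotW=> u; rewrite /pgroup_one !piE cats0. Qed.
Lemma pgroup_mulVg : left_inverse pgroup_one pgroup_inv pgroup_mul.
Proof. by elim/quotW=> u; rewrite /pgroup_one !piE; apply/pgroupP; exact: pres_word_invl. Qed.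
Lemma pgroup_mulgV : right_inverse pgroup_one pgroup_inv pgroup_mul.
Proof. by elim/quotW=> u; rewrite /pgroup_one !piE; apply/pgroupP; exact: pres_word_invr. Qed.
HB.instance Definition _ := isGroup.Build pgroup
  pgroup_mulA pgroup_mul1g pgroup_mulg1 pgroup_mulVg pgroup_mulgV.

Definition pgen (x : X) : pgroup := \pi_pgroup [:: (x, false)].

Lemma pgroup_word u : word_eval pgen u = \pi_pgroup u.
Proof.
elim: u => [|[x b] u IH]; first by rewrite /word_eval big_nil.
rewrite /word_eval big_cons -/(word_eval pgen u) IH /pgen -[(x, b) :: u]cat1s pi_pgroup_mul; case: b => //=.
exact: (congr1 (pgroup_mul^~ (\pi_pgroup u)) (esym (pi_pgroup_inv [:: (x, false)]))).
Qed.

Lemma pgroup_eval u v : word_eval pgen u = word_eval pgen v <-> peq u v.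
Proof. by rewrite !pgroup_word; exact: pgroupP. Qed.
End PresentedGroup.

Lemma word_eval_cat (G : groupType) (X : Type) (f : X -> G) (u v : word X) :
  word_eval f (u ++ v) = (word_eval f u * word_eval f v)%g.
Proof. by rewrite /word_eval big_cat. Qed.

Lemma pres_eq_eval (G : groupType) (X : Type) (f : X -> G) (rels : set (word X * word X)) :
  (forall u v, rels (u, v) -> word_eval f u = word_eval f v) ->
  forall u v, pres_eq rels u v -> word_eval f u = word_eval f v.
Proof.
move=> h u v; elim=> //.
- by move=> u1 v1 w1 _ -> _ ->.
- move=> x b; rewrite /word_eval !big_cons !big_nil mulg1.
  by case: b => /=; rewrite ?mulgV ?mulVg.
- by move=> u1 u2 v1 v2 _ e1 _ e2; rewrite !word_eval_cat e1 e2.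
Qed.

Section NineSquares.
Local Open Scope group_scope.
Variables (G : groupType) (b1 b2 c1 c2 : G).

Definition tile_relations := [/\ c1 * c1 = 1, c2 * c2 = 1, c1 * c2 = c2 * c1,
  b1 * b2 * c1 * b2 = 1 & b1 * c2 * b1 = b2].

Hypothesis rel : tile_relations.

Lemma tile_c1V : c1^-1 = c1. Proof. by have [e _ _ _ _] := rel; apply: (mulgI c1); rewrite e mulgV. Qed.
Lemma tile_c2V : c2^-1 = c2. Proof. by have [_ e _ _ _] := rel; apply: (mulgI c2); rewrite e mulgV. Qed.

Let b2E : b2 = b1 * c2 * b1. Proof. by have [] := rel. Qed.
Let b1V : b1^-1 = b2 * c1 * b2.
Proof. by have [_ _ _ e _] := rel; apply: (mulgI b1); rewrite !mulgA e mulgV. Qed.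

(** The nine squares follow from the five relations in any group. This generality allows their use
    both in the lattice and in the abstractly presented group. *)
Lemma nine_squares :
  [/\ c1 * c2 = c2 * c1, b1 * c2 = b2 * b1^-1, b1^-1 * c2 = b2^-1 * b1,
      b1 * b2^-1 = c2 * b1^-1 & b1^-1 * b2 = c2 * b1] /\
  [/\ b1 * b2 = b2^-1 * c1, c1 * b2 = b2^-1 * b1^-1,
      b1^-1 * b2^-1 = b2 * c1 & c1 * b2^-1 = b2 * b1].
Proof.
have b2V : b2^-1 = b1^-1 * c2 * b1^-1 by rewrite b2E !invgM tile_c2V mulgA.
have b1E : b1 = b2^-1 * c1 * b2^-1 by rewrite -[LHS]invgK b1V !invgM tile_c1V mulgA.
split; split.
- by have [] := rel.
- by rewrite b2E mulgK.
- by rewrite b2V -!mulgA mulVg mulg1.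
- by rewrite b2V !mulgA mulgV mul1g.
- by rewrite b2E !mulgA mulVg mul1g.
- by rewrite {1}b1E -!mulgA mulVg mulg1.
- by rewrite b1V !mulgA mulVg mul1g.
- by rewrite b1V mulgK.
- by rewrite b1E !mulgA mulgV mul1g.
Qed.
End NineSquares.

HB.instance Definition _ := gen_eqMixin gen.
HB.instance Definition _ := gen_choiceMixin gen.

Section TilePresentation.
Local Open Scope group_scope.
Variables (G : groupType) (b1 b2 c1 c2 : G).
Hypothesis rel : tile_relations b1 b2 c1 c2.
Hypotheses (uniqA : uniq [:: b1; b1^-1; c1]) (uniqB : uniq [:: b2; b2^-1; c2]).
Let A : set G := [set b1; b1^-1; c1].
Let B : set G := [set b2; b2^-1; c2].
Variables (H : set G) (V : V4_structure H A B).
Hypothesis red : forall la lb, all_in A la -> all_in B lb -> reduced la -> reduced lb ->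
  weval (vword la) * weval (hword lb) = 1 -> la = [::] /\ lb = [::].

Let f (x : gen) : G := match x with Gb1 => b1 | Gb2 => b2 | Gc1 => c1 | Gc2 => c2 end.
Let P : groupType := pgroup relations.
Let g (x : gen) : P := pgen relations x.

Lemma pgroup_tile : tile_relations (g Gb1) (g Gb2) (g Gc1) (g Gc2).
Proof.
have E u v : relations (u, v) -> word_eval g u = word_eval g v.
  by move=> h; apply/pgroup_eval; exact: PresRel.
have E1 := E _ _ (or_introl (or_introl (or_introl (or_introl erefl)))).
have E2 := E _ _ (or_introl (or_introl (or_introl (or_intror erefl)))).
have E3 := E _ _ (or_introl (or_introl (or_intror erefl))).
have E4 := E _ _ (or_introl (or_intror erefl)).
have E5 := E _ _ (or_intror erefl).
rewrite /word_eval !big_cons !big_nil /= !mulg1 in E1 E2 E3 E4 E5.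
split=> //; first by rewrite -!mulgA.
by apply: (mulIg (g Gb2)^-1); rewrite mulgV -!mulgA.
Qed.

(** The letters translated to the presented group. Distinctness of the three elements of A and of B
    makes the tests select the right generator. *)
Let back (l : bool * G) : P :=
  if l.1 then (if l.2 == b1 then g Gb1 else if l.2 == b1^-1 then (g Gb1)^-1 else g Gc1)
  else (if l.2 == b2 then g Gb2 else if l.2 == b2^-1 then (g Gb2)^-1 else g Gc2).

Let backE : [/\ back (true, b1) = g Gb1, back (true, b1^-1) = (g Gb1)^-1 & back (true, c1) = g Gc1] /\
  [/\ back (false, b2) = g Gb2, back (false, b2^-1) = (g Gb2)^-1 & back (false, c2) = g Gc2].
Proof.
move: uniqA uniqB; rewrite /= !inE !negb_or ![_ == b1^-1]eq_sym ![_ == b2^-1]eq_sym.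
move=> /and3P[/andP[n1 n2] n3 _] /and3P[/andP[m1 m2] m3 _].
by rewrite /back /= !eqxx (negPf n1) ![c1 == _]eq_sym ![c2 == _]eq_sym (negPf n2) (negPf n3)
  (negPf m1) (negPf m2) (negPf m3).
Qed.

(** The left and top sides determine a square, so every square is one of the nine, and these hold in
    the presented group. *)
Lemma weq_back w w' : weq A B w w' -> \prod_(l <- w) back l = \prod_(l <- w') back l.
Proof.
have [[e1 e2 e3] [e4 e5 e6]] := backE; have Pt := pgroup_tile.
have [[k1 k2 k3 k4 k5] [k6 k7 k8 k9]] := nine_squares rel.
have [[p1 p2 p3 p4 p5] [p6 p7 p8 p9]] := nine_squares Pt.
have [A1 A2 A3] : [/\ A b1, A b1^-1 & A c1] by split; [left; left|left; right|right].
have [B1 B2 B3] : [/\ B b2, B b2^-1 & B c2] by split; [left; left|left; right|right].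
elim=> //.
- by move=> w1 w2 w3 _ -> _ ->.
- move=> [] c; rewrite /lvalid /= big_cons big_seq1 big_nil => -[[]|] ->.
  + by rewrite e1 e2 mulgV.
  + by rewrite invgK e1 e2 mulVg.
  + by rewrite (tile_c1V rel) e3 -{1}(tile_c1V Pt) mulVg.
  + by rewrite e4 e5 mulgV.
  + by rewrite invgK e4 e5 mulVg.
  + by rewrite (tile_c2V rel) e6 -{1}(tile_c2V Pt) mulVg.
- move=> a b' b a' [ha ha' hb hb' E].
  have U a0 b0 : A a0 -> B b0 -> a * b' = b0 * a0 -> back (true, a) * back (false, b') = back (false, b0) * back (true, a0) ->
      \prod_(l <- [:: (true, a); (false, b')]) back l = \prod_(l <- [:: (false, b); (true, a')]) back l.
    move=> ha0 hb0 E0 Eb; rewrite !big_cons !big_nil !mulg1 Eb.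
    by have [-> ->] := V4_factorC_uniq V ha' hb ha0 hb0 (etrans (esym E) E0).
  move: ha hb' U {E} => [[]|] -> [[]|] -> U.
  + by apply: (U c1 b2^-1) => //; rewrite e1 e4 e5 e3.
  + by apply: (U b1^-1 c2) => //; rewrite e1 e2 e5 e6.
  + by apply: (U b1^-1 b2) => //; rewrite e1 e2 e4 e6.
  + by apply: (U b1 c2) => //; rewrite e1 e2 e4 e6.
  + by apply: (U c1 b2) => //; rewrite e2 e3 e4 e5.
  + by apply: (U b1 b2^-1) => //; rewrite e1 e2 e5 e6.
  + by apply: (U b1^-1 b2^-1) => //; rewrite e2 e3 e4 e5.
  + by apply: (U b1 b2) => //; rewrite e1 e3 e4 e5.
  + by apply: (U c1 c2) => //; rewrite e3 e6.
- by move=> u1 u2 v1 v2 _ h1 _ h2; rewrite !big_cat h1 h2.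
Qed.

Let letter (l : gen * bool) : bool * G :=
  (match l.1 with Gb1 | Gc1 => true | _ => false end, if l.2 then (f l.1)^-1 else f l.1).

Let letter_valid l : lvalid A B (letter l).
Proof.
case: l => -[] []; rewrite /lvalid /= ?(tile_c1V rel) ?(tile_c2V rel); by [left; left|left; right|right].
Qed.

Let letters_valid (u : word gen) : wvalid A B (map letter u).
Proof. by elim: u => //= l u IH; split=> //; exact: letter_valid. Qed.

Let letters_eval (u : word gen) : weval (map letter u) = word_eval f u.
Proof. by rewrite /weval big_map. Qed.

Let letters_back (u : word gen) : \prod_(l <- map letter u) back l = word_eval g u.
Proof.
have [[e1 e2 e3] [e4 e5 e6]] := backE; have Pt := pgroup_tile.
rewrite big_map; apply: eq_bigr => -[[] []] _; rewrite /letter /= ?(tile_c1V rel) ?(tile_c2V rel) //.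
- by rewrite e3 (tile_c1V Pt).
- by rewrite e6 (tile_c2V Pt).
Qed.

(** Words with equal values are related by cancellations and squares, since only the trivial normal
    form has value 1; [weq_back] carries this relation to the presented group. *)
Theorem tile_presentation : presentation H f relations.
Proof.
split.
- apply/seteqP; split=> [x /(in_words V)[w vw <-]|_ [u _ <-]].
    have letter_of l : lvalid A B l -> exists m, letter m = l.
      case: l => -[] c; rewrite /lvalid /= => -[[]|] ->.
      + by exists (Gb1, false). + by exists (Gb1, true). + by exists (Gc1, false).
      + by exists (Gb2, false). + by exists (Gb2, true). + by exists (Gc2, false).
    have [u <-] : exists u, map letter u = w.
      elim: w vw => [|l w IH] /=; first by exists [::].
      by move=> [/letter_of[m <-] /IH[u <-]]; exists (m :: u).
    by exists u => //; rewrite letters_eval.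
  by apply/(in_words V); exists (map letter u).
- move=> u v; split=> [E|].
    apply/pgroup_eval; rewrite -!letters_back; apply: weq_back.
    by apply: (weq_of_eval V red); rewrite ?letters_eval.
  apply: pres_eq_eval => {}u {}v; have [r1 r2 r3 r4 r5] := rel.
  rewrite /word_eval => -[[[[]|]|]|] [-> ->]; rewrite !big_cons !big_nil /= ?mulg1 //.
  + by rewrite !mulgA.
  + by rewrite !mulgA r5 mulgV.
Qed.
End TilePresentation.

(** * Stabilizers in G(R) are finite *)

Section NormForm.
Variable F : fieldType.
Hypothesis F2 : forall x : F, x = 0 \/ x = 1.
Implicit Types a b p r : {poly F}.

Lemma F2_add11 : 1 + 1 = 0 :> F.
Proof. by have [//|/(canRL (addrK 1))] := F2 (1 + 1); rewrite subrr => /eqP; rewrite oner_eq0. Qed.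
Lemma F2_opp1 : -1 = 1 :> F.
Proof. by apply/esym/eqP; rewrite -addr_eq0 F2_add11. Qed.
Lemma F2_oppE (x : F) : - x = x. Proof. by rewrite -mulN1r F2_opp1 mul1r. Qed.

(** The norm form of the quadratic extension generated by I, where I^2 + I = z. *)
Definition pform a b := a ^+ 2 + a * b - 'X * b ^+ 2.
Let l : {poly F} := 'X + 1%:P.
Let q : {poly F} := 'X ^+ 2 - 'X + 1.

Definition anisotropic_at p := forall a b, p %| pform a b -> p %| a /\ p %| b.

Let F2_simp := (expr0n, expr1n, mulr0, mul0r, mulr1, mul1r, F2_opp1, oppr0, addr0, add0r, F2_add11).

(** Modulo X + 1 the form becomes a^2 + ab + b^2 over F_2, which vanishes only at 0. *)
Lemma anisotropic_l : anisotropic_at l.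
Proof.
move=> a b; have lE : l = 'X - (-1)%:P by rewrite polyCN opprK.
rewrite lE !dvdp_XsubCl /root F2_opp1.
have -> : (pform a b).[1] = a.[1] ^+ 2 + a.[1] * b.[1] + b.[1] ^+ 2.
  by rewrite /pform !(hornerD, hornerN) !hornerM hornerX mul1r F2_oppE !expr2.
by have [->|->] := F2 a.[1]; have [->|->] := F2 b.[1]; rewrite ?F2_simp /= ?eqxx ?oner_eq0.
Qed.

Let size_q : size q = 3%N.
Proof.
have -> : q = 'X ^+ 2 - ('X - 1%:P) by rewrite polyC1 /q; ring.
by rewrite size_polyDl size_polyXn// size_polyN size_XsubC.
Qed.

Lemma small_dvd_q (c d : F) : q %| c%:P + d%:P * 'X -> c = 0 /\ d = 0.
Proof.
move=> h; have : c%:P + d%:P * 'X = 0.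
  apply: contraTeq h => n0; apply/negP => /(dvdp_leq n0); rewrite size_q addrC -cons_poly_def.
  by rewrite size_cons_poly; case: ifP => // _; apply/negP; rewrite -ltnNge !ltnS size_polyC_leq1.
move=> /polyP h'; have := h' 0%N; have := h' 1%N.
by rewrite !coefD !coefMX !coefC ?coef0 /= ?(if_same, addr0, add0r).
Qed.

Let modq_mono (a : {poly F}) : exists c d s, a = s * q + (c%:P + d%:P * 'X).
Proof.
exists (a %% q)`_0, (a %% q)`_1, (a %/ q).
rewrite {1}(divp_eq a q); congr (_ + _); apply/polyP => i.
have : (size (a %% q)%R <= 2)%N by rewrite -ltnS -size_q ltn_modp -size_poly_eq0 size_q.
rewrite coefD coefMX !coefC; case: i => [|[|i]] h /=; rewrite ?addr0 ?add0r//; by apply: nth_default; apply: leq_trans h _.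
Qed.

(** The residue field is F_4; with residues written as c + d X, vanishing of the form is checked on
    the sixteen possibilities. *)
Lemma anisotropic_q : anisotropic_at q.
Proof.
move=> a b; have [al [be [s ->]]] := modq_mono a; have [ga [de [s' ->]]] := modq_mono b.
(* The coefficients of the remainder of the form modulo q, obtained from X^2 = X - 1. *)
pose c := al ^+ 2 - be ^+ 2 + al * ga - be * de + ga * de + ga * de + de ^+ 2.
pose d := al * be + al * be + be ^+ 2 + al * de + be * ga + be * de - ga ^+ 2 - ga * de - ga * de.
set a0 := al%:P + be%:P * 'X; set b0 := ga%:P + de%:P * 'X.
have -> : pform (s * q + a0) (s' * q + b0) = q * (s ^+ 2 * q + s * a0 + s * a0 + s * s' * q + s * b0 + s' * a0
    - 'X * (s' ^+ 2 * q + s' * b0 + s' * b0)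
    + (be%:P ^+ 2 + be%:P * de%:P - ga%:P * de%:P - ga%:P * de%:P - de%:P ^+ 2 * ('X + 1))) + (c%:P + d%:P * 'X).
  by rewrite /pform /q /a0 /b0 /c /d !(polyCD, polyCN, polyCM, rmorphXn) /=; ring.
rewrite dvdp_addr ?dvdp_mulr// => /small_dvd_q.
move=> [c0 d0]; have [e1 e2 e3 e4] : [/\ al = 0, be = 0, ga = 0 & de = 0].
  move: c0 d0; rewrite /c /d; have [->|->] := F2 al; have [->|->] := F2 be; have [->|->] := F2 ga;
    have [->|->] := F2 de; rewrite ?F2_simp /= ?F2_simp /= => /eqP + /eqP; by rewrite ?eqxx ?oner_eq0.
by rewrite /a0 /b0 e1 e2 e3 e4 !mul0r !addr0 !dvdp_mulIr.
Qed.

Let lqE : 1 + 'X ^+ 3 = l * q.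
Proof. by rewrite /l /q polyC1; ring. Qed.

Definition pnorm (x0 x1 x2 x3 : {poly F}) := pform x0 x1 - (1 + 'X ^+ 3) * pform x2 x3.

Lemma pform_scale r a b : pform (r * a) (r * b) = r ^+ 2 * pform a b.
Proof. by rewrite /pform; ring. Qed.
Lemma pnorm_scale r x0 x1 x2 x3 : pnorm (r * x0) (r * x1) (r * x2) (r * x3) = r ^+ 2 * pnorm x0 x1 x2 x3.
Proof. by rewrite /pnorm !pform_scale; ring. Qed.

(** Modulo p only the form in x0, x1 survives, so p divides both. Then p^2 divides that form, and
    since p divides 1 + X^3 exactly once, p divides the form in x2, x3. *)
Lemma pnorm_square_dvd p s x0 x1 x2 x3 : p != 0 -> anisotropic_at p -> 1 + 'X ^+ 3 = p * s -> coprimep p s ->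
  p * p %| pnorm x0 x1 x2 x3 -> [/\ p %| x0, p %| x1, p %| x2 & p %| x3].
Proof.
move=> p0 an e cps h.
have [d0 d1] : p %| x0 /\ p %| x1.
  apply: an; have := dvdp_trans (dvdp_mulIl p p) h; rewrite /pnorm e dvdp_subl//.
  by rewrite -mulrA dvdp_mulIl.
have [d2 d3] : p %| x2 /\ p %| x3.
  apply: an; rewrite -(Gauss_dvdpr _ cps) -(dvdp_mul2l _ _ p0).
  move: h; rewrite /pnorm e mulrA dvdp_subr//.
  have /dvdpP[y0 ->] := d0; have /dvdpP[y1 ->] := d1.
  by rewrite ![_ * p]mulrC pform_scale expr2 dvdp_mulIl.
by split.
Qed.

Let l_irr : irreducible_poly l. Proof. exact: irredp_XaddC. Qed.
Let q_irr : irreducible_poly q.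
Proof.
apply: cubic_irreducible; first by rewrite size_q.
move=> x; rewrite /root /q !hornerE; have [->|->] := F2 x; rewrite ?F2_simp /= ?F2_simp ?oner_eq0//.
Qed.

Let irr_coprime p a : irreducible_poly p -> ~~ (p %| a) -> coprimep p a.
Proof.
move=> irr n; apply: contraR n => n; rewrite /coprimep in n.
by have := irr.2 _ n (dvdp_gcdl p a) => /eqp_dvdl <-; exact: dvdp_gcdr.
Qed.

Let coprime_lq : coprimep l q.
Proof.
apply: irr_coprime l_irr _; have -> : l = 'X - (-1)%:P by rewrite polyCN opprK.
rewrite dvdp_XsubCl /root F2_opp1 /q !hornerE F2_opp1.
by rewrite ?expr1n F2_add11 add0r oner_eq0.
Qed.

Let remove_prime p a : irreducible_poly p -> ~~ (p * p %| a) ->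
  exists a', [/\ a' %| a, ~~ (p %| a') & (size a <= (size p).-1 + size a')%N].
Proof.
move=> irr h; have [/dvdpP[a' e]|n] := boolP (p %| a); last by exists a; rewrite dvdpp leq_addl.
exists a'; rewrite e dvdp_mulIl; split=> //.
  by apply: contra h; rewrite e => h; exact: dvdp_mul.
by apply: leq_trans (size_polyMleq _ _) _; have [] := irr; case: (size p) => // k _ _; rewrite addnC addSn.
Qed.

(** The norm has only the prime factors X, l and q. X is excluded by hypothesis, and l and q occur
    at most once by primitivity, so the degree is at most 1 + 2. *)
Lemma size_pnorm_primitive x0 x1 x2 x3 N :
  pnorm x0 x1 x2 x3 %| ('X * (1 + 'X ^+ 3)) ^+ N -> ~~ ('X %| pnorm x0 x1 x2 x3) ->
  (forall r, (1 < size r)%N -> ~ [/\ r %| x0, r %| x1, r %| x2 & r %| x3]) ->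
  (size (pnorm x0 x1 x2 x3) <= 4)%N.
Proof.
move=> hD nX prim; set P := pnorm _ _ _ _ in hD nX *.
have nl : ~~ (l * l %| P).
  apply/negP => h; apply: (prim l l_irr.1).
  exact: (pnorm_square_dvd (irredp_neq0 l_irr) anisotropic_l lqE coprime_lq h).
have nq : ~~ (q * q %| P).
  apply/negP => h; apply: (prim q q_irr.1); apply: (pnorm_square_dvd (irredp_neq0 q_irr) anisotropic_q _ _ h).
    by rewrite lqE mulrC.
  by rewrite coprimep_sym.
have [P1 [d1 n1 s1]] := remove_prime l_irr nl.
have [P2 [d2 n2 s2]] : exists P2, [/\ P2 %| P1, ~~ (q %| P2) & (size P1 <= (size q).-1 + size P2)%N].
  by apply: remove_prime q_irr _; apply: contra nq => h; exact: dvdp_trans h d1.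
have cX : coprimep P2 'X.
  rewrite coprimep_sym; apply: irr_coprime; first by rewrite -['X]subr0; exact: irredp_XsubC.
  by apply: contra nX => h; apply: dvdp_trans h (dvdp_trans d2 d1).
have cl : coprimep P2 l.
  by rewrite coprimep_sym; apply: irr_coprime l_irr _; apply: contra n1 => h; exact: dvdp_trans h d2.
have cq : coprimep P2 q by rewrite coprimep_sym; exact: irr_coprime q_irr n2.
(* What remains after removing l and q is coprime to a multiple of itself, hence constant. *)
have : coprimep P2 P2.
  apply: coprimep_dvdl (dvdp_trans (dvdp_trans d2 d1) hD) _.
  by apply: coprimep_expr; rewrite lqE !coprimepMr cX cl cq.
rewrite coprimepp => /eqP e2; move: s1 s2; rewrite e2 size_q.
have -> : size l = 2%N by rewrite /l size_XaddC.
by move=> s1 s2; apply: leq_trans s1 _; rewrite /= (leq_add2l 1).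
Qed.

End NormForm.

Lemma sqrV_div (L : fieldType) (d D : L) : d != 0 -> D != 0 -> d^-1 ^+ 2 = D * (d ^+ 2 * D)^-1.
Proof. by move=> d0 D0; field; rewrite d0 D0. Qed.

Section FixingBase.
Variables (L : fieldType) (O : set L) (X : L) (dvr : dvr_F2 O X).
Implicit Types (g : 'M[L]_2) (c : L).

(** Fixing the base vertex means that a scalar multiple of the matrix lies in GL_2(O); this is
    expressed through the entries and the inverse of the determinant. *)
Lemma hclass_fix p q r s : hclass O (mx2 p q r s) = hclass O 1%:M ->
  exists2 c, c != 0 & [/\ O (c * p), O (c * q), O (c * r), O (c * s) & O (c ^+ 2 * (p * s - q * r))^-1].
Proof.
move=> /hclassP[c c0]; rewrite lat1 mx2Z => e; exists c => //.
have h v : std O v -> std O (mx2 (c * p) (c * q) (c * r) (c * s) *m v) by move=> hv; rewrite e; exists v.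
have O1 := dvr_int1 dvr; have O0 := dvr_int0 dvr.
have /std_col2[h1 h2] : std O (col2 (c * p) (c * r)).
  have := h (col2 1 0); rewrite mx2_col2 !mulr1 !mulr0 !addr0; apply; exact/std_col2.
have /std_col2[h3 h4] : std O (col2 (c * q) (c * s)).
  have := h (col2 0 1); rewrite mx2_col2 !mulr1 !mulr0 !add0r; apply; exact/std_col2.
split=> //; have : std O (col2 1 0) by exact/std_col2.
have : std O (col2 0 1) by exact/std_col2.
rewrite {1 2}e => -[v hv ev] [w hw ew].
move: hv ev; rewrite [v]col2E; move: (v 0 0) (v 1 0) => x y /std_col2[Ox Oy].
move: hw ew; rewrite [w]col2E; move: (w 0 0) (w 1 0) => x' y' /std_col2[Ox' Oy'].
have colI (a b a' b' : L) : col2 a b = col2 a' b' -> a = a' /\ b = b'.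
  by move=> /colP E; have := E 0; have := E 1; rewrite !mxE.
rewrite !mx2_col2 => /colI[e1 e2] /colI[e3 e4].
have E : c ^+ 2 * (p * s - q * r) * (x' * y - x * y') = 1.
  have -> : (1 : L) = (c * p * x' + c * q * y') * (c * r * x + c * s * y)
    - (c * p * x + c * q * y) * (c * r * x' + c * s * y') by rewrite e1 e2 e3 e4; ring.
  ring.
have d0 : c ^+ 2 * (p * s - q * r) != 0 by apply/eqP => d0; move/eqP: E; rewrite d0 mul0r eq_sym oner_eq0.
have -> : (c ^+ 2 * (p * s - q * r))^-1 = x' * y - x * y' by rewrite -[LHS]mulr1 -E mulKf.
by apply: (dvr_intB dvr); exact: (dvr_intM dvr).
Qed.

Lemma dvr_max_sqrt x : dvr_max O X (x ^+ 2) -> dvr_max O X x.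
Proof.
move=> h; have hx : O x by apply: (dvr_int_sqrt dvr); exact: (dvr_max_int dvr).
apply: contrapT => /(dvr_unitP dvr hx)[x0 [_ hV]]; apply: (dvr_max1 dvr).
by rewrite -(expr1n L 2) -(mulfV x0) exprMn; apply: (dvr_maxMr dvr) h _; exact: (dvr_intXn dvr).
Qed.

Variables (F : fieldType) (c : {rmorphism F -> L}).
Hypothesis Oc : forall x, O (c x).

(** At infinity the valuation measures the degree. *)
Lemma dvr_horner_sizeP u (r : {poly F}) n : dvr_max O X u -> u != 0 ->
  O (u ^+ n * (map_poly c r).[u^-1]) <-> (size r <= n.+1)%N.
Proof.
move=> mu u0; have Ou := dvr_max_int dvr mu; split=> [h|le].
  rewrite leqNgt; apply/negP => lt; pose k := (size r).-1.
  have sr : size r = k.+1 by rewrite prednK//; apply: leq_trans lt.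
  have lt' : (n < k)%N by rewrite -ltnS -sr.
  apply: (@dvr_horner_max _ _ _ dvr _ c Oc u (\poly_(j < k.+1) r`_(k - j)) mu).
    by rewrite horner_coef0 coef_poly /= subn0 -lead_coefE lead_coef_eq0 -size_poly_gt0 sr.
  rewrite -(horner_rev_poly c u0 sr) -(subnK lt') addnS exprS exprD mulrC -mulrA -[X in _ * X]mulrA.
  apply: (dvr_maxMr dvr) mu _; apply: (dvr_intM dvr); last exact: h.
  by apply: (dvr_intXn dvr).
have le' : (size (map_poly c r) <= n.+1)%N by rewrite size_map_poly.
rewrite (horner_coef_wide _ le') mulr_sumr; apply: big_ind.
- exact: (dvr_int0 dvr).
- exact: (dvrD dvr).
move=> i _; rewrite coef_map /= mulrCA -[in u ^+ n](subnK (leq_ord i)) exprD exprVn mulfK ?expf_neq0//.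
by apply: (dvr_intM dvr) (Oc _) _; exact: (dvr_intXn dvr).
Qed.

End FixingBase.

Section FixingPlaces.
Variables (L : fieldType) (O : set L) (X : L) (dvr : dvr_F2 O X).
Hypothesis char2 : (2 : L) = 0.
Variables (F : fieldType) (c : {rmorphism F -> L}).
Hypothesis Oc : forall x, O (c x).
Variables (K : fieldType) (i : {rmorphism {poly F} -> K}) (e : {rmorphism K -> L}).
Variable x : K.
Hypothesis xE : i 'X = x.
Variables x0 x1 x2 x3 : {poly F}.
Let P := pnorm x0 x1 x2 x3.
Hypothesis iP0 : i P != 0.
Local Notation Qx := (Quat x (1 + x ^+ 3) (i x0) (i x1) (i x2) (i x3)).
Local Notation rs := (rs O X).
Local Notation m := (dvr_max O X).

Let y := X.
Let zy := y ^+ 2 + y.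
Let u := zy.

Let m_zy : m zy. Proof. exact: dvr_max_XX. Qed.

Lemma i_pnorm : i P = i x0 ^+ 2 + i x0 * i x1 - x * i x1 ^+ 2
  - (1 + x ^+ 3) * (i x2 ^+ 2 + i x2 * i x3 - x * i x3 ^+ 2).
Proof. by rewrite /P /pnorm /pform !(rmorphB i, rmorphD i, rmorphM i, rmorphXn i) rmorph1 xE. Qed.

(** If X divides the norm, the scalar d normalizing the matrix has its inverse in the maximal ideal,
    so the matrix itself vanishes modulo that ideal, and its entries give the coordinates. *)
Lemma fix_y_dvd : (forall r, e (i r) = (map_poly c r).[X ^+ 2 + X]) ->
  hclass O (quat_rep e (yI X) (yJ X) Qx) = hclass O 1%:M ->
  'X %| P -> [/\ 'X %| x0, 'X %| x1, 'X %| x2 & 'X %| x3].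
Proof.
move=> eE; have ex : e x = X ^+ 2 + X by rewrite -xE eE map_polyX hornerX.
have -> : quat_rep e (yI X) (yJ X) Qx = mx2 (e (i x0) + e (i x1) * y)
   (e (i x2) * (1 + zy ^+ 3) + e (i x3) * (y * (1 + zy ^+ 3))) (e (i x2) + e (i x3) * (1 + y))
   (e (i x0) + e (i x1) * (1 + y)) by exact: repy_E.
move=> /(hclass_fix dvr)[d d0 [h1 h2 h3 h4 h5]] dP.
have dvdXP r : m (e (i r)) -> 'X %| r.
  move=> h; rewrite -['X]subr0 -polyC0 dvdp_XsubCl; apply/negP => /negP n.
  by apply: (dvr_horner_max dvr Oc m_zy n); rewrite -eE.
have Oe r : O (e (i r)) by rewrite eE; apply: (dvr_int_horner dvr Oc); exact: (dvr_max_int dvr).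
have mP : m (e (i P)).
  have /dvdpP[r ->] := dP; rewrite !rmorphM /= xE ex; exact: (dvr_maxMl dvr (Oe r) m_zy).
move: h5; set D := (_ * _ - _ * _) => h5.
have DE : D = e (i P).
  rewrite i_pnorm !(rmorphB e, rmorphD e, rmorphM e, rmorphXn e) rmorph1 ex /D -/y -/zy.
  move: (e (i x0)) (e (i x1)) (e (i x2)) (e (i x3)) => a0 a1 a2 a3.
  apply: (eq_char2 char2 (q := a0 * a1 * y + a1 ^+ 2 * y ^+ 2 + a1 ^+ 2 * y
    - (1 + zy ^+ 3) * (a2 * a3 * y + a3 ^+ 2 * y ^+ 2 + a3 ^+ 2 * y))).
  by rewrite /zy; ring.
have md : m d^-1.
  apply: (dvr_max_sqrt dvr); have -> : d^-1 ^+ 2 = D * (d ^+ 2 * D)^-1.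
    by apply: sqrV_div => //; rewrite DE fmorph_eq0.
  by rewrite DE in h5 *; exact: (dvr_maxMr dvr mP h5).
have mE a : O (d * a) -> rs a = false.
  by move=> h; apply/rsP; rewrite -(mulKf d0 a); exact: (dvr_maxMr dvr md h).
have Oy : O y := dvr_intX dvr; have Ozy : O zy := dvr_max_int dvr m_zy.
have O1 := dvr_int1 dvr; have rzy : rs zy = false by apply/rsP.
have Ob : O (1 + zy ^+ 3) by apply: (dvr_intD dvr) => //; exact: (dvr_intXn dvr).
have rb : rs (1 + zy ^+ 3) = true.
  rewrite (rsD dvr)//; last exact: (dvr_intXn dvr).
  by rewrite exprS (rsM dvr)//; [rewrite rzy (rs1 dvr)|exact: (dvr_intXn dvr)].
have OM a a' : O a -> O a' -> O (a * a') := @dvr_intM _ _ _ dvr a a'.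
have OD a a' : O a -> O a' -> O (a + a') := @dvr_intD _ _ _ dvr a a'.
have r1y : rs (1 + y) = true by rewrite (rsD dvr)// (rs1 dvr) (rsX dvr).
have := mE _ h1; have := mE _ h2; have := mE _ h3; have := mE _ h4.
rewrite !(rsD dvr); try by auto.
rewrite !(rsM dvr); try by auto.
(* Modulo y the four entries are x0, x2, x2 + x3 and x0 + x1. *)
rewrite rb r1y (rsX dvr) !andbT !andbF /= !addbF => r4 r3 r2 r1.
by split; apply: dvdXP; apply/rsP; move: r1 r2 r3 r4;
  case: (rs (e (i x0))); case: (rs (e (i x1))); case: (rs (e (i x2))); case: (rs (e (i x3))).
Qed.

(** The norm has degree at most 3, which bounds the normalizing scalar: u^2 d^-1 is integral. So u^2
    times each matrix entry is integral, and the linear system of [rept_E] is solved for the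
    coordinates. *)
Lemma fix_t_size : (forall r, e (i r) = (map_poly c r).[(X ^+ 2 + X)^-1]) ->
  hclass O (quat_rep e (tI X) (tJ X) Qx) = hclass O 1%:M ->
  (size P <= 4)%N -> [/\ (size x0 <= 5)%N, (size x1 <= 5)%N, (size x2 <= 5)%N & (size x3 <= 5)%N].
Proof.
move=> eE; have ex : e x = (X ^+ 2 + X)^-1 by rewrite -xE eE map_polyX hornerX.
have u0 : u != 0 := ut0 dvr.
have -> : quat_rep e (tI X) (tJ X) Qx =
    mx2 (e (i x0) + e (i x1) * (1 + u + y) + e (i x3) * (u^-1 ^+ 2 + u))
      (e (i x1) * (1 + u ^+ 3) + e (i x2) * (u^-1 + u ^+ 2) + e (i x3) * ((1 + u + y) * (u^-1 + u ^+ 2)))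
      (e (i x1) * u^-1 + e (i x2) * u^-1 ^+ 2 + e (i x3) * ((u + y) * u^-1 ^+ 2))
      (e (i x0) + e (i x1) * (u + y) + e (i x3) * (u^-1 ^+ 2 + u)) by exact: (rept_E dvr).
move=> /(hclass_fix dvr)[d d0 [h1 h2 h3 h4 h5]] sP.
set A := e (i x0) + _ + _ in h1 h5; set B := e (i x1) * (1 + _) + _ + _ in h2 h5.
set C := e (i x1) * u^-1 + _ + _ in h3 h5; set E := _ + _ + _ in h4 h5.
have DE : A * E - B * C = e (i P).
  rewrite i_pnorm !(rmorphB e, rmorphD e, rmorphM e, rmorphXn e) rmorph1 ex /A /B /C /E -/y -/zy -/u.
  have uv : u * u^-1 = 1 by exact: mulfV.
  have yE : y ^+ 2 = u - y by rewrite /u /zy addrK.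
  move: (e (i x0)) (e (i x1)) (e (i x2)) (e (i x3)) => a0 a1 a2 a3.
  move: u^-1 uv => v uv.
  apply: (eq_char2 char2 (q := u * a0 * a1 + y * a0 * a1 + v ^+ 2 * a0 * a3 + u * a0 * a3 + y * u * a1 ^+ 2
    + u * a1 ^+ 2 - u * a1 * a2 - v ^+ 2 * a1 * a2 - v ^+ 2 * a2 * a3 - y * v ^+ 3 * a2 * a3 - u * a2 * a3
    - y * a2 * a3 - y * v ^+ 2 * a3 ^+ 2 - y * u * a3 ^+ 2 - v ^+ 2 * a3 ^+ 2 - u * a3 ^+ 2)).
  by ring: uv yE.
have mu : m u := m_zy; have Ou : O u := dvr_max_int dvr mu; have Oy : O y := dvr_intX dvr.
have OM a a' : O a -> O a' -> O (a * a') := @dvr_intM _ _ _ dvr a a'.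
have OD a a' : O a -> O a' -> O (a + a') := @dvr_intD _ _ _ dvr a a'.
have OB a a' : O a -> O a' -> O (a - a') := @dvr_intB _ _ _ dvr a a'.
(* Its square is u^4 d^-2, where u^3 clears the norm and one more factor u makes the exponent
   even. *)
have Og : O (u ^+ 2 * d^-1).
  apply: (dvr_int_sqrt dvr); rewrite exprMn (sqrV_div (D := e (i P)) d0) ?fmorph_eq0//.
  rewrite DE in h5; rewrite mulrA; apply: (OM) h5; rewrite -exprM exprS -mulrA; apply: (OM) => //.
  by rewrite eE; apply/(dvr_horner_sizeP dvr Oc _ _ mu u0).
have sc a : O (d * a) -> O (u ^+ 2 * a).
  by move=> h; rewrite -(mulKf d0 a) mulrA; exact: OM.
have {h1}h1 := sc _ h1; have {h2}h2 := sc _ h2; have {h3}h3 := sc _ h3; have {h4}h4 := sc _ h4.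
have [w0 Ow] : 1 + u ^+ 3 != 0 /\ O (1 + u ^+ 3)^-1.
  have O3 : O (u ^+ 3) by exact: (dvr_intXn dvr).
  apply: (rs_unit dvr); first by apply: (OD) (dvr_int1 dvr) O3.
  rewrite (rsD dvr) ?(dvr_int1 dvr)//; last exact: (dvr_int1 dvr).
  rewrite (rs1 dvr) exprS (rsM dvr)//; last exact: (dvr_intXn dvr).
  by rewrite (rsP O X u).2.
have g1 : O (u ^+ 2 * e (i x1)).
  have -> : u ^+ 2 * e (i x1) = u ^+ 2 * A - u ^+ 2 * E by rewrite /A /E; ring.
  exact: OB.
(* B/(1 + u^3) and u C have the same terms in x1 and x2 and differ by x3/u. *)
have g3 : O (u * e (i x3)).
  have -> : u * e (i x3) = u ^+ 2 * B * (1 + u ^+ 3)^-1 - u * (u ^+ 2 * C).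
    by rewrite /B /C; field; rewrite w0 u0.
  by apply: (OB); apply: (OM).
have g3' : O (u ^+ 2 * e (i x3)) by rewrite expr2 -mulrA; exact: OM.
have g2 : O (u ^+ 2 * e (i x2)).
  have -> : u ^+ 2 * e (i x2) = u ^+ 2 * (u ^+ 2 * C) - u * (u ^+ 2 * e (i x1)) - u ^+ 2 * e (i x3) * (u + y).
    by rewrite /C; field.
  have Ou2 : O (u ^+ 2) by exact: (dvr_intXn dvr).
  by apply: (OB); [apply: (OB)|]; apply: (OM) => //; exact: OD.
have g0 : O (u ^+ 3 * e (i x0)).
  have -> : u ^+ 3 * e (i x0) = u * (u ^+ 2 * E) - u * (u ^+ 2 * e (i x1)) * (u + y)
      - (u * e (i x3) + u ^+ 3 * (u * e (i x3))) by rewrite /E; field.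
  apply: (OB); first by apply: (OB); apply: (OM) => //; [exact: OM|exact: OD].
  by apply: (OD) => //; apply: (OM) => //; exact: (dvr_intXn dvr).
have fin r k : (k <= 4)%N -> O (u ^+ k * e (i r)) -> (size r <= 5)%N.
  move=> hk h; apply/(dvr_horner_sizeP dvr Oc r 4 mu u0).
  by rewrite -eE -(subnK hk) exprD -mulrA; apply: (OM) h; exact: (dvr_intXn dvr).
by split; [exact: (fin _ 3 isT g0)|exact: (fin _ 2 isT g1)|exact: (fin _ 2 isT g2)|exact: (fin _ 2 isT g3')].
Qed.

End FixingPlaces.

(** * Primitive representatives of elements of G(R) *)

Section IntegralStabilizer.
Variables (F : fieldType) (K : fieldType) (i : {rmorphism {poly F} -> K}).
Hypothesis F2 : forall a : F, a = 0 \/ a = 1.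
Hypothesis i0 : forall r, r != 0 -> i r != 0.
Variable x : K.
Hypothesis xE : i 'X = x.
Local Notation Q := (quat x (1 + x ^+ 3)).
Let D : {poly F} := 'X * (1 + 'X ^+ 3).
Let d := x * (1 + x ^+ 3).

Definition qpoly (x0 x1 x2 x3 : {poly F}) : Q := Quat x (1 + x ^+ 3) (i x0) (i x1) (i x2) (i x3).

Let i_inj r s : i r = i s -> r = s.
Proof.
move=> e; apply/eqP; rewrite -subr_eq0; apply: contra_eqT e => /i0.
by rewrite rmorphB subr_eq0.
Qed.

Let iD : i D = d.
Proof. by rewrite /D /d !(rmorphM i, rmorphD i, rmorphXn i) rmorph1 xE. Qed.

Let D0 : D != 0.
Proof.
rewrite /D mulf_neq0 ?polyX_eq0//; apply/eqP => /(congr1 (fun r : {poly F} => r`_0)).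
by rewrite coefD coefXn coef1 coef0 addr0 => /eqP; rewrite oner_eq0.
Qed.

Let d0 : d != 0. Proof. by rewrite -iD i0. Qed.

Definition coord_int : set K := [set a : K | exists p n, a = i p / d ^+ n].

Lemma integral_common a : coord_int a -> exists n, forall m, (n <= m)%N -> exists p, a * d ^+ m = i p.
Proof.
move=> [p [n ->]]; exists n => m nm; exists (p * D ^+ (m - n)).
rewrite rmorphM rmorphXn /= iD -[in LHS](subnK nm) exprD mulrCA mulrAC -mulrA [RHS]mulrC.
by rewrite mulfV ?mulr1// expf_neq0.
Qed.

Lemma qunormZ (c : K) (y : Q) : qunorm (c *: y) = c ^+ 2 * qunorm y.
Proof. by case: y => * /=; ring. Qed.

Lemma qunorm_qpoly x0 x1 x2 x3 : qunorm (qpoly x0 x1 x2 x3) = i (pnorm x0 x1 x2 x3).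
Proof. by rewrite (i_pnorm xE). Qed.

Lemma integral_qpoly (y : Q) :
  [/\ coord_int (qu1 y), coord_int (quI y), coord_int (quJ y) & coord_int (quIJ y)] ->
  exists n x0 x1 x2 x3, d ^+ n *: y = qpoly x0 x1 x2 x3.
Proof.
move=> [/integral_common[n0 h0] /integral_common[n1 h1] /integral_common[n2 h2] /integral_common[n3 h3]].
pose n := (n0 + n1 + n2 + n3)%N; exists n.
have [|x0 e0] := h0 n; first by rewrite /n; lia.
have [|x1 e1] := h1 n; first by rewrite /n; lia.
have [|x2 e2] := h2 n; first by rewrite /n; lia.
have [|x3 e3] := h3 n; first by rewrite /n; lia.
exists x0, x1, x2, x3; rewrite /qpoly -e0 -e1 -e2 -e3.
by case: (y) => y0 y1 y2 y3; congr Quat => /=; rewrite mulrC.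
Qed.

Let good (y : Q) x0 x1 x2 x3 := [/\ qpoly x0 x1 x2 x3 \is a GRing.unit,
  pclass (qpoly x0 x1 x2 x3) = pclass y & exists N, pnorm x0 x1 x2 x3 %| D ^+ N].

(** After clearing denominators of y and of y^-1 the two norms have product a power of X(1 + X^3),
    so the norm of the first divides such a power. *)
Lemma unit_qpoly (y : Q) : y \is a GRing.unit ->
  [/\ coord_int (qu1 y), coord_int (quI y), coord_int (quJ y) & coord_int (quIJ y)] ->
  [/\ coord_int (qu1 y^-1), coord_int (quI y^-1), coord_int (quJ y^-1) & coord_int (quIJ y^-1)] ->
  exists x0 x1 x2 x3, good y x0 x1 x2 x3.
Proof.
move=> uy /integral_qpoly[n [x0 [x1 [x2 [x3 e]]]]] /integral_qpoly[n' [y0 [y1 [y2 [y3 e']]]]].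
have dn k : d ^+ k != 0 by exact: expf_neq0.
have uq : qpoly x0 x1 x2 x3 \is a GRing.unit by rewrite -e scaler_unit// unitfE.
exists x0, x1, x2, x3; split=> //; first by apply/(pclass_eq uq uy); exists (d ^+ n).
exists (n * 2 + n' * 2)%N; apply/dvdpP; exists (pnorm y0 y1 y2 y3); apply: i_inj.
rewrite rmorphM -!qunorm_qpoly -e -e' !qunormZ mulrACA -qunormM mulVr// qunorm1 mulr1.
by rewrite rmorphXn /= iD exprD !exprM mulrC.
Qed.

(** Choose a representative whose norm has least degree; a common factor of the coordinates could be
    divided out and would lower it. *)
Lemma good_primitive (y : Q) : (exists x0 x1 x2 x3, good y x0 x1 x2 x3) ->
  exists x0 x1 x2 x3, good y x0 x1 x2 x3 /\
    forall r : {poly F}, (1 < size r)%N -> ~ [/\ r %| x0, r %| x1, r %| x2 & r %| x3].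
Proof.
move=> [x0 [x1 [x2 [x3 g]]]].
pose S k := `[< exists x0 x1 x2 x3, good y x0 x1 x2 x3 /\ size (pnorm x0 x1 x2 x3) = k >].
have exS : exists k, S k by exists (size (pnorm x0 x1 x2 x3)); apply/asboolP; exists x0, x1, x2, x3.
case: (ex_minnP exS) => k /asboolP[y0 [y1 [y2 [y3 [[u c [N h]] sk]]]]] mink.
exists y0, y1, y2, y3; split; first by split=> //; exists N.
move=> r sr [/dvdpP[z0 e0] /dvdpP[z1 e1] /dvdpP[z2 e2] /dvdpP[z3 e3]].
have r0 : r != 0 by rewrite -size_poly_gt0; exact: ltnW.
have eq : qpoly y0 y1 y2 y3 = i r *: qpoly z0 z1 z2 z3.
  by rewrite /qpoly e0 e1 e2 e3 !rmorphM; congr Quat => /=; rewrite mulrC.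
have ep : pnorm y0 y1 y2 y3 = r ^+ 2 * pnorm z0 z1 z2 z3.
  by rewrite e0 e1 e2 e3 ![_ * r]mulrC pnorm_scale.
have p0 : pnorm y0 y1 y2 y3 != 0.
  by apply: contraTneq h => ->; rewrite dvd0p expf_neq0.
have uz : qpoly z0 z1 z2 z3 \is a GRing.unit.
  by move: u; rewrite eq scaler_unit// unitfE i0.
have : S (size (pnorm z0 z1 z2 z3)).
  apply/asboolP; exists z0, z1, z2, z3; split=> //; split=> //.
    by rewrite -c; apply/esym/(pclass_eq u uz); exists (i r); rewrite ?i0.
  by exists N; apply: dvdp_trans h; rewrite ep dvdp_mulIr.
move=> /mink; rewrite -sk ep.
have z0' : pnorm z0 z1 z2 z3 != 0 by apply: contraNneq p0 => z0'; rewrite ep z0' mulr0.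
rewrite leqNgt => /negP; apply; rewrite size_mul ?expf_neq0// expr2 size_mul//.
by move: sr; move: (size _) (size _) => s' s; lia.
Qed.

Variables (L : fieldType) (O : set L) (X : L) (dvr : dvr_F2 O X).
Hypothesis char2 : (2 : L) = 0.
Variable c : {rmorphism F -> L}.
Hypothesis Oc : forall a, O (c a).
Variables ey et : {rmorphism K -> L}.
Hypothesis eyE : forall r, ey (i r) = (map_poly c r).[X ^+ 2 + X].
Hypothesis etE : forall r, et (i r) = (map_poly c r).[(X ^+ 2 + X)^-1].
Let v0 := hclass O 1%:M.

Theorem stabilizer_qpoly (y : Q) : y \is a GRing.unit ->
  [/\ coord_int (qu1 y), coord_int (quI y), coord_int (quJ y) & coord_int (quIJ y)] ->
  [/\ coord_int (qu1 y^-1), coord_int (quI y^-1), coord_int (quJ y^-1) & coord_int (quIJ y^-1)] ->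
  act ey (yI X) (yJ X) (pclass y) v0 = v0 -> act et (tI X) (tJ X) (pclass y) v0 = v0 ->
  exists x0 x1 x2 x3 : {poly F}, [/\ (size x0 <= 5)%N, (size x1 <= 5)%N, (size x2 <= 5)%N & (size x3 <= 5)%N] /\
    pclass y = pclass (qpoly x0 x1 x2 x3).
Proof.
move=> uy h h' fy ft.
have [x0 [x1 [x2 [x3 [[u e [N dN]] prim]]]]] := good_primitive (unit_qpoly uy h h').
exists x0, x1, x2, x3; split=> //.
have P0 : i (pnorm x0 x1 x2 x3) != 0 by rewrite -qunorm_qpoly.
move: fy ft; rewrite -e !act_pclass// !mulmx1 => fy ft.
apply: (fix_t_size dvr char2 Oc xE P0 etE ft); apply: (size_pnorm_primitive F2 dN _ prim).
apply/negP => /(fix_y_dvd dvr char2 Oc xE P0 eyE fy); apply: prim.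
by rewrite size_polyX.
Qed.

End IntegralStabilizer.

Section IntegralOrder.
Variables (F : fieldType) (K : fieldType) (i : {rmorphism {poly F} -> K}).
Variable x : K.
Hypothesis xE : i 'X = x.
Hypotheses (x0 : x != 0) (x31 : 1 + x ^+ 3 != 0).
Local Notation Q := (quat x (1 + x ^+ 3)).
Local Notation O := (coord_int i x).
Let D : {poly F} := 'X * (1 + 'X ^+ 3).
Let d := x * (1 + x ^+ 3).

Let d0 n : d ^+ n != 0. Proof. by rewrite expf_neq0// mulf_neq0. Qed.
Let iD n : i (D ^+ n) = d ^+ n.
Proof. by rewrite rmorphXn /= /D /d !(rmorphM i, rmorphD i, rmorphXn i) rmorph1 xE. Qed.

Lemma integral_poly p : O (i p).
Proof. by exists p, 0%N; rewrite expr0 divr1. Qed.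
Lemma integralD a b : O a -> O b -> O (a + b).
Proof.
move=> [p [n ->]] [p' [n' ->]]; exists (p * D ^+ n' + p' * D ^+ n), (n + n')%N.
rewrite rmorphD !rmorphM !iD exprD; move: (d ^+ n) (d ^+ n') (d0 n) (d0 n') => e e' e0 e0'.
by field; rewrite e0 e0'.
Qed.
Lemma integralN a : O a -> O (- a).
Proof. by move=> [p [n ->]]; exists (- p), n; rewrite rmorphN mulNr. Qed.
Lemma integralM a b : O a -> O b -> O (a * b).
Proof.
move=> [p [n ->]] [p' [n' ->]]; exists (p * p'), (n + n')%N.
by rewrite rmorphM exprD mulf_div.
Qed.
Lemma integral0 : O 0. Proof. by rewrite -(rmorph0 i); exact: integral_poly. Qed.
Lemma integral1 : O 1. Proof. by rewrite -(rmorph1 i); exact: integral_poly. Qed.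
Lemma integralx : O x. Proof. by have := integral_poly 'X; rewrite xE. Qed.
Lemma integralXn a n : O a -> O (a ^+ n).
Proof. by move=> ha; elim: n => [|n IH]; [exact: integral1|rewrite exprS; exact: integralM]. Qed.
Lemma integralxV : O x^-1.
Proof.
exists (1 + 'X ^+ 3), 1%N; rewrite expr1 rmorphD rmorph1 rmorphXn xE /=.
by field; rewrite x0 x31.
Qed.
Lemma integralx1V : O (1 + x)^-1.
Proof.
exists ('X * ('X ^+ 2 - 'X + 1)), 1%N; rewrite expr1 !(rmorphM i, rmorphD i, rmorphB i, rmorphXn i) rmorphN rmorph1 xE /=.
have e : 1 + x ^+ 3 = (1 + x) * (x ^+ 2 - x + 1) by ring.
move: x31; rewrite e mulf_eq0 negb_or => /andP[h1 h2].
rewrite -expr2; move: (x ^+ 2 - x + 1) (1 + x) h1 h2 => w w' h1 h2.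
by field; rewrite x0 h1 h2.
Qed.

Definition integral_quat (y : Q) := [/\ O (qu1 y), O (quI y), O (quJ y) & O (quIJ y)].

Ltac coord_int := first [assumption | exact: integral1 | exact: integral0 | exact: integralx
  | apply: integralXn; coord_int | apply: integralN; coord_int
  | apply: integralD; coord_int | apply: integralM; coord_int].

Lemma integral_quatM y y' : integral_quat y -> integral_quat y' -> integral_quat (y * y').
Proof.
case: y y' => [a0 a1 a2 a3] [b0 b1 b2 b3] [/= ? ? ? ?] [/= ? ? ? ?].
by split=> /=; coord_int.
Qed.

Lemma integral_quat1 : integral_quat 1.
Proof. by split=> /=; coord_int. Qed.

Lemma integral_quatV y : y \is a GRing.unit -> integral_quat y -> O (qunorm y)^-1 -> integral_quat y^-1.
Proof.
move=> uy [? ? ? ?] ?; have ny : qunorm y != 0 by [].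
have -> : y^-1 = (qunorm y)^-1 *: quconj y by rewrite -[y^-1]/(quV y) /quV (negPf ny).
by split=> /=; coord_int.
Qed.

Definition integral_units : set (pquat x (1 + x ^+ 3)) :=
  [set g | exists y : Q, [/\ y \is a GRing.unit, integral_quat y, integral_quat y^-1 & g = pclass y]].

Lemma integral_units_subgroup : subgroup integral_units.
Proof.
split.
- by exists 1; split; rewrite ?unitr1 ?invr1 ?pclass1//; exact: integral_quat1.
- move=> _ _ [y [uy oy oy' ->]] [y' [uy' o2 o2' ->]]; exists (y * y').
  by split; rewrite ?unitrMl ?pclassM ?invrM//; exact: integral_quatM.
- by move=> _ [y [uy oy oy' ->]]; exists y^-1; rewrite unitrV invrK pclassV.
Qed.

Hypothesis F_char2 : (2 : K) = 0.
Let C1 : Q := Quat x (1 + x ^+ 3) (1 + x ^+ 2) 0 0 1.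
Let C2 : Q := Quat x (1 + x ^+ 3) (x + x ^+ 2) 0 0 1.
Let B1 : Q := Quat x (1 + x ^+ 3) 0 (1 + x) 1 0.
Let B2 : Q := Quat x (1 + x ^+ 3) (x + x ^+ 2) (1 + x) 1 1.
Hypotheses (uC1 : C1 \is a GRing.unit) (uC2 : C2 \is a GRing.unit)
  (uB1 : B1 \is a GRing.unit) (uB2 : B2 \is a GRing.unit).

(** The norms are products of z and 1 + z, which are invertible in R, so conjugation gives integral
    inverses. *)
Lemma integral_units_generators :
  [/\ integral_units (pclass B1), integral_units (pclass B2),
      integral_units (pclass C1) & integral_units (pclass C2)].
Proof.
have h y : y \is a GRing.unit -> integral_quat y -> O (qunorm y)^-1 -> integral_units (pclass y).
  by move=> uy oy on; exists y; split=> //; exact: integral_quatV.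
have hV := integralM integralxV integralx1V.
split; apply: h => //; try by split=> /=; coord_int.
- by rewrite /B1 -B1_coord (qunorm_B1 x F_char2); exact: integralx1V.
- by rewrite /B2 -B2_coord (qunorm_B2 x F_char2) invfM.
- by rewrite /C1 -C1_coord (qunorm_C1 x F_char2); exact: integralx1V.
- by rewrite /C2 -C2_coord (qunorm_C2 x F_char2) invfM.
Qed.

End IntegralOrder.

Lemma finite_small_qpoly (F : finFieldType) (K : fieldType) (i : {rmorphism {poly F} -> K}) (x : K) n :
  finite_set [set g | exists x0 x1 x2 x3 : {poly F},
    [/\ (size x0 <= n)%N, (size x1 <= n)%N, (size x2 <= n)%N & (size x3 <= n)%N] /\
    g = pclass (qpoly i x x0 x1 x2 x3)].
Proof.
pose p (f : {ffun 'I_n -> F}) : {poly F} := \poly_(j < n) (if insub j is Some k then f k else 0).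
have pE (r : {poly F}) : (size r <= n)%N -> exists f, p f = r.
  move=> sx; exists [ffun k : 'I_n => r`_k]; apply/polyP => j; rewrite coef_poly.
  case: ltnP => hj; last by rewrite nth_default// (leq_trans sx).
  by rewrite insubT ffunE.
pose T := ({ffun 'I_n -> F} * {ffun 'I_n -> F} * ({ffun 'I_n -> F} * {ffun 'I_n -> F}))%type.
apply: (@sub_finite_set _ _ ((fun t : T => pclass (qpoly i x (p t.1.1) (p t.1.2) (p t.2.1) (p t.2.2))) @` setT)).
  move=> _ [x0 [x1 [x2 [x3 [[/pE[f0 <-] /pE[f1 <-] /pE[f2 <-] /pE[f3 <-]] ->]]]]].
  by exists (f0, f1, (f2, f3)).
apply: finite_image; exact: finite_finset.
Qed.

Section FiniteIndex.
Local Open Scope group_scope.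
Variables (G : groupType).
Implicit Types H N : set G.

Lemma lcoset_mulr N g h : subgroup N -> N h -> prod_set [set g * h] N = prod_set [set g] N.
Proof.
move=> [N1 NM NV] hh; apply/seteqP; split=> _ [_ -> [k hk <-]].
  by exists g => //; exists (h * k); [exact: NM|rewrite mulgA].
by exists (g * h) => //; exists (h^-1 * k); [apply: NM => //; exact: NV|rewrite mulgA mulgK].
Qed.

(** The finite set S is a stock of coset representatives. *)
Lemma finite_index_reps N H (S : set G) : subgroup N -> finite_set S ->
  (forall g, H g -> exists2 h, N h & S (g * h)) -> finite_index N H.
Proof.
move=> sN finS ex; apply: (@sub_finite_set _ _ ((fun s => prod_set [set s] N) @` S)).
  move=> _ [g Hg <-]; have [h Nh Sg] := ex g Hg.
  by exists (g * h) => //; exact: lcoset_mulr.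
exact: finite_image.
Qed.

Lemma subgroup_generated (A : set G) : subgroup (generated A).
Proof.
split.
- by move=> B [[B1 _ _] _].
- move=> g h hg hh B [sB AB]; have [_ BM _] := sB.
  by apply: BM; [apply: hg|apply: hh].
- move=> g hg B [sB AB]; have [_ _ BV] := sB; by apply: BV; apply: hg.
Qed.

Lemma generated_sub (A B : set G) : subgroup B -> A `<=` B -> generated A `<=` B.
Proof. by move=> sB AB g; apply. Qed.

End FiniteIndex.

Section Counting.

Lemma three_uniq (T : eqType) (a b c : T) : ([set a; b; c] #= `I_3)%card -> uniq [:: a; b; c].
Proof.
have -> : [set a; b; c] = [set` undup [:: a; b; c]].
  apply/seteqP; split=> t; rewrite /mkset mem_undup !inE.
    by move=> [[]|] ->; rewrite eqxx ?orbT.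
  by move=> /or3P[] /eqP ->; [left; left|left; right|right].
move=> h; have := card_eq_trans (card_esym (card_uniq_seq (undup_uniq _))) h.
move=> /card_eq_II sz; apply: contraT; rewrite -ltn_size_undup sz.
by [].
Qed.

Lemma card_seq_set (T : eqType) (A : set T) (s : seq T) : uniq s -> A = [set` s] -> (A #= `I_(size s))%card.
Proof. by move=> us ->; exact: card_uniq_seq. Qed.

Variables (G : groupType) (A B : set G) (sA sB : seq G).
Hypotheses (uA : uniq sA) (uB : uniq sB) (eA : A = [set` sA]) (eB : B = [set` sB]).

Lemma card_sc_edges : (sc_edges A B #= `I_(2 * size sA + 2 * size sB))%card.
Proof.
pose f (e : edge G) := match e with VEdge a i => (true, (a, i)) | HEdge b j => (false, (b, j)) end.
have finj : injective f by move=> [a i|b j] [a' i'|b' j'] //= [-> ->].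
apply: (card_eq_trans (card_esym (inj_card_eq (f := f) _))); first by move=> e e' _ _; exact: finj.
pose s := [seq (true, (a, i)) | a <- sA, i <- [:: true; false]] ++ [seq (false, (b, i)) | b <- sB, i <- [:: true; false]].
have -> : (2 * size sA + 2 * size sB)%N = size s by rewrite size_cat !size_allpairs mulnC [(2 * size sB)%N]mulnC.
apply: card_seq_set.
  rewrite cat_uniq !allpairs_uniq//; try by move=> [? ?] [? ?] _ _ [-> ->].
  rewrite andbT; apply/hasPn => _ /allpairsP[[b i] [_ _ ->]].
  by apply/negP => /allpairsP[[? ?] [_ _]].
apply/seteqP; split=> t.
  move=> [[a i|b j]] /=; rewrite ?eA ?eB /= => hs <-; rewrite mem_cat; apply/orP.
    by left; apply/allpairsP; exists (a, i); split=> //; case: (i).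
  by right; apply/allpairsP; exists (b, j); split=> //; case: (j).
rewrite /mkset mem_cat => /orP[] /allpairsP[[c k] [hc _ ->]].
  by exists (VEdge c k) => //=; rewrite eA.
by exists (HEdge c k) => //=; rewrite eB.
Qed.

(** A square is determined by its left and top sides, and these are arbitrary because AB = BA. *)
Lemma card_sc_squares H (V : V4_structure H A B) : (sc_squares A B #= `I_(size sA * size sB))%card.
Proof.
pose f (q : square G) := let: Sq a b' b a' := q in (a, b').
apply: (card_eq_trans (card_esym (inj_card_eq (f := f) _))).
  move=> [a b' b a'] [c d' d c'] /set_mem[ha ha' hb hb' e] /set_mem[hc hc' hd hd' e'] [ac bd].
  rewrite -ac -bd in e' *.
  by have [-> ->] := V4_factorC_uniq V ha' hb hc' hd (etrans (esym e) e').
have -> : (size sA * size sB)%N = size [seq (a, b) | a <- sA, b <- sB] by rewrite size_allpairs.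
apply: card_seq_set; first by rewrite allpairs_uniq// => -[? ?] [? ?] _ _ [-> ->].
apply/seteqP; split=> [_ [[a b' b a'] [ha _ _ hb' _] <-]|_ /allpairsP[[a b'] [/= ha hb ->]]].
  by rewrite eA in ha; rewrite eB in hb'; apply/allpairsP; exists (a, b').
have : prod_set A B (a * b')%g by exists a; rewrite ?eA//; exists b'; rewrite ?eB.
rewrite (V4_comm V) => -[b hb' [a' ha' e]].
by exists (Sq a b' b a') => //; split; rewrite ?eA ?eB// -?eA -?eB.
Qed.
End Counting.

(** * The tile group *)

Lemma ta_act_cancel (G : groupType) (T : Type) (V : set T) adj (act : G -> T -> T) v0 F M g h v :
  tree_action V adj act v0 F M -> V v -> act h v = act g^-1%g v -> act (g * h)%g v = v.
Proof. by move=> ta hv e; rewrite (ta_actM ta)// e (ta_actKV ta). Qed.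

(** The moving set is in bijection with the neighbours of the base vertex. Thus the valency 3 shows
    that the letters of A and of B are distinct. *)
Lemma ta_moving_card (G : groupType) (T : eqType) (V : set T) adj (act : G -> T -> T) v0 F M n :
  tree_action V adj act v0 F M -> regular_tree V adj n -> (M #= `I_n)%card.
Proof.
move=> ta rt; apply: card_eq_trans (rt_valency rt (ta_base ta)).
have -> : [set w | adj v0 w] = (fun g => act g v0) @` M.
  apply/seteqP; split=> w; first by move=> /(ta_nbr ta)[g hg ->]; exists g.
  by move=> [g hg <-]; exact: (ta_mv ta).
apply/card_esym/inj_card_eq => g h /set_mem hg /set_mem hh; exact: (ta_inj ta).
Qed.

Lemma uniq_setA : uniq [:: b1; b1^-1%g; c1].
Proof. exact: three_uniq (ta_moving_card tree_action_oo T_regular). Qed.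
Lemma uniq_setB : uniq [:: b2; b2^-1%g; c2].
Proof. exact: three_uniq (ta_moving_card tree_action_0 T_regular). Qed.

Lemma PQ_tiles : tile_relations b1 b2 c1 c2. Proof. exact: PQ_relations. Qed.

Section TileSets.
Local Open Scope group_scope.
Variables (G : groupType) (b1 b2 c1 c2 : G).
Hypothesis rel : tile_relations b1 b2 c1 c2.
Let A : set G := [set b1; b1^-1; c1].
Let B : set G := [set b2; b2^-1; c2].

Lemma three_seq (a b c : G) : [set a; b; c] = [set` [:: a; b; c]].
Proof.
apply/seteqP; split=> t; rewrite /mkset !inE; first by move=> [[]|] ->; rewrite eqxx ?orbT.
by move=> /or3P[] /eqP ->; [left; left|left; right|right].
Qed.

Lemma tile_invA a : A a -> A a^-1.
Proof.
by move=> [[]|] ->; [left; right|left; left; rewrite invgK|right; rewrite (tile_c1V rel)].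
Qed.
Lemma tile_invB b : B b -> B b^-1.
Proof.
by move=> [[]|] ->; [left; right|left; left; rewrite invgK|right; rewrite (tile_c2V rel)].
Qed.

(** The nine squares give one inclusion; inverting, with A and B closed under inverses, gives the
    other. *)
Lemma tile_comm : prod_set A B = prod_set B A.
Proof.
have [[k1 k2 k3 k4 k5] [k6 k7 k8 k9]] := nine_squares rel.
have [A1 A2 A3] : [/\ A b1, A b1^-1 & A c1] by split; [left; left|left; right|right].
have [B1 B2 B3] : [/\ B b2, B b2^-1 & B c2] by split; [left; left|left; right|right].
have w b a : B b -> A a -> prod_set B A (b * a) by move=> hb ha; exists b => //; exists a.
have sub g : prod_set A B g -> prod_set B A g.
  move=> [_ [[]|] -> [_ [[]|] -> <-]]; rewrite ?(k1, k2, k3, k4, k5, k6, k7, k8, k9); exact: w.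
apply/seteqP; split=> // g [b hb [a ha <-]].
have [b' hb' [a' ha' e]] : prod_set B A (a^-1 * b^-1).
  by apply: sub; exists a^-1; [exact: tile_invA|exists b^-1 => //; exact: tile_invB].
exists a'^-1; first exact: tile_invA.
by exists b'^-1; [exact: tile_invB|rewrite -invgM e invgM !invgK].
Qed.

Lemma tile_gen : generated (A `|` B) = generated [set b1; b2; c1; c2].
Proof.
have S := subgroup_generated.
apply/seteqP; split; apply: generated_sub; try exact: S.
- have gen g : [set b1; b2; c1; c2] g -> generated [set b1; b2; c1; c2] g.
    by move=> hg H [_]; apply.
  have [_ _ V] := S _ [set b1; b2; c1; c2].
  move=> g [[[]|]|[[]|]] ->.
  + by apply: gen; left; left; left.
  + by apply: V; apply: gen; left; left; left.
  + by apply: gen; left; right.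
  + by apply: gen; left; left; right.
  + by apply: V; apply: gen; left; left; right.
  + by apply: gen; right.
- by move=> g [[[]|]|] -> H [_]; apply; [left; left; left|right; left; left|left; right|right; right].
Qed.
End TileSets.


Section ArithmeticLattice.
Local Notation i := (@tofrac {poly 'F_2} : {rmorphism {poly 'F_2} -> K}).

Lemma F2_cases (a : 'F_2) : a = 0 \/ a = 1.
Proof. by case: a => -[|[|//]] h; [left|right]; apply: val_inj. Qed.

Lemma tofrac_neq0 (r : {poly 'F_2}) : r != 0 -> i r != 0.
Proof. by move=> r0; rewrite /= tofrac_eq0. Qed.

Lemma z31_neq0 : 1 + z ^+ 3 != 0.
Proof.
have -> : 1 + z ^+ 3 = i (1 + 'X ^+ 3) by rewrite rmorphD rmorph1 rmorphXn.
apply: tofrac_neq0; apply/eqP => /(congr1 (fun r : {poly 'F_2} => r`_0)).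
by rewrite coefD coefXn coef1 coef0 addr0 => /eqP; rewrite oner_eq0.
Qed.

Lemma zE : i 'X = z. Proof. by []. Qed.

Lemma coord_ringE : coord_ring = coord_int i z. Proof. by []. Qed.
Lemma order_OE (x : Q) : order_O x = integral_quat i x.
Proof. by rewrite /order_O coord_ringE. Qed.
Lemma G_RE : G_R = integral_units (x := z) i.
Proof.
apply/seteqP; split=> g [x [ux ox ox' ->]]; exists x; rewrite !order_OE in ox ox' *.
  by split.
by split.
Qed.

Lemma G_R_stabilizer g : G_R g -> act_0 g base = base -> act_oo g base = base ->
  exists x0 x1 x2 x3 : {poly 'F_2},
    [/\ (size x0 <= 5)%N, (size x1 <= 5)%N, (size x2 <= 5)%N & (size x3 <= 5)%N] /\
    g = pclass (qpoly i z x0 x1 x2 x3).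
Proof.
rewrite G_RE act_0E act_ooE => -[y [uy oy oy' ->]] fy ft.
have H := stabilizer_qpoly F2_cases tofrac_neq0 zE laurent_dvr laurent_char2 (@laur_intC _)
  emb_y_poly emb_t_poly uy oy oy' fy ft.
exact: H.
Qed.

Let Lambda := generated [set b1; b2; c1; c2].

Lemma Lambda_sub_G_R : Lambda `<=` G_R.
Proof.
have U1 := C1_unit; have U2 := C2_unit; have U3 := B1_unit; have U4 := B2_unit.
have [g1 g2 g3 g4] : [/\ integral_units (x := z) i b1, integral_units (x := z) i b2,
    integral_units (x := z) i c1 & integral_units (x := z) i c2].
  rewrite /b1 /b2 /c1 /c2.
  rewrite C1E in U1 *; rewrite C2E in U2 *; rewrite B1E in U3 *; rewrite B2E in U4 *.
  have H := integral_units_generators zE z_neq0 z31_neq0 K_char2 U1 U2 U3 U4.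
  exact: H.
apply: generated_sub.
  by rewrite G_RE; exact: integral_units_subgroup zE z_neq0 z31_neq0.
rewrite G_RE => g [[[]|]|] ->; [exact g1|exact g2|exact g3|exact g4].
Qed.

Lemma finite_setA : finite_set setA. Proof. by rewrite /setA three_seq; exact: finite_seq. Qed.
Lemma finite_setB : finite_set setB. Proof. by rewrite /setB three_seq; exact: finite_seq. Qed.

Definition V4_tiles : V4_structure (generated [set b1; b2; c1; c2]) setA setB :=
  two_trees_V4 tree_action_0 tree_action_oo finite_setA finite_setB
    (tile_invA PQ_tiles) (tile_invB PQ_tiles) (tile_comm PQ_tiles) (tile_gen _ _ _ _).

Definition Lambda_transitive := two_trees_transitive tree_action_0 tree_action_oo finite_setA finite_setB
  (tile_invA PQ_tiles) (tile_invB PQ_tiles) (tile_comm PQ_tiles) (tile_gen b1 b2 c1 c2).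

(** As Lambda lies in G(R), only its index there matters. By transitivity every coset of Lambda
    contains an element fixing both base vertices, and such elements of G(R) form a finite set. *)
Lemma Lambda_arithmetic : arithmetic_lattice Lambda.
Proof.
have sL := subgroup_generated [set b1; b2; c1; c2].
have [G1 GM GV] : subgroup G_R by rewrite G_RE; exact: integral_units_subgroup zE z_neq0 z31_neq0.
have LG := Lambda_sub_G_R.
split=> //; rewrite /commensurable (setIidl LG); split.
  apply: (finite_index_reps sL (finite_set1 1%g)) => g hg.
  by have [_ _ LV] := sL; exists g^-1%g; [exact: LV|rewrite mulgV].
apply: (finite_index_reps sL (finite_small_qpoly i z 5)) => g hg.
have base_v := ta_base tree_action_0; have V0 := @ta_vertex _ _ _ _ _ _ _ _ tree_action_0.
have base_w := ta_base tree_action_oo; have W0 := @ta_vertex _ _ _ _ _ _ _ _ tree_action_oo.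
(* The element h of Lambda takes the base pair to its image under g^-1, so that g h fixes it. *)
have [h [hh e1 e2]] := Lambda_transitive (V0 g^-1%g _ base_v) (W0 g^-1%g _ base_w).
exists h; first exact hh.
exact (G_R_stabilizer (GM _ _ hg (LG _ hh)) (ta_act_cancel tree_action_0 base_v e1)
  (ta_act_cancel tree_action_oo base_w e2)).
Qed.
End ArithmeticLattice.

Theorem theorem1 (R : realType) :
  exists (V : V4_structure (generated [set b1; b2; c1; c2]) setA setB)
         (Lambda : set PQ),
    let Sigma := realization R setA setB in
    let s00 : Sigma := base_vertex R setA setB in
    [/\ arithmetic_lattice Lambda,

        (* (1) *)
        regular_tree T_vertex T_adj 3 /\ simply_transitive Lambda,

        (* (2) *)
        [/\ isomorphic Lambda (fun x y => x * y)%g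
              (pi1_orb R (V4_act R V) s00) (pi1_orb_mul R (V4_act R V)),
            [/\ sc_vertices #= `I_4, sc_edges setA setB #= `I_12
              & sc_squares setA setB #= `I_9]
          & presentation Lambda gen_val relations]

      & (* (3) *)
        exists Gamma : set PQ,
          [/\ normal_subgroup Gamma Lambda, torsion_free Gamma,
              isomorphic (lcosets Gamma Lambda) (@prod_set _)
                [set: V4] (fun x y => x * y)%g
            & isomorphic Gamma (fun x y => x * y)%g
                (pi1 R s00) (pi1_mul R)]].
Proof.
have red := @two_trees_reduced_eval1 _ _ _ _ _ _ _ _ _ _ _ _ _ tree_action_0 tree_action_oo
  (tile_invA PQ_tiles) (tile_invB PQ_tiles).
have A0 : setA !=set0 by exists c1; right.
have B0 : setB !=set0 by exists c2; right.
exists V4_tiles, (generated [set b1; b2; c1; c2]) => Sigma s00; split.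
- exact: Lambda_arithmetic.
- split; first exact: T_regular.
  move=> v w v' w'.
  exact: (two_trees_simply_transitive tree_action_0 tree_action_oo finite_setA finite_setB
    (tile_invA PQ_tiles) (tile_invB PQ_tiles) (tile_comm PQ_tiles) (tile_gen b1 b2 c1 c2)).
- split; first exact (orb_map_isomorphic V4_tiles red R A0 B0).
    split.
    + rewrite /sc_vertices (_ : setT = [set` [:: (true, true); (true, false); (false, true); (false, false)]]).
        exact: card_uniq_seq.
      by apply/seteqP; split=> -[[] []].
    + exact: card_sc_edges uniq_setA uniq_setB (three_seq _ _ _) (three_seq _ _ _).
    + exact (card_sc_squares uniq_setA uniq_setB (three_seq _ _ _) (three_seq _ _ _) V4_tiles).
  exact: (tile_presentation PQ_tiles uniq_setA uniq_setB V4_tiles red).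
- exists (type_kernel V4_tiles R); split.
  + exact (type_kernel_normal V4_tiles red R A0 B0).
  + exact (@two_trees_torsion_free _ _ _ _ _ _ _ _ _ _ _ _ _ tree_action_0 tree_action_oo
      finite_setA finite_setB (tile_invA PQ_tiles) (tile_invB PQ_tiles) (tile_comm PQ_tiles) _
      (tile_gen b1 b2 c1 c2) R A0 B0).
  + exact (type_cosets_isomorphic V4_tiles red R A0 B0).
  + exact (type_kernel_isomorphic V4_tiles red R A0 B0).
Qed.
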